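(* Let $j\in\mathbb{N}$, $j\ge1$. Let $T>0$ and $0\le b'\le b\le 1$ be given, with $b>0$. Suppose that $u_n\in X_T^{0,b}$ and $f_n\in X_T^{-2j+2jb,-b}$ satisfy $$\partial_t u_n+(-1)^{j+1}\partial_x^{2j+1}u_n=f_n$$ for $n\in\mathbb{N}$. Assume that there exists a constant $C>0$ such that $\|u_n\|_{X_T^{0,b}}\le C$ for all $n$, and that $$\|u_n\|_{X_T^{-2j+2jb,-b}}+\|f_n\|_{X_T^{-2j+2jb,-b}}+\|u_n\|_{X_T^{-1+2jb',-b'}}\to 0\quad\text{as } n\to+\infty.$$ In addition, assume that for some nonempty open set $\omega\subset\mathbb{T}$ it holds that $u_n\to0$ strongly in $L^2(0,T;L^2(\omega))$. Then $$u_n\to 0\ \text{ strongly in } L^2_{loc}((0,T);L^2(\mathbb{T}))\quad\text{as } n\to+\infty.$$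
   Context: $\mathbb{T}=\mathbb{R}/2\pi\mathbb{Z}$, $\langle\cdot\rangle=(1+|\cdot|^2)^{1/2}$, and $\widetilde f(\tau,k)=\frac1{2\pi}\int_{\mathbb{R}}\int_{\mathbb{T}}e^{-it\tau}e^{-ikx}f(t,x)\,dx\,dt$ is the space-time Fourier transform. Functions $u_n$ are real-valued. For $s,b\in\mathbb{R}$, the space $X^{s,b}$ (depending on $j$) is the closure of the Schwartz functions $\mathcal{S}_{t,x}(\mathbb{R}\times\mathbb{T})$ under the norm $$\|f\|_{X^{s,b}}^2=\frac1{2\pi}\sum_{k\in\mathbb{Z}}\int_{\mathbb{R}}\langle k\rangle^{2s}\langle\tau-k^{2j+1}\rangle^{2b}|\widetilde f(\tau,k)|^2\,d\tau.$$ $X_T^{s,b}$ is its time localization to $(0,T)$, with norm $\|f\|_{X_T^{s,b}}=\inf\{\|F\|_{X^{s,b}}: F=f\text{ on }(0,T)\times\mathbb{T}\}$. *)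

(* Defs.v *)
From mathcomp Require Import all_boot all_order all_algebra.
From mathcomp Require Import complex.
From mathcomp Require Import all_classical all_reals all_analysis.

Set Implicit Arguments.
Unset Strict Implicit.
Unset Printing Implicit Defensive.

Import Order.TTheory GRing.Theory Num.Theory.
Import numFieldNormedType.Exports.

Local Open Scope classical_set_scope.
Local Open Scope ring_scope.
Local Open Scope complex_scope.

(* A function on R * T, with T = R / 2 pi Z, is a curried function of (t, x)
   that is 2 pi-periodic in x; integrals over T are taken over [0, 2 pi]. *)

Section Bourgain.
Context {R : realType}.
Local Notation mu := (@lebesgue_measure R).

Definition periodicx (V : Type) (I : set R) (f : R -> R -> V) : Prop :=
  forall t x, I t -> f t (x + 2 * pi) = f t x.

Definition torus_open (omega : set R) : Prop :=
  open omega /\ (forall x, omega (x + 2 * pi) <-> omega x).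

Definition partial_t (f : R -> R -> R) : R -> R -> R :=
  fun t x => derive1 (fun s => f s x) t.

Definition partial_x (f : R -> R -> R) : R -> R -> R :=
  fun t x => derive1 (f t) x.

(* Mixed partial derivative along a word: [true] is d/dt, [false] is d/dx. *)
Fixpoint partials (w : seq bool) (f : R -> R -> R) : R -> R -> R :=
  if w is c :: w' then
    (if c then partial_t else partial_x) (partials w' f)
  else f.

Definition smooth (f : R -> R -> R) : Prop :=
  forall w : seq bool,
    [/\ forall t x, derivable (fun s => partials w f s x) t 1,
        forall t x, derivable (partials w f t) x 1 &
        continuous (fun p : R * R => partials w f p.1 p.2)].

Definition schwartz (f : R -> R -> R) : Prop :=
  [/\ periodicx setT f, smooth f &
      forall (w : seq bool) (m : nat), exists M : R,
        forall t x, `|t| ^+ m * `|partials w f t x| <= M].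

Definition schwartzC (f : R -> R -> R[i]) : Prop :=
  schwartz (fun t x => complex.Re (f t x)) /\ schwartz (fun t x => complex.Im (f t x)).

(* C_c^oo ((0, T) * T) *)
Definition test_function (T : R) (f : R -> R -> R) : Prop :=
  [/\ periodicx setT f, smooth f &
      exists a c : R, [/\ 0 < a, c < T &
        forall t x, f t x != 0 -> a <= t <= c]].

Definition stint (I : set R) (g : R -> R -> R) : R :=
  \int[mu]_(t in I) \int[mu]_(x in `[0, 2 * pi]) g t x.

Definition stintC (I : set R) (g : R -> R -> R[i]) : R[i] :=
  stint I (fun t x => complex.Re (g t x)) +i* stint I (fun t x => complex.Im (g t x)).

Definition expNi (a : R) : R[i] := cos a -i* sin a.

Definition fourier (f : R -> R -> R[i]) (tau : R) (k : int) : R[i] :=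
  (2 * pi)^-1%:C *
    stintC setT (fun t x => expNi (t * tau) * expNi (k%:~R * x) * f t x).

Definition bracket (y : R) : R := Num.sqrt (1 + y ^+ 2).

Definition XnormS (j : nat) (s b : R) (f : R -> R -> R[i]) : \bar R :=
  sqrte ((2 * pi)^-1%:E * \esum_(k in [set: int])
    \int[mu]_tau
      (bracket k%:~R `^ (2 * s) *
       bracket (tau - k%:~R ^+ (2 * j).+1) `^ (2 * b) *
       Normc.normc (fourier f tau k) ^+ 2)%:E)%E.

(* Complex-valued distributions, given by their values on real-valued test
   functions. Linearity and continuity are not bundled: they are automatic for
   the members of the Bourgain spaces below. *)
Definition distr : Type := (R -> R -> R) -> R[i].

Definition distr_of (f : R -> R -> R[i]) : distr :=
  fun psi => stintC setT (fun t x => f t x * (psi t x)%:C).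

Definition distr_of_real (T : R) (u : R -> R -> R) : distr :=
  fun phi => (stint `]0, T[ (fun t x => u t x * phi t x))%:C.

Definition distr_dt (d : distr) : distr := fun phi => - d (partial_t phi).

Definition distr_dx (d : distr) : distr := fun phi => - d (partial_x phi).

(* X^{s,b} is the closure of the Schwartz functions, realized in the tempered
   distributions: F is the weak limit of a sequence of Schwartz functions that
   is Cauchy for the X^{s,b} norm. *)
Definition Xapprox (j : nat) (s b : R) (F : distr)
    (g : nat -> R -> R -> R[i]) : Prop :=
  [/\ forall m, schwartzC (g m),
      forall e : R, 0 < e -> exists N : nat, forall m p, (N <= m)%N ->
        (N <= p)%N ->
        (XnormS j s b (fun t x => (g m t x - g p t x)%R) < e%:E)%E &
      forall psi, schwartz psi ->
        (fun m => complex.Re (distr_of (g m) psi)) @ \oo --> complex.Re (F psi) /\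
        (fun m => complex.Im (distr_of (g m) psi)) @ \oo --> complex.Im (F psi)].

Definition Xspace (j : nat) (s b : R) (F : distr) : Prop :=
  exists g, Xapprox j s b F g.

(* The norm extended by continuity. The limit does not depend on the
   approximating sequence; the infimum is +oo when F is not in X^{s,b}. *)
Definition Xnorm (j : nat) (s b : R) (F : distr) : \bar R :=
  ereal_inf [set limn (fun m => XnormS j s b (g m)) |
             g in Xapprox j s b F].

Definition eq_on (T : R) (F f : distr) : Prop :=
  forall phi, test_function T phi -> F phi = f phi.

Definition XTspace (j : nat) (s b T : R) (f : distr) : Prop :=
  exists F, Xspace j s b F /\ eq_on T F f.

Definition XTnorm (j : nat) (s b T : R) (f : distr) : \bar R :=
  ereal_inf [set Xnorm j s b F |
             F in [set F | Xspace j s b F /\ eq_on T F f]].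

(* The square of the norm of L^2(I; L^2(A)), for I in time and A a
   2 pi-periodic subset of R. *)
Definition L2sqnorm (I A : set R) (u : R -> R -> R) : \bar R :=
  (\int[mu]_(t in I) \int[mu]_(x in A `&` `[0%R, (2 * pi)%R]) (u t x ^+ 2)%:E)%E.

(* Real-valued functions in L^2((0, T) * T): the elements of X_T^{0,b} with
   b >= 0 are of this kind. *)
Definition L2fun (T : R) (u : R -> R -> R) : Prop :=
  [/\ periodicx `]0, T[ u,
      measurable_fun (`]0, T[%classic `*` setT) (fun p : R * R => u p.1 p.2) &
      (L2sqnorm `]0%R, T[ setT u < +oo)%E].

End Bourgain.

(* Main.v *)
(** Let [kappa_k = k^(2j+1)].  The spatial Fourier modes of [u_n] satisfy
    [u_k' = i kappa_k u_k + f_k], so integrating the derivative of [u_k conj(u_m)] against a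
    smooth [psi] expresses [(kappa_k - kappa_m) int psi u_k conj(u_m)] through pairings of one
    factor bounded in [X^{0,b}] with one factor small in [X^{-2j+2jb,-b}].  In Fourier variables
    such a pairing is a double integral whose kernel decays in [tau - sigma], and since
    [|kappa_k - kappa_m| >= m^(2j)] the division by [kappa_k - kappa_m] compensates exactly for
    the ratio of the two weights.  Hence, for every trigonometric polynomial [q], the integral
    [int psi int q u_n^2] differs from [mean(q) int psi int u_n^2] by [o(1)].  Taking
    [q(x) = ((1 + cos(x - x0))/2)^L] with [x0] in [omega] and [L] large, [q] is small compared
    with its mean outside [omega], so smallness in [L^2(omega)] forces smallness in [L^2(T)]. *)
Require Import Defs.
From mathcomp Require Import all_boot all_order all_algebra.
From mathcomp Require Import complex.
From mathcomp Require Import all_classical all_reals all_analysis.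
From mathcomp Require Import measurable_realfun lra ring zify.
Set Implicit Arguments.
Unset Strict Implicit.
Unset Printing Implicit Defensive.
Import Order.TTheory GRing.Theory Num.Theory.
Import numFieldNormedType.Exports.
Local Open Scope classical_set_scope.
Local Open Scope ring_scope.
Local Open Scope complex_scope.

(** * Integration of real-valued functions *)

(** Members of the Bourgain spaces are given only as weak limits of Schwartz functions, so their
    modes cannot be differentiated directly. Everything is therefore tested against [rho (t - s)]
    for an even mollifier [rho]: for the solution this yields modes differentiable in [t], and for a
    Schwartz approximation it multiplies the Fourier transform by a factor of absolute value at most
    1, which increases no norm. The solution is approximated twice, once in $X^{0,b}$, where it is
    bounded, and once in $X^{-2j+2jb,-b}$, where it is small. The bound on the sums of pairings
    depends neither on the mollifier nor on the number of modes, only on the bandwidth [L] of the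
    window; so the approximations, the mollification and the truncation to finitely many modes can
    be removed one after the other. In the bilinear estimate Cauchy-Schwarz takes the form
    $2xy\le\eta x^2+\eta^{-1}y^2$; taking $\eta$ equal to the size [e] of the small norms makes the
    final error linear in [e]. Complex quantities are carried as pairs of real ones. *)

Notation itg D f := (integrable (@lebesgue_measure _) D (EFin \o f)).

Section RealIntegral.
Context {R : realType}.
Local Notation mu := (@lebesgue_measure R).
Implicit Types (D E : set R) (f g h a b F : R -> R).

(* [lebesgue_measure] lives on [measurableTypeR R], whose display differs from
   the one inferred for [R]; the two structures are convertible. *)
Lemma measurable_EFin_comp D f : measurable_fun D f ->
  @measurable_fun _ _ (measurableTypeR R) (\bar R) D (fun x => (f x)%:E).
Proof. by move=> mf; apply/(@measurable_EFinP _ (measurableTypeR R)). Qed.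

Lemma measurable_patch D (F : R -> \bar R) : measurable D ->
  measurable_fun D F -> measurable_fun setT (F \_ D).
Proof. by move=> mD; exact: (measurable_restrictT F mD).1. Qed.

Lemma itg_measurable D f : itg D f -> measurable_fun D f.
Proof. by move=> /integrableP[/measurable_EFinP]. Qed.

Lemma itgD D f g : measurable D -> itg D f -> itg D g ->
  itg D (fun x => f x + g x).
Proof. by move=> mD; exact: integrableD. Qed.

Lemma itgB D f g : measurable D -> itg D f -> itg D g ->
  itg D (fun x => f x - g x).
Proof.
move=> mD if_ ig; have := @integrableB _ _ _ mu D mD _ _ if_ ig.
by apply: eq_integrable => // x _; rewrite /= EFinB.
Qed.

Lemma itgZl D (r : R) f : measurable D -> itg D f -> itg D (fun x => r * f x).
Proof.
move=> mD if_; have := @integrableZl _ _ _ mu D mD r _ if_.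
by apply: eq_integrable => // x _; rewrite /= EFinM.
Qed.

Lemma itgZr D (r : R) f : measurable D -> itg D f -> itg D (fun x => f x * r).
Proof.
move=> mD if_; have := itgZl r mD if_.
by apply: eq_integrable => // x _; rewrite /= mulrC.
Qed.

Lemma itgN D f : measurable D -> itg D f -> itg D (fun x => - f x).
Proof.
move=> mD /(itgZl (-1) mD).
by have -> : (fun x => -1 * f x) = (fun x => - f x) by apply/funext => x; rewrite mulN1r.
Qed.

Lemma itg_le D g f : measurable D -> measurable_fun D f ->
  (forall x, D x -> `|f x| <= g x) -> itg D g -> itg D f.
Proof.
move=> mD mf fg; apply: le_integrable => //; first exact/measurable_EFinP.
by move=> x Dx /=; rewrite lee_fin (le_trans (fg _ Dx))// ler_norm.
Qed.

Lemma itg_norm D f : measurable D -> itg D f -> itg D (fun x => `|f x|).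
Proof. by move=> mD; exact: integrable_norm. Qed.

Lemma itgM_bdd D h f (M : R) : measurable D -> measurable_fun D h ->
  (forall x, D x -> `|h x| <= M) -> itg D f -> itg D (fun x => h x * f x).
Proof.
move=> mD mh hM if_.
apply: (@itg_le _ (fun x => M * `|f x|)) => //.
- by apply: measurable_funM => //; exact: itg_measurable.
- by move=> x Dx; rewrite normrM ler_wpM2r// hM.
- by apply: itgZl => //; exact: itg_norm.
Qed.

Lemma itg_bdd D f (M : R) : measurable D -> (mu D < +oo)%E ->
  measurable_fun D f -> (forall x, D x -> `|f x| <= M) -> itg D f.
Proof.
move=> mD Doo mf fM; apply: measurable_bounded_integrable => //.
exists M; split; first exact: num_real.
by move=> x Mx y Dy; exact: (le_trans (fM _ Dy) (ltW Mx)).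
Qed.

Lemma mu_itv_lty (a b : R) (x y : bool) :
  (mu [set` Interval (BSide x a) (BSide y b)] < +oo)%E.
Proof. by rewrite lebesgue_measure_itv/=; case: ifP => // _; rewrite -EFinB ltry. Qed.

Lemma itg_cont (a b : R) f : continuous f -> itg `[a, b] f.
Proof.
move=> cf; apply: continuous_compact_integrable; first exact: segment_compact.
exact: continuous_subspaceT.
Qed.

Lemma measurable_cont f D : measurable D -> continuous f -> measurable_fun D f.
Proof.
move=> mD cf; apply: (measurable_funS measurableT) => //.
exact: continuous_measurable_fun.
Qed.

Lemma itg_sum D (I : Type) (s : seq I) (P : pred I) (F : I -> R -> R) :
  measurable D -> (forall i, itg D (F i)) ->
  itg D (fun x => \sum_(i <- s | P i) F i x).
Proof.
move=> mD iF.
have := @integrable_sum _ _ _ mu D mD _ s P (fun i x => (F i x)%:E) (fun i _ => iF i).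
by apply: eq_integrable => // x _; rewrite /= sumEFin.
Qed.

Lemma Rint_sum D (I : Type) (s : seq I) (P : pred I) (F : I -> R -> R) :
  measurable D -> (forall i, itg D (F i)) ->
  \int[mu]_(x in D) (\sum_(i <- s | P i) F i x) =
  \sum_(i <- s | P i) \int[mu]_(x in D) F i x.
Proof.
move=> mD iF; elim: s => [|i s IH].
  by under eq_Rintegral do rewrite big_nil; rewrite Rintegral_cst// mul0r big_nil.
rewrite big_cons; case: ifPn => Pi; last first.
  by rewrite -IH; apply: eq_Rintegral => x _; rewrite big_cons (negbTE Pi).
rewrite -IH -RintegralD//; last exact: itg_sum.
by apply: eq_Rintegral => x _; rewrite big_cons Pi.
Qed.

Lemma Rint_bound D g f : measurable D -> measurable_fun D f -> itg D g ->
  (forall x, D x -> `|f x| <= g x) ->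
  `|\int[mu]_(x in D) f x| <= \int[mu]_(x in D) g x.
Proof.
move=> mD mf ig fg; have if_ : itg D f by exact: (itg_le _ _ fg).
apply: (le_trans (@le_normr_Rintegral _ _ _ mu D f mD if_)).
by apply: le_Rintegral => //; exact: itg_norm.
Qed.

(** Holds also where [f] is not integrable: [fine] sends infinite values to 0, so after splitting
    into positive and negative parts the infinite cases are settled by computation. *)
Lemma RintN D f :
  \int[mu]_(x in D) (- f x) = - \int[mu]_(x in D) f x.
Proof.
rewrite /Rintegral.
pose g (x : R) := (f x)%:E.
have -> : (\int[mu]_(x in D) (- f x)%:E = \int[mu]_(x in D) g^\- x - \int[mu]_(x in D) g^\+ x)%E.
  rewrite integralE; congr (_ - _)%E; apply: eq_integral => x _; first by rewrite -funeposN.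
  by rewrite -funenegN.
have -> : (\int[mu]_(x in D) (f x)%:E = \int[mu]_(x in D) g^\+ x - \int[mu]_(x in D) g^\- x)%E.
  by rewrite integralE.
have := @integral_ge0 _ _ R mu D _ (fun x _ => funepos_ge0 g x).
have := @integral_ge0 _ _ R mu D _ (fun x _ => funeneg_ge0 g x).
move: (\int[mu]_(x in D) (g^\+ x))%E (\int[mu]_(x in D) (g^\- x))%E.
case=> [x| |] [y| |] //= _ _; rewrite ?oppr0//; ring.
Qed.

Lemma Rint_EFin D f : measurable D -> itg D f ->
  (\int[mu]_(x in D) f x)%:E = (\int[mu]_(x in D) (f x)%:E)%E.
Proof. by move=> mD if_; rewrite fineK//; exact: integrable_fin_num. Qed.

Lemma Rdominated D (f_ : nat -> R -> R) f g : measurable D ->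
  (forall n, measurable_fun D (f_ n)) -> measurable_fun D f -> itg D g ->
  (forall x, D x -> f_ n x @[n --> \oo] --> f x) ->
  (forall n x, D x -> `|f_ n x| <= g x) ->
  \int[mu]_(x in D) f_ n x @[n --> \oo] --> \int[mu]_(x in D) f x.
Proof.
move=> mD mf_ mf ig cf fg.
have [] := @dominated_convergence _ _ _ mu D mD (fun n => EFin \o f_ n)
  (EFin \o f) (EFin \o g).
- by move=> n; exact: measurable_EFin_comp.
- exact: measurable_EFin_comp.
- by apply: aeW => x Dx; apply: cvg_EFin; [exact: nearW|exact: cf].
- exact: ig.
- by apply: aeW => x n Dx /=; rewrite lee_fin fg.
move=> if_ _ h.
have h' : [sequence (\int[mu]_(x in D) (f_ n x)%:E)%E]_n @ \oo -->
   (fine (\int[mu]_(x in D) (f x)%:E)%E)%:E.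
  by rewrite fineK//; exact: integrable_fin_num.
exact: fine_cvg h'.
Qed.

(** The indicator factors extend [f] by zero to the plane, so that Fubini's theorem for the full
    product measure yields the version on [D] times [E]. *)
Let prodF D E (f : R -> R -> R) (p : R * R) : \bar R :=
  (f p.1 p.2 * \1_D p.1 * \1_E p.2)%:E.

Let prodF1 D E (f : R -> R -> R) x : (\int[mu]_y prodF D E f (x, y))%E =
  if x \in D then (\int[mu]_(y in E) (f x y)%:E)%E else 0%E.
Proof.
case: ifPn => Dx.
  rewrite [RHS]integral_mkcond; apply: eq_integral => y _.
  rewrite /prodF/= patchE !indicE Dx mulr1.
  by case: (y \in E); rewrite ?mulr1 ?mulr0.
by rewrite integral0_eq// => y _; rewrite /prodF/= !indicE (negbTE Dx) mulr0 mul0r.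
Qed.

Let prodF2 D E (f : R -> R -> R) y : (\int[mu]_x prodF D E f (x, y))%E =
  if y \in E then (\int[mu]_(x in D) (f x y)%:E)%E else 0%E.
Proof.
case: ifPn => Dx.
  rewrite [RHS]integral_mkcond; apply: eq_integral => x _.
  rewrite /prodF/= patchE !indicE Dx mulr1.
  by case: (x \in D); rewrite ?mulr1 ?mulr0.
by rewrite integral0_eq// => x _; rewrite /prodF/= !indicE (negbTE Dx) mulr0.
Qed.

Section product_domination.
Variables (D E : set R) (f : R -> R -> R) (a b : R -> R).
Hypotheses (mD : measurable D) (mE : measurable E)
  (mf : measurable_fun setT (fun p : R * R => f p.1 p.2))
  (ia : itg D a) (ib : itg E b)
  (fab : forall x y, D x -> E y -> `|f x y| <= a x * b y).

Lemma measurable_section1 x : measurable_fun E (f x).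
Proof.
apply: (measurable_funS measurableT) => //.
by apply: (measurableT_comp (g := fun y => (x, y)) mf); exact: pair1_measurable.
Qed.

Lemma measurable_section2 y : measurable_fun D (f ^~ y).
Proof.
apply: (measurable_funS measurableT) => //.
by apply: (measurableT_comp (g := fun x => (x, y)) mf); exact: pair2_measurable.
Qed.

Lemma itg_section1 x : D x -> itg E (f x).
Proof.
move=> Dx; apply: (@itg_le _ (fun y => a x * b y)) => //; last exact: itgZl.
  exact: measurable_section1.
by move=> y Ey; exact: fab.
Qed.

Lemma itg_section2 y : E y -> itg D (f ^~ y).
Proof.
move=> Ey; apply: (@itg_le _ (fun x => a x * b y)) => //; last exact: itgZr.
  exact: measurable_section2.
by move=> x Dx; exact: fab.
Qed.

(** By Tonelli: the iterated integral of the absolute value is at most the product of the $L^1$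
    norms of [a] and [b]. Domination by such a product is what every later exchange of integrals has
    to check. *)
Let iF : (mu \x mu)%E.-integrable setT (prodF D E f).
Proof.
have mF : measurable_fun setT (prodF D E f).
  apply/measurable_EFinP; apply: measurable_funM; first apply: measurable_funM.
  - exact: mf.
  - exact: (measurableT_comp (measurable_indic mD) measurable_fst).
  - exact: (measurableT_comp (measurable_indic mE) measurable_snd).
apply/integrable12ltyP => //.
apply: (@le_lt_trans _ _ (\int[mu]_(x in D) (`|a x| * \int[mu]_(y in E) `|b y|)%:E)%E).
  rewrite [leRHS]integral_mkcond; apply: ge0_le_integral => //.
  - by move=> x _; exact: integral_ge0.
  - apply: (@measurable_fun_fubini_tonelli_F _ _ _ _ _ mu (abse \o prodF D E f)).
      exact: measurableT_comp.
    by move=> p; exact: abse_ge0.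
  - apply: (@measurable_patch _ (fun x => (`|a x| * \int[mu]_(y in E) `|b y|)%:E)) => //.
    apply/measurable_EFinP; apply: measurable_funM => //.
    by apply: measurableT_comp => //; exact: itg_measurable ia.
  - move=> x _; rewrite patchE; case: ifPn => Dx; last first.
      rewrite integral0_eq// => y _.
      by rewrite /prodF/= !indicE (negbTE Dx) mulr0 mul0r normr0.
    apply: (@le_trans _ _ (\int[mu]_(y in E) (`|a x| * `|b y|)%:E)%E).
      rewrite [leRHS]integral_mkcond; apply: ge0_le_integral => //.
      + apply: measurableT_comp => //.
        by apply: (measurableT_comp (g := fun y => (x, y)) mF); exact: pair1_measurable.
      + apply: (@measurable_patch _ (fun y => (`|a x| * `|b y|)%:E)) => //.
        apply/measurable_EFinP; apply: measurable_funM => //.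
        by apply: measurableT_comp => //; exact: itg_measurable ib.
      + move=> y _; rewrite patchE /prodF/= !indicE Dx mulr1; case: ifPn => Ey.
          rewrite mulr1 lee_fin -normrM (le_trans (fab (set_mem Dx) (set_mem Ey)))//.
          by rewrite ler_norm.
        by rewrite mulr0 normr0.
    rewrite -Rint_EFin//; last by apply: itgZl => //; exact: itg_norm.
    by rewrite lee_fin RintegralZl//; exact: itg_norm.
rewrite -Rint_EFin ?ltry//.
by apply: itgZr => //; exact: itg_norm.
Qed.

Lemma Rfubini :
  \int[mu]_(x in D) \int[mu]_(y in E) f x y =
  \int[mu]_(y in E) \int[mu]_(x in D) f x y.
Proof.
have := Fubini iF.
under eq_integral do rewrite prodF1.
under [RHS]eq_integral do rewrite prodF2.
rewrite /Rintegral => H; congr fine.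
transitivity (\int[mu]_x (if x \in D then \int[mu]_(y in E) (f x y)%:E else 0))%E.
  rewrite [LHS]integral_mkcond; apply: eq_integral => x _.
  rewrite patchE; case: (boolP (x \in D)) => // Dx.
  by rewrite -Rint_EFin//; exact: itg_section1 (set_mem Dx).
rewrite H [RHS]integral_mkcond; apply: eq_integral => x _.
rewrite patchE; case: (boolP (x \in E)) => // Dx.
by rewrite -Rint_EFin//; exact: itg_section2 (set_mem Dx).
Qed.

Lemma itg_fubini : itg D (fun x => \int[mu]_(y in E) f x y).
Proof.
have := integrable_fubini_F iF.
move=> /(@integrableS _ _ _ mu setT D _ measurableT mD (@subsetT _ _)).
apply: eq_integrable => // x Dx; rewrite /fubini_F/= prodF1 Dx.
by rewrite -Rint_EFin//; exact: itg_section1 (set_mem Dx).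
Qed.

End product_domination.

Lemma FTC2 (F f : R -> R) (a b : R) : a <= b -> (forall x : R, is_derive x (1 : R) F (f x)) ->
  continuous f -> \int[mu]_(x in `[a, b]) f x = F b - F a.
Proof.
rewrite le_eqVlt => /predU1P[->|ab] dF cf.
  by rewrite set_itv1 Rintegral_set1 subrr.
have cF : continuous F.
  move=> x; apply: differentiable_continuous.
  by apply/derivable1_diffP; case: (dF x).
rewrite /Rintegral (@continuous_FTC2 _ f F)//.
- exact: continuous_subspaceT.
- split; first by move=> x _; case: (dF x).
  + by apply: cvg_at_right_filter; exact: cF.
  + by apply: cvg_at_left_filter; exact: cF.
- by move=> x _; rewrite derive1E; case: (dF x).
Qed.

Lemma is_derive_cont F f : (forall x : R, is_derive x (1 : R) F (f x)) -> continuous F.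
Proof.
move=> dF x; apply: differentiable_continuous.
by apply/derivable1_diffP; case: (dF x).
Qed.

Lemma Rint_cst_itv (a b c : R) : a <= b -> \int[mu]_(_ in `[a, b]) c = c * (b - a).
Proof.
move=> ab; have hmu : mu `[a, b]%classic = (b - a)%:E.
  rewrite lebesgue_measure_itv/= lte_fin; case: ltP => // ba.
  by have -> : a = b by [apply/eqP; rewrite eq_le ab ba]; rewrite subrr.
by rewrite Rintegral_cst//; congr (_ * _); exact: (congr1 fine hmu).
Qed.

Lemma cvg_scale (c l : R) (u : nat -> R) :
  u n @[n --> \oo] --> l -> (c * u n) @[n --> \oo] --> c * l.
Proof. by move=> ul; apply: cvgM => //; exact: cvg_cst. Qed.

Lemma cvg_dist_le (l : R) (u v : nat -> R) : (forall n, `|u n - l| <= v n) ->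
  v n @[n --> \oo] --> (0 : R) -> u n @[n --> \oo] --> l.
Proof.
move=> uv v0; apply/cvgrPdist_le => e e0.
move/cvgrPdist_le : v0 => /(_ _ e0); apply: filterS => n; rewrite sub0r normrN => h.
by rewrite distrC (le_trans (uv n))// (le_trans (ler_norm _)).
Qed.

End RealIntegral.

(** * Convergence and density in $L^2$ *)

Section L2.
Context {R : realType}.
Local Notation mu := (@lebesgue_measure R).
Implicit Types (D E : set R) (f g h v w F G : R -> R) (x y N : R).

(* Young's inequality (x + y)^2 <= (1 + d) x^2 + (1 + 1/d) y^2, in disguise *)
Lemma sqr_dist_le (x y d : R) : 0 < d ->
  `|x ^+ 2 - y ^+ 2| <= d * y ^+ 2 + (1 + d^-1) * (x - y) ^+ 2.
Proof.
move=> d0; set z := x - y; have -> : x = y + z by rewrite /z addrC subrK.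
have -> : (y + z) ^+ 2 - y ^+ 2 = y * z *+ 2 + z ^+ 2 by ring.
have H : `|y * z *+ 2| <= d * y ^+ 2 + d^-1 * z ^+ 2.
  have sd : Num.sqrt d ^+ 2 = d by rewrite sqr_sqrtr// ltW.
  have sd0 : Num.sqrt d != 0 by rewrite gt_eqF// sqrtr_gt0.
  rewrite -[X in X * y ^+ 2]sd -[X in X^-1 * z ^+ 2]sd -exprVn -!exprMn.
  have := sqr_ge0 (Num.sqrt d * y - (Num.sqrt d)^-1 * z).
  have := sqr_ge0 (Num.sqrt d * y + (Num.sqrt d)^-1 * z).
  rewrite sqrrB sqrrD mulrACA mulfV// mul1r => h1 h2.
  by rewrite ler_norml; apply/andP; split; lra.
apply: (le_trans (ler_normD _ _)); rewrite (ger0_norm (sqr_ge0 z)).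
by rewrite mulrDl mul1r addrA addrAC lerD2r.
Qed.

Lemma itg_mulL2 D f g : measurable D -> measurable_fun D f ->
  measurable_fun D g -> itg D (fun x => f x ^+ 2) -> itg D (fun x => g x ^+ 2) ->
  itg D (fun x => f x * g x).
Proof.
move=> mD mf mg if2 ig2.
apply: (@itg_le _ _ (fun x => f x ^+ 2 + g x ^+ 2)) => //.
- exact: measurable_funM.
- move=> x _; rewrite normrM -(real_normK (num_real (f x))).
  rewrite -(real_normK (num_real (g x))).
  by have := sqr_ge0 (`|f x| - `|g x|); nra.
- exact: itgD.
Qed.

Lemma itg_sqrD D f g : measurable D -> measurable_fun D f ->
  measurable_fun D g -> itg D (fun x => f x ^+ 2) -> itg D (fun x => g x ^+ 2) ->
  itg D (fun x => (f x + g x) ^+ 2).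
Proof.
move=> mD mf mg if2 ig2.
apply: (@itg_le _ _ (fun x => 2 * (f x ^+ 2 + g x ^+ 2))) => //.
- by apply: measurable_funX; exact: measurable_funD.
- move=> x _; rewrite ger0_norm ?sqr_ge0//.
  by have := sqr_ge0 (f x - g x); nra.
- by apply: itgZl => //; exact: itgD.
Qed.

Lemma itg_sqrB D f g : measurable D -> measurable_fun D f ->
  measurable_fun D g -> itg D (fun x => f x ^+ 2) -> itg D (fun x => g x ^+ 2) ->
  itg D (fun x => (f x - g x) ^+ 2).
Proof.
move=> mD mf mg if2 ig2.
apply: (@itg_le _ _ (fun x => 2 * (f x ^+ 2 + g x ^+ 2))) => //.
- by apply: measurable_funX; exact: measurable_funB.
- move=> x _; rewrite ger0_norm ?sqr_ge0//.
  by have := sqr_ge0 (f x + g x); nra.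
- by apply: itgZl => //; exact: itgD.
Qed.

Lemma itg_L2_L1 D f : measurable D -> (mu D < +oo)%E -> measurable_fun D f ->
  itg D (fun x => f x ^+ 2) -> itg D f.
Proof.
move=> mD Doo mf if2.
have i1 : itg D (fun=> 1) by apply: (@itg_bdd _ _ _ 1) => // x _; rewrite normr1.
apply: (@itg_le _ _ (fun x => 1 + f x ^+ 2)) => //; last exact: itgD.
move=> x _; rewrite -(real_normK (num_real (f x))).
by have := sqr_ge0 (`|f x| - 1); have := normr_ge0 (f x); nra.
Qed.

(** Young's inequality times the bound on [c], integrated: [d] is chosen first to make $d\int F^2$
    small, then [n] to make $(1+1/d)\int(F_n-F)^2$ small. *)
Lemma cvg_sq_L2 D (c : R -> R) (M : R) (F_ : nat -> R -> R) F : measurable D ->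
  measurable_fun D c -> (forall x, D x -> `|c x| <= M) ->
  (forall n, measurable_fun D (F_ n)) -> measurable_fun D F ->
  (forall n, itg D (fun x => F_ n x ^+ 2)) -> itg D (fun x => F x ^+ 2) ->
  \int[mu]_(x in D) (F_ n x - F x) ^+ 2 @[n --> \oo] --> (0 : R) ->
  \int[mu]_(x in D) (c x * F_ n x ^+ 2) @[n --> \oo] -->
  \int[mu]_(x in D) (c x * F x ^+ 2).
Proof.
move=> mD mc cM mF_ mF iF_ iF cF.
(* [M] itself may be negative when [D] is empty. *)
have M0 : 0 <= `|M| + 1 by rewrite addr_ge0.
have cM' x : D x -> `|c x| <= `|M| + 1.
  by move=> /cM /le_trans; apply; have := ler_norm M; lra.
set M' := `|M| + 1 in M0 cM'.
have icF n : itg D (fun x => c x * F_ n x ^+ 2) by exact: (itgM_bdd _ mc cM).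
have icF' : itg D (fun x => c x * F x ^+ 2) by exact: (itgM_bdd _ mc cM).
have idF n : itg D (fun x => (F_ n x - F x) ^+ 2) by exact: itg_sqrB.
set S := \int[mu]_(x in D) F x ^+ 2.
have S0 : 0 <= S by apply: Rintegral_ge0 => x _; exact: sqr_ge0.
apply/cvgrPdist_le => e e0.
pose d := e / (2 * (M' * S + 1)).
have MS0 : 0 < M' * S + 1 by rewrite ltr_wpDl// mulr_ge0.
have d0 : 0 < d by rewrite divr_gt0// mulr_gt0.
have K0 : 0 < M' * (1 + d^-1) + 1.
  by rewrite ltr_wpDl// mulr_ge0// addr_ge0// invr_ge0 ltW.
pose e' := e / (2 * (M' * (1 + d^-1) + 1)).
have e'0 : 0 < e' by rewrite divr_gt0// mulr_gt0.
move/cvgrPdist_le : cF => /(_ _ e'0); apply: filterS => n.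
rewrite sub0r normrN ger0_norm; last by apply: Rintegral_ge0 => x _; exact: sqr_ge0.
set Z := (X in X <= _) => Ze.
have Z0 : 0 <= Z by apply: Rintegral_ge0 => x _; exact: sqr_ge0.
rewrite -RintegralB//.
apply: (@le_trans _ _ (\int[mu]_(x in D)
   (M' * (d * F x ^+ 2 + (1 + d^-1) * (F_ n x - F x) ^+ 2)))).
  apply: Rint_bound => //.
  - by apply: measurable_funB; exact: itg_measurable.
  - by apply: itgZl => //; apply: itgD => //; exact: itgZl.
  - move=> x Dx; rewrite -mulrBr normrM; apply: ler_pM => //; first exact: cM'.
    by rewrite distrC; exact: sqr_dist_le.
rewrite RintegralZl//; last by apply: itgD => //; exact: itgZl.
rewrite RintegralD//; [|exact: itgZl|exact: itgZl].
rewrite !RintegralZl// -/S -/Z mulrDr.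
have h1 : M' * (d * S) <= e / 2.
  have -> : M' * (d * S) = e * (M' * S) / (2 * (M' * S + 1)) by rewrite /d; ring.
  rewrite ler_pdivrMr ?mulr_gt0//; move: (M' * S) => t; lra.
have h2 : M' * ((1 + d^-1) * Z) <= e / 2.
  rewrite mulrA (@le_trans _ _ (M' * (1 + d^-1) * e'))//.
    by rewrite ler_wpM2l// mulr_ge0// addr_ge0// invr_ge0 ltW.
  have -> : M' * (1 + d^-1) * e' = e * (M' * (1 + d^-1)) / (2 * (M' * (1 + d^-1) + 1)).
    by rewrite /e'; ring.
  rewrite ler_pdivrMr ?mulr_gt0//; move: (M' * _) => t; lra.
by rewrite [leRHS](splitr e) lerD.
Qed.

(** Polarization: $fg=((f+g)^2-(f-g)^2)/4$ reduces products to squares. The factor [s] in the proof,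
    with $s^2=1$, treats both signs at once. *)
Lemma cvg_prod_L2 D (c : R -> R) (M : R) (F_ G_ : nat -> R -> R) F G :
  measurable D ->
  measurable_fun D c -> (forall x, D x -> `|c x| <= M) ->
  (forall n, measurable_fun D (F_ n)) -> measurable_fun D F ->
  (forall n, measurable_fun D (G_ n)) -> measurable_fun D G ->
  (forall n, itg D (fun x => F_ n x ^+ 2)) -> itg D (fun x => F x ^+ 2) ->
  (forall n, itg D (fun x => G_ n x ^+ 2)) -> itg D (fun x => G x ^+ 2) ->
  \int[mu]_(x in D) (F_ n x - F x) ^+ 2 @[n --> \oo] --> (0 : R) ->
  \int[mu]_(x in D) (G_ n x - G x) ^+ 2 @[n --> \oo] --> (0 : R) ->
  \int[mu]_(x in D) (c x * (F_ n x * G_ n x)) @[n --> \oo] -->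
  \int[mu]_(x in D) (c x * (F x * G x)).
Proof.
move=> mD mc cM mF_ mF mG_ mG iF_ iF iG_ iG cF cG.
have id1 n : itg D (fun x => (F_ n x - F x) ^+ 2) by exact: itg_sqrB.
have id2 n : itg D (fun x => (G_ n x - G x) ^+ 2) by exact: itg_sqrB.
have aux (s : R) : s ^+ 2 = 1 ->
    \int[mu]_(x in D) ((F_ n x + s * G_ n x) - (F x + s * G x)) ^+ 2
      @[n --> \oo] --> (0 : R).
  move=> s2.
  apply: (@cvg_dist_le _ _ _ (fun n =>
      2 * (\int[mu]_(x in D) (F_ n x - F x) ^+ 2) +
      2 * (\int[mu]_(x in D) (G_ n x - G x) ^+ 2))) => [n|].
  - rewrite subr0 -!RintegralZl// -RintegralD//; [|exact: itgZl|exact: itgZl].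
    apply: Rint_bound => //.
    + by apply: measurable_funX; apply: measurable_funB; apply: measurable_funD => //;
        exact: measurable_funM.
    + by apply: itgD => //; exact: itgZl.
    + move=> x _; rewrite ger0_norm ?sqr_ge0//.
      have -> : F_ n x + s * G_ n x - (F x + s * G x) =
         (F_ n x - F x) + s * (G_ n x - G x) by ring.
      move: (F_ n x - F x) (G_ n x - G x) => p q.
      have := sqr_ge0 (p - s * q); rewrite sqrrB sqrrD exprMn s2 mul1r; lra.
  - rewrite -[X in _ --> X](addr0 (0 : R)) -{1 2}(mulr0 (2 : R)).
    by apply: cvgD; exact: cvg_scale.
have msum (s : R) (f g : R -> R) : measurable_fun D f -> measurable_fun D g ->
    measurable_fun D (fun x => f x + s * g x).
  by move=> mf mg; apply: measurable_funD => //; exact: measurable_funM.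
have isum (s : R) (f g : R -> R) : measurable_fun D f -> measurable_fun D g ->
    itg D (fun x => f x ^+ 2) -> itg D (fun x => g x ^+ 2) ->
    itg D (fun x => (f x + s * g x) ^+ 2).
  move=> mf mg if2 ig2; apply: itg_sqrD => //; first exact: measurable_funM.
  apply: (@eq_integrable _ _ _ mu D mD (EFin \o (fun x => s ^+ 2 * g x ^+ 2))).
    by move=> x _ /=; rewrite exprMn.
  exact: itgZl.
have step (s : R) : s ^+ 2 = 1 ->
   \int[mu]_(x in D) (c x * (F_ n x + s * G_ n x) ^+ 2) @[n --> \oo] -->
   \int[mu]_(x in D) (c x * (F x + s * G x) ^+ 2).
  move=> s2; apply: (@cvg_sq_L2 D c M (fun n x => F_ n x + s * G_ n x)) => //.
  - by move=> n; exact: msum.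
  - exact: msum.
  - by move=> n; exact: isum.
  - exact: isum.
  - exact: aux.
have pol (f g : R -> R) : measurable_fun D f -> measurable_fun D g ->
    itg D (fun x => f x ^+ 2) -> itg D (fun x => g x ^+ 2) ->
   \int[mu]_(x in D) (c x * (f x * g x)) =
   4^-1 * (\int[mu]_(x in D) (c x * (f x + 1 * g x) ^+ 2) -
           \int[mu]_(x in D) (c x * (f x + (-1) * g x) ^+ 2)).
  move=> mf mg if2 ig2.
  have i1 (s : R) : itg D (fun x => c x * (f x + s * g x) ^+ 2).
    by apply: (itgM_bdd _ mc cM) => //; exact: isum.
  rewrite -RintegralB// -RintegralZl//; last exact: itgB.
  by apply: eq_Rintegral => x _; field.
rewrite pol//; under eq_fun do rewrite pol//.
apply: cvg_scale; apply: cvgB; first by apply: step; rewrite expr1n.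
by apply: step; rewrite sqrrN expr1n.
Qed.

Definition clip (N x : R) : R := Num.max (- N) (Num.min x N).

Lemma clip_bound N x : 0 <= N -> `|clip N x| <= N.
Proof.
move=> N0; rewrite /clip ler_norml le_max lexx/= ge_max ge_min lexx orbT andbT.
by lra.
Qed.

Lemma clip_id N x : `|x| <= N -> clip N x = x.
Proof.
rewrite ler_norml => /andP[h1 h2]; rewrite /clip (min_idPl _)//.
by rewrite (max_idPr _).
Qed.

Lemma clip_cases N x : 0 <= N -> [\/ x <= - N /\ clip N x = - N,
  - N <= x /\ x <= N /\ clip N x = x | N <= x /\ clip N x = N].
Proof.
move=> N0; rewrite /clip; have [xN|Nx] := leP x N; last first.
  by apply: Or33; rewrite (max_idPr _); [split => //; exact: ltW|lra].
have [xN'|Nx'] := leP x (- N); first exact: Or31.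
by apply: Or32; split; [exact: ltW|].
Qed.

Lemma clip_lip N x y : 0 <= N -> `|clip N x - clip N y| <= `|x - y|.
Proof.
move=> N0.
by case: (clip_cases x N0) => [[? ->]|[?[? ->]]|[? ->]];
  case: (clip_cases y N0) => [[? ->]|[?[? ->]]|[? ->]];
  case: (ger0P (x - y)) => ?;
  by [exact: lexx|rewrite ler_norml; apply/andP; split; lra].
Qed.

Lemma clip_cont N : continuous (clip N).
Proof.
move=> x; have c1 : {for x, continuous (fun z : R => Num.min z N : R^o)}.
  by apply: (@continuous_min R R (fun z => z) (fun=> N)); [exact: cvg_id|exact: cst_continuous].
apply: (@continuous_max R R (fun=> - N) (fun z => Num.min z N)) => //.
exact: cst_continuous.
Qed.

(** [v] is truncated at height [N], the truncation is approximated in $L^1$ by a continuous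
    function, and that function is truncated in turn. For two functions bounded by [N] the squared
    $L^2$ distance is at most [2 N] times the $L^1$ distance, which upgrades the approximation from
    $L^1$ to $L^2$. *)
Lemma L2_dense (D : set R) v (e : R) : measurable D -> (mu D < +oo)%E ->
  measurable_fun D v -> itg D (fun x => v x ^+ 2) -> 0 < e ->
  exists (g : R -> R), [/\ continuous g, (exists M, forall x, `|g x| <= M) &
    \int[mu]_(x in D) (v x - g x) ^+ 2 <= e].
Proof.
move=> mD Doo mv iv e0.
have mclip (N : R) w : measurable_fun D w -> measurable_fun D (fun x => clip N (w x)).
  by move=> mw; apply: (measurableT_comp (f := clip N)) => //;
     apply: continuous_measurable_fun; exact: clip_cont.
have c1 : \int[mu]_(x in D) (v x - clip n%:R (v x)) ^+ 2 @[n --> \oo] --> (0 : R).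
  have -> : (0 : R) = \int[mu]_(x in D) 0 by rewrite Rintegral_cst// mul0r.
  apply: (Rdominated (f_ := fun n x => (v x - clip n%:R (v x)) ^+ 2) (f := cst 0)
     (g := fun x => 4 * v x ^+ 2)) => //.
  - by move=> n; apply: measurable_funX; apply: measurable_funB => //; exact: mclip.
  - exact: itgZl.
  - move=> x Dx; apply: cvg_near_cst.
    near=> n; apply/eqP; rewrite clip_id ?subrr ?expr0n//.
    near: n; have := cvgry_ge (cvgr_idn : n%:R @[n --> \oo] --> (+oo%R : set_system R)) `|v x|.
    exact.
  - move=> n x Dx; rewrite ger0_norm ?sqr_ge0//.
    have : `|v x - clip n%:R (v x)| <= 2 * `|v x|.
      have := @clip_lip n%:R (v x) 0 (ler0n _ _).
      rewrite [clip _ 0]clip_id ?normr0// !subr0 => h.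
      by have := ler_normB (v x) (clip n%:R (v x)); lra.
    rewrite -(real_normK (num_real (v x - clip n%:R (v x)))) -(real_normK (num_real (v x))).
    have := normr_ge0 (v x - clip n%:R (v x)); have := normr_ge0 (v x).
    move: `|v x| `|_ - _| => p q; nra.
have e4 : 0 < e / 4 by rewrite divr_gt0.
move/cvgrPdist_le : c1 => /(_ _ e4)[N0 _ /(_ N0 (leqnn _))].
rewrite sub0r normrN ger0_norm; last by apply: Rintegral_ge0 => x _; exact: sqr_ge0.
set N : R := N0%:R => hN; have N00 : 0 <= N by rewrite ler0n.
have icv : itg D (fun x => clip N (v x)).
  by apply: (@itg_bdd _ _ _ N) => //; [exact: mclip|move=> x _; exact: clip_bound].
have [g_ [cg ig hg]] := @approximation_continuous_integrable _ D _ mD Doo icv.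
have ia n : itg D (fun x => `|clip N (v x) - g_ n x|).
  by apply: itg_norm => //; apply: itgB => //; exact: ig.
have hg' : \int[mu]_(x in D) `|clip N (v x) - g_ n x| @[n --> \oo] --> (0 : R).
  have : (\int[mu]_(z in D) `|(clip N (v z) - g_ n z)%:E|)%E @[n --> \oo] --> (0%R)%:E by [].
  by move/fine_cvg.
(* The two contributions will be [2 * (e / 4)] and [4 * N * (e / (8 * N + 1))], each at most
   [e / 2]; the [+ 1] covers [N = 0]. *)
have e5 : 0 < e / (8 * N + 1) by rewrite divr_gt0// ltr_wpDl// mulr_ge0.
move/cvgrPdist_le : hg' => /(_ _ e5)[n0 _ /(_ n0 (leqnn _))].
rewrite sub0r normrN ger0_norm; last by apply: Rintegral_ge0.
set I1 := (X in X <= _) => hI1.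
exists (fun x => clip N (g_ n0 x)); split.
- move=> x; apply: (@continuous_comp _ _ _ (g_ n0) (clip N)); first exact: cg.
  exact: clip_cont.
- by exists N => x; exact: clip_bound.
have mg : measurable_fun D (fun x => clip N (g_ n0 x)).
  by apply: mclip; apply: measurable_cont.
have i1 : itg D (fun x => (v x - clip N (v x)) ^+ 2).
  apply: itg_sqrB => //; first exact: mclip.
  apply: (@itg_bdd _ _ _ (N ^+ 2)) => //; first by apply: measurable_funX; exact: mclip.
  move=> x _; rewrite normrX; apply: lerXn2r; rewrite ?nnegrE//.
  exact: clip_bound.
apply: (@le_trans _ _ (\int[mu]_(x in D) (2 * (v x - clip N (v x)) ^+ 2 +
   4 * N * `|clip N (v x) - g_ n0 x|))).
  apply: (le_trans (ler_norm _)); apply: Rint_bound => //.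
  - by apply: measurable_funX; exact: measurable_funB.
  - by apply: itgD => //; exact: itgZl.
  - move=> x Dx; rewrite ger0_norm ?sqr_ge0//.
    have h1 := clip_lip (clip N (v x)) (g_ n0 x) N00.
    rewrite (@clip_id _ (clip N (v x))) ?clip_bound// in h1.
    have h2 : `|clip N (v x) - clip N (clip N (g_ n0 x))| <= 2 * N.
      rewrite (@clip_id _ (clip N (g_ n0 x))) ?clip_bound//.
      have := clip_bound (v x) N00; have := clip_bound (g_ n0 x) N00.
      by have := ler_normB (clip N (v x)) (clip N (g_ n0 x)); lra.
    rewrite (@clip_id _ (clip N (g_ n0 x))) ?clip_bound// in h2.
    have -> : v x - clip N (g_ n0 x) = (v x - clip N (v x)) +
       (clip N (v x) - clip N (g_ n0 x)) by ring.
    have h3 : (clip N (v x) - clip N (g_ n0 x)) ^+ 2 <= 2 * N * `|clip N (v x) - g_ n0 x|.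
      rewrite -(real_normK (num_real (clip N (v x) - clip N (g_ n0 x)))) expr2; apply: ler_pM => //.
    move: h3; move: (v x - clip N (v x)) (clip N (v x) - clip N (g_ n0 x)) => p q hpq.
    have := sqr_ge0 (p - q); rewrite sqrrB sqrrD; lra.
rewrite RintegralD//; [|exact: itgZl|exact: itgZl].
rewrite !RintegralZl// -/I1.
have h4 : 4 * N * I1 <= e / 2.
  apply: (@le_trans _ _ (4 * N * (e / (8 * N + 1)))).
    by rewrite ler_wpM2l// mulr_ge0.
  rewrite mulrA ler_pdivrMr; last by rewrite ltr_wpDl// mulr_ge0.
  by nra.
by lra.
Unshelve. all: by end_near. Qed.

End L2.

(** * Approximate identities *)

Section ApproximateIdentity.
Context {R : realType}.
Local Notation mu := (@lebesgue_measure R).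
Implicit Types (v w : R -> R).

(** The mass of [k n] need only tend to 1, which covers the Poisson kernel cut to a bounded
    interval. The error splits into the part near [x] (continuity of [g]), the part away from [x]
    (smallness of the kernel) and the defect of mass. *)
Lemma approx_id_pt (a b : R) (k : nat -> R -> R) (g : R -> R) (x M : R) :
  (forall n, continuous (k n)) -> (forall n y, 0 <= k n y) ->
  \int[mu]_(y in `[a, b]) k n y @[n --> \oo] --> (1 : R) ->
  (forall eta e : R, 0 < eta -> 0 < e -> exists N, forall n, (N <= n)%N ->
     forall y, a <= y <= b -> eta <= `|y - x| -> k n y <= e) ->
  measurable_fun `[a, b] g -> (forall y, a <= y <= b -> `|g y| <= M) ->
  {for x, continuous g} ->
  \int[mu]_(y in `[a, b]) (k n y * g y) @[n --> \oo] --> g x.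
Proof.
move=> ck k0 k1 conc mg gM cg.
set I : set R := `[a, b]%classic.
have mI : measurable I by exact: measurable_itv.
have Ioo : (mu I < +oo)%E by exact: mu_itv_lty.
have IE y : I y -> a <= y <= b by rewrite /I /= in_itv.
have ik n : itg I (k n) by exact: itg_cont.
have i1 (c : R) : itg I (fun=> c) by apply: (@itg_bdd _ _ _ `|c|).
have ig : itg I g by apply: (@itg_bdd _ _ _ M) => // y /IE; exact: gM.
have ikg n : itg I (fun y => k n y * g y).
  have : itg I (fun y => g y * k n y).
    by apply: (@itgM_bdd _ _ _ _ M) => // y /IE; exact: gM.
  by apply: eq_integrable => // y _; rewrite /= mulrC.
pose L := fine (mu I).
have L0 : 0 <= L by rewrite fine_ge0.
pose M' := `|M| + `|g x|.
have M'0 : 0 <= M' by rewrite addr_ge0.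
have gM' y : I y -> `|g y - g x| <= M'.
  move=> /IE /gM h; rewrite (le_trans (ler_normB _ _))// lerD2r (le_trans h)//.
  exact: ler_norm.
pose S n := \int[mu]_(y in I) k n y.
have S0 n : 0 <= S n by exact: Rintegral_ge0.
apply/cvgrPdist_le => e e0.
(* Once the mass is at most 2, the near part contributes at most [e / 2]; the two remaining parts
   contribute at most [e / 4] each. *)
pose d := e / 4; have d0 : 0 < d by rewrite divr_gt0.
have /cvgrPdist_le/(_ d d0) := cg.
move/nbhs_ballP => [eta /= eta0 heta].
pose e' := e / (4 * (M' * L + 1)).
have ML : 0 < M' * L + 1 by rewrite ltr_wpDl// mulr_ge0.
have e'0 : 0 < e' by rewrite divr_gt0// mulr_gt0.
have [N hN] := conc _ _ eta0 e'0.
pose e2 := Num.min 1 (e / (4 * (`|g x| + 1))).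
have gx1 : 0 < `|g x| + 1 by rewrite ltr_wpDl.
have e20 : 0 < e2 by rewrite lt_min ltr01 divr_gt0// mulr_gt0.
move/cvgrPdist_le : k1 => /(_ _ e20).
move=> k1; near=> n.
have Sn : `|1 - S n| <= e2 by near: n; exact: k1.
have Nn : (N <= n)%N by near: n; exact: nbhs_infty_ge.
have bnd : `|\int[mu]_(y in I) (k n y * (g y - g x))| <=
    d * S n + e' * M' * L.
  have -> : d * S n + e' * M' * L =
      \int[mu]_(y in I) (d * k n y + e' * M').
    rewrite RintegralD; [|exact: mI|exact: itgZl|exact: i1].
    by rewrite RintegralZl// Rintegral_cst.
  apply: Rint_bound => //.
  - apply: measurable_funM; first exact: itg_measurable.
    exact: measurable_funB.
  - by apply: itgD => //; exact: itgZl.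
  - move=> y Iy; rewrite normrM ger0_norm//.
    have [yx|yx] := leP eta `|y - x|.
      apply: (@le_trans _ _ (e' * M')); last by rewrite lerDr mulr_ge0// ltW.
      by apply: ler_pM => //; [apply: hN => //; exact: IE|exact: gM'].
    apply: (@le_trans _ _ (d * k n y)); last by rewrite lerDl mulr_ge0// ltW.
    rewrite mulrC ler_wpM2r// distrC; apply: heta.
    by rewrite -ball_normE /ball_/= distrC.
have eqn : \int[mu]_(y in I) (k n y * g y) =
    \int[mu]_(y in I) (k n y * (g y - g x)) + S n * g x.
  have -> : \int[mu]_(y in I) (k n y * (g y - g x)) =
      \int[mu]_(y in I) (k n y * g y - k n y * g x).
    by apply: eq_Rintegral => y _; rewrite mulrBr.
  rewrite RintegralB//; last exact: itgZr.
  by rewrite RintegralZr// subrK.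
rewrite eqn distrC -/I.
have -> : \int[mu]_(y in I) (k n y * (g y - g x)) + S n * g x - g x =
  \int[mu]_(y in I) (k n y * (g y - g x)) + (S n - 1) * g x by ring.
apply: (le_trans (ler_normD _ _)); rewrite normrM.
have S2 : S n <= 2.
  move: Sn; rewrite distrC le_min => /andP[+ _].
  by rewrite ler_norml => /andP[_]; lra.
have h1 : d * S n <= e / 2 by rewrite /d; nra.
have h2 : e' * M' * L <= e / 4.
  have -> : e' * M' * L = e * (M' * L) / (4 * (M' * L + 1)) by rewrite /e'; ring.
  rewrite ler_pdivrMr ?mulr_gt0//; move: (M' * L) => t; lra.
have h3 : `|S n - 1| * `|g x| <= e / 4.
  move: Sn; rewrite distrC le_min => /andP[_ h].
  apply: (@le_trans _ _ (e / (4 * (`|g x| + 1)) * `|g x|)).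
    by rewrite ler_wpM2r.
  rewrite mulrAC ler_pdivrMr ?mulr_gt0//; move: `|g x| => t; lra.
by have := lerD bnd h3; lra.
Unshelve. all: by end_near. Qed.

(** Expand $\int k\,(w-m)^2\ge0$ with $m=\int k\,w$. *)
Lemma jensen_sq (a b : R) (k w : R -> R) : continuous k -> (forall y, 0 <= k y) ->
  \int[mu]_(y in `[a, b]) k y = 1 -> measurable_fun `[a, b] w ->
  itg `[a, b] (fun y => w y ^+ 2) ->
  (\int[mu]_(y in `[a, b]) (k y * w y)) ^+ 2 <=
  \int[mu]_(y in `[a, b]) (k y * w y ^+ 2).
Proof.
move=> ck k0 k1 mw iw.
set I : set R := `[a, b]%classic.
have mI : measurable I by exact: measurable_itv.
have Ioo : (mu I < +oo)%E by exact: mu_itv_lty.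
have [K hK] : exists K, forall y, I y -> `|k y| <= K.
  have /compact_bounded[K [_ hK]] : compact (k @` I).
    by apply: continuous_compact; [exact: continuous_subspaceT|exact: segment_compact].
  by exists (K + 1) => y Iy; apply: hK; [rewrite ltrDl|exists y].
have mk : measurable_fun I k by exact: measurable_cont.
have iw1 : itg I w by exact: itg_L2_L1.
have ik : itg I k by exact: itg_cont.
have ikw : itg I (fun y => k y * w y) by exact: (itgM_bdd _ mk hK).
have ikw2 : itg I (fun y => k y * w y ^+ 2) by exact: (itgM_bdd _ mk hK).
set m := \int[mu]_(y in I) (k y * w y).
have : 0 <= \int[mu]_(y in I) (k y * (w y - m) ^+ 2).
  by apply: Rintegral_ge0 => y _; rewrite mulr_ge0// sqr_ge0.
have -> : \int[mu]_(y in I) (k y * (w y - m) ^+ 2) =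
   \int[mu]_(y in I) (k y * w y ^+ 2 + (m ^+ 2 * k y - (2 * m) * (k y * w y))).
  by apply: eq_Rintegral => y _; ring.
rewrite RintegralD//; last by apply: itgB => //; exact: itgZl.
rewrite RintegralB//; [|exact: itgZl|exact: itgZl].
by rewrite !RintegralZl// k1 -/m; lra.
Qed.

Section L2.
Variables (a b a' b' : R) (k : nat -> R -> R -> R) (B : nat -> R).
Hypotheses (aa' : a <= a') (bb' : b' <= b)
  (ck : forall n x, continuous (k n x))
  (mk : forall n, measurable_fun setT (fun p : R * R => k n p.1 p.2))
  (k0 : forall n x y, 0 <= k n x y) (kB : forall n x y, k n x y <= B n)
  (k1 : forall n x, a' < x < b' -> \int[mu]_(y in `[a, b]) k n x y = 1)
  (k2 : forall n y, a <= y <= b -> \int[mu]_(x in `]a', b'[) k n x y <= 1)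
  (conc : forall x, a' < x < b' ->
   forall eta e : R, 0 < eta -> 0 < e -> exists N, forall n, (N <= n)%N ->
     forall y, a <= y <= b -> eta <= `|y - x| -> k n x y <= e).

Let I : set R := `[a, b]%classic.
Let J : set R := `]a', b'[%classic.
Let mI : measurable I. Proof. exact: measurable_itv. Qed.
Let mJ : measurable J. Proof. exact: measurable_itv. Qed.
Let Ioo : (mu I < +oo)%E. Proof. exact: mu_itv_lty. Qed.
Let Joo : (mu J < +oo)%E. Proof. exact: mu_itv_lty. Qed.
Let JI : J `<=` I.
Proof.
move=> x; rewrite /J /I /= !in_itv/= => /andP[h1 h2].
by rewrite (le_trans aa' (ltW h1))/= (le_trans (ltW h2)).
Qed.
Let JE x : J x -> a' < x < b'. Proof. by rewrite /J /= in_itv. Qed.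
Let IE x : I x -> a <= x <= b. Proof. by rewrite /I /= in_itv. Qed.

(** The integral runs over [[a, b]] but the result is studied only on []a', b'[]: a time mollifier
    has full mass only away from the ends of the interval, whereas in space the two intervals share
    their ends. *)
Definition kconv n (v : R -> R) x := \int[mu]_(y in `[a, b]) (k n x y * v y).

Let ae1 (D : set R) : measurable D -> (mu D < +oo)%E -> forall c, itg D (fun=> c).
Proof. by move=> mD Doo c; apply: (@itg_bdd _ _ _ `|c|). Qed.

Let mkv n (v : R -> R) : measurable_fun I v ->
  measurable_fun setT (fun p : R * R => k n p.1 p.2 * (v \_ I) p.2).
Proof.
move=> mv; apply: measurable_funM; first exact: mk.
apply: (measurableT_comp (f := v \_ I)); last exact: measurable_snd.
exact: (measurable_restrictT v mI).1.
Qed.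

Let kdom n (v : R -> R) x y : J x -> I y ->
  `|k n x y * (v \_ I) y| <= `|B n| * `|v y|.
Proof.
move=> _ Iy; rewrite patchE mem_set// normrM ler_wpM2r// ger0_norm//.
by rewrite (le_trans (kB n x y))// ler_norm.
Qed.

Let kconvE n (v : R -> R) x :
  kconv n v x = \int[mu]_(y in I) (k n x y * (v \_ I) y).
Proof. by apply: eq_Rintegral => y Iy; rewrite patchE Iy. Qed.

Lemma itg_kconv n v : itg I v -> itg J (kconv n v).
Proof.
move=> iv.
have iv' := itg_norm mI iv.
apply: (@eq_integrable _ _ _ mu J mJ (EFin \o (fun x => \int[mu]_(y in I) (k n x y * (v \_ I) y)))).
  by move=> x _ /=; rewrite kconvE.
apply: (@itg_fubini _ J I _ (fun=> `|B n|) (fun y => `|v y|)) => //.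
- by apply: mkv; exact: itg_measurable.
- exact: ae1.
- exact: kdom.
Qed.

(** Jensen in each row, then Fubini, the mass of every column being at most 1. The operators
    [kconv n] are thus contractions in $L^2$, uniformly in [n]. *)
Lemma kconv_sq_le n w : measurable_fun I w -> itg I (fun y => w y ^+ 2) ->
  itg J (fun x => kconv n w x ^+ 2) /\
  \int[mu]_(x in J) kconv n w x ^+ 2 <= \int[mu]_(y in I) w y ^+ 2.
Proof.
move=> mw iw2.
have iw : itg I w by exact: itg_L2_L1.
pose h x := \int[mu]_(y in I) (k n x y * w y ^+ 2).
have ih : itg J h := itg_kconv n iw2.
have jen x : J x -> kconv n w x ^+ 2 <= h x.
  by move=> Jx; apply: jensen_sq => //; exact: k1 (JE Jx).
have mkw : measurable_fun J (fun x => kconv n w x ^+ 2).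
  by apply: measurable_funX; apply: itg_measurable; exact: itg_kconv.
have isq : itg J (fun x => kconv n w x ^+ 2).
  apply: (itg_le mJ mkw _ ih) => x Jx; rewrite ger0_norm ?sqr_ge0//; exact: jen.
split => //; apply: (@le_trans _ _ (\int[mu]_(x in J) h x)).
  by apply: le_Rintegral => // x Jx; exact: jen.
have -> : \int[mu]_(x in J) h x =
  \int[mu]_(x in J) \int[mu]_(y in I) (k n x y * ((fun y => w y ^+ 2) \_ I) y).
  by apply: eq_Rintegral => x _; exact: kconvE.
rewrite (@Rfubini _ J I _ (fun=> `|B n|) (fun y => `|w y ^+ 2|)) //; last 4 first.
- by apply: mkv; exact: itg_measurable.
- exact: ae1.
- exact: itg_norm.
- by move=> x y Jx Iy; exact: kdom.
have ikx y : itg J (k n ^~ y).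
  apply: (@itg_bdd _ _ _ `|B n|) => //.
    apply: (measurable_funS measurableT) => //.
    by apply: (measurableT_comp (g := fun x => (x, y)) (mk n)); exact: pair2_measurable.
  by move=> x _; rewrite ger0_norm// (le_trans (kB n x y))// ler_norm.
have iF : itg I (fun y => \int[mu]_(x in J) (k n x y * ((fun y => w y ^+ 2) \_ I) y)).
  apply: (@itg_fubini _ I J _ (fun y => `|w y ^+ 2|) (fun=> `|B n|)) => //.
  - have := mkv n (itg_measurable iw2) => hm.
    have hs : measurable_fun setT (fun p : R * R => (p.2, p.1)).
      by apply: measurable_fun_pair; [exact: measurable_snd|exact: measurable_fst].
    exact: (measurableT_comp hm hs).
  - exact: itg_norm.
  - exact: ae1.
  - by move=> y x Iy Jx; rewrite mulrC -[leRHS]mulrC mulrC; exact: kdom.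
apply: le_Rintegral => // y Iy.
rewrite patchE mem_set// RintegralZr//.
by rewrite -[leRHS]mul1r ler_wpM2r ?sqr_ge0// k2// IE.
Qed.

(** Density: [v] is replaced by a bounded continuous [g], for which pointwise and dominated
    convergence apply; the contraction property controls the image of [v - g]. *)
Lemma approx_id_L2 v : measurable_fun I v -> itg I (fun y => v y ^+ 2) ->
  \int[mu]_(x in J) (kconv n v x - v x) ^+ 2 @[n --> \oo] --> (0 : R).
Proof.
move=> mv iv2.
have mvJ : measurable_fun J v by exact: measurable_funS mv.
have iv2J : itg J (fun y => v y ^+ 2) by exact: integrableS iv2.
apply/cvgrPdist_le => e e0.
(* Three errors of size [e / 9] enter through $(p+q-r)^2\le3(p^2+q^2+r^2)$. *)
have e9 : 0 < e / 9 by rewrite divr_gt0.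
have [g [cg [M gM] vg]] := L2_dense mI Ioo mv iv2 e9.
have mg : measurable_fun I g by exact: measurable_cont.
have ig2 : itg I (fun y => g y ^+ 2).
  apply: (@itg_bdd _ _ _ (M ^+ 2)) => //; first exact: measurable_funX.
  move=> x _; rewrite normrX; apply: lerXn2r; rewrite ?nnegrE//.
  exact: le_trans (gM x).
have ig : itg I g by exact: itg_L2_L1.
have iv : itg I v by exact: itg_L2_L1.
have M0 : 0 <= M by exact: le_trans (gM 0).
have cvg2 : \int[mu]_(x in J) (kconv n g x - g x) ^+ 2 @[n --> \oo] --> (0 : R).
  have -> : (0 : R) = \int[mu]_(x in J) 0 by rewrite Rintegral_cst// mul0r.
  apply: (Rdominated (f_ := fun n x => (kconv n g x - g x) ^+ 2) (f := cst 0)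
     (g := fun x => (2 * M) ^+ 2)) => //.
  - move=> n; apply: measurable_funX; apply: measurable_funB.
      by apply: itg_measurable; exact: itg_kconv.
    exact: measurable_cont.
  - exact: ae1.
  - move=> x Jx.
    have : kconv n g x @[n --> \oo] --> g x.
      apply: (@approx_id_pt a b (fun n => k n x) g x M) => //.
      + have -> : (fun n => \int[mu]_(y in `[a, b]) k n x y) = (fun=> 1).
          by apply/funext => n; apply: k1; exact: JE.
        exact: cvg_cst.
      + by apply: conc; exact: JE.
      + exact: cg.
    move=> h.
    have h1 : (kconv n g x - g x) @[n --> \oo] --> (0 : R).
      by rewrite -(subrr (g x)); apply: cvgB => //; exact: cvg_cst.
    rewrite /cst -(mulr0 (0 : R)).
    under eq_fun do rewrite expr2.
    exact: cvgM.
  - move=> n x Jx; rewrite normrX; apply: lerXn2r; rewrite ?nnegrE ?mulr_ge0//.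
    apply: (le_trans (ler_normB _ _)).
    have : `|kconv n g x| <= M.
      apply: (@le_trans _ _ (\int[mu]_(y in I) (k n x y * M))).
        apply: Rint_bound => //.
        + by apply: measurable_funM => //; exact: measurable_cont.
        + by apply: itgZr => //; exact: itg_cont.
        + by move=> y _; rewrite normrM ger0_norm// ler_wpM2l.
      rewrite RintegralZr//; last exact: itg_cont.
      by rewrite k1 ?mul1r//; exact: JE.
    by have := gM x; lra.
move/cvgrPdist_le : cvg2 => /(_ _ e9); apply: filterS => n.
rewrite !sub0r !normrN !ger0_norm; try by apply: Rintegral_ge0 => x _; exact: sqr_ge0.
move=> h2.
have iw2 : itg I (fun y => (v y - g y) ^+ 2) by exact: itg_sqrB.
have mw : measurable_fun I (fun y => v y - g y) by exact: measurable_funB.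
have iw : itg I (fun y => v y - g y) by exact: itgB.
have [isq h1] := kconv_sq_le n mw iw2.
have h3 : \int[mu]_(x in J) (v x - g x) ^+ 2 <= e / 9.
  apply: le_trans vg; rewrite -lee_fin !Rint_EFin//; last exact: integrableS iw2.
  apply: ge0_subset_integral => //.
  - by apply: measurable_EFin_comp; exact: itg_measurable iw2.
  - by move=> x _; rewrite lee_fin sqr_ge0.
have mgJ : measurable_fun J g by exact: measurable_funS mg.
have mkg (w : R -> R) : itg I w -> measurable_fun J (kconv n w).
  by move=> iw'; apply: itg_measurable; exact: itg_kconv.
have i3 : itg J (fun x => (v x - g x) ^+ 2) by exact: integrableS iw2.
have i2 : itg J (fun x => (kconv n g x - g x) ^+ 2).
  apply: itg_sqrB => //; first exact: mkg.
  - by case: (kconv_sq_le n mg ig2).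
  - by exact: integrableS ig2.
have klin x : J x -> kconv n v x = kconv n (fun y => v y - g y) x + kconv n g x.
  move=> Jx; have ikw (w : R -> R) : itg I w -> itg I (fun y => k n x y * w y).
    move=> iw'; apply: (@itgM_bdd _ _ _ _ (B n)) => //; first exact: measurable_cont.
    by move=> y _; rewrite ger0_norm.
  rewrite /kconv -RintegralD//; [|exact: ikw|exact: ikw].
  by apply: eq_Rintegral => y _; ring.
apply: (@le_trans _ _ (\int[mu]_(x in J)
  (3 * (kconv n (fun y => v y - g y) x ^+ 2 + (kconv n g x - g x) ^+ 2
    + (v x - g x) ^+ 2)))).
  apply: (le_trans (ler_norm _)); apply: Rint_bound => //.
  - apply: measurable_funX; apply: measurable_funB => //; exact: mkg.
  - by apply: itgZl => //; apply: itgD => //; exact: itgD.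
  - move=> x Jx; rewrite ger0_norm ?sqr_ge0// klin//.
    have -> : kconv n (fun y => v y - g y) x + kconv n g x - v x =
      kconv n (fun y => v y - g y) x + (kconv n g x - g x) - (v x - g x) by ring.
    move: (kconv n (fun y => v y - g y) x) (kconv n g x - g x) (v x - g x) => p q r.
    have := sqr_ge0 (p - q); have := sqr_ge0 (p + r); have := sqr_ge0 (q + r); nra.
rewrite RintegralZl//; last by apply: itgD => //; exact: itgD.
rewrite RintegralD//; last exact: itgD.
rewrite RintegralD//.
by lra.
Qed.

End L2.
End ApproximateIdentity.

(** * Powers of the raised cosine *)

Section Trig.
Context {R : realType}.
Local Notation mu := (@lebesgue_measure R).
Local Notation pi := (@pi R).

Lemma is_derive_affine (a b x : R) : is_derive x (1 : R) (fun y => a * y + b) a.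
Proof.
have h : is_derive x (1 : R) ((a \*: @id R) + cst b) (a *: 1 + 0) by exact: is_deriveD.
by apply: (is_derive_eq h); rewrite addr0 /GRing.scale/= mulr1.
Qed.

Lemma is_derive_comp_affine (F f : R -> R) (a b x : R) :
  (forall y : R, is_derive y (1 : R) F (f y)) ->
  is_derive x (1 : R) (fun y => F (a * y + b)) (a * f (a * x + b)).
Proof.
move=> dF; rewrite mulrC.
exact: (@is_derive1_comp R F (fun y => a * y + b) x _ _ (dF (a * x + b))
  (is_derive_affine a b x)).
Qed.

Lemma is_derive_sin_affine (a b x : R) :
  is_derive x (1 : R) (fun y => sin (a * y + b)) (a * cos (a * x + b)).
Proof. exact: (is_derive_comp_affine _ _ _ (@is_derive_sin R)). Qed.

Lemma is_derive_cos_affine (a b x : R) :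
  is_derive x (1 : R) (fun y => cos (a * y + b)) (a * - sin (a * x + b)).
Proof. exact: (is_derive_comp_affine _ _ _ (@is_derive_cos R)). Qed.

Lemma continuous_cos_affine (a b : R) : continuous (fun x : R => cos (a * x + b)).
Proof. exact: (is_derive_cont (is_derive_cos_affine a b)). Qed.

Lemma continuous_sin_affine (a b : R) : continuous (fun x : R => sin (a * x + b)).
Proof. exact: (is_derive_cont (is_derive_sin_affine a b)). Qed.

Lemma cosDint2pi (x : R) (k : int) : cos (x + k%:~R * (2 * pi)) = cos x.
Proof.
have h (n : nat) y : cos (y + n%:R * (2 * pi)) = cos y.
  by rewrite !mulr_natl -[in LHS]mulr_natl mulr_natl (periodicn (@cosD2pi R)).
case: (intP k) => [|n|n]; first by rewrite mul0r addr0.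
  exact: h.
by rewrite -(h n.+1 (x + _)) -addrA -mulrDl mulrNz addNr mul0r addr0.
Qed.

Lemma sinDint2pi (x : R) (k : int) : sin (x + k%:~R * (2 * pi)) = sin x.
Proof.
have := cosDint2pi (x - pi / 2) k.
by rewrite addrAC !cosBpihalf.
Qed.

Lemma int_cos_affine (k : int) (b : R) : k != 0 ->
  \int[mu]_(x in `[0, 2 * pi]) cos (k%:~R * x + b) = 0.
Proof.
move=> k0; have kR : k%:~R != 0 :> R by rewrite intr_eq0.
have p0 : 0 <= 2 * pi by rewrite mulr_ge0// pi_ge0.
have dF (x : R) : is_derive x (1 : R) (fun x => k%:~R^-1 * sin (k%:~R * x + b))
    (cos (k%:~R * x + b)).
  have h := @is_deriveZ R R R (fun x => sin (k%:~R * x + b)) (k%:~R^-1) x 1 _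
    (is_derive_sin_affine _ _ _).
  by apply: (is_derive_eq h); rewrite /GRing.scale/= mulrA mulVf// mul1r.
rewrite (FTC2 p0 dF (@continuous_cos_affine _ _)).
by rewrite mulr0 add0r (addrC (k%:~R * _) b) sinDint2pi subrr.
Qed.

(** This is $\cos^{2N}(z/2)$, a nonnegative trigonometric polynomial of degree [N] peaked at 0. It
    has two uses: centred at [x0] it is the window of the localisation argument, and divided by its
    mass it is the kernel that truncates functions of [x] to finitely many frequencies. *)
Definition cospow (N : nat) (z : R) : R := ((1 + cos z) / 2) ^+ N.

Lemma cospow_ge0 N z : 0 <= cospow N z.
Proof. by rewrite exprn_ge0// divr_ge0//; have := cos_geN1 z; lra. Qed.

Lemma cospow_le1 N z : cospow N z <= 1.
Proof.
apply: exprn_ile1; first by rewrite divr_ge0//; have := cos_geN1 z; lra.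
by have := cos_le1 z; lra.
Qed.

Lemma cospowS N z : cospow N.+1 z = cospow N z / 2 + cospow N z * cos z / 2.
Proof. by rewrite /cospow exprS; field. Qed.

Lemma cospow_even N z : cospow N (- z) = cospow N z.
Proof. by rewrite /cospow cosN. Qed.

Lemma continuous_cospow_affine N (a b : R) : continuous (fun x : R => cospow N (a * x + b)).
Proof.
move=> x.
have h : {for x, continuous (fun x : R => (1 + cos (a * x + b)) / 2)}.
  apply: cvgM; last exact: cvg_cst.
  by apply: cvgD; [exact: cvg_cst|exact: continuous_cos_affine].
exact: (continuous_comp h (@exprn_continuous _ _ _)).
Qed.

Lemma continuous_cospow N : continuous (cospow N).
Proof.
have := @continuous_cospow_affine N 1 0.
by under eq_fun do rewrite mul1r addr0.
Qed.

Lemma continuous_cospowB N (y : R) : continuous (fun x : R => cospow N (x - y)).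
Proof.
have := @continuous_cospow_affine N 1 (- y).
by under eq_fun do rewrite mul1r.
Qed.

Let itg2 (f g : R -> R) : continuous f -> continuous g ->
  itg `[0, 2 * pi] (fun x => f x * g x).
Proof. by move=> cf cg; apply: itg_cont => x; apply: cvgM; [exact: cf|exact: cg]. Qed.

(** A polynomial of degree [N] is orthogonal to higher frequencies: by [cospowS] each further factor
    moves the frequency [l] by at most one, so the induction ends at a nonconstant cosine integrated
    over full periods. *)
Lemma int_cospow_cos0 (N : nat) (l : int) (x0 b : R) : (N < `|l|)%N ->
  \int[mu]_(x in `[0, 2 * pi]) (cospow N (x - x0) * cos (l%:~R * x + b)) = 0.
Proof.
elim: N l b => [l b l0|N IH l b Nl].
  under eq_Rintegral do rewrite /cospow expr0 mul1r.
  by apply: int_cos_affine; rewrite -absz_gt0.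
have -> : \int[mu]_(x in `[0, 2 * pi]) (cospow N.+1 (x - x0) * cos (l%:~R * x + b)) =
   \int[mu]_(x in `[0, 2 * pi])
     (2^-1 * (cospow N (x - x0) * cos (l%:~R * x + b)) +
      (4^-1 * (cospow N (x - x0) * cos ((l + 1)%:~R * x + (b - x0))) +
       4^-1 * (cospow N (x - x0) * cos ((l - 1)%:~R * x + (b + x0))))).
  apply: eq_Rintegral => x _; rewrite cospowS.
  have -> : (l + 1)%:~R * x + (b - x0) = (l%:~R * x + b) + (x - x0).
    by rewrite intrD mulrDl mul1r; ring.
  have -> : (l - 1)%:~R * x + (b + x0) = (l%:~R * x + b) - (x - x0).
    by rewrite intrB mulrBl mul1r; ring.
  by rewrite (cosD (_ + _)) (cosB (_ + _)); field.
have ii k c : itg `[0, 2 * pi] (fun x => cospow N (x - x0) * cos (k%:~R * x + c)).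
  by apply: itg2; [exact: continuous_cospowB|exact: continuous_cos_affine].
rewrite RintegralD//; [|exact: itgZl|by apply: itgD => //; exact: itgZl].
rewrite RintegralD//; [|exact: itgZl|exact: itgZl].
by rewrite !RintegralZl// !IH ?mulr0 ?addr0//; lia.
Qed.

Lemma int_cospow_sin0 (N : nat) (l : int) (x0 : R) : (N < `|l|)%N ->
  \int[mu]_(x in `[0, 2 * pi]) (cospow N (x - x0) * sin (l%:~R * x)) = 0.
Proof.
move=> Nl; rewrite -[RHS](int_cospow_cos0 x0 (- (pi / 2)) Nl).
by apply: eq_Rintegral => x _; rewrite cosBpihalf.
Qed.

Definition cpcoef (N : nat) (k : int) : R := (2 * pi)^-1 *
  \int[mu]_(y in `[0, 2 * pi]) (cospow N y * cos (k%:~R * y)).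

Lemma cpcoef0 N k : (N < `|k|)%N -> cpcoef N k = 0.
Proof.
move=> Nk; rewrite /cpcoef -[X in _ * X](_ : 0 = _) ?mulr0//.
rewrite -[LHS](int_cospow_cos0 0 0 Nk).
by apply: eq_Rintegral => x _; rewrite subr0 addr0.
Qed.

Lemma cpcoefN N k : cpcoef N (- k) = cpcoef N k.
Proof.
by congr (_ * _); apply: eq_Rintegral => x _; rewrite mulrNz mulNr cosN.
Qed.

Lemma cpcoefS N k : cpcoef N.+1 k =
  cpcoef N k / 2 + cpcoef N (k + 1) / 4 + cpcoef N (k - 1) / 4.
Proof.
have ii l : itg `[0, 2 * pi] (fun x => cospow N x * cos (l%:~R * x)).
  apply: itg2; first exact: continuous_cospow.
  by have := @continuous_cos_affine l%:~R 0; under eq_fun do rewrite addr0.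
rewrite /cpcoef.
have -> : \int[mu]_(x in `[0, 2 * pi]) (cospow N.+1 x * cos (k%:~R * x)) =
   \int[mu]_(x in `[0, 2 * pi])
     (2^-1 * (cospow N x * cos (k%:~R * x)) +
      (4^-1 * (cospow N x * cos ((k + 1)%:~R * x)) +
       4^-1 * (cospow N x * cos ((k - 1)%:~R * x)))).
  apply: eq_Rintegral => x _; rewrite cospowS.
  have -> : (k + 1)%:~R * x = k%:~R * x + x by rewrite intrD; ring.
  have -> : (k - 1)%:~R * x = k%:~R * x - x by rewrite intrB; ring.
  by rewrite cosB cosD; field.
rewrite RintegralD//; [|exact: itgZl|by apply: itgD => //; exact: itgZl].
rewrite RintegralD//; [|exact: itgZl|exact: itgZl].
by rewrite !RintegralZl//; ring.
Qed.

Lemma cpcoef00 k : cpcoef 0 k = (k == 0)%:R.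
Proof.
have [->|k0] := eqVneq k 0; last by rewrite cpcoef0// absz_gt0.
rewrite /cpcoef; under eq_Rintegral do rewrite /cospow expr0 mul1r mul0r cos0.
rewrite Rint_cst_itv ?mulr_ge0 ?pi_ge0//.
by rewrite subr0 mul1r mulVf// mulf_neq0// gt_eqF// pi_gt0.
Qed.

(** Shifting the summation index leaves two boundary terms. Both vanish in the use below, where the
    coefficients are zero beyond the degree. *)
Lemma sum_shift (a b : int -> R) (M n : nat) :
  \sum_(i < n) a (i%:Z - M%:Z + 1) * b (i%:Z - M%:Z) =
  \sum_(i < n) a (i%:Z - M%:Z) * b (i%:Z - M%:Z - 1)
   + a (n%:Z - M%:Z) * b (n%:Z - M%:Z - 1) - a (- M%:Z) * b (- M%:Z - 1).
Proof.
elim: n => [|n IH]; first by rewrite !big_ord0 sub0r; ring.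
rewrite !big_ord_recr/= IH.
have -> : n.+1%:Z - M%:Z = n%:Z - M%:Z + 1 by lia.
by rewrite addrK; ring.
Qed.

(** Induction on [N] through the recursion [cpcoefS]. The range from [-M] to [M] may exceed the
    degree, so that both sides of the inductive step are sums over the same range and the boundary
    terms of the index shift fall on vanishing coefficients. *)
Lemma cospow_expand (N M : nat) z : (N <= M)%N -> cospow N z =
  \sum_(i < (2 * M).+1) cpcoef N (i%:Z - M%:Z) * cos ((i%:Z - M%:Z)%:~R * z).
Proof.
elim: N => [|N IH] in M *.
  move=> _; rewrite /cospow expr0.
  have hM : (M < (2 * M).+1)%N by lia.
  rewrite (bigD1 (Ordinal hM))//= subrr cpcoef00 eqxx mul0r cos0 mulr1 big1 ?addr0// => i.
  rewrite -val_eqE/= => iM; rewrite cpcoef00 (_ : (_ == 0) = false) ?mul0r//.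
  by apply/negbTE; rewrite subr_eq0; apply: contra iM => /eqP[->].
move=> NM.
rewrite cospowS (IH M (ltnW NM)).
under [RHS]eq_bigr do rewrite cpcoefS !mulrDl.
rewrite !big_split/=.
pose c k := cpcoef N k; pose d (k : int) := cos (k%:~R * z).
have E1 : \sum_(i < (2 * M).+1) cpcoef N (i%:Z - M%:Z + 1) / 4 * cos ((i%:Z - M%:Z)%:~R * z) =
   4^-1 * \sum_(i < (2 * M).+1) c (i%:Z - M%:Z) * d (i%:Z - M%:Z - 1).
  have := sum_shift c d M (2 * M).+1.
  have -> : c ((2 * M).+1%:Z - M%:Z) = 0 by apply: cpcoef0; lia.
  have -> : c (- M%:Z) = 0 by apply: cpcoef0; lia.
  rewrite !mul0r addr0 subr0 => <-.
  by rewrite big_distrr/=; apply: eq_bigr => i _; rewrite /c /d; ring.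
have E2 : \sum_(i < (2 * M).+1) cpcoef N (i%:Z - M%:Z - 1) / 4 * cos ((i%:Z - M%:Z)%:~R * z) =
   4^-1 * \sum_(i < (2 * M).+1) c (i%:Z - M%:Z) * d (i%:Z - M%:Z + 1).
  have := sum_shift d (fun k => c k) M (2 * M).+1.
  have -> : c ((2 * M).+1%:Z - M%:Z - 1) = c M%:Z by congr c; lia.
  have -> : c M%:Z = 0 by apply: cpcoef0; lia.
  have -> : c (- M%:Z - 1) = 0 by apply: cpcoef0; lia.
  rewrite !mulr0 addr0 subr0 => h.
  rewrite [RHS](_ : _ = 4^-1 * \sum_(i < (2 * M).+1) d (i%:Z - M%:Z + 1) * c (i%:Z - M%:Z)).
    by rewrite h big_distrr/=; apply: eq_bigr => i _; rewrite /c /d; ring.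
  by congr (_ * _); apply: eq_bigr => i _; rewrite mulrC.
rewrite E1 E2 !big_distrr/= !big_distrl/= -!big_split/=.
apply: eq_bigr => i _; rewrite /c /d.
have -> (k : int) : (k + 1)%:~R * z = k%:~R * z + z by rewrite intrD; ring.
have -> (k : int) : (k - 1)%:~R * z = k%:~R * z - z by rewrite intrB; ring.
by rewrite cosB cosD; field.
Qed.

Definition cpmass N : R := \int[mu]_(y in `[0, 2 * pi]) cospow N y.

Lemma cpcoef_bound N k : `|cpcoef N k| <= (2 * pi)^-1 * cpmass N.
Proof.
have p0 : 0 <= (2 * pi)^-1 by rewrite invr_ge0 mulr_ge0// pi_ge0.
rewrite normrM ger0_norm// ler_wpM2l//; apply: Rint_bound => //.
- apply: measurable_funM; apply: measurable_cont => //; first exact: continuous_cospow.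
  by have := @continuous_cos_affine k%:~R 0; under eq_fun do rewrite addr0.
- by apply: itg_cont; exact: continuous_cospow.
- by move=> x _; rewrite normrM (ger0_norm (cospow_ge0 _ _)) ler_piMr ?cospow_ge0// cos_max.
Qed.

(** Only the coefficient of frequency 0 survives integration over a period, so reflecting and
    translating the argument does not change the mass; [main] treats $a=1$ and $a=-1$ together. *)
Lemma cpmass_shift N x : \int[mu]_(y in `[0, 2 * pi]) cospow N (x - y) = cpmass N.
Proof.
have main (a b : R) : a ^+ 2 = 1 -> \int[mu]_(y in `[0, 2 * pi]) cospow N (a * y + b) =
    cpcoef N 0 * (2 * pi).
  move=> a1.
  have aE : a = 1 \/ a = -1.
    by move/eqP : a1; rewrite -subr_eq0 -[X in _ - X](expr1n _ 2) subr_sqr mulf_eq0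
      subr_eq0 addr_eq0 => /orP[/eqP->|/eqP->]; [left|right].
  under eq_Rintegral do rewrite (cospow_expand _ (leqnn N)).
  rewrite Rint_sum//; last first.
    move=> i; apply: itgZl => //; apply: itg_cont.
    have := @continuous_cos_affine ((i%:Z - N%:Z)%:~R * a) ((i%:Z - N%:Z)%:~R * b).
    by under eq_fun do rewrite -mulrA -mulrDr.
  have hN : (N < (2 * N).+1)%N by lia.
  have ii (k : int) : itg `[0, 2 * pi] (fun y => cos (k%:~R * (a * y + b))).
    apply: itg_cont; have := @continuous_cos_affine (k%:~R * a) (k%:~R * b).
    by under eq_fun do rewrite -mulrA -mulrDr.
  rewrite (bigD1 (Ordinal hN))//= big1 ?addr0.
    rewrite RintegralZl// subrr; congr (_ * _).
    under eq_Rintegral do rewrite mul0r cos0.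
    by rewrite Rint_cst_itv ?mulr_ge0 ?pi_ge0// subr0 mul1r.
  move=> i; rewrite -val_eqE/= => iN; rewrite RintegralZl//.
  have k0 : i%:Z - N%:Z != 0 by rewrite subr_eq0; apply: contra iN => /eqP[->].
  rewrite [X in _ * X](_ : _ = 0) ?mulr0//.
  case: aE => aE.
    rewrite -[RHS](int_cos_affine ((i%:Z - N%:Z)%:~R * b) k0).
    by apply: eq_Rintegral => y _; rewrite aE mul1r mulrDr.
  rewrite -[RHS](int_cos_affine (- ((i%:Z - N%:Z)%:~R * b)) k0).
  by apply: eq_Rintegral => y _; rewrite -cosN aE; congr cos; ring.
have := main 1 0; rewrite expr1n => /(_ erefl).
have := main (-1) x; rewrite sqrrN expr1n => /(_ erefl) h1 h2.
transitivity (\int[mu]_(y in `[0, 2 * pi]) cospow N (-1 * y + x)).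
  by apply: eq_Rintegral => y _; rewrite mulN1r addrC.
by rewrite h1 -h2; apply: eq_Rintegral => y _; rewrite mul1r addr0.
Qed.

Lemma cpmass_shift2 N x : \int[mu]_(y in `[0, 2 * pi]) cospow N (y - x) = cpmass N.
Proof.
rewrite -(cpmass_shift N x); apply: eq_Rintegral => y _.
by rewrite -cospow_even opprB.
Qed.

(** [cospow N] decreases on $[0,\pi]$, so its values on [[0, eta]] are at least the one at [eta]. *)
Lemma cpmass_ge N (eta : R) : 0 < eta <= pi -> eta * cospow N eta <= cpmass N.
Proof.
move=> /andP[e0 epi].
have e2 : eta <= 2 * pi by have := @pi_gt0 R; lra.
have i1 : itg `[0, 2 * pi] (cospow N) by apply: itg_cont; exact: continuous_cospow.
have sub : `[0, eta] `<=` `[0, 2 * pi].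
  by move=> x; rewrite /= !in_itv/= => /andP[-> /le_trans]; exact.
have i2 : itg `[0, eta] (cospow N) by apply: itg_cont; exact: continuous_cospow.
apply: (@le_trans _ _ (\int[mu]_(y in `[0, eta]) cospow N y)); last first.
  rewrite -lee_fin /cpmass !Rint_EFin//; apply: ge0_subset_integral => //.
  - by apply: measurable_EFin_comp; exact: itg_measurable i1.
  - by move=> x _; rewrite lee_fin cospow_ge0.
have -> : eta * cospow N eta = \int[mu]_(y in `[0, eta]) cospow N eta.
  by rewrite Rint_cst_itv ?ltW// subr0 mulrC.
apply: le_Rintegral => //.
  apply: (@itg_bdd _ _ _ 1) => //; first exact: mu_itv_lty.
  by move=> x _; rewrite ger0_norm ?cospow_ge0 ?cospow_le1.
move=> x; rewrite /= in_itv/= => /andP[x0 xe].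
apply: lerXn2r; rewrite ?nnegrE ?divr_ge0//; try (by have := @cos_geN1 R x; have := @cos_geN1 R eta; lra).
rewrite ler_pM2r// lerD2l leNgt ltr_cos ?in_itv/=; first by rewrite -leNgt.
  by apply/andP; split; lra.
by apply/andP; split; lra.
Qed.

Lemma cpmass_gt0 N : 0 < cpmass N.
Proof.
have h : 0 < pi / 2 <= pi by have := @pi_gt0 R; lra.
apply: (lt_le_trans _ (cpmass_ge N h)).
rewrite mulr_gt0 ?divr_gt0 ?pi_gt0// exprn_gt0// divr_gt0//.
by rewrite cos_pihalf addr0.
Qed.

(** Away from [x0] the kernel is at most $r^N$, while its mass is at least $\eta_2 r'^N$ with
    $r<r'$: the quotient decays geometrically. *)
Lemma cospow_concentration (x0 eta e : R) : 0 < x0 < 2 * pi -> 0 < eta -> 0 < e ->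
  exists N0, forall N, (N0 <= N)%N -> forall x, 0 <= x <= 2 * pi ->
    eta <= `|x - x0| -> cospow N (x - x0) <= e * cpmass N.
Proof.
move=> /andP[x00 x02] eta0 e0.
have p0 := @pi_gt0 R.
(* As [eta1] is at most the distance from [x0] to either end, a point of $[0,2\pi]$ at distance at
   least [eta1] from [x0] is that far from it modulo $2\pi$ as well. *)
pose eta1 := Num.min eta (Num.min x0 (2 * pi - x0)).
have e10 : 0 < eta1 by rewrite !lt_min eta0 x00 subr_gt0.
have e1eta : eta1 <= eta by rewrite /eta1 ge_min lexx.
have e1x : eta1 <= x0 by rewrite /eta1 !ge_min lexx orbT.
have e1x' : eta1 <= 2 * pi - x0 by rewrite /eta1 !ge_min lexx !orbT.
have e1pi : eta1 <= pi by lra.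
pose eta2 := eta1 / 2.
have e20 : 0 < eta2 by rewrite divr_gt0.
have lec : cos eta1 < cos eta2.
  by rewrite ltr_cos ?in_itv/=; rewrite /eta2; lra.
pose r := (1 + cos eta1) / 2; pose r' := (1 + cos eta2) / 2.
have r0 : 0 <= r by rewrite /r; have := @cos_geN1 R eta1; lra.
have rr' : r < r' by rewrite /r /r'; lra.
have r'0 : 0 < r' by exact: le_lt_trans rr'.
have upper x : 0 <= x <= 2 * pi -> eta <= `|x - x0| -> (1 + cos (x - x0)) / 2 <= r.
  move=> /andP[x1 x2] h; rewrite /r -cos_norm.
  set z := `|x - x0| in h *.
  have z1 : eta1 <= z by exact: le_trans h.
  have z2 : z <= 2 * pi - eta1 by rewrite /z ler_norml; apply/andP; split; lra.
  have : cos z <= cos eta1.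
    have [zpi|zpi] := leP z pi.
      by rewrite leNgt ltr_cos ?in_itv/= -?leNgt//; apply/andP; split; lra.
    have -> : cos z = cos (2 * pi - z).
      by rewrite -[LHS]cosN -(cosDint2pi _ 1) mul1r addrC.
    by rewrite leNgt ltr_cos ?in_itv/= -?leNgt; lra.
  by lra.
have q1 : `|r / r'| < 1.
  by rewrite ger0_norm ?divr_ge0// ?ltW// ltr_pdivrMr// mul1r.
have := @cvg_expr R _ q1.
have ee : 0 < e * eta2 by rewrite mulr_gt0.
move/cvgrPdist_le => /(_ _ ee)[N0 _ hN0]; exists N0 => N NN0 x xI xe.
have := hN0 N NN0; rewrite sub0r normrN ger0_norm; last by rewrite exprn_ge0// divr_ge0// ltW.
rewrite /= expr_div_n ler_pdivrMr ?exprn_gt0// => h.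
have h1 : cospow N (x - x0) <= r ^+ N.
  apply: lerXn2r; last exact: upper.
    by rewrite nnegrE divr_ge0//; have := @cos_geN1 R (x - x0); lra.
  by rewrite nnegrE.
apply: (le_trans h1); apply: (le_trans h).
rewrite -mulrA; apply: (ler_wpM2l (ltW e0)); apply: (@cpmass_ge N eta2).
by rewrite /eta2; apply/andP; split; lra.
Qed.

End Trig.

(** * Mollifiers *)

Section Smooth.
Context {R : realType}.
Local Notation mu := (@lebesgue_measure R).

Lemma is_derive_addf (f g : R -> R) (x df dg : R) :
  is_derive x (1 : R) f df -> is_derive x (1 : R) g dg ->
  is_derive x (1 : R) (fun y => f y + g y) (df + dg).
Proof. exact: is_deriveD. Qed.

Lemma is_derive_mulf (f g : R -> R) (x df dg : R) :
  is_derive x (1 : R) f df -> is_derive x (1 : R) g dg ->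
  is_derive x (1 : R) (fun y => f y * g y) (df * g x + f x * dg).
Proof.
move=> hf hg; apply: (is_derive_eq (is_deriveM hf hg)).
by rewrite /GRing.scale/= addrC mulrC.
Qed.

Lemma is_derive_scalef (c : R) (f : R -> R) (x df : R) :
  is_derive x (1 : R) f df -> is_derive x (1 : R) (fun y => c * f y) (c * df).
Proof. by move=> hf; exact: is_deriveZ. Qed.

Lemma derive1_is_derive (f f' : R -> R) :
  (forall x : R, is_derive x (1 : R) f (f' x)) -> derive1 f = f'.
Proof. by move=> h; apply/funext => x; rewrite derive1E; case: (h x). Qed.

(** The derivative is carried as a witness, so that closure under sums, products and affine
    substitution is a direct induction on [n]. *)
Fixpoint Ck (n : nat) (f : R -> R) : Prop :=
  if n is m.+1 then
    exists2 f' : R -> R, (forall x : R, is_derive x (1 : R) f (f' x)) & Ck m f'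
  else True.

Definition smooth1 (f : R -> R) := forall n, Ck n f.

Lemma CkW n f : Ck n.+1 f -> Ck n f.
Proof.
elim: n f => [//|n IH] f [f' hf' h]; exists f' => //; exact: IH.
Qed.

Lemma Ck_add n f g : Ck n f -> Ck n g -> Ck n (fun x => f x + g x).
Proof.
elim: n f g => [//|n IH] f g [f' hf Cf] [g' hg Cg].
exists (fun x => f' x + g' x); last exact: IH.
by move=> x; exact: is_derive_addf.
Qed.

Lemma Ck_scale n (c : R) f : Ck n f -> Ck n (fun x => c * f x).
Proof.
elim: n f => [//|n IH] f [f' hf Cf].
exists (fun x => c * f' x); last exact: IH.
by move=> x; exact: is_derive_scalef.
Qed.

Lemma Ck_mul n f g : Ck n f -> Ck n g -> Ck n (fun x => f x * g x).
Proof.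
elim: n f g => [//|n IH] f g Cf Cg.
have Cf0 := CkW Cf; have Cg0 := CkW Cg.
case: Cf => f' hf Cf; case: Cg => g' hg Cg.
exists (fun x => f' x * g x + f x * g' x); last by apply: Ck_add; exact: IH.
by move=> x; exact: is_derive_mulf.
Qed.

Lemma Ck_affine n f (a b : R) : Ck n f -> Ck n (fun x => f (a * x + b)).
Proof.
elim: n f => [//|n IH] f [f' hf Cf].
exists (fun x => a * f' (a * x + b)); last by apply: Ck_scale; exact: IH.
by move=> x; exact: is_derive_comp_affine.
Qed.

Lemma smooth1_scale (c : R) f : smooth1 f -> smooth1 (fun x => c * f x).
Proof. by move=> h n; exact: Ck_scale. Qed.

Lemma smooth1_mul f g : smooth1 f -> smooth1 g -> smooth1 (fun x => f x * g x).
Proof. by move=> h h' n; exact: Ck_mul. Qed.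

Lemma smooth1_affine f (a b : R) : smooth1 f -> smooth1 (fun x => f (a * x + b)).
Proof. by move=> h n; exact: Ck_affine. Qed.

Lemma smooth1_is_derive f : smooth1 f ->
  forall x : R, is_derive x (1 : R) f (derive1 f x).
Proof. by move=> /(_ 1)[f' hf _]; rewrite (derive1_is_derive hf). Qed.

Lemma smooth1_derive1 f : smooth1 f -> smooth1 (derive1 f).
Proof. by move=> h n; have [f' hf Cf] := h n.+1; rewrite (derive1_is_derive hf). Qed.

Lemma smooth1_continuous f : smooth1 f -> continuous f.
Proof. by move=> /smooth1_is_derive; exact: is_derive_cont. Qed.

Lemma smooth1_cos_affine (a b : R) : smooth1 (fun x => cos (a * x + b)).
Proof.
apply: smooth1_affine => n.
suff: Ck n (@cos R) /\ Ck n (@sin R) by case.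
elim: n => [//|n [IHc IHs]]; split.
  exists (fun x => (-1) * sin x); last exact: Ck_scale.
  by move=> x; rewrite mulN1r; exact: is_derive_cos.
by exists (@cos R) => // x; exact: is_derive_sin.
Qed.

(** With a polynomial in $1/y$ as a factor the family is closed under differentiation, so smoothness
    to all orders is one induction. *)
Definition flat (P : {poly R}) (y : R) : R :=
  if 0 < y then P.[y^-1] * expR (- y^-1) else 0.

(** Quadratic vanishing at the origin, which yields derivative 0 there. For $z=1/y\ge1$ one has
    $|P(z)|\le Sz^d$ and $e^z\ge z^{d+2}/(d+2)!$. *)
Lemma flat_bound (P : {poly R}) :
  exists2 C, 0 <= C & forall y, 0 < y -> y <= 1 -> `|flat P y| <= C * y ^+ 2.
Proof.
pose d := size P; pose S := \sum_(i < d) `|P`_i|.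
have S0 : 0 <= S by apply: sumr_ge0.
exists (S * d.+2`!%:R); first by rewrite mulr_ge0.
move=> y y0 y1; rewrite /flat y0.
set z := y^-1; have z1 : 1 <= z by rewrite invf_ge1.
have z0 : 0 < z by exact: lt_le_trans z1.
have Pz : `|P.[z]| <= S * z ^+ d.
  rewrite horner_coef (le_trans (ler_norm_sum _ _ _))// /S big_distrl/=.
  apply: ler_sum => i _; rewrite normrM ler_wpM2l// normrX gtr0_norm//.
  by rewrite ler_weXn2l// ltnW.
have ez : z ^+ d.+2 <= d.+2`!%:R * expR z.
  have := expR_ge1Dxn d.+1 (ltW z0).
  rewrite -ler_pdivrMl ?ltr0n ?fact_gt0// mulrC.
  by apply: le_trans; rewrite lerDr.
rewrite normrM (ger0_norm (expR_ge0 _)) expRN.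
rewrite ler_pdivrMr ?expR_gt0//.
apply: (le_trans Pz); rewrite -!mulrA ler_wpM2l//.
have yz : z ^+ 2 * y ^+ 2 = 1.
  by rewrite -exprMn /z mulVf ?expr1n// gt_eqF.
have -> : z ^+ d = y ^+ 2 * z ^+ d.+2.
  by rewrite mulrC -addn2 exprD -mulrA yz mulr1.
apply: (@le_trans _ _ (y ^+ 2 * (d.+2`!%:R * expR z))).
  by apply: ler_wpM2l => //; exact: sqr_ge0.
by rewrite mulrCA expr2 -mulrA.
Qed.

(** Away from 0 this is the chain rule; at 0 the difference quotient is at most $C|h|$ by
    [flat_bound]. *)
Lemma is_derive_flat (P : {poly R}) (y : R) :
  is_derive y (1 : R) (flat P) (flat ('X^2 * (P - P^`())) y).
Proof.
have [y0|y0|<-] := ltgtP 0 y.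
- have dv : is_derive y (1 : R) (fun z => z^-1) (- y ^- 2).
    apply: (is_derive_eq (is_deriveV _ (is_derive_id y 1))); first by rewrite /= gt_eqF.
    by rewrite /GRing.scale/= mulr1.
  have d1 : is_derive y (1 : R) (fun z => P.[z^-1]) (P^`().[y^-1] * - y ^- 2).
    exact: (@is_derive1_comp _ (horner P) (fun z => z^-1)).
  have d2 : is_derive y (1 : R) (fun z => expR (- z^-1)) (expR (- y^-1) * (- (- y ^- 2))).
    apply: (@is_derive1_comp _ expR (fun z => - z^-1)).
  have d3 := is_derive_mulf d1 d2.
  apply: (@near_eq_is_derive R R R (fun z : R => P.[z^-1] * expR (- z^-1))).
    near=> z; rewrite /flat; have -> // : 0 < z.
    by near: z; exact: lt_nbhsr.
  apply: (is_derive_eq d3); rewrite /flat y0 !hornerE/=.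
  by rewrite ?hornerXn ?exprVn; ring.
- apply: (@near_eq_is_derive R R R (cst 0)).
    near=> z; rewrite /flat; have z0 : z < 0 by near: z; exact: lt_nbhsl.
    by rewrite ltNge (ltW z0).
  by rewrite /flat ltNge (ltW y0)/=; exact: is_derive_cst.
- rewrite {2}/flat ltxx.
  have [C C0 hC] := flat_bound P.
  have lim0 : (h^-1 *: (flat P (h + 0) - flat P 0)) @[h --> (0 : R)^'] --> (0 : R).
    apply/cvgrPdist_le => e e0.
    have hC0 : 0 < C + 1 by rewrite ltr_wpDl.
    near=> h; rewrite sub0r normrN addr0 {2}/flat ltxx subr0 /GRing.scale/=.
    have [h0|h0] := ltP 0 h; last by rewrite /flat ltNge h0/= mulr0 normr0 ltW.
    have h1 : h <= 1.
      rewrite (le_trans (ler_norm _))//; near: h.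
      by apply: dnbhs0_le.
    have he : `|h| <= e / (C + 1).
      by near: h; apply: dnbhs0_le; rewrite divr_gt0//.
    rewrite normrM (@gtr0_norm _ h^-1) ?invr_gt0//; rewrite [leLHS]mulrC ler_pdivrMr//.
    apply: (le_trans (hC h h0 h1)); rewrite expr2 mulrA ler_pM2r//.
    rewrite (gtr0_norm h0) in he.
    apply: (@le_trans _ _ (C * (e / (C + 1)))); first by rewrite ler_wpM2l.
    by rewrite mulrA ler_pdivrMr// mulrDr mulr1 mulrC lerDl ltW.
  have e0 : (fun h : R => h^-1 *: ((flat P \o shift 0) (h *: 1) - flat P 0)) =
     (fun h : R => h^-1 *: (flat P (h + 0) - flat P 0)).
    by apply/funext => h /=; rewrite /GRing.scale/= mulr1.
  apply: DeriveDef.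
    by apply/cvg_ex; exists 0; rewrite e0.
  by rewrite /derive e0; apply/cvg_lim.
Unshelve. all: by end_near. Qed.

Lemma smooth1_flat P : smooth1 (flat P).
Proof.
move=> n; elim: n P => [//|n IH] P.
by exists (flat ('X^2 * (P - P^`()))) => // x; exact: is_derive_flat.
Qed.

Lemma itg_support (f : R -> R) (a b : R) (D : set R) : continuous f ->
  (forall x, f x != 0 -> a <= x <= b) -> measurable D -> itg D f.
Proof.
move=> cf fs mD; apply: (@integrableS _ _ _ mu setT D) => //.
have := @itg_cont _ a b f cf.
have mI : measurable (`[a, b] : set R) by [].
move=> /(@integrable_mkcond _ _ _ mu _ _ mI).
apply: eq_integrable => // x _; rewrite patchE; case: ifPn => //= xI.
have [-> //|/fs h] := eqVneq (f x) 0.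
by move: xI; rewrite notin_setE /= in_itv/= h.
Qed.

Lemma Rint_support (f : R -> R) (a b : R) (D : set R) :
  (forall x, f x != 0 -> a <= x <= b) -> `[a, b] `<=` D ->
  \int[mu]_(x in D) f x = \int[mu]_(x in `[a, b]) f x.
Proof.
move=> fs sub; rewrite Rintegral_mkcond [RHS]Rintegral_mkcond.
apply: eq_Rintegral => x _; rewrite !patchE.
have [xI|xI] := boolP (x \in `[a, b]%classic).
  by rewrite mem_set//; apply: sub; exact: set_mem.
case: ifPn => // _; have [-> //|/fs h] := eqVneq (f x) 0.
by move: xI; rewrite notin_setE /= in_itv/= h.
Qed.

Lemma flat1E y : 0 < y -> flat 1 y = expR (- y^-1).
Proof. by rewrite /flat => ->; rewrite hornerC mul1r. Qed.

Definition bump (x : R) : R := flat 1 (1 + x) * flat 1 (1 - x).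

Lemma bump_ge0 x : 0 <= bump x.
Proof.
by rewrite mulr_ge0// /flat; case: ifP => // _; rewrite hornerE mul1r expR_ge0.
Qed.

Lemma bump_even x : bump (- x) = bump x.
Proof. by rewrite /bump opprK mulrC. Qed.

Lemma bump_support x : bump x != 0 -> -1 < x < 1.
Proof.
rewrite /bump mulf_eq0 negb_or /flat => /andP[].
case: ifP => [h1 _|_]; last by rewrite eqxx.
case: ifP => [h2 _|_]; last by rewrite eqxx.
by apply/andP; split; lra.
Qed.

Lemma smooth1_bump : smooth1 bump.
Proof.
apply: smooth1_mul.
  have := smooth1_affine 1 1 (smooth1_flat 1).
  by congr smooth1; apply/funext => x; rewrite mul1r addrC.
have := smooth1_affine (-1) 1 (smooth1_flat 1).
by congr smooth1; apply/funext => x; rewrite mulN1r addrC.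
Qed.

Lemma bump_gt0 : 0 < \int[mu]_(x in `[-1, 1]) bump x.
Proof.
have cb := smooth1_continuous smooth1_bump.
(* For $|x|\le1/2$ both $1+x$ and $1-x$ are at least $1/2$, so each factor of [bump] is at least
   $e^{-2}$. *)
pose c : R := expR (-2) * expR (-2).
have c0 : 0 < c by rewrite mulr_gt0 ?expR_gt0.
have lb x : `|x| <= 2^-1 -> c <= bump x.
  rewrite ler_norml => /andP[x1 x2]; rewrite /bump !flat1E; [|lra|lra].
  apply: ler_pM; try exact: expR_ge0; rewrite ler_expR lerN2 invf_ple ?posrE; lra.
have sub : `[- 2^-1, 2^-1] `<=` `[-1 : R, 1].
  by move=> x; rewrite /= !in_itv/= => /andP[h1 h2]; apply/andP; split; lra.
have i1 : itg `[-1, 1] bump by exact: itg_cont.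
have i2 : itg `[- 2^-1, 2^-1] bump by exact: itg_cont.
apply: (@lt_le_trans _ _ (\int[mu]_(x in `[- 2^-1, 2^-1]) bump x)); last first.
  rewrite -lee_fin !Rint_EFin//; apply: ge0_subset_integral => //.
  - by apply: measurable_EFin_comp; exact: itg_measurable i1.
  - by move=> x _; rewrite lee_fin bump_ge0.
apply: (@lt_le_trans _ _ (\int[mu]_(x in `[- 2^-1, 2^-1]) c)).
  by rewrite Rint_cst_itv ?mulr_gt0//; lra.
apply: le_Rintegral => //.
  by apply: itg_cont; exact: cst_continuous.
by move=> x; rewrite /= in_itv/= => h; apply: lb; rewrite ler_norml.
Qed.

(** With a primitive at hand, the integrals of rescaled translates of [f] follow from the
    fundamental theorem of calculus, without a change of variables. *)
Lemma primitive_unit (f : R -> R) : continuous f -> (forall x, 0 <= f x) ->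
  (forall x, f x != 0 -> -1 < x < 1) -> \int[mu]_(x in `[-1, 1]) f x = 1 ->
  exists Phi : R -> R, [/\ forall x : R, is_derive x (1 : R) Phi (f x),
    forall x, 0 <= Phi x <= 1, forall x, x <= -1 -> Phi x = 0 &
    forall x, 1 <= x -> Phi x = 1].
Proof.
move=> cf f0 fs' f1.
have fs x : f x != 0 -> -1 <= x <= 1 by move=> /fs' /andP[h1 h2]; rewrite !ltW.
pose Phi x := \int[mu]_(t in `]-oo, x]) f t.
have hi x : 1 <= x -> Phi x = 1.
  move=> x1; rewrite /Phi (Rint_support fs)// => y; rewrite /= !in_itv/=.
  by move=> /andP[_ /le_trans]; exact.
have ii (x : R) : itg `]-oo, x] f by exact: (itg_support cf fs).
have mono x y : x <= y -> Phi x <= Phi y.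
  move=> xy; rewrite -lee_fin /Phi !Rint_EFin//; apply: ge0_subset_integral => //.
  - by apply: measurable_EFin_comp; exact: itg_measurable.
  - by move=> z _; rewrite lee_fin.
  - by move=> z; rewrite /= !in_itv/= => /le_trans; exact.
exists Phi; split => //.
- move=> x.
  have x1 : x < x + 1 by rewrite ltrDl.
  have [dP P'] := @continuous_FTC1 R f -oo%O x _ x1 (ii _) (ltNyr _) (cf x).
  by apply: DeriveDef => //; rewrite -derive1E.
- move=> x; rewrite Rintegral_ge0//=.
  have [x1|x1] := leP 1 x; first by rewrite hi.
  by rewrite -(hi 1)//; apply: mono; exact: ltW.
- move=> x x1; transitivity (\int[mu]_(t in `]-oo, x]) (0 : R)); last first.
    by rewrite Rintegral_cst// mul0r.
  apply: eq_Rintegral => y; rewrite inE/= in_itv/= => yx.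
  have [//|/fs' /andP[h _]] := eqVneq (f y) 0.
  by have := le_lt_trans (le_trans yx x1) h; rewrite ltxx.
Qed.

(** The mollifiers are dilates of one normalised bump, all supported in [[- delta, delta]]. Mass 1
    is claimed only over intervals that contain the whole support of the translate; the bound by 1
    holds over any interval. *)
Lemma mollifier_exists (delta : R) : 0 < delta -> exists rho : nat -> R -> R,
  [/\ forall n, smooth1 (rho n), forall n x, 0 <= rho n x,
   forall n x, rho n (- x) = rho n x,
   forall n x, rho n x != 0 -> - delta <= x <= delta &
  [/\ forall n a b t, a + delta <= t -> t <= b - delta ->
        \int[mu]_(s in `[a, b]) rho n (t - s) = 1,
     forall n a b s, a <= b -> \int[mu]_(t in `[a, b]) rho n (t - s) <= 1,
     forall n, exists B, forall x, rho n x <= B &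
     forall eta, 0 < eta -> exists N, forall n, (N <= n)%N ->
       forall x, eta <= `|x| -> rho n x = 0]].
Proof.
move=> d0.
pose m := \int[mu]_(x in `[-1, 1]) bump x.
have m0 : 0 < m by exact: bump_gt0.
pose f x := m^-1 * bump x.
have sf : smooth1 f by apply: smooth1_scale; exact: smooth1_bump.
have f0 x : 0 <= f x by rewrite mulr_ge0 ?bump_ge0// invr_ge0 ltW.
have fs x : f x != 0 -> -1 < x < 1.
  by rewrite mulf_eq0 negb_or => /andP[_]; exact: bump_support.
have f1 : \int[mu]_(x in `[-1, 1]) f x = 1.
  rewrite RintegralZl//; first by rewrite mulVf// gt_eqF.
  by apply: itg_cont; exact: smooth1_continuous smooth1_bump.
have [Phi [dPhi Phi01 Phi0 Phi1]] := primitive_unit (smooth1_continuous sf) f0 fs f1.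
(* This scale gives [rho n] a support of radius [delta / n.+1]. *)
pose lam (n : nat) : R := n.+1%:R / delta.
have lam0 n : 0 < lam n by rewrite divr_gt0.
pose rho n x := lam n * f (lam n * x).
have dA n t (s : R) : is_derive s (1 : R) (fun s => - Phi (lam n * (t - s))) (rho n (t - s)).
  have h := @is_derive_comp_affine R Phi f (- lam n) (lam n * t) s dPhi.
  have h2 := is_derive_scalef (-1) h.
  have -> : (fun s => - Phi (lam n * (t - s))) =
     (fun y => -1 * Phi (- lam n * y + lam n * t)).
    by apply/funext => y; rewrite mulN1r; congr (- Phi _); ring.
  apply: (is_derive_eq h2); rewrite /rho mulN1r mulNr opprK; congr (_ * f _); ring.
have dB n t (s : R) : is_derive s (1 : R) (fun s => Phi (lam n * (s - t))) (rho n (s - t)).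
  have h := @is_derive_comp_affine R Phi f (lam n) (- (lam n * t)) s dPhi.
  have -> : (fun s => Phi (lam n * (s - t))) =
     (fun y => Phi (lam n * y + - (lam n * t))).
    by apply/funext => y; congr (Phi _); ring.
  apply: (is_derive_eq h); rewrite /rho; congr (_ * f _); ring.
have srho n : smooth1 (rho n).
  apply: smooth1_scale.
  have := smooth1_affine (lam n) 0 sf.
  by congr smooth1; apply/funext => x; rewrite addr0.
have crho n := smooth1_continuous (srho n).
have crhoB n t : continuous (fun s => rho n (t - s)).
  have -> : (fun s => rho n (t - s)) = (fun s => rho n (-1 * s + t)).
    by apply/funext => x; rewrite mulN1r addrC.
  exact: (smooth1_continuous (smooth1_affine (-1) t (srho n))).
have crhoC n t : continuous (fun s => rho n (s - t)).
  have -> : (fun s => rho n (s - t)) = (fun s => rho n (1 * s + (- t))).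
    by apply/funext => x; rewrite mul1r.
  exact: (smooth1_continuous (smooth1_affine 1 (- t) (srho n))).
have supp n x : rho n x != 0 -> `|x| < (lam n)^-1.
  rewrite mulf_eq0 negb_or => /andP[_ /fs /andP[h1 h2]].
  rewrite ltr_norml -[(lam n)^-1]mulr1 -mulrN.
  by rewrite ltr_pdivrMl// ltr_pdivlMl// h1 h2.
have lamd n : 1 <= lam n * delta.
  by rewrite /lam divfK ?gt_eqF// ler1n.
exists rho; split => //.
- by move=> n x; rewrite mulr_ge0// ltW.
- by move=> n x; rewrite /rho /f mulrN bump_even.
- move=> n x /supp /ltW h; rewrite -ler_norml (le_trans h)//.
  by rewrite invf_ple ?posrE// -(ler_pM2r d0) mulVf ?gt_eqF.
split.
- move=> n a b t ta tb.
  have ab : a <= b by lra.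
  rewrite (FTC2 ab (dA n t) (crhoB n t)) opprK addrC Phi1; last first.
    by rewrite (le_trans (lamd n))// ler_pM2l//; lra.
  rewrite Phi0 ?subr0//.
  apply: (@le_trans _ _ (lam n * (- delta))); first by rewrite ler_pM2l//; lra.
  by rewrite mulrN lerN2.
- move=> n a b s ab; rewrite (FTC2 ab (dB n s) (crhoC n s)).
  have := Phi01 (lam n * (b - s)); have := Phi01 (lam n * (a - s)).
  by move=> /andP[+ _] /andP[_]; lra.
- move=> n.
  have /compact_bounded[K [_ hK]] : compact (rho n @` `[- delta, delta]).
    apply: continuous_compact; last exact: segment_compact.
    by apply: continuous_subspaceT; exact: crho.
  exists (`|K| + 1) => x; have [->|xn] := eqVneq (rho n x) 0; first by rewrite addr_ge0.
  apply: (le_trans (ler_norm _)); apply: hK; first by rewrite ltr_pwDr// ler_norm.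
  exists x => //; rewrite /= in_itv/= -ler_norml.
  rewrite (le_trans (ltW (supp _ _ xn)))//.
  by rewrite invf_ple ?posrE// -(ler_pM2r d0) mulVf ?gt_eqF.
- move=> eta eta0.
  have [N hN] : exists N : nat, delta / eta < N.+1%:R.
    have h0 : 0 <= delta / eta by rewrite divr_ge0// ltW.
    exists (Num.truncn (delta / eta)).
    by have /andP[] := truncn_itv h0.
  exists N => n Nn x xe; apply/eqP; apply: contraT => /supp.
  rewrite ltNge (le_trans _ xe)// invf_ple ?posrE//.
  rewrite /lam ler_pdivlMr// mulrC (le_trans (ltW hN))// ler_nat ltnS//.
Qed.

End Smooth.

(** * Fourier inversion *)

Section Fourier.
Context {R : realType}.
Local Notation mu := (@lebesgue_measure R).
Local Notation pi := (@pi R).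

Lemma continuous_cosl (x : R) : continuous (fun s : R => cos (x * s)).
Proof. by have := @continuous_cos_affine R x 0; under eq_fun do rewrite addr0. Qed.

Lemma continuous_sinl (x : R) : continuous (fun s : R => sin (x * s)).
Proof. by have := @continuous_sin_affine R x 0; under eq_fun do rewrite addr0. Qed.

Lemma continuous_cosr (x : R) : continuous (fun s : R => cos (s * x)).
Proof. by under eq_fun do rewrite mulrC; exact: continuous_cosl. Qed.

Lemma continuous_sinr (x : R) : continuous (fun s : R => sin (s * x)).
Proof. by under eq_fun do rewrite mulrC; exact: continuous_sinl. Qed.

Lemma continuous_param (B : set R) (F : R -> R -> R) (G : R -> R) :
  measurable B -> (forall x, measurable_fun B (F x)) ->
  (forall y, continuous (F ^~ y)) -> itg B G ->
  (forall x y, B y -> `|F x y| <= G y) ->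
  continuous (fun x => \int[mu]_(y in B) F x y).
Proof.
move=> mB mF cF iG FG x.
have iF z : itg B (F z).
  by apply: (@itg_le _ _ G) => // y; exact: FG.
have H := @continuity_under_integral R _ _ mu F B mB (x - 1) (x + 1).
apply: (H _ _ G) => //.
- by apply: aeW => y By z _; exact: cF.
- by move=> z _; apply: aeW => y By; exact: FG.
- by rewrite inE /= in_itv/=; apply/andP; split; lra.
Qed.

Lemma is_derive_param (B : set R) (F F' : R -> R -> R) (G : R -> R) (x : R) :
  measurable B -> (forall x, itg B (F x)) ->
  (forall x y : R, is_derive x (1 : R) (F ^~ y) (F' x y)) -> itg B G ->
  (forall x y, B y -> `|F' x y| <= G y) ->
  is_derive x (1 : R) (fun x => \int[mu]_(y in B) F x y) (\int[mu]_(y in B) F' x y).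
Proof.
move=> mB iF dF iG FG.
have Ix : `]x - 1, x + 1[%classic x.
  by rewrite /= in_itv/=; apply/andP; split; lra.
have iG' : itg B (fun y => `|G y|) by exact: itg_norm.
have FG' z y : `]x - 1, x + 1[%classic z -> B y -> `|partial1of2 F z y| <= `|G y|.
  move=> _ By; rewrite partial1of2E; case: (dF z y) => _ ->.
  by rewrite (le_trans (FG _ _ By))// ler_norm.
have dF1 (z y : R) : `]x - 1, x + 1[%classic z -> B y -> derivable (F ^~ y) z 1.
  by move=> _ _; case: (dF z y).
have iF' (z : R) : `]x - 1, x + 1[%classic z -> itg B (F z) by [].
have G0 y : 0 <= `|G y| by [].
apply: DeriveDef.
  exact: (@derivable_under_integral R _ _ mu F B mB x _ _ Ix iF' dF1 _ G0 iG' FG').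
rewrite -derive1E (@differentiation_under_integral R _ _ mu F B mB x _ _ Ix iF' dF1 _ G0 iG' FG').
by apply: eq_Rintegral => y _; rewrite partial1of2E; case: (dF x y).
Qed.

Lemma int_split (g : R -> R) (a b c : R) : a <= b -> b <= c -> continuous g ->
  \int[mu]_(x in `[a, c]) g x =
  \int[mu]_(x in `[a, b]) g x + \int[mu]_(x in `[b, c]) g x.
Proof.
move=> ab bc cg; have ic : itg `[a, c] g by exact: itg_cont.
have := @Rintegral_itvB R g (BLeft a) (BRight c) b ic.
rewrite !bnd_simp => /(_ ab bc) /eqP; rewrite subr_eq addrC => /eqP ->.
congr (_ + _); apply: Rintegral_itv_obnd_cbnd.
by apply: integrableS ic => // x; rewrite /= !in_itv/= => /andP[h1 ->];
  rewrite andbT (le_trans ab (ltW h1)).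
Qed.

Lemma int_symm (g : R -> R) (A : R) : 0 <= A -> continuous g ->
  \int[mu]_(x in `[- A, A]) g x = \int[mu]_(x in `[0, A]) (g x + g (- x)).
Proof.
move=> A0 cg.
have cgN : continuous (fun x => g (- x)).
  by move=> x; apply: (@continuous_comp _ _ _ -%R g); [exact: opp_continuous|exact: cg].
rewrite (@int_split _ _ 0)// ?oppr_le0// RintegralD//; [|exact: itg_cont|exact: itg_cont].
rewrite addrC; congr (_ + _); rewrite /Rintegral; congr fine.
have := @integration_by_substitution_oppr R g 0 A A0; rewrite oppr0; apply.
exact: continuous_subspaceT.
Qed.

Lemma cvg_int_line (g : R -> R) : itg setT g ->
  \int[mu]_(x in `[- n%:R, n%:R]) g x @[n --> \oo] --> \int[mu]_x g x.
Proof.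
move=> ig.
under eq_fun do rewrite Rintegral_mkcond.
apply: (Rdominated (g := fun x => `|g x|)) => //.
- move=> n; apply: (measurable_restrictT g _).1 => //.
  by apply: (measurable_funS measurableT) => //; exact: itg_measurable.
- exact: itg_measurable.
- exact: itg_norm.
- move=> x _; apply: cvg_near_cst; near=> n.
  rewrite patchE mem_set// /= in_itv/= -ler_norml.
  by near: n; exact: nbhs_infty_ger.
- by move=> n x _; rewrite patchE; case: ifP => // _; rewrite normr0.
Unshelve. all: by end_near. Qed.

Lemma int_odd (g : R -> R) : continuous g -> itg setT g ->
  (forall x, g (- x) = - g x) -> \int[mu]_x g x = 0.
Proof.
move=> cg ig odd; have := cvg_int_line ig.
under eq_fun do rewrite int_symm//.
have -> : (fun n : nat => \int[mu]_(x in `[0, n%:R]) (g x + g (- x))) = (fun=> 0).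
  apply/funext => n; rewrite -[RHS](mul0r (n%:R - 0)) -Rint_cst_itv//.
  by apply: eq_Rintegral => x _; rewrite odd subrr.
by move=> /(cvg_lim (@Rhausdorff R)) <-; rewrite lim_cst.
Qed.

Lemma int_even (g : R -> R) : continuous g -> itg setT g ->
  (forall x, g (- x) = g x) ->
  \int[mu]_(x in `[0, n%:R]) g x @[n --> \oo] --> 2^-1 * \int[mu]_x g x.
Proof.
move=> cg ig even; have := cvg_int_line ig.
under eq_fun do rewrite int_symm//.
move=> /(cvg_scale (c := 2^-1)); apply: cvg_trans; apply: near_eq_cvg; apply: nearW => n.
rewrite -RintegralZl//; last by apply: itgD => //; apply: itg_cont => // x;
  apply: (@continuous_comp _ _ _ -%R g); [exact: opp_continuous|exact: cg].
by apply: eq_Rintegral => x _; rewrite even; field.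
Qed.

Lemma itg_oneDsqrV : itg setT (fun x : R => (1 + x ^+ 2)^-1).
Proof.
apply/integrableP; split.
  apply: measurable_EFin_comp; apply: continuous_measurable_fun.
  exact: continuous_oneDsqrV.
have e0 x : 0 <= (1 + x ^+ 2 : R)^-1 by rewrite invr_ge0 addr_ge0// sqr_ge0.
under eq_integral do rewrite /= ger0_norm//.
rewrite ge0_symfun_integralT//; first last.
- by move=> x; rewrite /= sqrrN.
- exact: continuous_oneDsqrV.
by rewrite -set_itvcy integral0y_oneDsqr -EFinM ltry.
Qed.

Lemma int_oneDsqrV_shift (t A B : R) : A <= B ->
  \int[mu]_(x in `[A, B]) (1 + (t - x) ^+ 2)^-1 <= pi.
Proof.
move=> AB.
have dF (x : R) : is_derive x (1 : R) (fun x => atan (x - t)) (1 + (t - x) ^+ 2)^-1.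
  have := @is_derive_comp_affine R atan _ 1 (- t) x (@is_derive1_atan R).
  under eq_fun do rewrite mul1r.
  by rewrite !mul1r => h; apply: (is_derive_eq h); rewrite -(sqrrN (t - x)) opprB.
have cf : continuous (fun x : R => (1 + (t - x) ^+ 2)^-1).
  move=> x; apply: (@continuous_comp _ _ _ (fun x => t - x) (fun z => (1 + z ^+ 2)^-1)).
    by apply: cvgB; [exact: cvg_cst|exact: cvg_id].
  exact: continuous_oneDsqrV.
rewrite (FTC2 AB dF cf).
by have := atan_ltpi2 (B - t); have := atan_gtNpi2 (A - t); lra.
Qed.

(** The free phase [c] covers sine and cosine together: each integration by parts adds $\pi/2$ to
    it. *)
Lemma ibp_cos (F f : R -> R) (a b x c : R) : a <= b ->
  (forall t : R, is_derive t (1 : R) F (f t)) -> continuous f ->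
  F a = 0 -> F b = 0 ->
  x * \int[mu]_(t in `[a, b]) (F t * cos (x * t + c)) =
  \int[mu]_(t in `[a, b]) (f t * cos (x * t + (c + pi / 2))).
Proof.
move=> ab dF cf Fa Fb.
have cF := is_derive_cont dF.
have d1 (t : R) : is_derive t (1 : R) (fun t => F t * sin (x * t + c))
    (f t * sin (x * t + c) + F t * (x * cos (x * t + c))).
  by apply: is_derive_mulf => //; exact: is_derive_sin_affine.
have c1 : continuous (fun t => f t * sin (x * t + c)).
  by move=> t; apply: cvgM; [exact: cf|exact: continuous_sin_affine].
have c2 : continuous (fun t => F t * (x * cos (x * t + c))).
  move=> t; apply: cvgM; [exact: cF|apply: cvgM]; first exact: cvg_cst.
  exact: continuous_cos_affine.
have c2' : continuous (fun t => F t * cos (x * t + c)).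
  by move=> t; apply: cvgM; [exact: cF|exact: continuous_cos_affine].
have c12 : continuous (fun t => f t * sin (x * t + c) + F t * (x * cos (x * t + c))).
  by move=> t; apply: cvgD; [exact: c1|exact: c2].
have H := FTC2 ab d1 c12.
rewrite Fa Fb !mul0r subrr in H.
rewrite RintegralD in H; [|by []|exact: itg_cont|exact: itg_cont].
rewrite -RintegralZl//; last exact: itg_cont.
have -> : \int[mu]_(t in `[a, b]) (x * (F t * cos (x * t + c))) =
  \int[mu]_(t in `[a, b]) (F t * (x * cos (x * t + c))).
  by apply: eq_Rintegral => t _; rewrite mulrCA.
rewrite -(addr0_eq H).
rewrite -RintN.
by apply: eq_Rintegral => t _; rewrite addrA cosDpihalf mulrN.
Qed.

Let norm_int_le (F : R -> R) (a b x c : R) : continuous F ->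
  `|\int[mu]_(t in `[a, b]) (F t * cos (x * t + c))| <=
  \int[mu]_(t in `[a, b]) `|F t|.
Proof.
move=> cF; apply: Rint_bound => //.
- apply: measurable_cont => // t.
  by apply: cvgM; [exact: cF|exact: continuous_cos_affine].
- by apply: itg_norm => //; exact: itg_cont.
- by move=> t _; rewrite normrM ler_piMr// cos_max.
Qed.

Lemma decay2 (F F1 F2 : R -> R) (a b : R) : a <= b ->
  (forall t : R, is_derive t (1 : R) F (F1 t)) ->
  (forall t : R, is_derive t (1 : R) F1 (F2 t)) -> continuous F2 ->
  F a = 0 -> F b = 0 -> F1 a = 0 -> F1 b = 0 ->
  exists K, forall x c,
   `|\int[mu]_(t in `[a, b]) (F t * cos (x * t + c))| * (1 + x ^+ 2) <= K.
Proof.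
move=> ab d1 d2 c2 Fa Fb F1a F1b.
have cF := is_derive_cont d1; have c1 := is_derive_cont d2.
exists (\int[mu]_(t in `[a, b]) `|F t| + \int[mu]_(t in `[a, b]) `|F2 t|) => x c.
rewrite mulrDr mulr1 lerD//; first exact: norm_int_le.
rewrite -(ger0_norm (sqr_ge0 x)) -normrM mulrC expr2 -mulrA.
by rewrite (ibp_cos _ _ ab d1)// (ibp_cos _ _ ab d2)//; exact: norm_int_le.
Qed.

(** Meant for the cutoff in time. Of the decay $(1+x^2)^{-2}$ one factor $(1+x^2)^{-1}$ is later
    spent on comparing the weights of two modes, the other on the Schur test. *)
Lemma decay4 (F F1 F2 F3 F4 : R -> R) (a b : R) : a <= b ->
  (forall t : R, is_derive t (1 : R) F (F1 t)) ->
  (forall t : R, is_derive t (1 : R) F1 (F2 t)) ->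
  (forall t : R, is_derive t (1 : R) F2 (F3 t)) ->
  (forall t : R, is_derive t (1 : R) F3 (F4 t)) -> continuous F4 ->
  F a = 0 -> F b = 0 -> F1 a = 0 -> F1 b = 0 ->
  F2 a = 0 -> F2 b = 0 -> F3 a = 0 -> F3 b = 0 ->
  exists K, forall x c,
   `|\int[mu]_(t in `[a, b]) (F t * cos (x * t + c))| * (1 + x ^+ 2) ^+ 2 <= K.
Proof.
move=> ab d1 d2 d3 d4 c4 Fa Fb F1a F1b F2a F2b F3a F3b.
have c3 := is_derive_cont d4; have c2 := is_derive_cont d3; have c1 := is_derive_cont d2.
have [K hK] := decay2 ab d1 d2 c2 Fa Fb F1a F1b.
have [K' hK'] := decay2 ab d3 d4 c4 F2a F2b F3a F3b.
exists (K + K') => x c.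
set I := \int[mu]_(t in _) _.
have -> : `|I| * (1 + x ^+ 2) ^+ 2 = `|I| * (1 + x ^+ 2) + `|x * (x * I)| * (1 + x ^+ 2).
  rewrite !normrM mulrA -expr2 real_normK ?num_real//; ring.
rewrite lerD//; first exact: hK.
by rewrite /I (ibp_cos _ _ ab d1)// (ibp_cos _ _ ab d2)//; exact: hK'.
Qed.

Section Inversion.
Variables (f : R -> R) (d : R).
Hypotheses (d0 : 0 < d) (sf : smooth1 f) (feven : forall x, f (- x) = f x)
  (fs : forall x, f x != 0 -> - d <= x <= d).

Let cf : continuous f. Proof. exact: smooth1_continuous. Qed.

(** For an even [f] supported in [[- d, d]] this is the full Fourier transform: the sine part
    vanishes. *)
Definition cosT (tau : R) : R := \int[mu]_(s in `[- d, d]) (f s * cos (tau * s)).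

Let dd : - d <= d. Proof. by rewrite (le_trans _ (ltW d0))// oppr_le0 ltW. Qed.

Let zero_ext (g : R -> R) (x : R) : continuous g ->
  (forall y, x < y -> g y = 0) -> g x = 0.
Proof.
move=> cg g0; apply/eqP; rewrite -normr_le0; apply/ler_addgt0Pr => e e0; rewrite add0r.
have /cvgrPdist_le/(_ e e0) := cg x.
move=> /nbhs_ballP[r /= r0 hr].
have gz : g (x + r / 2) = 0 by apply: g0; rewrite ltrDl divr_gt0.
have := hr (x + r / 2); rewrite gz subr0.
apply; rewrite -ball_normE /ball_/= opprD addrA subrr sub0r normrN gtr0_norm ?divr_gt0//.
by lra.
Qed.

Lemma support_edge (g : R -> R) : continuous g ->
  (forall x, g x != 0 -> - d <= x <= d) -> g d = 0 /\ g (- d) = 0.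
Proof.
move=> cg gs; split.
  apply: zero_ext => // y dy; apply/eqP; apply: contraT => /gs /andP[_].
  by rewrite leNgt dy.
have := @zero_ext (fun x => g (- x)) d; rewrite ?opprK; apply.
  by move=> x; apply: (@continuous_comp _ _ _ -%R g); [exact: opp_continuous|exact: cg].
move=> y dy; apply/eqP; apply: contraT => /gs /andP[h _].
by move: h; rewrite lerN2 leNgt dy.
Qed.

Lemma derive_support (g g' : R -> R) : (forall x : R, is_derive x (1 : R) g (g' x)) ->
  (forall x, g x != 0 -> - d <= x <= d) -> continuous g' ->
  (forall x, g' x != 0 -> - d <= x <= d).
Proof.
move=> dg gs cg' x; apply: contraNT => xd.
have near0 : \forall z \near x, g z = 0.
  move: xd; rewrite negb_and -!ltNge => /orP[h|h].
    near=> z; apply/eqP; apply: contraT => /gs /andP[h' _].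
    have zd : z < - d by near: z; exact: lt_nbhsl.
    by have := le_lt_trans h' zd; rewrite ltxx.
  near=> z; apply/eqP; apply: contraT => /gs /andP[_ h'].
  have zx : d < z by near: z; exact: lt_nbhsr.
  by have := lt_le_trans zx h'; rewrite ltxx.
have h0 : is_derive x (1 : R) g (0 : R).
  apply: (@near_eq_is_derive R R R (cst (0 : R))); first by apply: filterS near0 => z ->.
by case: (dg x) => _ <-; case: h0 => _ ->.
Unshelve. all: by end_near. Qed.

Lemma cosT_decay : exists K, forall tau, `|cosT tau| * (1 + tau ^+ 2) <= K.
Proof.
have d1 := smooth1_is_derive sf.
have s1 := smooth1_derive1 sf.
have d2 := smooth1_is_derive s1.
have c1 := smooth1_continuous s1.
have c2 := smooth1_continuous (smooth1_derive1 s1).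
have [e1 e2] := support_edge cf fs.
have [e3 e4] := support_edge c1 (derive_support d1 fs c1).
have [K hK] := decay2 dd d1 d2 c2 e2 e1 e4 e3.
exists K => tau; have := hK tau 0; rewrite /cosT.
by under eq_Rintegral do rewrite addr0.
Qed.

Lemma continuous_cosT : continuous cosT.
Proof.
apply: (@continuous_param _ (fun tau s => f s * cos (tau * s)) (fun s => `|f s|)) => //.
- move=> x; apply: measurable_cont => // s; apply: cvgM; first exact: cf.
  exact: continuous_cosl.
- move=> s tau; apply: cvgM; first exact: cvg_cst.
  exact: continuous_cosr.
- by apply: itg_norm => //; exact: itg_cont.
- by move=> x y _; rewrite normrM ler_piMr// cos_max.
Qed.

Lemma itg_cosT : itg setT cosT.
Proof.
have [K hK] := cosT_decay.
apply: (@itg_le _ _ (fun tau => K * (1 + tau ^+ 2)^-1)) => //.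
- by apply: continuous_measurable_fun; exact: continuous_cosT.
- move=> tau _; rewrite ler_pdivlMr ?hK//.
  by rewrite ltr_pwDl// sqr_ge0.
- by apply: itgZl => //; exact: itg_oneDsqrV.
Qed.

Lemma cosTN tau : cosT (- tau) = cosT tau.
Proof. by apply: eq_Rintegral => s _; rewrite mulNr cosN. Qed.

(** The sine term of $\cos(\tau(s-t))$ integrates to 0 because [f] is even. *)
Let fcos_shift (tau t : R) : cosT tau * cos (tau * t) =
  \int[mu]_(s in `[- d, d]) (f s * cos (tau * (s - t))).
Proof.
have cc : continuous (fun s => f s * cos (tau * s)).
  move=> s; apply: cvgM; first exact: cf.
  exact: continuous_cosl.
have cs : continuous (fun s => f s * sin (tau * s)).
  move=> s; apply: cvgM; first exact: cf.
  exact: continuous_sinl.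
have s0 : \int[mu]_(s in `[- d, d]) (f s * sin (tau * s)) = 0.
  rewrite int_symm//; last exact: ltW.
  rewrite -[RHS](mul0r (d - 0)) -Rint_cst_itv ?ltW//.
  by apply: eq_Rintegral => s _; rewrite feven mulrN sinN mulrN subrr.
transitivity (\int[mu]_(s in `[- d, d])
  (f s * cos (tau * s) * cos (tau * t) + f s * sin (tau * s) * sin (tau * t))).
  rewrite RintegralD//; [|by apply: itgZr => //; exact: itg_cont..].
  rewrite RintegralZr//; last exact: itg_cont.
  rewrite RintegralZr//; last exact: itg_cont.
  by rewrite s0 mul0r addr0.
by apply: eq_Rintegral => s _; rewrite mulrBr cosB; ring.
Qed.

(** [del n] is the damping of an Abel summation and [A n] the frequency at which the integral is
    cut. Their product is [n.+1], so the boundary term at [A n] carries the factor $e^{-(n+1)}$. *)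
Let del (n : nat) : R := n.+1%:R^-1.
Let A (n : nat) : R := (n.+1 ^ 2)%:R.

Let del0 n : 0 < del n. Proof. by rewrite invr_gt0. Qed.
Let A0 n : 0 <= A n. Proof. by rewrite ler0n. Qed.

(** The first term is $\pi$ times the Poisson kernel of width [del n]; the second is the
    contribution of the upper limit. *)
Let abel (n : nat) (x : R) : \int[mu]_(tau in `[0, A n]) (expR (- del n * tau) * cos (tau * x)) =
  del n / (del n ^+ 2 + x ^+ 2) +
  expR (- n.+1%:R) * (x * sin (A n * x) - del n * cos (A n * x)) / (del n ^+ 2 + x ^+ 2).
Proof.
have D0 : del n ^+ 2 + x ^+ 2 != 0.
  by rewrite gt_eqF// ltr_pwDl ?sqr_ge0// exprn_gt0.
pose F tau := (del n ^+ 2 + x ^+ 2)^-1 *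
   (expR (- del n * tau) * (x * sin (tau * x) - del n * cos (tau * x))).
have dF (tau : R) : is_derive tau (1 : R) F (expR (- del n * tau) * cos (tau * x)).
  have de : is_derive tau (1 : R) (fun tau => expR (- del n * tau)) (- del n * expR (- del n * tau)).
    have := @is_derive_comp_affine R expR expR (- del n) 0 tau (@is_derive_expR R).
    by under eq_fun do rewrite addr0; rewrite addr0.
  have ds : is_derive tau (1 : R) (fun tau => sin (tau * x)) (x * cos (tau * x)).
    have := is_derive_sin_affine x 0 tau.
    by under eq_fun do rewrite addr0 mulrC; rewrite addr0 (mulrC x tau).
  have dc : is_derive tau (1 : R) (fun tau => cos (tau * x)) (x * - sin (tau * x)).
    have := is_derive_cos_affine x 0 tau.
    by under eq_fun do rewrite addr0 mulrC; rewrite addr0 (mulrC x tau).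
  have h := is_derive_scalef (del n ^+ 2 + x ^+ 2)^-1 (is_derive_mulf de
    (is_derive_addf (is_derive_scalef x ds) (is_derive_scalef (- del n) dc))).
  have -> : F = (fun y => (del n ^+ 2 + x ^+ 2)^-1 * (expR (- del n * y) *
     (x * sin (y * x) + - del n * cos (y * x)))).
    by apply/funext => y; rewrite /F; congr (_ * (_ * _)); rewrite mulNr.
  by apply: (is_derive_eq h); field.
have cF : continuous (fun tau => expR (- del n * tau) * cos (tau * x)).
  move=> tau; apply: cvgM.
    apply: (@continuous_comp _ _ _ (fun t => - del n * t) expR); last exact: continuous_expR.
    by apply: cvgM; [exact: cvg_cst|exact: cvg_id].
  exact: continuous_cosr.
rewrite (FTC2 (A0 n) dF cF) /F !mul0r mulr0 expR0 sin0 cos0 !mulr0 !mulr1 sub0r mul1r.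
have -> : - del n * A n = - n.+1%:R.
  by rewrite /del /A natrX expr2 mulNr mulKf.
by field.
Qed.

(** Abel summation: the integral over $\tau$ is damped and truncated, Fubini moves it inside the
    integral over $s$, and what appears is the Poisson kernel acting on [f], an approximate
    identity. *)
Lemma cosT_inversion (t : R) : \int[mu]_tau (cosT tau * cos (tau * t)) = 2 * pi * f t.
Proof.
pose g tau := cosT tau * cos (tau * t).
have cg : continuous g.
  move=> tau; apply: cvgM; first exact: continuous_cosT.
  exact: continuous_cosr.
have ig : itg setT g.
  apply: (@itg_le _ _ (fun tau => `|cosT tau|)) => //.
  - exact: continuous_measurable_fun.
  - by move=> tau _; rewrite normrM ler_piMr// cos_max.
  - by apply: itg_norm => //; exact: itg_cosT.
have geven x : g (- x) = g x by rewrite /g cosTN mulNr cosN.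
have ig' : itg `[0, +oo[ g by exact: integrableS ig.
(* One dominated convergence on the half line handles damping and truncation together; used without
   damping it identifies the half-line integral with half of the full one. *)
have lim_half (h : nat -> R -> R) (B : nat -> R) : (forall n, continuous (h n)) ->
    (forall n x, 0 <= x -> `|h n x| <= `|g x|) ->
    (forall x, 0 <= x -> h n x @[n --> \oo] --> g x) ->
    (forall n, n%:R <= B n) ->
    \int[mu]_(tau in `[0, B n]) h n tau @[n --> \oo] -->
    \int[mu]_(tau in `[0, +oo[) g tau.
  move=> ch hg hl hB.
  have -> : (fun n => \int[mu]_(tau in `[0, B n]) h n tau) =
    (fun n => \int[mu]_(tau in `[0, +oo[) (h n \_ `[0, B n]) tau).
    apply/funext => n; rewrite -Rintegral_mkcondr; congr Rintegral.
    by apply/seteqP; split => x; rewrite /= !in_itv/= ?andbT; [move=> /andP[-> ->]|case].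
  apply: (Rdominated (g := fun x => `|g x|)) => //.
  - move=> n; apply: (measurable_funS measurableT) => //.
    apply: (measurable_restrictT (h n) _).1 => //.
    exact: measurable_cont.
  - exact: measurable_cont.
  - exact: itg_norm.
  - move=> x; rewrite /= in_itv/= andbT => x0.
    apply: cvg_trans (hl _ x0); apply: near_eq_cvg; near=> n.
    rewrite patchE mem_set//= in_itv/= x0/= (le_trans _ (hB n))//.
    by near: n; exact: nbhs_infty_ger.
  - move=> n x; rewrite /= in_itv/= andbT => x0.
    by rewrite patchE; case: ifP => _; [exact: hg|rewrite normr0].
have half : \int[mu]_(tau in `[0, +oo[) g tau = 2^-1 * \int[mu]_tau g tau.
  have l1 : \int[mu]_(tau in `[0, n%:R]) g tau @[n --> \oo] -->
      \int[mu]_(tau in `[0, +oo[) g tau.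
    by apply: (@lim_half (fun=> g) (fun n => n%:R)) => // x _; exact: cvg_cst.
  have l2 := int_even cg ig geven.
  by rewrite -(cvg_lim (@Rhausdorff R) l1) -(cvg_lim (@Rhausdorff R) l2).
have ce n : continuous (fun tau => expR (- del n * tau)).
  move=> tau; apply: (@continuous_comp _ _ _ (fun t => - del n * t) expR); last exact: continuous_expR.
  by apply: cvgM; [exact: cvg_cst|exact: cvg_id].
have delcvg : del n @[n --> \oo] --> (0 : R) by exact: cvg_harmonic.
have lim1 : \int[mu]_(tau in `[0, A n]) (expR (- del n * tau) * g tau) @[n --> \oo]
   --> \int[mu]_(tau in `[0, +oo[) g tau.
  apply: lim_half.
  - by move=> n tau; apply: cvgM; [exact: ce|exact: cg].
  - move=> n x x0; rewrite normrM ler_piMl// ger0_norm ?expR_ge0//.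
    by rewrite expR_le1 mulNr oppr_le0 mulr_ge0// ltW.
  - move=> x x0; rewrite -[X in _ --> X]mul1r; apply: cvgM; last exact: cvg_cst.
    rewrite -expR0; apply: continuous_cvg; first exact: continuous_expR.
    rewrite -(mul0r x); apply: cvgM; last exact: cvg_cst.
    by rewrite -oppr0; apply: cvgN.
  - by move=> n; rewrite /A ler_nat; lia.
(* Large enough that [[- D, D]] contains the support of [f] and has [t] in its interior, as the
   convergence of the mass to 1 requires. *)
pose D := d + `|t| + 1.
pose k n y := pi^-1 * (del n / (del n ^+ 2 + (y - t) ^+ 2)).
have DD n y : 0 < del n ^+ 2 + (y - t) ^+ 2.
  by rewrite ltr_pwDl ?sqr_ge0// exprn_gt0.
have ck n : continuous (k n).
  move=> y; apply: cvgM; first exact: cvg_cst.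
  apply: cvgM; first exact: cvg_cst.
  apply: cvgV; first by rewrite gt_eqF.
  apply: cvgD; first exact: cvg_cst.
  rewrite expr2; under eq_fun do rewrite expr2.
  by apply: cvgM; apply: cvgB; [exact: cvg_id|exact: cvg_cst|exact: cvg_id|exact: cvg_cst].
have pi0 : 0 < pi by exact: pi_gt0.
have k0 n y : 0 <= k n y.
  by rewrite mulr_ge0 ?invr_ge0 ?ltW// divr_gt0.
have tD : - D < t < D.
  have /andP[h1 h2] : - `|t| <= t <= `|t| by rewrite -ler_norml.
  by have := d0; rewrite /D => dpos; apply/andP; split; lra.
have DD0 : - D <= D by move/andP : tD => [h1 h2]; exact: ltW (lt_trans h1 h2).
have kint n : \int[mu]_(y in `[- D, D]) k n y =
   pi^-1 * (atan ((D - t) * n.+1%:R) + atan ((D + t) * n.+1%:R)).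
  have dF (y : R) : is_derive y (1 : R) (fun y => pi^-1 * atan (n.+1%:R * y + - (n.+1%:R * t)))
      (k n y).
    have h := is_derive_scalef pi^-1 (is_derive_comp_affine n.+1%:R (- (n.+1%:R * t)) y
      (@is_derive1_atan R)).
    apply: (is_derive_eq h); rewrite /k; congr (_ * _).
    have n0 : n.+1%:R != 0 :> R by [].
    have h1 : 1 + (n.+1%:R * y + - (n.+1%:R * t)) ^+ 2 != 0.
      by rewrite gt_eqF// ltr_pwDl ?sqr_ge0.
    have h2 : del n ^+ 2 + (y - t) ^+ 2 != 0 by rewrite gt_eqF.
    have nd : n.+1%:R * del n = 1 by rewrite /del divff.
    apply/eqP; rewrite eqr_div//; apply/eqP.
    have -> : del n * (1 + (n.+1%:R * y + - (n.+1%:R * t)) ^+ 2) =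
       del n + n.+1%:R * (n.+1%:R * del n) * (y - t) ^+ 2 by ring.
    have -> : n.+1%:R * (del n ^+ 2 + (y - t) ^+ 2) =
      (n.+1%:R * del n) * del n + n.+1%:R * (y - t) ^+ 2 by ring.
    by rewrite nd mul1r mulr1.
  rewrite (FTC2 DD0 dF (ck n)) -mulrBr; congr (_ * _).
  rewrite -[X in _ - X]opprK -atanN opprK; congr (atan _ + atan _); ring.
have klim : \int[mu]_(y in `[- D, D]) k n y @[n --> \oo] --> (1 : R).
  have at1 (c : R) : 0 < c -> atan (c * n.+1%:R) @[n --> \oo] --> pi / 2.
    move=> c0; apply: (cvg_comp _ (@atan R) _ (@cvgy_atan R)).
    apply/cvgryPge => M; near=> n; rewrite -ler_pdivrMl//.
    apply: (@le_trans _ _ n%:R); last by rewrite ler_nat.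
    by near: n; exact: nbhs_infty_ger.
  have e1 : pi^-1 * (pi / 2 + pi / 2) = 1 by rewrite -splitr mulVf// gt_eqF.
  have h : (pi^-1 * (atan ((D - t) * n.+1%:R) + atan ((D + t) * n.+1%:R)))
      @[n --> \oo] --> pi^-1 * (pi / 2 + pi / 2).
    by move/andP : tD => [h1 h2]; apply: cvg_scale; apply: cvgD; apply: at1; lra.
  by rewrite e1 in h; under eq_fun do rewrite kint.
have L3 : \int[mu]_(y in `[- D, D]) (k n y * f y) @[n --> \oo] --> f t.
  have [M hM] : exists M, forall y, - D <= y <= D -> `|f y| <= M.
    have /compact_bounded[M [_ hM]] : compact (f @` `[- D, D]).
      by apply: continuous_compact; [exact: continuous_subspaceT|exact: segment_compact].
    by exists (M + 1) => y yD; apply: hM; [rewrite ltrDl|exists y => //; rewrite /= in_itv].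
  apply: (@approx_id_pt R (- D) D k f t M) => //; last exact: cf.
    move=> eta e eta0 e0.
    have ee : 0 < e * (pi * eta ^+ 2) by rewrite !mulr_gt0// exprn_gt0.
    move/cvgrPdist_le : delcvg => /(_ _ ee)[N _ hN].
    exists N => n Nn y _ yt.
    have := hN n Nn; rewrite sub0r normrN gtr0_norm// => h.
    rewrite /k mulrC ler_pdivrMr// ler_pdivrMr//.
    apply: (le_trans h); rewrite mulrA; apply: ler_wpM2l.
      by rewrite mulr_ge0// ltW.
    apply: (@le_trans _ _ (`|y - t| ^+ 2)); first by apply: lerXn2r; rewrite ?nnegrE// ltW.
    by rewrite real_normK ?num_real// lerDr sqr_ge0.
  by apply: measurable_cont.
have subD : `[- d, d] `<=` `[- D, D].
  have := normr_ge0 t; rewrite /D => tt x; rewrite /= !in_itv/= => /andP[h1 h2].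
  by apply/andP; split; lra.
pose rem n y := expR (- n.+1%:R) * ((y - t) * sin (A n * (y - t)) - del n * cos (A n * (y - t)))
   / (del n ^+ 2 + (y - t) ^+ 2).
have crem n : continuous (rem n).
  have cB : continuous (fun y : R => y - t).
    by move=> y; apply: cvgB; [exact: cvg_id|exact: cvg_cst].
  move=> y; apply: cvgM; last first.
    apply: cvgV; first by rewrite gt_eqF.
    apply: cvgD; first exact: cvg_cst.
    rewrite expr2; under eq_fun do rewrite expr2.
    by apply: cvgM; exact: cB.
  apply: cvgM; first exact: cvg_cst.
  apply: cvgB; apply: cvgM; [exact: cB| |exact: cvg_cst|].
    by apply: (@continuous_comp _ _ _ (fun y : R => y - t) (fun z => sin (A n * z)));
      [exact: cB|exact: continuous_sinl].
  by apply: (@continuous_comp _ _ _ (fun y : R => y - t) (fun z => cos (A n * z)));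
    [exact: cB|exact: continuous_cosl].
have step n : \int[mu]_(tau in `[0, A n]) (expR (- del n * tau) * g tau) =
   pi * \int[mu]_(y in `[- D, D]) (k n y * f y) +
   \int[mu]_(y in `[- d, d]) (f y * rem n y).
  have -> : \int[mu]_(tau in `[0, A n]) (expR (- del n * tau) * g tau) =
     \int[mu]_(tau in `[0, A n]) \int[mu]_(s in `[- d, d])
       (expR (- del n * tau) * (f s * cos (tau * (s - t)))).
    apply: eq_Rintegral => tau _; rewrite /g fcos_shift RintegralZl//.
    apply: itg_cont => s; apply: cvgM; first exact: cf.
    apply: (@continuous_comp _ _ _ (fun y : R => y - t) (fun z => cos (tau * z)));
      last exact: continuous_cosl.
    by apply: cvgB; [exact: cvg_id|exact: cvg_cst].
  rewrite (@Rfubini _ _ _ _ (fun=> 1) (fun s => `|f s|)) //; last first.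
  - move=> tau s; rewrite /= !in_itv/= => /andP[tau0 _] _.
    rewrite mul1r !normrM ger0_norm ?expR_ge0// -[leRHS]mul1r.
    apply: ler_pM; rewrite ?mulr_ge0 ?expR_ge0//.
      by rewrite expR_le1 mulNr oppr_le0 mulr_ge0// ltW.
    by rewrite ler_piMr// cos_max.
  - by apply: itg_norm => //; exact: itg_cont.
  - by apply: itg_cont; exact: cst_continuous.
  - apply: measurable_funM.
      apply: (@measurableT_comp _ _ _ _ _ _ (fun tau => expR (- del n * tau))); last exact: measurable_fst.
      exact: continuous_measurable_fun.
    apply: measurable_funM.
      apply: (@measurableT_comp _ _ _ _ _ _ f); last exact: measurable_snd.
      exact: continuous_measurable_fun.
    apply: (@measurableT_comp _ _ _ _ _ _ (@cos R)).
      by apply: continuous_measurable_fun; exact: continuous_cos.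
    apply: measurable_funM; first exact: measurable_fst.
    by apply: measurable_funB; [exact: measurable_snd|exact: measurable_cst].
  have cfk : continuous (fun y => f y * (del n / (del n ^+ 2 + (y - t) ^+ 2))).
    have -> : (fun y => f y * (del n / (del n ^+ 2 + (y - t) ^+ 2))) =
        (fun y => f y * (pi * k n y)).
      by apply/funext => z; rewrite /k (mulrA pi) divff ?mul1r// gt_eqF.
    move=> y; apply: cvgM; first exact: cf.
    by apply: cvgM; [exact: cvg_cst|exact: ck].
  have -> : pi * \int[mu]_(y in `[- D, D]) (k n y * f y) =
     \int[mu]_(y in `[- d, d]) (f y * (del n / (del n ^+ 2 + (y - t) ^+ 2))).
    rewrite -RintegralZl//; last first.
      by apply: itg_cont => y; apply: cvgM; [exact: ck|exact: cf].
    rewrite -(@Rint_support R _ (- d) d `[- D, D]) //.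
      apply: eq_Rintegral => y _; rewrite /k (mulrA pi) (mulrA pi) divff ?gt_eqF//.
      by rewrite mul1r mulrC.
    by move=> y; rewrite mulf_eq0 negb_or => /andP[/fs].
  rewrite -RintegralD//; [|exact: itg_cont|]; last first.
    by apply: itg_cont => y; apply: cvgM; [exact: cf|exact: crem].
  apply: eq_Rintegral => s _; rewrite -mulrDr /rem -abel -RintegralZl//.
    by apply: eq_Rintegral => tau _; rewrite mulrCA.
  by apply: itg_cont => tau; apply: cvgM; [exact: ce|exact: continuous_cosr].
(* The denominator is absorbed by $|y-t|+\delta\le2(n+1)(\delta^2+|y-t|^2)$ with
   $\delta=1/(n+1)$. *)
have remb n : `|\int[mu]_(y in `[- d, d]) (f y * rem n y)| <=
   2 * n.+1%:R * expR (- n.+1%:R) * \int[mu]_(y in `[- d, d]) `|f y|.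
  have ifn : itg `[- d, d] (fun y => `|f y|) by apply: itg_norm => //; exact: itg_cont.
  rewrite -RintegralZl//; apply: Rint_bound => //.
  - by apply: measurable_cont => // y; apply: cvgM; [exact: cf|exact: crem].
  - exact: itgZl.
  - move=> y _; rewrite normrM mulrC ler_wpM2r// /rem.
    rewrite normrM (@ger0_norm _ (_^-1)); last by rewrite invr_ge0 ltW.
    rewrite ler_pdivrMr//.
    rewrite normrM ger0_norm ?expR_ge0//.
    apply: (@le_trans _ _ (expR (- n.+1%:R) * (`|y - t| + del n))).
      rewrite ler_wpM2l ?expR_ge0// (le_trans (ler_normB _ _))// lerD// normrM.
        by rewrite ler_piMr// sin_max.
      by rewrite gtr0_norm// ler_piMr ?cos_max// ltW.
    rewrite mulrAC mulrC ler_wpM2r ?expR_ge0//.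
    have nd : n.+1%:R * del n = 1 by rewrite /del divff.
    have -> : `|y - t| + del n = n.+1%:R * (del n * `|y - t| + del n ^+ 2).
      by rewrite expr2 mulrDr !mulrA nd !mul1r.
    rewrite -mulrA mulrCA ler_wpM2l//.
    rewrite -(real_normK (num_real (y - t))).
    have := sqr_ge0 (del n - `|y - t|); rewrite sqrrB.
    move: (del n) (`|y - t|) => p q; rewrite mulr2n; nra.
(* As $e^{n+1}\ge(n+1)^2/2$, the bound [remb] is at most a multiple of [del n]. *)
have reml : \int[mu]_(y in `[- d, d]) (f y * rem n y) @[n --> \oo] --> (0 : R).
  pose S := \int[mu]_(y in `[- d, d]) `|f y|.
  have S0 : 0 <= S by exact: Rintegral_ge0.
  apply: (@cvg_dist_le _ _ _ (fun n => 4 * S * del n)); last first.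
    by rewrite -(mulr0 (4 * S)); exact: cvg_scale.
  move=> n; rewrite subr0; apply: (le_trans (remb n)); rewrite -/S [leRHS]mulrAC ler_wpM2r//.
  rewrite expRN ler_pdivrMr ?expR_gt0//.
  have := @expR_ge1Dxn R n.+1%:R 1 (ler0n _ _); rewrite (_ : 2`! = 2%N)// => h.
  apply: (@le_trans _ _ (4 * del n * (n.+1%:R ^+ 2 / 2))).
    by rewrite expr2 /del; have : n.+1%:R != 0 :> R by []; move: n.+1%:R => p p0;
      rewrite le_eqVlt; apply/orP; left; apply/eqP; field.
  apply: ler_wpM2l; first by rewrite mulr_ge0// ltW.
  by apply: le_trans h; rewrite lerDr.
have lim2 : \int[mu]_(tau in `[0, A n]) (expR (- del n * tau) * g tau) @[n --> \oo]
   --> pi * f t.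
  have -> : (fun n => \int[mu]_(tau in `[0, A n]) (expR (- del n * tau) * g tau)) =
    (fun n => pi * \int[mu]_(y in `[- D, D]) (k n y * f y) +
       \int[mu]_(y in `[- d, d]) (f y * rem n y)) by apply/funext => n; exact: step.
  by rewrite -[pi * f t]addr0; apply: cvgD => //; exact: cvg_scale.
have := cvg_unique (@Rhausdorff R) lim1 lim2.
by rewrite half => h; rewrite -mulrA -h; field.
Unshelve. all: by end_near. Qed.

End Inversion.
End Fourier.

(** * Modes of Schwartz functions *)

Section Modes.
Context {R : realType}.
Local Notation mu := (@lebesgue_measure R).
Local Notation pi := (@pi R).
Local Notation D1 := (@derive1 R R).

Definition tens (theta chi : R -> R) : R -> R -> R := fun t x => theta t * chi x.

(** Phase 0 gives the cosine and phase $-\pi/2$ the sine; each derivative in [x] adds $\pi/2$ to the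
    phase. One real family thus stands for the complex exponentials. *)
Definition wave (k : int) (c : R) (x : R) : R := cos (k%:~R * x + c).

Lemma smooth1_wave k c : smooth1 (wave k c).
Proof. exact: smooth1_cos_affine. Qed.

Lemma derive1_wave k c : derive1 (wave k c) = (fun x => k%:~R * wave k (c + pi / 2) x).
Proof.
apply: derive1_is_derive => x; apply: (is_derive_eq (is_derive_cos_affine _ _ _)).
by rewrite /wave addrA cosDpihalf.
Qed.

Lemma derive1_scale (a : R) (f : R -> R) : smooth1 f ->
  derive1 (fun x => a * f x) = (fun x => a * derive1 f x).
Proof.
move=> sf; apply: derive1_is_derive => x.
by apply: is_derive_scalef; exact: smooth1_is_derive.
Qed.

Lemma iter_derive1_wave n k c : iter n D1 (wave k c) =
  (fun x => k%:~R ^+ n * wave k (c + n%:R * (pi / 2)) x).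
Proof.
elim: n => [|n IH] /=.
  by apply/funext => x; rewrite expr0 mul1r mul0r addr0.
rewrite IH derive1_scale; last exact: smooth1_wave.
have -> : c + n.+1%:R * (pi / 2) = c + n%:R * (pi / 2) + pi / 2.
  by rewrite -natr1 mulrDl mul1r addrA.
by apply/funext => x; rewrite derive1_wave exprSr -[RHS]mulrA.
Qed.

Lemma smooth1_iter n (f : R -> R) : smooth1 f -> smooth1 (iter n D1 f).
Proof. by move=> sf; elim: n => //= n; exact: smooth1_derive1. Qed.

Lemma partial_t_tens theta chi : smooth1 theta ->
  partial_t (tens theta chi) = tens (derive1 theta) chi.
Proof.
move=> st; apply/funext => t; apply/funext => x; rewrite /partial_t /tens.
have -> : (fun s => theta s * chi x) = (fun s => chi x * theta s).
  by apply/funext => s; rewrite mulrC.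
by rewrite derive1_scale// mulrC.
Qed.

Lemma partial_x_tens theta chi : smooth1 chi ->
  partial_x (tens theta chi) = tens theta (derive1 chi).
Proof.
move=> st; apply/funext => t; apply/funext => x; rewrite /partial_x /tens.
by rewrite derive1_scale.
Qed.

Lemma iter_partial_x_tens n theta chi : smooth1 chi ->
  iter n partial_x (tens theta chi) = tens theta (iter n D1 chi).
Proof.
by move=> sc; elim: n => //= n ->; rewrite partial_x_tens//; exact: smooth1_iter.
Qed.

Lemma partials_tens w theta chi : smooth1 theta -> smooth1 chi ->
  exists p q, partials w (tens theta chi) = tens (iter p D1 theta) (iter q D1 chi).
Proof.
move=> st sc; elim: w => [|b w [p [q IH]]] /=; first by exists 0%N, 0%N.
rewrite IH; case: b.
  by exists p.+1, q; rewrite partial_t_tens//; exact: smooth1_iter.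
by exists p, q.+1; rewrite partial_x_tens//; exact: smooth1_iter.
Qed.

Lemma continuous_tens theta chi : continuous theta -> continuous chi ->
  continuous (fun p : R * R => tens theta chi p.1 p.2).
Proof.
move=> ct cc p; apply: cvgM.
  apply: (@continuous_comp _ _ _ fst theta); [exact: cvg_fst|exact: ct].
by apply: (@continuous_comp _ _ _ snd chi); [exact: cvg_snd|exact: cc].
Qed.

Lemma smooth_tens theta chi : smooth1 theta -> smooth1 chi -> smooth (tens theta chi).
Proof.
move=> st sc w; have [p [q ->]] := partials_tens w st sc.
have sp := smooth1_iter p st; have sq := smooth1_iter q sc.
split.
- move=> t x.
  have h := is_derive_scalef (iter q D1 chi x) (smooth1_is_derive sp t).
  rewrite (_ : (fun s => _) = (fun y => iter q D1 chi x * iter p D1 theta y)).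
    by case: h.
  by apply/funext => s; rewrite /tens mulrC.
- move=> t x.
  by case: (is_derive_scalef (iter p D1 theta t) (smooth1_is_derive sq x)).
- by apply: continuous_tens; exact: smooth1_continuous.
Qed.

Lemma wave_periodic theta k c (I : set R) : periodicx I (tens theta (wave k c)).
Proof.
move=> t x _; rewrite /tens /wave mulrDr addrAC.
by rewrite cosDint2pi.
Qed.

Lemma test_function_tens (T a c : R) theta k ph : smooth1 theta -> 0 < a -> c < T ->
  (forall t, theta t != 0 -> a <= t <= c) -> test_function T (tens theta (wave k ph)).
Proof.
move=> st a0 cT ts; split.
- exact: wave_periodic.
- by apply: smooth_tens => //; exact: smooth1_wave.
- exists a, c; split => // t x; rewrite /tens mulf_eq0 negb_or => /andP[h _].
  exact: ts.
Qed.

Lemma iter_support p (theta : R -> R) (d : R) : smooth1 theta ->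
  (forall t, theta t != 0 -> - d <= t <= d) ->
  forall t, iter p D1 theta t != 0 -> - d <= t <= d.
Proof.
move=> st ts; elim: p => //= p IH.
have sp := smooth1_iter p st.
apply: (derive_support (smooth1_is_derive sp) IH).
by apply: smooth1_continuous; exact: smooth1_derive1.
Qed.

Lemma schwartz_tens (d : R) theta k ph : smooth1 theta ->
  (forall t, theta t != 0 -> - d <= t <= d) -> schwartz (tens theta (wave k ph)).
Proof.
move=> st ts; split.
- exact: wave_periodic.
- by apply: smooth_tens => //; exact: smooth1_wave.
- move=> w m; have [p [q ->]] := partials_tens w st (@smooth1_wave k ph).
  have sp := smooth1_iter p st.
  have cp := smooth1_continuous sp.
  have tp := @iter_support p _ _ st ts.
  have [M hM] : exists M, forall t, `|t| ^+ m * `|iter p D1 theta t| <= M.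
    have ch : continuous (fun t => `|t| ^+ m * `|iter p D1 theta t|).
      move=> t; apply: cvgM.
        apply: (@continuous_comp _ _ _ (fun y : R => `|y|) (fun y => y ^+ m)); first exact: norm_continuous.
        exact: exprn_continuous.
      apply: (@continuous_comp _ _ _ (iter p D1 theta) (fun y : R => `|y|)); first exact: cp.
      exact: norm_continuous.
    have /compact_bounded[M [_ hM]] : compact
        ((fun t => `|t| ^+ m * `|iter p D1 theta t|) @` `[- d, d]).
      by apply: continuous_compact; [exact: continuous_subspaceT|exact: segment_compact].
    exists (`|M| + 1) => t; have [->|h] := eqVneq (iter p D1 theta t) 0.
      by rewrite normr0 mulr0 addr_ge0.
    apply: (le_trans (ler_norm _)); apply: (hM (`|M| + 1)).
      by rewrite ltr_pwDr// ler_norm.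
    by exists t => //; rewrite /= in_itv/=; exact: tp.
  exists (`|M| * `|k%:~R ^+ q|) => t x.
  rewrite /tens normrM mulrA; apply: ler_pM; rewrite ?mulr_ge0 ?exprn_ge0//.
    by rewrite (le_trans (hM t))// ler_norm.
  by rewrite iter_derive1_wave normrM ler_piMr// cos_max.
Qed.

Section SchwartzBounds.
Variable f : R -> R -> R.
Hypothesis sf : schwartz f.

Lemma schwartz_continuous : continuous (fun p : R * R => f p.1 p.2).
Proof. by case: sf => _ /(_ [::])[_ _]. Qed.

Lemma schwartz_continuous1 x : continuous (f ^~ x).
Proof.
move=> t; apply: (@continuous_comp _ _ _ (fun s => (s, x)) (fun p : R * R => f p.1 p.2)).
  exact: (cvg_pair (@cvg_id _ _) (cvg_cst x)).
exact: schwartz_continuous.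
Qed.

Lemma schwartz_continuous2 t : continuous (f t).
Proof.
move=> x; apply: (@continuous_comp _ _ _ (fun s => (t, s)) (fun p : R * R => f p.1 p.2)).
  exact: (cvg_pair (cvg_cst t) (@cvg_id _ _)).
exact: schwartz_continuous.
Qed.

Lemma schwartz_bound : exists2 M, 0 <= M & forall t x, `|f t x| <= M * (1 + t ^+ 2)^-1.
Proof.
case: sf => _ _ h; have [M0 h0] := h [::] 0%N; have [M2 h2] := h [::] 2%N.
have M00 : 0 <= M0 by rewrite (le_trans _ (h0 0 0))// mulr_ge0// exprn_ge0.
have M20 : 0 <= M2 by rewrite (le_trans _ (h2 0 0))// mulr_ge0// exprn_ge0.
exists (M0 + M2); first exact: addr_ge0.
move=> t x; rewrite ler_pdivlMr; last by rewrite ltr_pwDl// sqr_ge0.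
rewrite mulrDr mulr1 lerD//.
  by have := h0 t x; rewrite expr0 mul1r.
by have := h2 t x; rewrite /= real_normK ?num_real// mulrC.
Qed.

End SchwartzBounds.

Lemma itg_weight (M : R) : itg setT (fun s : R => M * (1 + s ^+ 2)^-1).
Proof. by apply: itgZl => //; exact: itg_oneDsqrV. Qed.

Definition xint (chi : R -> R) (f : R -> R -> R) (s : R) : R :=
  \int[mu]_(y in `[0, 2 * pi]) (chi y * f s y).

Section XInt.
Variables (chi : R -> R) (f : R -> R -> R).
Hypotheses (cchi : continuous chi) (chi1 : forall y, `|chi y| <= 1) (sf : schwartz f).

Lemma itg_xint_in s : itg `[0, 2 * pi] (fun y => chi y * f s y).
Proof.
by apply: itg_cont => y; apply: cvgM; [exact: cchi|exact: schwartz_continuous2].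
Qed.

Lemma continuous_xint : continuous (xint chi f).
Proof.
have [M M0 hM] := schwartz_bound sf.
apply: (@continuous_param _ _ (fun s y => chi y * f s y) (fun=> M)) => //.
- move=> s; apply: measurable_cont => // y.
  by apply: cvgM; [exact: cchi|exact: schwartz_continuous2].
- move=> y s; apply: cvgM; first exact: cvg_cst.
  exact: schwartz_continuous1.
- by apply: itg_cont; exact: cst_continuous.
- move=> s y _; rewrite normrM -[leRHS]mul1r; apply: ler_pM => //.
  rewrite (le_trans (hM s y))// ler_piMr// invf_le1 ?lerDl ?sqr_ge0//.
  by rewrite ltr_pwDl// sqr_ge0.
Qed.

Lemma itg_xint : itg setT (xint chi f).
Proof.
have [M M0 hM] := schwartz_bound sf.
apply: (@itg_le _ _ (fun s => (M * (2 * pi)) * (1 + s ^+ 2)^-1)) => //.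
- by apply: continuous_measurable_fun; exact: continuous_xint.
- move=> s _; have -> : M * (2 * pi) * (1 + s ^+ 2)^-1 =
     \int[mu]_(y in `[0, 2 * pi]) (M * (1 + s ^+ 2)^-1).
    by rewrite Rint_cst_itv ?mulr_ge0 ?pi_ge0// subr0 mulrAC.
  apply: Rint_bound => //.
  + by apply: itg_measurable; exact: itg_xint_in.
  + by apply: itg_cont; exact: cst_continuous.
  + move=> y _; rewrite normrM -[leRHS]mul1r; exact: ler_pM.
- exact: itg_weight.
Qed.

End XInt.

(** Real part of $\int e^{-ikx}(r+iw)\,dx$; the imaginary part is [modeR k] applied to [w] and
    [- r]. *)
Definition modeR (k : int) (r w : R -> R -> R) (s : R) : R :=
  xint (wave k 0) r s + xint (wave k (- (pi / 2))) w s.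

Section Mode.
Variables (r w : R -> R -> R) (k : int).
Hypotheses (sr : schwartz r) (sw : schwartz w).

Lemma wave_cont k' c : continuous (wave k' c).
Proof. exact: smooth1_continuous (smooth1_wave k' c). Qed.

Lemma wave_le1 k' c x : `|wave k' c x| <= 1.
Proof. exact: cos_max. Qed.

Lemma itg_modeR : itg setT (modeR k r w).
Proof.
by apply: itgD => //; apply: itg_xint => //; first [exact: wave_cont|exact: wave_le1].
Qed.

End Mode.

Lemma waveS k x : wave k (- (pi / 2)) x = sin (k%:~R * x).
Proof. by rewrite /wave cosBpihalf. Qed.

Lemma waveC k x : wave k 0 x = cos (k%:~R * x).
Proof. by rewrite /wave addr0. Qed.

Lemma schwartzN (f : R -> R -> R) : schwartz f -> schwartz (fun t x => - f t x).
Proof.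
move=> [pf smf bf].
have pE w : partials w (fun t x => - f t x) = (fun t x => - partials w f t x).
  elim: w => //= b w ->; have [d1 d2 _] := smf w.
  case: b; apply/funext => t; apply/funext => x.
    rewrite /partial_t !derive1E.
    by rewrite (@deriveN R R R (fun s => partials w f s x)).
  rewrite /partial_x !derive1E.
  by rewrite (@deriveN R R R (partials w f t)).
split.
- by move=> t x tI; rewrite pf.
- move=> w; rewrite pE; have [d1 d2 c] := smf w; split.
  + by move=> t x; apply: (@derivableN R R R (fun s => partials w f s x)).
  + by move=> t x; apply: (@derivableN R R R (partials w f t)).
  + by move=> p; apply: cvgN; exact: c.
- move=> w m; have [M hM] := bf w m; exists M => t x.
  by rewrite pE normrN.
Qed.

End Modes.

(** * Fourier representation of mollified modes *)

Section Rep.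
Context {R : realType}.
Local Notation mu := (@lebesgue_measure R).
Local Notation pi := (@pi R).

(** With [FTim]: real and imaginary parts of $\int e^{-is\tau}(G_r+iG_i)\,ds$. Multiplication by
    $-i$ turns the imaginary part into a real one, so continuity and bounds are proved for [FTre]
    only. *)
Definition FTre (Gr Gi : R -> R) (tau : R) : R :=
  \int[mu]_s (cos (s * tau) * Gr s + sin (s * tau) * Gi s).

Definition FTim (Gr Gi : R -> R) (tau : R) : R :=
  \int[mu]_s (cos (s * tau) * Gi s - sin (s * tau) * Gr s).

Lemma FTimE Gr Gi : FTim Gr Gi = FTre Gi (fun s => - Gr s).
Proof. by apply/funext => tau; apply: eq_Rintegral => s _; rewrite mulrN. Qed.

Lemma FTimN Gr Gi : FTim Gi (fun s => - Gr s) = (fun tau => - FTre Gr Gi tau).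
Proof.
apply/funext => tau; rewrite /FTim /FTre -RintN.
by apply: eq_Rintegral => s _; rewrite mulrN opprD.
Qed.

Section FT.
Variables (Gr Gi : R -> R).
Hypotheses (iGr : itg setT Gr) (iGi : itg setT Gi).

Let mcos tau : measurable_fun setT (fun s : R => cos (s * tau)).
Proof. by apply: continuous_measurable_fun; exact: continuous_cosr. Qed.

Let msin tau : measurable_fun setT (fun s : R => sin (s * tau)).
Proof. by apply: continuous_measurable_fun; exact: continuous_sinr. Qed.

Let icos tau (G : R -> R) : itg setT G -> itg setT (fun s => cos (s * tau) * G s).
Proof. by apply: (itgM_bdd _ (mcos tau)) => // x _; exact: cos_max. Qed.

Let isin tau (G : R -> R) : itg setT G -> itg setT (fun s => sin (s * tau) * G s).
Proof. by apply: (itgM_bdd _ (msin tau)) => // x _; exact: sin_max. Qed.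

Lemma itg_FTre tau : itg setT (fun s => cos (s * tau) * Gr s + sin (s * tau) * Gi s).
Proof. by apply: itgD => //; [exact: icos|exact: isin]. Qed.

Let iGG : itg setT (fun s => `|Gr s| + `|Gi s|).
Proof. by apply: itgD => //; exact: itg_norm. Qed.

Let FT_le tau s : `|cos (s * tau) * Gr s + sin (s * tau) * Gi s| <= `|Gr s| + `|Gi s|.
Proof.
apply: (le_trans (ler_normD _ _)); rewrite !normrM.
by apply: lerD; rewrite ler_piMl// ?cos_max ?sin_max.
Qed.

Lemma continuous_FTre : continuous (FTre Gr Gi).
Proof.
apply: (@continuous_param _ _ (fun tau s => cos (s * tau) * Gr s + sin (s * tau) * Gi s)
   (fun s => `|Gr s| + `|Gi s|)) => //.
- by move=> tau; apply: itg_measurable; exact: itg_FTre.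
- move=> s tau; apply: cvgD; apply: cvgM; try exact: cvg_cst.
    exact: continuous_cosl.
  exact: continuous_sinl.
Qed.

Lemma FTre_bound : exists M, forall tau, `|FTre Gr Gi tau| <= M.
Proof.
exists (\int[mu]_s (`|Gr s| + `|Gi s|)) => tau; apply: Rint_bound => //.
by apply: itg_measurable; exact: itg_FTre.
Qed.

End FT.

Section ConvRep.
Variables (rho : R -> R) (d : R).
Hypotheses (d0 : 0 < d) (srho : smooth1 rho) (rhoeven : forall x, rho (- x) = rho x)
  (rhos : forall x, rho x != 0 -> - d <= x <= d) (rhoM : exists M, forall x, `|rho x| <= M).
Let hat := cosT rho d.

(** Convolution with [rho] is multiplication by its transform [hat]; the right side is the real part
    of the inversion integral. Fubini brings the integral over $\tau$ inside, where the cosine part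
    is [cosT_inversion] and the sine part vanishes because [hat] is even. *)
Lemma conv_rep (Gr Gi : R -> R) (t : R) : itg setT Gr -> itg setT Gi ->
  \int[mu]_s (rho (t - s) * Gr s) = (2 * pi)^-1 *
  \int[mu]_tau (hat tau * (cos (t * tau) * FTre Gr Gi tau - sin (t * tau) * FTim Gr Gi tau)).
Proof.
move=> iGr iGi.
have ihat : itg setT hat by exact: (itg_cosT d0 srho).
have chat : continuous hat by exact: continuous_cosT.
have mhat : measurable_fun setT hat by exact: continuous_measurable_fun.
have iGi' : itg setT (fun s => - Gr s).
  by have := itgZl (-1) measurableT iGr; under eq_fun do rewrite mulN1r.
have inner tau : cos (t * tau) * FTre Gr Gi tau - sin (t * tau) * FTim Gr Gi tau =
    \int[mu]_s (cos ((t - s) * tau) * Gr s - sin ((t - s) * tau) * Gi s).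
  rewrite FTimE /FTre -RintegralZl//; last exact: itg_FTre.
  rewrite -RintegralZl//; last exact: itg_FTre.
  rewrite -RintegralB//; [|by apply: itgZl => //; exact: itg_FTre..].
  by apply: eq_Rintegral => s _; rewrite mulrBl cosB sinB; ring.
pose F tau s := hat tau * (cos ((t - s) * tau) * Gr s - sin ((t - s) * tau) * Gi s).
have -> : \int[mu]_tau (hat tau * (cos (t * tau) * FTre Gr Gi tau - sin (t * tau) * FTim Gr Gi tau)) =
   \int[mu]_tau \int[mu]_s F tau s.
  apply: eq_Rintegral => tau _; rewrite inner RintegralZl//.
  apply: itgB => //.
    apply: (itgM_bdd (M := 1) _ _ _ iGr) => //; last by move=> x _; exact: cos_max.
    apply: continuous_measurable_fun => s.
    apply: (@continuous_comp _ _ _ (fun s => t - s) (fun z => cos (z * tau))); last exact: continuous_cosr.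
    by apply: cvgB; [exact: cvg_cst|exact: cvg_id].
  apply: (itgM_bdd (M := 1) _ _ _ iGi) => //; last by move=> x _; exact: sin_max.
  apply: continuous_measurable_fun => s.
  apply: (@continuous_comp _ _ _ (fun s => t - s) (fun z => sin (z * tau))); last exact: continuous_sinr.
  by apply: cvgB; [exact: cvg_cst|exact: cvg_id].
have mts : measurable_fun setT (fun p : R * R => (t - p.2) * p.1).
  apply: measurable_funM; last exact: measurable_fst.
  by apply: measurable_funB; [exact: measurable_cst|exact: measurable_snd].
rewrite (@Rfubini _ _ _ F (fun tau => `|hat tau|) (fun s => `|Gr s| + `|Gi s|)) //; last 4 first.
- apply: measurable_funM; first exact: (measurableT_comp mhat measurable_fst).
  apply: measurable_funB; apply: measurable_funM.
  + by apply: measurableT_comp mts; apply: continuous_measurable_fun; exact: continuous_cos.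
  + exact: (measurableT_comp (itg_measurable iGr) measurable_snd).
  + by apply: measurableT_comp mts; apply: continuous_measurable_fun; exact: continuous_sin.
  + exact: (measurableT_comp (itg_measurable iGi) measurable_snd).
- exact: itg_norm.
- by apply: itgD => //; exact: itg_norm.
- move=> tau s _ _; rewrite normrM ler_wpM2l// (le_trans (ler_normB _ _))// !normrM.
  by apply: lerD; rewrite ler_piMl// ?cos_max ?sin_max.
have c1 x : continuous (fun tau => hat tau * cos (tau * x)).
  by move=> tau; apply: cvgM; [exact: chat|exact: continuous_cosr].
have c2 x : continuous (fun tau => hat tau * sin (tau * x)).
  by move=> tau; apply: cvgM; [exact: chat|exact: continuous_sinr].
have i1 x : itg setT (fun tau => hat tau * cos (tau * x)).
  apply: (itg_le _ _ _ (itg_norm _ ihat)) => //; first exact: continuous_measurable_fun.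
  by move=> tau _; rewrite normrM ler_piMr// cos_max.
have i2 x : itg setT (fun tau => hat tau * sin (tau * x)).
  apply: (itg_le _ _ _ (itg_norm _ ihat)) => //; first exact: continuous_measurable_fun.
  by move=> tau _; rewrite normrM ler_piMr// sin_max.
have FE s : \int[mu]_tau F tau s = 2 * pi * (rho (t - s) * Gr s).
  have -> : \int[mu]_tau F tau s = \int[mu]_tau (Gr s * (hat tau * cos (tau * (t - s)))
      - Gi s * (hat tau * sin (tau * (t - s)))).
    by apply: eq_Rintegral => tau _; rewrite /F (mulrC (t - s)); ring.
  rewrite RintegralB//; [|exact: itgZl..].
  rewrite !RintegralZl// (cosT_inversion d0 srho rhoeven rhos).
  rewrite (int_odd (c2 (t - s)) (i2 _)) ?mulr0 ?subr0; first by ring.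
  by move=> x; rewrite /hat cosTN mulNr sinN mulrN.
under [in RHS]eq_Rintegral do rewrite FE.
case: rhoM => M hM; rewrite RintegralZl//.
  by rewrite mulrA mulVf ?mul1r// mulf_neq0// gt_eqF// pi_gt0.
apply: (itgM_bdd (M := M) _ _ _ iGr) => //.
apply: continuous_measurable_fun => s.
apply: (@continuous_comp _ _ _ (fun s => t - s) rho); last exact: smooth1_continuous.
by apply: cvgB; [exact: cvg_cst|exact: cvg_id].
Qed.

Lemma itg_hatM (h : R -> R) (M : R) : continuous h -> (forall x, `|h x| <= M) ->
  itg setT (fun tau => hat tau * h tau).
Proof.
move=> ch hM; have : itg setT (fun tau => h tau * hat tau).
  apply: (itgM_bdd (M := M)) => //; first exact: continuous_measurable_fun.
  exact: (itg_cosT d0 srho).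
by under eq_fun do rewrite mulrC.
Qed.

End ConvRep.

Lemma stint_tens (theta chi : R -> R) (f : R -> R -> R) : continuous chi ->
  schwartz f ->
  stint setT (fun t x => f t x * tens theta chi t x) =
  \int[mu]_t (theta t * xint chi f t).
Proof.
move=> cc sf; apply: eq_Rintegral => t _.
rewrite -RintegralZl//; last exact: itg_xint_in.
by apply: eq_Rintegral => x _; rewrite /tens; ring.
Qed.

(* [moR + i moI] is the value of [d] at [theta(t) e^{-ikx}]. *)
Definition moR (d : @distr R) (theta : R -> R) (k : int) : R :=
  complex.Re (d (tens theta (wave k 0))) + complex.Im (d (tens theta (wave k (- (pi / 2))))).

Definition moI (d : @distr R) (theta : R -> R) (k : int) : R :=
  complex.Im (d (tens theta (wave k 0))) - complex.Re (d (tens theta (wave k (- (pi / 2))))).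

Section SchwartzMode.
Variable (g : R -> R -> R[i]).
Hypothesis sg : schwartzC g.
Let r t x := complex.Re (g t x).
Let w t x := complex.Im (g t x).
Let sr : schwartz r. Proof. by case: sg. Qed.
Let sw : schwartz w. Proof. by case: sg. Qed.

Definition Gre k := modeR k r w.
Definition Gim k := modeR k w (fun t x => - r t x).

Lemma itg_Gre k : itg setT (Gre k). Proof. exact: itg_modeR. Qed.
Lemma itg_Gim k : itg setT (Gim k).
Proof. by apply: itg_modeR => //; exact: schwartzN. Qed.

Let xintN (chi : R -> R) (f : R -> R -> R) s : continuous chi -> schwartz f ->
  xint chi (fun t x => - f t x) s = - xint chi f s.
Proof.
move=> cc sf; rewrite /xint -RintN.
by apply: eq_Rintegral => x _; rewrite mulrN.
Qed.

Lemma Re_distr_tens theta chi : continuous chi ->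
  complex.Re (distr_of g (tens theta chi)) = \int[mu]_t (theta t * xint chi r t).
Proof.
move=> cc; rewrite -stint_tens//=; congr stint; apply/funext => t; apply/funext => x.
by rewrite /r; case: (g t x) => a b /=; rewrite mulr0 subr0.
Qed.

Lemma Im_distr_tens theta chi : continuous chi ->
  complex.Im (distr_of g (tens theta chi)) = \int[mu]_t (theta t * xint chi w t).
Proof.
move=> cc; rewrite -stint_tens//=; congr stint; apply/funext => t; apply/funext => x.
by rewrite /w; case: (g t x) => a b /=; rewrite mulr0 add0r.
Qed.

Let ith (theta chi : R -> R) (f : R -> R -> R) : continuous theta -> (exists M, forall x, `|theta x| <= M) ->
  continuous chi -> (forall y, `|chi y| <= 1) -> schwartz f ->
  itg setT (fun t => theta t * xint chi f t).
Proof.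
move=> ct [M hM] cc c1 sf; apply: (itgM_bdd (M := M)) => //.
  exact: continuous_measurable_fun.
exact: itg_xint.
Qed.

Lemma moR_distr theta k : continuous theta -> (exists M, forall x, `|theta x| <= M) ->
  moR (distr_of g) theta k = \int[mu]_t (theta t * Gre k t).
Proof.
move=> ct cM; rewrite /moR Re_distr_tens; last exact: wave_cont.
rewrite Im_distr_tens; last exact: wave_cont.
rewrite -RintegralD//; [|by apply: ith => //; first [exact: wave_cont|exact: wave_le1]..].
by apply: eq_Rintegral => t _; rewrite -mulrDr.
Qed.

Lemma moI_distr theta k : continuous theta -> (exists M, forall x, `|theta x| <= M) ->
  moI (distr_of g) theta k = \int[mu]_t (theta t * Gim k t).
Proof.
move=> ct cM; rewrite /moI Re_distr_tens; last exact: wave_cont.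
rewrite Im_distr_tens; last exact: wave_cont.
rewrite -RintegralB//; [|by apply: ith => //; first [exact: wave_cont|exact: wave_le1]..].
apply: eq_Rintegral => t _; rewrite /Gim /modeR xintN//; last exact: wave_cont.
by rewrite mulrDr mulrN.
Qed.

Lemma Re_fourier tau k : complex.Re (fourier g tau k) =
  (2 * pi)^-1 * FTre (Gre k) (Gim k) tau.
Proof.
rewrite /fourier /= mul0r subr0; congr (_ * _).
apply: eq_Rintegral => t _.
have ix (chi : R -> R) (f : R -> R -> R) : continuous chi -> schwartz f -> itg `[0, 2 * pi] (fun y => chi y * f t y).
  by move=> cc sf; exact: itg_xint_in.
have ixN (chi : R -> R) : continuous chi -> itg `[0, 2 * pi] (fun y => chi y * - r t y).
  by move=> cc; apply: (ix chi (fun t x => - r t x)) => //; exact: schwartzN.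
transitivity (\int[mu]_(x in `[0, 2 * pi])
  (cos (t * tau) * (wave k 0 x * r t x + wave k (- (pi / 2)) x * w t x) +
   sin (t * tau) * (wave k 0 x * w t x + wave k (- (pi / 2)) x * - r t x))).
  apply: eq_Rintegral => x _; rewrite waveC waveS /r /w.
  by case: (g t x) => a b /=; ring.
rewrite RintegralD//; last 2 first.
- by apply: itgZl => //; apply: itgD => //; first [by apply: ix => //; exact: wave_cont|by apply: ixN; exact: wave_cont].
- apply: itgZl => //; apply: itgD => //; first [by apply: ix => //; exact: wave_cont|by apply: ixN; exact: wave_cont].
rewrite !RintegralZl//; last 2 first.
- apply: itgD => //; first [by apply: ix => //; exact: wave_cont|by apply: ixN; exact: wave_cont].
- by apply: itgD => //; first [by apply: ix => //; exact: wave_cont|by apply: ixN; exact: wave_cont].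
rewrite !RintegralD//; try by first [by apply: ix => //; exact: wave_cont|by apply: ixN; exact: wave_cont].
Qed.

Lemma Im_fourier tau k : complex.Im (fourier g tau k) =
  (2 * pi)^-1 * FTim (Gre k) (Gim k) tau.
Proof.
rewrite /fourier /= mul0r addr0; congr (_ * _).
apply: eq_Rintegral => t _.
have ix (chi : R -> R) (f : R -> R -> R) : continuous chi -> schwartz f -> itg `[0, 2 * pi] (fun y => chi y * f t y).
  by move=> cc sf; exact: itg_xint_in.
have ixN (chi : R -> R) : continuous chi -> itg `[0, 2 * pi] (fun y => chi y * - r t y).
  by move=> cc; apply: (ix chi (fun t x => - r t x)) => //; exact: schwartzN.
transitivity (\int[mu]_(x in `[0, 2 * pi])
  (cos (t * tau) * (wave k 0 x * w t x + wave k (- (pi / 2)) x * - r t x) -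
   sin (t * tau) * (wave k 0 x * r t x + wave k (- (pi / 2)) x * w t x))).
  apply: eq_Rintegral => x _; rewrite waveC waveS /r /w.
  by case: (g t x) => a b /=; ring.
rewrite RintegralB//; last 2 first.
- apply: itgZl => //; apply: itgD => //; first [by apply: ix => //; exact: wave_cont|by apply: ixN; exact: wave_cont].
- by apply: itgZl => //; apply: itgD => //; first [by apply: ix => //; exact: wave_cont|by apply: ixN; exact: wave_cont].
rewrite !RintegralZl//; last 2 first.
- by apply: itgD => //; first [by apply: ix => //; exact: wave_cont|by apply: ixN; exact: wave_cont].
- apply: itgD => //; first [by apply: ix => //; exact: wave_cont|by apply: ixN; exact: wave_cont].
rewrite !RintegralD//; try by first [by apply: ix => //; exact: wave_cont|by apply: ixN; exact: wave_cont].
Qed.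

Lemma continuous_Re_fourier k : continuous (fun tau => complex.Re (fourier g tau k)).
Proof.
under eq_fun do rewrite Re_fourier.
move=> tau; apply: cvgM; first exact: cvg_cst.
by apply: continuous_FTre; [exact: itg_Gre|exact: itg_Gim].
Qed.

Let itg_NGre k : itg setT (fun s => - Gre k s).
Proof. by have := itgZl (-1) measurableT (itg_Gre k); under eq_fun do rewrite mulN1r. Qed.

Lemma continuous_Im_fourier k : continuous (fun tau => complex.Im (fourier g tau k)).
Proof.
under eq_fun do rewrite Im_fourier.
move=> tau; apply: cvgM; first exact: cvg_cst.
rewrite FTimE; apply: continuous_FTre; [exact: itg_Gim|exact: itg_NGre].
Qed.

Lemma fourier_bound k : exists M, forall tau,
  `|complex.Re (fourier g tau k)| <= M /\ `|complex.Im (fourier g tau k)| <= M.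
Proof.
have [M1 h1] := FTre_bound (itg_Gre k) (itg_Gim k).
have [M2 h2] := FTre_bound (itg_Gim k) (itg_NGre k).
exists ((2 * pi)^-1 * (M1 + M2)) => tau.
have p0 : 0 <= (2 * pi)^-1 by rewrite invr_ge0 mulr_ge0// pi_ge0.
have M10 := le_trans (normr_ge0 _) (h1 0).
have M20 := le_trans (normr_ge0 _) (h2 0).
rewrite Re_fourier Im_fourier FTimE !normrM ger0_norm//; split; rewrite ler_wpM2l//.
  by rewrite (le_trans (h1 _))// lerDl.
by rewrite (le_trans (h2 _))// lerDr.
Qed.

Section Kernel.
Variables (rho : R -> R) (d : R) (t : R) (k : int).
Hypotheses (d0 : 0 < d) (srho : smooth1 rho) (rhoeven : forall x, rho (- x) = rho x)
  (rhos : forall x, rho x != 0 -> - d <= x <= d) (rhoM : exists M, forall x, `|rho x| <= M).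
Let hat := cosT rho d.

Let crho : continuous (fun s => rho (t - s)).
Proof.
have -> : (fun s => rho (t - s)) = (fun s => rho (-1 * s + t)).
  by apply/funext => s; rewrite mulN1r addrC.
exact: smooth1_continuous (smooth1_affine (-1) t srho).
Qed.

Let rhoM' : exists M, forall s, `|rho (t - s)| <= M.
Proof. by case: rhoM => M hM; exists M. Qed.

Let itg_hat_comb (a b : R -> R) (M : R) : continuous a -> continuous b ->
  (forall x, `|a x| <= M) -> (forall x, `|b x| <= M) ->
  itg setT (fun tau => hat tau * (cos (t * tau) * a tau - sin (t * tau) * b tau)).
Proof.
move=> ca cb aM bM; apply: (@itg_hatM rho d d0 srho rhos (fun tau => cos (t * tau) * a tau - sin (t * tau) * b tau)
  (M + M)) => [x|x].
  apply: cvgB; apply: cvgM; [|exact: ca| |exact: cb].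
    exact: continuous_cosl.
  exact: continuous_sinl.
rewrite (le_trans (ler_normB _ _))// !normrM; apply: lerD.
  by rewrite (le_trans _ (aM x))// ler_piMl// cos_max.
by rewrite (le_trans _ (bM x))// ler_piMl// sin_max.
Qed.

Let FT_scaled (A B : R -> R) (a b : R -> R) (c : R) : c != 0 ->
  (forall x, a x = c * A x) -> (forall x, b x = c * B x) ->
  continuous a -> continuous b -> (exists M, forall x, `|a x| <= M /\ `|b x| <= M) ->
  c * \int[mu]_tau (hat tau * (cos (t * tau) * A tau - sin (t * tau) * B tau)) =
  \int[mu]_tau (hat tau * (cos (t * tau) * a tau - sin (t * tau) * b tau)).
Proof.
move=> c0 aA bB ca cb [M hM].
have ii := itg_hat_comb ca cb (fun x => (hM x).1) (fun x => (hM x).2).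
apply: (mulfI (invr_neq0 c0)); rewrite mulKf// -RintegralZl//.
by apply: eq_Rintegral => x _; rewrite aA bB; field.
Qed.

Let c0 : (2 * pi)^-1 != 0.
Proof. by rewrite invr_neq0// mulf_neq0// gt_eqF// pi_gt0. Qed.

(** The factor $(2\pi)^{-1}$ of the inversion formula is the one in the definition of [fourier], so
    no constant remains. *)
Lemma moR_rep : moR (distr_of g) (fun s => rho (t - s)) k =
  \int[mu]_tau (hat tau * (cos (t * tau) * complex.Re (fourier g tau k)
     - sin (t * tau) * complex.Im (fourier g tau k))).
Proof.
rewrite moR_distr// (conv_rep d0 srho rhoeven rhos rhoM t (itg_Gre k) (itg_Gim k)).
apply: FT_scaled => //.
- by move=> x; exact: Re_fourier.
- by move=> x; exact: Im_fourier.
- exact: continuous_Re_fourier.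
- exact: continuous_Im_fourier.
- exact: fourier_bound.
Qed.

(** [conv_rep] for $-i$ times the mode, whose components are [Gim] and [- Gre]. *)
Lemma moI_rep : moI (distr_of g) (fun s => rho (t - s)) k =
  \int[mu]_tau (hat tau * (cos (t * tau) * complex.Im (fourier g tau k)
     + sin (t * tau) * complex.Re (fourier g tau k))).
Proof.
rewrite moI_distr// (conv_rep d0 srho rhoeven rhos rhoM t (itg_Gim k) (itg_NGre k)).
rewrite -FTimE FTimN.
rewrite (@FT_scaled _ _ (fun tau => complex.Im (fourier g tau k))
  (fun tau => - complex.Re (fourier g tau k)))//.
- by apply: eq_Rintegral => x _; rewrite mulrN opprK.
- by move=> x; exact: Im_fourier.
- by move=> x; rewrite Re_fourier mulrN.
- exact: continuous_Im_fourier.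
- by move=> x; apply: cvgN; exact: continuous_Re_fourier.
- have [M hM] := fourier_bound k; exists M => x; rewrite normrN.
  by case: (hM x).
Qed.

End Kernel.
End SchwartzMode.
End Rep.

(** * Bourgain norms *)

Section Norms.
Context {R : realType}.
Local Notation mu := (@lebesgue_measure R).
Local Notation pi := (@pi R).

(** The sequence stands for squared norms. Minkowski's inequality is replaced by
    $\|g\|^2\le(1+\eta)\|h\|^2+(1+\eta^{-1})\|g-h\|^2$, whose proof is pointwise; [e] bounds the
    squared distance and [eta] is free. *)
Lemma quasi_cauchy (x : nat -> \bar R) : (forall m, 0 <= x m)%E ->
  (forall e : R, 0 < e -> exists N, forall m p, (N <= m)%N -> (N <= p)%N ->
    forall eta : R, 0 < eta ->
    (x m <= (1 + eta)%:E * x p + ((1 + eta^-1) * e)%:E)%E) ->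
  exists l, [/\ sqrte (x m) @[m --> \oo] --> l, (0 <= l)%E &
    forall A : R, 0 < A -> (l < A%:E)%E ->
      exists N, forall m, (N <= m)%N -> (x m <= (A ^+ 2)%:E)%E].
Proof.
move=> x0 H; have [N1 hN1] := H 1 ltr01.
(* If no term of the tail is finite the limit is $+\infty$; if one is, the inequality with [eta = 1]
   makes the whole tail finite and bounded. *)
have [[p [pN xp]]|noP] := pselect (exists p, (N1 <= p)%N /\ (x p < +oo)%E); last first.
  exists +oo%E; split => //.
  apply: cvg_near_cst; exists N1 => // m /= mN.
  have -> // : x m = +oo%E.
  apply/eqP; rewrite -leye_eq leNgt; apply/negP => h; apply: noP.
  by exists m.
pose y m := fine (x m).
have fin m : (N1 <= m)%N -> x m = (y m)%:E.
  move=> mN; rewrite fineK// ge0_fin_numE//.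
  apply: (le_lt_trans (hN1 m p mN pN 1 ltr01)).
  by rewrite lte_add_pinfty ?ltry// lte_mul_pinfty// lee_fin addr_ge0.
have y0 m : 0 <= y m by exact: fine_ge0.
pose B := 2 * y p + 2.
have yB m : (N1 <= m)%N -> y m <= B.
  move=> mN; have := hN1 m p mN pN 1 ltr01.
  rewrite (fin m mN) (fin p pN) -EFinM -EFinD lee_fin invr1 /B; lra.
have B0 : 0 < B by rewrite /B; have := y0 p; lra.
have cy : cvg (y @ \oo).
  apply: R_complete; apply/cauchyP => e e0.
  (* [B] bounds the tail, so this [eta] makes the first correction at most [e / 4]; then [e'] makes
     the second equal to [e / 4]. *)
  pose eta := e / (4 * B).
  have eta0 : 0 < eta by rewrite divr_gt0// mulr_gt0.
  have c0 : 0 < 1 + eta^-1 by rewrite addr_gt0// invr_gt0.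
  pose e' := e / (4 * (1 + eta^-1)).
  have e'0 : 0 < e' by rewrite divr_gt0// mulr_gt0.
  have [N2 hN2] := H e' e'0.
  have key m q : (maxn N1 N2 <= m)%N -> (maxn N1 N2 <= q)%N -> y m - y q <= e / 2.
    rewrite !geq_max => /andP[m1 m2] /andP[q1 q2].
    have := hN2 m q m2 q2 eta eta0.
    rewrite (fin m m1) (fin q q1) -EFinM -EFinD lee_fin.
    have -> : (1 + eta^-1) * e' = e / 4.
      by rewrite /e'; set c := 1 + _ in c0 *; field; rewrite gt_eqF.
    have : eta * y q <= e / 4.
      apply: (@le_trans _ _ (eta * B)); first by rewrite ler_wpM2l ?yB// ltW.
      by rewrite /eta le_eqVlt; apply/orP; left; apply/eqP; field; rewrite gt_eqF.
    rewrite mulrDl mul1r; lra.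
  exists (y (maxn N1 N2)); exists (maxn N1 N2) => // q /= hq; rewrite /ball /=.
  have hm := leqnn (maxn N1 N2).
  have h1 := key _ q hm hq; have h2 := key q _ hq hm.
  by rewrite ltr_norml; apply/andP; split; lra.
have [l yl] : exists l : R, y @ \oo --> l by exists (lim (y @ \oo)).
have xE : \forall m \near \oo, (Num.sqrt (y m))%:E = sqrte (x m).
  by exists N1 => // m /= mN; rewrite (fin m mN).
exists (Num.sqrt l)%:E; split.
- apply: cvg_trans; first exact: (near_eq_cvg xE).
  apply: cvg_EFin; first exact: nearW.
  have h : (fun m => Num.sqrt (y m)) @ \oo --> Num.sqrt l.
    by apply: continuous_cvg => //; exact: sqrt_continuous.
  exact: h.
- by rewrite lee_fin sqrtr_ge0.
- move=> A A0; rewrite lte_fin => lA.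
  have lA2 : l < A ^+ 2.
    have [l0|l0] := ltP l 0; first by rewrite (lt_le_trans l0)// sqr_ge0.
    by rewrite -[ltLHS]sqr_sqrtr// ltrXn2r.
  have /cvgr_lt/(_ _ lA2)[N2 _ hN2] := yl.
  exists (maxn N1 N2) => m; rewrite geq_max => /andP[m1 m2].
  by rewrite (fin m m1) lee_fin ltW//; exact: hN2.
Qed.

Lemma schwartzB (f g : R -> R -> R) : schwartz f -> schwartz g ->
  schwartz (fun t x => f t x - g t x).
Proof.
move=> [pf sf bf] [pg sg bg].
have pE w : partials w (fun t x => f t x - g t x) =
    (fun t x => partials w f t x - partials w g t x).
  elim: w => //= b w ->; have [d1 d2 _] := sf w; have [d1' d2' _] := sg w.
  case: b; apply/funext => t; apply/funext => x.
    rewrite /partial_t !derive1E.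
    by rewrite (@deriveB R R R (fun s => partials w f s x) (fun s => partials w g s x)).
  rewrite /partial_x !derive1E.
  by rewrite (@deriveB R R R (partials w f t) (partials w g t)).
split.
- by move=> t x tI; rewrite pf// pg.
- move=> w; rewrite pE; have [d1 d2 c] := sf w; have [d1' d2' c'] := sg w; split.
  + by move=> t x; apply: (@derivableB R R R (fun s => partials w f s x) (fun s => partials w g s x)).
  + by move=> t x; apply: (@derivableB R R R (partials w f t) (partials w g t)).
  + by move=> p; apply: cvgB; [exact: c|exact: c'].
- move=> w m; have [M hM] := bf w m; have [M' hM'] := bg w m; exists (M + M') => t x.
  rewrite pE (le_trans (ler_wpM2l _ (ler_normB _ _)))// ?exprn_ge0//.
  by rewrite mulrDr lerD.
Qed.

Lemma xintB (chi : R -> R) (f g : R -> R -> R) s : continuous chi ->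
  schwartz f -> schwartz g ->
  xint chi (fun t x => f t x - g t x) s = xint chi f s - xint chi g s.
Proof.
move=> cc sf sg; rewrite /xint -RintegralB//; [|exact: itg_xint_in..].
by apply: eq_Rintegral => x _; rewrite mulrBr.
Qed.

Definition en (g : R -> R -> R[i]) (tau : R) (k : int) : R :=
  complex.Re (fourier g tau k) ^+ 2 + complex.Im (fourier g tau k) ^+ 2.

Lemma en_ge0 g tau k : 0 <= en g tau k.
Proof. by rewrite addr_ge0// sqr_ge0. Qed.

Lemma normc_en g tau k : Normc.normc (fourier g tau k) ^+ 2 = en g tau k.
Proof.
rewrite /en; case: (fourier g tau k) => a b /=.
by rewrite sqr_sqrtr// addr_ge0// sqr_ge0.
Qed.

Lemma continuous_sqrD (F G : R -> R) : continuous F -> continuous G ->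
  continuous (fun x => F x ^+ 2 + G x ^+ 2).
Proof.
move=> cF cG x; rewrite /continuous_at; under eq_fun do rewrite 2!expr2.
rewrite 2!expr2; apply: cvgD; apply: cvgM; by [exact: cF|exact: cG].
Qed.

Lemma continuous_en g k : schwartzC g -> continuous (fun tau => en g tau k).
Proof.
move=> sg.
by apply: continuous_sqrD; [exact: continuous_Re_fourier|exact: continuous_Im_fourier].
Qed.

Lemma eqB3 (x a b x' a' b' : R) : x = x' -> a = a' -> b = b' -> x' = a' - b' -> x = a - b.
Proof. by move=> -> -> ->. Qed.

Lemma sqrD_quasi (x1 x2 y1 y2 z1 z2 eta : R) : 0 < eta -> z1 = x1 - y1 -> z2 = x2 - y2 ->
  x1 ^+ 2 + x2 ^+ 2 <= (1 + eta) * (y1 ^+ 2 + y2 ^+ 2) + (1 + eta^-1) * (z1 ^+ 2 + z2 ^+ 2).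
Proof.
move=> eta0 -> ->.
have K (a b : R) : a ^+ 2 <= (1 + eta) * b ^+ 2 + (1 + eta^-1) * (a - b) ^+ 2.
  have := sqr_dist_le a b eta0; rewrite ler_norml => /andP[_].
  rewrite (mulrDl 1 eta) mul1r; lra.
have := lerD (K x1 y1) (K x2 y2); lra.
Qed.

Section Diff.
Variables (g h : R -> R -> R[i]).
Hypotheses (sg : schwartzC g) (sh : schwartzC h).

Lemma schwartzCB : schwartzC (fun t x => (g t x - h t x)%R).
Proof.
case: sg => g1 g2; case: sh => h1 h2; split.
  have := schwartzB g1 h1; congr schwartz; apply/funext => t; apply/funext => x.
  by case: (g t x) (h t x) => [? ?] [].
have := schwartzB g2 h2; congr schwartz; apply/funext => t; apply/funext => x.
by case: (g t x) (h t x) => [? ?] [].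
Qed.

Lemma GreB k s : Gre (fun t x => (g t x - h t x)%R) k s = Gre g k s - Gre h k s.
Proof.
case: sg => g1 g2; case: sh => h1 h2.
rewrite /Gre /modeR.
have -> : (fun t x => complex.Re (g t x - h t x)%R) =
   (fun t x => complex.Re (g t x) - complex.Re (h t x)).
  by apply/funext => t; apply/funext => x; case: (g t x) (h t x) => [? ?] [].
have -> : (fun t x => complex.Im (g t x - h t x)%R) =
   (fun t x => complex.Im (g t x) - complex.Im (h t x)).
  by apply/funext => t; apply/funext => x; case: (g t x) (h t x) => [? ?] [].
by rewrite !xintB//; try exact: wave_cont; ring.
Qed.

Lemma GimB k s : Gim (fun t x => (g t x - h t x)%R) k s = Gim g k s - Gim h k s.
Proof.
case: sg => g1 g2; case: sh => h1 h2.
rewrite /Gim /modeR.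
have -> : (fun t x => - complex.Re (g t x - h t x)%R) =
   (fun t x => - complex.Re (g t x) - - complex.Re (h t x)).
  by apply/funext => t; apply/funext => x; case: (g t x) (h t x) => [? ?] [? ?] /=; ring.
have -> : (fun t x => complex.Im (g t x - h t x)%R) =
   (fun t x => complex.Im (g t x) - complex.Im (h t x)).
  by apply/funext => t; apply/funext => x; case: (g t x) (h t x) => [? ?] [].
rewrite !xintB//; try exact: wave_cont; try exact: schwartzN.
by ring.
Qed.

Lemma FTreB (A B A' B' : R -> R) tau : itg setT A -> itg setT B ->
  itg setT A' -> itg setT B' ->
  FTre (fun s => A s - A' s) (fun s => B s - B' s) tau = FTre A B tau - FTre A' B' tau.
Proof.
move=> iA iB iA' iB'; rewrite /FTre -RintegralB//; [|exact: itg_FTre..].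
by apply: eq_Rintegral => s _; ring.
Qed.

Lemma Re_fourierB tau k : complex.Re (fourier (fun t x => (g t x - h t x)%R) tau k) =
  complex.Re (fourier g tau k) - complex.Re (fourier h tau k).
Proof.
have sgh := schwartzCB.
apply: (eqB3 (Re_fourier sgh tau k) (Re_fourier sg tau k) (Re_fourier sh tau k)).
rewrite -mulrBr; congr (_ * _).
apply: etrans (FTreB tau (itg_Gre sg k) (itg_Gim sg k) (itg_Gre sh k) (itg_Gim sh k)).
by congr (FTre _ _ tau); apply/funext => s; [exact: GreB|exact: GimB].
Qed.

Lemma Im_fourierB tau k : complex.Im (fourier (fun t x => (g t x - h t x)%R) tau k) =
  complex.Im (fourier g tau k) - complex.Im (fourier h tau k).
Proof.
have sgh := schwartzCB.
have iN (u : R -> R -> R[i]) (su : schwartzC u) := itgN measurableT (itg_Gre su k).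
apply: (eqB3 (Im_fourier sgh tau k) (Im_fourier sg tau k) (Im_fourier sh tau k)).
rewrite -mulrBr; congr (_ * _).
rewrite !FTimE.
apply: etrans (FTreB tau (itg_Gim sg k) (iN _ sg) (itg_Gim sh k) (iN _ sh)).
congr (FTre _ _ tau); apply/funext => s; first exact: GimB.
by rewrite GreB; ring.
Qed.

Lemma en_quasi tau k (eta : R) : 0 < eta ->
  en g tau k <= (1 + eta) * en h tau k +
    (1 + eta^-1) * en (fun t x => (g t x - h t x)%R) tau k.
Proof.
move=> eta0.
exact: (sqrD_quasi eta0 (Re_fourierB tau k) (Im_fourierB tau k)).
Qed.

End Diff.

Section Weighted.
Variables (j : nat) (s b : R).

Definition weight (k : int) (tau : R) : R :=
  bracket k%:~R `^ (2 * s) * bracket (tau - k%:~R ^+ (2 * j).+1) `^ (2 * b).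

Lemma weight_ge0 k tau : 0 <= weight k tau.
Proof. by rewrite mulr_ge0// powR_ge0. Qed.

Lemma measurable_weight k : measurable_fun setT (weight k).
Proof.
apply: measurable_funM; first exact: measurable_cst.
apply: (measurableT_comp (measurable_powR (2 * b))).
apply: continuous_measurable_fun => tau.
apply: (@continuous_comp _ _ _ (fun t : R => t - k%:~R ^+ (2 * j).+1) bracket).
  by apply: cvgB; [exact: cvg_id|exact: cvg_cst].
apply: (@continuous_comp _ _ _ (fun y : R => 1 + y ^+ 2) Num.sqrt); last exact: sqrt_continuous.
by apply: cvgD; [exact: cvg_cst|exact: exprn_continuous].
Qed.

Definition Xterm (g : R -> R -> R[i]) (k : int) : \bar R :=
  (\int[mu]_tau (weight k tau * en g tau k)%:E)%E.

Definition Xsq (g : R -> R -> R[i]) : \bar R := (\esum_(k in [set: int]) Xterm g k)%E.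

Lemma Xterm_ge0 g k : (0 <= Xterm g k)%E.
Proof.
by apply: integral_ge0 => tau _; rewrite lee_fin mulr_ge0// ?weight_ge0// en_ge0.
Qed.

Lemma Xsq_ge0 g : (0 <= Xsq g)%E.
Proof. by apply: esum_ge0 => k _; exact: Xterm_ge0. Qed.

Lemma XnormSE g : XnormS j s b g = sqrte ((2 * pi)^-1%:E * Xsq g).
Proof.
rewrite /XnormS; congr (sqrte (_ * _)%E); apply: eq_esum => k _.
by apply: eq_integral => tau _; rewrite normc_en.
Qed.

Lemma measurable_wen g k : schwartzC g -> measurable_fun setT (fun tau => weight k tau * en g tau k).
Proof.
move=> sg; apply: measurable_funM; first exact: measurable_weight.
by apply: continuous_measurable_fun; exact: continuous_en.
Qed.

Lemma esumZ_le (a : int -> \bar R) (c : R) : 0 <= c -> (forall k, 0 <= a k)%E ->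
  (\esum_(k in [set: int]) (c%:E * a k) <= c%:E * \esum_(k in [set: int]) a k)%E.
Proof.
move=> c0 a0; apply: ge_ereal_sup => _ [X [finX XI]] <-.
rewrite -ge0_mule_fsumr//; apply: lee_wpmul2l; first by rewrite lee_fin.
by apply: esum_ge; exists X.
Qed.

Lemma Xsq_quasi g h (eta : R) : schwartzC g -> schwartzC h -> 0 < eta ->
  (Xsq g <= (1 + eta)%:E * Xsq h +
    (1 + eta^-1)%:E * Xsq (fun t x => (g t x - h t x)%R))%E.
Proof.
move=> sg sh eta0.
have c1 : 0 <= 1 + eta by rewrite addr_ge0// ltW.
have c2 : 0 <= 1 + eta^-1 by rewrite addr_ge0// invr_ge0 ltW.
have sgh := schwartzCB sg sh.
set gh := (fun t x => (g t x - h t x)%R) in sgh *.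
apply: (@le_trans _ _ (\esum_(k in [set: int])
   ((1 + eta)%:E * Xterm h k + (1 + eta^-1)%:E * Xterm gh k))%E); last first.
  rewrite esumD => [|k _|k _]; try by rewrite mule_ge0// ?lee_fin// Xterm_ge0.
  by apply: leeD; apply: esumZ_le => // k; exact: Xterm_ge0.
apply: le_esum => k _.
have pos (u : R -> R -> R[i]) tau : (0 <= (weight k tau * en u tau k)%:E)%E.
  by rewrite lee_fin mulr_ge0// ?weight_ge0// en_ge0.
have meas (u : R -> R -> R[i]) : schwartzC u ->
    @measurable_fun _ _ (measurableTypeR R) (\bar R) setT (fun tau => (weight k tau * en u tau k)%:E).
  by move=> su; apply: measurable_EFin_comp; exact: measurable_wen.
rewrite /Xterm -!ge0_integralZl//; try (by apply: meas); try by rewrite lee_fin.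
rewrite -ge0_integralD//; last 4 first.
- by move=> tau _; rewrite mule_ge0// lee_fin.
- by apply: measurable_funeM; exact: meas.
- by move=> tau _; rewrite mule_ge0// lee_fin.
- by apply: measurable_funeM; exact: meas.
apply: ge0_le_integral => //.
- exact: meas.
- by apply: emeasurable_funD; apply: measurable_funeM; exact: meas.
- move=> tau _; rewrite -!EFinM -EFinD lee_fin.
  have K (w x y z c d : R) : 0 <= w -> x <= c * y + d * z -> w * x <= c * (w * y) + d * (w * z).
    by move=> w0 /(ler_wpM2l w0); rewrite mulrDr !(mulrCA w).
  exact: (K _ _ _ _ _ _ (weight_ge0 k tau) (en_quasi sg sh tau k eta0)).
Qed.

(** The [limn] in [Xnorm] is a genuine limit, so a strict bound on it holds, in squared form, for
    all late members of the sequence. *)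
Lemma Xapprox_limit (F : distr) (g : nat -> R -> R -> R[i]) : Xapprox j s b F g ->
  exists l, [/\ limn (fun m => XnormS j s b (g m)) = l, (0 <= l)%E &
    forall A : R, 0 < A -> (l < A%:E)%E ->
      exists N, forall m, (N <= m)%N -> ((2 * pi)^-1%:E * Xsq (g m) <= (A ^+ 2)%:E)%E].
Proof.
move=> [sg cg _].
have p0 : 0 <= (2 * pi)^-1 by rewrite invr_ge0 mulr_ge0// pi_ge0.
have [|e e0|l [xl l0 hl]] := @quasi_cauchy (fun m => (2 * pi)^-1%:E * Xsq (g m))%E.
- by move=> m; rewrite mule_ge0 ?lee_fin// Xsq_ge0.
(* The Cauchy condition bounds norms while [quasi_cauchy] asks for squared norms: hence the
   threshold $\sqrt e$. *)
- have se0 : 0 < Num.sqrt e by rewrite sqrtr_gt0.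
  have [N hN] := cg _ se0; exists N => m p mN pN eta eta0.
  have c2 : 0 <= 1 + eta^-1 by rewrite addr_ge0// invr_ge0 ltW.
  have d1 : ((2 * pi)^-1%:E * Xsq (fun t x => (g m t x - g p t x)%R) <= e%:E)%E.
    have := hN m p mN pN; rewrite XnormSE => /ltW.
    have -> : (Num.sqrt e)%:E = sqrte e%:E by [].
    by rewrite lee_sqrt// lee_fin ltW.
  apply: (@le_trans _ _ ((2 * pi)^-1%:E * ((1 + eta)%:E * Xsq (g p) +
    (1 + eta^-1)%:E * Xsq (fun t x => (g m t x - g p t x)%R)))%E).
    by apply: lee_wpmul2l; rewrite ?lee_fin//; exact: Xsq_quasi.
  rewrite ge0_muleDr; last 2 first.
  - by rewrite mule_ge0 ?Xsq_ge0// lee_fin addr_ge0// ltW.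
  - by rewrite mule_ge0 ?Xsq_ge0// lee_fin.
  apply: leeD; first by rewrite muleCA.
  by rewrite muleCA EFinM; apply: lee_wpmul2l.
exists l; split => //; apply/cvg_lim => //.
by under eq_fun do rewrite XnormSE.
Qed.

Lemma XTnorm_ge0 T d : (0 <= XTnorm j s b T d)%E.
Proof.
apply: le_ereal_inf_tmp => _ [F _ <-].
apply: le_ereal_inf_tmp => _ [g hg <-].
by have [l [-> ]] := Xapprox_limit hg.
Qed.

(** Unwinds both infima and drops the first terms of the sequence. Apart from nonnegativity this is
    all that is used about the $X_T$ norms: a strict bound provides Schwartz functions of uniformly
    bounded energy converging to [d] on tests in $(0,T)$. The factor $2\pi$ undoes the normalisation
    of the norm. *)
Lemma XT_approx (T A : R) d : 0 < A -> (XTnorm j s b T d < A%:E)%E ->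
  exists g : nat -> R -> R -> R[i], [/\ forall m, schwartzC (g m),
    forall m, (Xsq (g m) <= (2 * pi * A ^+ 2)%:E)%E &
    forall psi, test_function T psi -> schwartz psi ->
      complex.Re (distr_of (g m) psi) @[m --> \oo] --> complex.Re (d psi) /\
      complex.Im (distr_of (g m) psi) @[m --> \oo] --> complex.Im (d psi)].
Proof.
move=> A0 /ereal_inf_lt[_ [F [_ eqF] <-]] /ereal_inf_lt[_ [g hg <-]].
have [l [-> _ hl]] := Xapprox_limit hg => lA.
have [N hN] := hl A A0 lA.
case: hg => sg _ wg.
exists (fun m => g (m + N)%N); split.
- by move=> m; exact: sg.
- move=> m; have := hN (m + N)%N (leq_addl _ _).
  have p0 : 0 < 2 * pi by rewrite mulr_gt0// pi_gt0.
  rewrite muleC lee_pdivrMr//; first by rewrite -EFinM mulrC.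
- move=> psi tpsi spsi; rewrite -(eqF psi tpsi).
  have [h1 h2] := wg psi spsi.
  split.
    by rewrite -(cvg_shiftn N) in h1.
  by rewrite -(cvg_shiftn N) in h2.
Qed.

End Weighted.
End Norms.

(** * The bilinear estimate *)

Section Bilinear.
Context {R : realType}.
Local Notation mu := (@lebesgue_measure R).
Local Notation pi := (@pi R).

Lemma Rint_lin (D : set R) (x y : R) (f g : R -> R) : measurable D -> itg D f -> itg D g ->
  \int[mu]_(t in D) (x * f t + y * g t) =
  x * \int[mu]_(t in D) f t + y * \int[mu]_(t in D) g t.
Proof.
move=> mD itf ig; rewrite RintegralD//; try exact: itgZl.
by rewrite !RintegralZl.
Qed.

Lemma measurable_pr1 (f : R -> R) : measurable_fun setT f ->
  measurable_fun setT (fun p : R * R => f p.1).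
Proof. by move=> mf; exact: (measurableT_comp mf measurable_fst). Qed.

Lemma measurable_pr2 (f : R -> R) : measurable_fun setT f ->
  measurable_fun setT (fun p : R * R => f p.2).
Proof. by move=> mf; exact: (measurableT_comp mf measurable_snd). Qed.

Lemma measurable_prM (f : R -> R) : measurable_fun setT f ->
  measurable_fun setT (fun p : R * R => f (p.1 * p.2)).
Proof.
move=> mf; apply: (measurableT_comp mf).
by apply: measurable_funM; [exact: measurable_fst|exact: measurable_snd].
Qed.

Lemma measurable_prB (f : R -> R) : measurable_fun setT f ->
  measurable_fun setT (fun p : R * R => f (p.1 - p.2)).
Proof.
move=> mf; apply: (measurableT_comp mf).
by apply: measurable_funB; [exact: measurable_fst|exact: measurable_snd].
Qed.

Lemma measurable_section_ge0 (B : set R) (h : R -> R -> R) : measurable B ->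
  measurable_fun setT (fun p : R * R => h p.1 p.2) -> (forall t x, 0 <= h t x) ->
  measurable_fun setT (fun t => \int[mu]_(x in B) (h t x)%:E)%E.
Proof.
move=> mB mh h0; pose f (p : R * R) := (h p.1 p.2 * \1_B p.2)%:E.
have mf : measurable_fun setT f.
  apply/measurable_EFinP; apply: measurable_funM; first exact: mh.
  exact: (measurableT_comp (measurable_indic mB) measurable_snd).
have f0 p : (0 <= f p)%E by rewrite lee_fin mulr_ge0.
have := @measurable_fun_fubini_tonelli_F _ _ _ _ _ mu f mf f0.
congr (measurable_fun _ _); apply/funext => t; rewrite /fubini_F [RHS]integral_mkcond.
apply: eq_integral => x _; rewrite patchE /f /= indicE.
by case: (x \in B); rewrite ?mulr1// mulr0.
Qed.

(** The integral is [fine] of a difference of two measurable extended functions, so measurability in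
    [t] holds even where the section is not integrable. *)
Lemma measurable_section (B : set R) (h : R -> R -> R) : measurable B ->
  measurable_fun setT (fun p : R * R => h p.1 p.2) ->
  measurable_fun setT (fun t => \int[mu]_(x in B) h t x).
Proof.
move=> mB mh.
have E t : (\int[mu]_(x in B) (h t x)%:E = \int[mu]_(x in B) (Num.max (h t x) 0)%:E -
    \int[mu]_(x in B) (Num.max (- h t x) 0)%:E)%E.
  rewrite integralE; congr (_ - _)%E; apply: eq_integral => x _.
    by rewrite funeposE EFin_max.
  by rewrite funenegE EFin_max EFinN.
have -> : (fun t => \int[mu]_(x in B) h t x) = fine \o (fun t => \int[mu]_(x in B) (Num.max (h t x) 0)%:E -
    \int[mu]_(x in B) (Num.max (- h t x) 0)%:E)%E.
  by apply/funext => t; rewrite /Rintegral E.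
apply: measurableT_comp => //; apply: emeasurable_funB.
- apply: measurable_section_ge0 => //; last by move=> t x; rewrite le_max lexx orbT.
  exact: measurable_maxr.
- apply: (@measurable_section_ge0 B (fun t x => Num.max (- h t x) 0)) => //.
    by apply: measurable_maxr => //; exact: measurableT_comp.
  by move=> t x; rewrite le_max lexx orbT.
Qed.

Lemma itv_bounded (f : R -> R) (a c : R) : a <= c -> continuous f ->
  exists2 M, 0 <= M & forall t, `]a, c[%classic t -> `|f t| <= M.
Proof.
move=> ac cf; have cn : {within `[a, c], continuous (fun x => `|f x|)}.
  by apply: continuous_subspaceT => x; apply: cvg_norm; exact: cf.
have [z _ hz] := EVT_max ac cn; exists `|f z| => // t /= tac; apply: hz.
by move: tac; rewrite !in_itv /= => /andP[/ltW-> /ltW->].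
Qed.

Local Notation w x := ((1 + x ^+ 2)^-1 : R).

Lemma oneDsqr_gt0 (x : R) : 0 < 1 + x ^+ 2.
Proof. by rewrite ltr_pwDl// sqr_ge0. Qed.

Lemma w_ge0 (x : R) : 0 <= w x.
Proof. by rewrite invr_ge0 ltW// oneDsqr_gt0. Qed.

Lemma w_le1 (x : R) : w x <= 1.
Proof. by rewrite invf_le1 ?oneDsqr_gt0// lerDl sqr_ge0. Qed.

Lemma continuous_w : continuous (fun x : R => w x).
Proof. exact: continuous_oneDsqrV. Qed.

Lemma itg_w_shift (t : R) : itg setT (fun x => w (t - x)).
Proof.
apply: (@itg_le _ _ (fun x => (2 * (1 + t ^+ 2)) * w x)) => //; last first.
- by apply: itgZl => //; exact: itg_oneDsqrV.
- move=> x _; rewrite ger0_norm ?w_ge0// ler_pdivlMr ?oneDsqr_gt0//.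
  rewrite mulrC ler_pdivrMr ?oneDsqr_gt0//.
  have h1 := sqr_ge0 (t * (t - x)); have h2 := sqr_ge0 (2 * t - x).
  have -> : 2 * (1 + t ^+ 2) * (1 + (t - x) ^+ 2) =
    1 + x ^+ 2 + (1 + 2 * (t * (t - x)) ^+ 2 + (2 * t - x) ^+ 2) by ring.
  lra.
- apply: continuous_measurable_fun => x.
  apply: (@continuous_comp _ _ _ (fun x : R => t - x) (fun x => w x)).
    by apply: cvgB; [exact: cvg_cst|exact: cvg_id].
  exact: continuous_w.
Qed.

Lemma int_w_shift (t : R) : \int[mu]_x w (t - x) <= pi.
Proof.
have h := cvg_int_line (itg_w_shift t).
rewrite -(cvg_lim _ h)//; apply: limr_le; first by apply/cvg_ex; exists (\int[mu]_x w (t - x)).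
by apply: nearW => n; apply: int_oneDsqrV_shift; have := ler0n R n; lra.
Qed.

(** [|F|] is split into [F1], at most $w(x-y)p(x)$, and [F2], at most $w(x-y)q(y)$. Each is
    integrated first in the variable that occurs in [w] only, where the integral is at most $\pi$.
    The majorant [a x * b y] justifies Fubini and leaves no trace in the bound. *)
Lemma schur (F : R -> R -> R) (a b p q : R -> R) :
  measurable_fun setT (fun z : R * R => F z.1 z.2) -> itg setT a -> itg setT b ->
  (forall x y, `|F x y| <= a x * b y) ->
  (forall x, 0 <= p x) -> (forall x, 0 <= q x) -> itg setT p -> itg setT q ->
  (forall x y, `|F x y| <= w (x - y) * (p x + q y)) ->
  `|\int[mu]_x \int[mu]_y F x y| <= pi * (\int[mu]_x p x + \int[mu]_x q x).
Proof.
move=> mF ia ib Fab p0 q0 ip iq Fpq.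
have mw : measurable_fun setT (fun x : R => w x).
  by apply: continuous_measurable_fun; exact: continuous_w.
pose F1 x y := Num.min `|F x y| (w (x - y) * p x).
pose F2 x y := `|F x y| - F1 x y.
have wp0 x y : 0 <= w (x - y) * p x by rewrite mulr_ge0 ?w_ge0.
have F1le x y : F1 x y <= `|F x y| by rewrite ge_min lexx.
have F1p x y : F1 x y <= w (x - y) * p x by rewrite ge_min lexx orbT.
have F10 x y : 0 <= F1 x y by rewrite le_min normr_ge0 wp0.
have F20 x y : 0 <= F2 x y by rewrite subr_ge0.
have F2le x y : F2 x y <= `|F x y| by rewrite lerBlDr lerDl.
have F2q x y : F2 x y <= w (x - y) * q y.
  rewrite /F2 /F1; have h := Fpq x y; rewrite mulrDr in h.
  have h0 : 0 <= w (x - y) * q y by rewrite mulr_ge0 ?w_ge0.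
  by case: (leP `|F x y| (w (x - y) * p x)) => _; lra.
have mnF : measurable_fun setT (fun z : R * R => `|F z.1 z.2|) by exact: measurableT_comp.
have mF1 : measurable_fun setT (fun z : R * R => F1 z.1 z.2).
  apply: measurable_minr => //; apply: measurable_funM; first exact: (measurable_prB mw).
  by apply: measurable_pr1; exact: itg_measurable.
have mF2 : measurable_fun setT (fun z : R * R => F2 z.1 z.2) by exact: measurable_funB.
have dF1 x y : setT x -> setT y -> `|F1 x y| <= a x * b y.
  by move=> _ _; rewrite ger0_norm// (le_trans (F1le x y)).
have dF2 x y : setT x -> setT y -> `|F2 x y| <= a x * b y.
  by move=> _ _; rewrite ger0_norm// (le_trans (F2le x y)).
have dF x y : setT x -> setT y -> `|F x y| <= a x * b y by [].
have mT := @measurableT _ R.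
have i1 := itg_fubini mT mT mF1 ia ib dF1.
have i2 := itg_fubini mT mT mF2 ia ib dF2.
have i3 := itg_fubini mT mT mF ia ib dF.
have s1 x : itg setT (F1 x) := itg_section1 mT mF1 ib dF1 (I : setT x).
have s2 x : itg setT (F2 x) := itg_section1 mT mF2 ib dF2 (I : setT x).
have s2' y : itg setT (F2 ^~ y) := itg_section2 mT mF2 ia dF2 (I : setT y).
have s3 x : itg setT (F x) := itg_section1 mT mF ib dF (I : setT x).
apply: (@le_trans _ _ (\int[mu]_x (\int[mu]_y F1 x y + \int[mu]_y F2 x y))).
  apply: Rint_bound => //; [exact: itg_measurable|exact: itgD|] => x _.
  rewrite -RintegralD//; apply: Rint_bound => //; [exact: itg_measurable|exact: itgD|].
  by move=> y _; rewrite /F2 addrC subrK.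
rewrite RintegralD// (Rfubini mT mT mF2 ia ib dF2) mulrDr; apply: lerD.
- rewrite -RintegralZl//; apply: le_Rintegral => //; first exact: itgZl.
  move=> x _; apply: (@le_trans _ _ (p x * \int[mu]_y w (x - y))).
    rewrite -RintegralZl//; last exact: itg_w_shift.
    apply: le_Rintegral => //; first by apply: itgZl => //; exact: itg_w_shift.
    by move=> y _; rewrite mulrC.
  by rewrite mulrC ler_wpM2r// int_w_shift.
- have i2' : itg setT (fun y => \int[mu]_x F2 x y).
    apply: (@itg_fubini _ setT setT (fun y x => F2 x y) b a) => //.
      have h : measurable_fun setT (fun z : R * R => (z.2, z.1)) by exact: measurable_swap.
      exact: (measurableT_comp (f := fun z => F2 z.1 z.2) mF2 h).
    by move=> y x _ _; rewrite mulrC dF2.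
  rewrite -RintegralZl//; apply: le_Rintegral => //; first exact: itgZl.
  move=> y _; apply: (@le_trans _ _ (q y * \int[mu]_x w (y - x))).
    rewrite -RintegralZl//; last exact: itg_w_shift.
    apply: le_Rintegral => //; first by apply: itgZl => //; exact: itg_w_shift.
    by move=> x _; rewrite mulrC -(sqrrN (y - x)) opprB.
  by rewrite mulrC ler_wpM2r// int_w_shift.
Qed.

(** Real part of $e^{it\tau}(A+iB)$; replacing [A], [B] by [B], [- A] gives the imaginary part. *)
Definition oscR (A B : R -> R) (t tau : R) := cos (t * tau) * A tau - sin (t * tau) * B tau.
Definition osc (A B : R -> R) (t : R) := \int[mu]_tau oscR A B t tau.

Lemma oscR_le A B t tau : `|oscR A B t tau| <= `|A tau| + `|B tau|.
Proof.
rewrite /oscR (le_trans (ler_normB _ _))// !normrM lerD// ler_piMl ?normr_ge0//.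
  exact: cos_max.
exact: sin_max.
Qed.

Lemma continuous_oscR A B tau : continuous (fun t => oscR A B t tau).
Proof.
move=> t; apply: cvgB; apply: cvgM; try exact: cvg_cst.
  exact: continuous_cosr.
exact: continuous_sinr.
Qed.

Section Step.
Variables (A B : R -> R).
Hypotheses (iA : itg setT A) (iB : itg setT B).

Lemma measurable_oscR : measurable_fun setT (fun p : R * R => oscR A B p.1 p.2).
Proof.
apply: measurable_funB; apply: measurable_funM.
- by apply: measurable_prM; apply: continuous_measurable_fun; exact: continuous_cos.
- by apply: measurable_pr2; exact: itg_measurable.
- by apply: measurable_prM; apply: continuous_measurable_fun; exact: continuous_sin.
- by apply: measurable_pr2; exact: itg_measurable.
Qed.

Let iAB : itg setT (fun x => `|A x| + `|B x|).
Proof. by apply: itgD => //; exact: itg_norm. Qed.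

Lemma itg_oscR t : itg setT (oscR A B t).
Proof.
apply: (@itg_le _ _ (fun x => `|A x| + `|B x|)) => //.
  by apply: (measurableT_comp (g := fun y => (t, y)) measurable_oscR); exact: pair1_measurable.
by move=> x _; exact: oscR_le.
Qed.

Lemma continuous_osc : continuous (osc A B).
Proof.
apply: (@continuous_param _ _ _ (fun x => `|A x| + `|B x|)) => //.
- by move=> t; apply: itg_measurable; exact: itg_oscR.
- by move=> tau; exact: continuous_oscR.
- by move=> t tau _; exact: oscR_le.
Qed.
End Step.

Lemma osc_swap (A B A' B' psi1 psi2 : R -> R) (a c : R) :
  itg setT A -> itg setT B -> itg setT A' -> itg setT B' ->
  continuous psi1 -> continuous psi2 ->
  \int[mu]_(t in `[a, c]) (psi1 t * osc A B t + psi2 t * osc A' B' t) =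
  \int[mu]_tau \int[mu]_(t in `[a, c]) (psi1 t * oscR A B t tau + psi2 t * oscR A' B' t tau).
Proof.
move=> iA iB iA' iB' c1 c2.
transitivity (\int[mu]_(t in `[a, c]) \int[mu]_tau
    (psi1 t * oscR A B t tau + psi2 t * oscR A' B' t tau)).
  by apply: eq_Rintegral => t _; rewrite Rint_lin//; exact: itg_oscR.
apply: (@Rfubini _ `[a, c] setT (fun t tau => psi1 t * oscR A B t tau + psi2 t * oscR A' B' t tau)
  (fun t => `|psi1 t| + `|psi2 t|) (fun x => (`|A x| + `|B x|) + (`|A' x| + `|B' x|))) => //.
- apply: measurable_funD; apply: measurable_funM; try exact: measurable_oscR;
    by apply: measurable_pr1; exact: continuous_measurable_fun.
- by apply: itgD => //; apply: itg_norm => //; exact: itg_cont.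
- by apply: itgD => //; apply: itgD => //; exact: itg_norm.
- move=> t tau _ _; rewrite (le_trans (ler_normD _ _))// !normrM mulrDl.
  rewrite lerD// ler_wpM2l// (le_trans (oscR_le _ _ _ _))//.
    by rewrite lerDl addr_ge0.
  by rewrite lerDr addr_ge0.
Qed.

Section Pair.
Variables (a c K : R) (psi : R -> R).
Hypotheses (cpsi : continuous psi)
  (hK : forall x p, `|\int[mu]_(t in `[a, c]) (psi t * cos (x * t + p))| * (1 + x ^+ 2) ^+ 2 <= K).

Let Psi p x := \int[mu]_(t in `[a, c]) (psi t * cos (x * t + p)).

Let cpc p x : continuous (fun t => psi t * cos (x * t + p)).
Proof.
move=> t; apply: cvgM; first exact: cpsi.
exact: continuous_cos_affine.
Qed.

Let cPsi p : continuous (Psi p).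
Proof.
apply: (@continuous_param _ _ _ (fun t => `|psi t|)) => //.
- by move=> x; apply: measurable_cont => //; exact: cpc.
- move=> t x; apply: cvgM; first exact: cvg_cst.
  under eq_fun do rewrite mulrC.
  by rewrite mulrC; exact: continuous_cos_affine.
- by apply: itg_norm => //; exact: itg_cont.
- by move=> x t _; rewrite normrM ler_piMr// cos_max.
Qed.

Let PsiK p x : `|Psi p x| <= K * w x ^+ 2.
Proof. by rewrite exprVn ler_pdivlMr ?hK// exprn_gt0// oneDsqr_gt0. Qed.

Let K0 : 0 <= K.
Proof. by apply: le_trans (hK 0 0); rewrite mulr_ge0// exprn_ge0// ltW// oneDsqr_gt0. Qed.

(** The left side is $\int\psi\,\mathrm{Re}(Z\overline{Z'})$ for the inverse transforms of $A+iB$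
    and $A'+iB'$. Exchanging integrals gives a double integral whose kernel is a transform of [psi]
    at $x-y$, at most $K\,w(x-y)^2$. One factor [w] is traded for [D * (P x * Q y)], the other feeds
    the Schur test, and [eta] distributes the product between the two energies. *)
Lemma bilinear_bound (A B A' B' P Q : R -> R) (D eta : R) :
  itg setT A -> itg setT B -> itg setT A' -> itg setT B' ->
  (forall x, 0 <= P x) -> (forall x, 0 <= Q x) -> 0 < eta -> 0 <= D ->
  (forall x y, w (x - y) <= D * (P x * Q y)) ->
  itg setT (fun x => P x ^+ 2 * (A x ^+ 2 + B x ^+ 2)) ->
  itg setT (fun x => Q x ^+ 2 * (A' x ^+ 2 + B' x ^+ 2)) ->
  `|\int[mu]_(t in `[a, c]) (psi t * (osc A B t * osc A' B' t
      + osc B (fun x => - A x) t * osc B' (fun x => - A' x) t))| <=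
  K * D * pi * (eta * \int[mu]_x (P x ^+ 2 * (A x ^+ 2 + B x ^+ 2))
               + eta^-1 * \int[mu]_x (Q x ^+ 2 * (A' x ^+ 2 + B' x ^+ 2))).
Proof.
move=> iA iB iA' iB' P0 Q0 eta0 D0 wPQ ip iq.
have iNA := itgN measurableT iA; have iNA' := itgN measurableT iA'.
(* The real part of the product $Z\overline{Z'}$ in Fourier variables meets the cosine transform of
   [psi], the cross terms meet the sine transform. *)
pose F x y := (A x * A' y + B x * B' y) * Psi 0 (x - y) +
   (A x * B' y - B x * A' y) * Psi (- (pi / 2)) (x - y).
have -> : \int[mu]_(t in `[a, c]) (psi t * (osc A B t * osc A' B' t
      + osc B (fun x => - A x) t * osc B' (fun x => - A' x) t)) =
   \int[mu]_x \int[mu]_y F x y.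
  transitivity (\int[mu]_(t in `[a, c]) ((psi t * osc A' B' t) * osc A B t +
      (psi t * osc B' (fun x => - A' x) t) * osc B (fun x => - A x) t)).
    by apply: eq_Rintegral => t _; ring.
  rewrite osc_swap//; last 2 first.
  - by move=> t; apply: cvgM; [exact: cpsi|exact: continuous_osc].
  - by move=> t; apply: cvgM; [exact: cpsi|exact: continuous_osc].
  apply: eq_Rintegral => x _.
  transitivity (\int[mu]_(t in `[a, c]) ((psi t * oscR A B t x) * osc A' B' t +
      (psi t * oscR B (fun x => - A x) t x) * osc B' (fun x => - A' x) t)).
    by apply: eq_Rintegral => t _; ring.
  rewrite osc_swap//; last 2 first.
  - by move=> t; apply: cvgM; [exact: cpsi|exact: continuous_oscR].
  - by move=> t; apply: cvgM; [exact: cpsi|exact: continuous_oscR].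
  apply: eq_Rintegral => y _.
  rewrite /F /Psi -Rint_lin//; try by apply: itg_cont; exact: cpc.
  apply: eq_Rintegral => t _; rewrite addr0 cosBpihalf.
  have -> : (x - y) * t = t * x - t * y by ring.
  rewrite cosB sinB /oscR; ring.
have mPsi p : measurable_fun setT (Psi p) by exact: continuous_measurable_fun.
have mA := itg_measurable iA; have mB := itg_measurable iB.
have mA' := itg_measurable iA'; have mB' := itg_measurable iB'.
have KD0 : 0 <= K * D by exact: mulr_ge0.
have amgm (x y : R) : 2 * `|x * y| <= eta * x ^+ 2 + eta^-1 * y ^+ 2.
  have e0 : eta != 0 by rewrite gt_eqF.
  have h (z : R) : 0 <= eta * x ^+ 2 + eta^-1 * z ^+ 2 - 2 * (x * z).
    have -> : eta * x ^+ 2 + eta^-1 * z ^+ 2 - 2 * (x * z) = eta * (x - eta^-1 * z) ^+ 2.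
      by field.
    by rewrite mulr_ge0 ?sqr_ge0// ltW.
  have h1 := h y; have h2 := h (- y); rewrite sqrrN mulrN in h2.
  by case: (ger0P (x * y)) => _; lra.
have bnd x y : `|F x y| <= K * w (x - y) ^+ 2 *
    (`|A x * A' y| + `|B x * B' y| + `|A x * B' y| + `|B x * A' y|).
  rewrite /F (le_trans (ler_normD _ _))// -[X in _ <= _ * X]addrA mulrDr; apply: lerD.
    by rewrite normrM mulrC; apply: ler_pM => //; exact: ler_normD.
  by rewrite normrM mulrC; apply: ler_pM => //; exact: ler_normB.
rewrite [leRHS](_ : _ =
  pi * (\int[mu]_x ((K * D * eta) * (P x ^+ 2 * (A x ^+ 2 + B x ^+ 2))) +
        \int[mu]_x ((K * D * eta^-1) * (Q x ^+ 2 * (A' x ^+ 2 + B' x ^+ 2))))); last first.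
  by rewrite !RintegralZl//; ring.
apply: (@schur F (fun x => K * (`|A x| + `|B x|)) (fun x => `|A' x| + `|B' x|)).
- apply: measurable_funD; apply: measurable_funM; try exact: measurable_prB.
    apply: measurable_funD; apply: measurable_funM;
      by [exact: measurable_pr1|exact: measurable_pr2].
  apply: measurable_funB; apply: measurable_funM;
    by [exact: measurable_pr1|exact: measurable_pr2].
- by apply: itgZl => //; apply: itgD => //; exact: itg_norm.
- by apply: itgD => //; exact: itg_norm.
- move=> x y; apply: (le_trans (bnd x y)); rewrite -mulrA -[leRHS]mulrA ler_wpM2l//.
  rewrite !normrM; apply: (@le_trans _ _ (1 * ((`|A x| + `|B x|) * (`|A' y| + `|B' y|)))).
    apply: ler_pM; rewrite ?exprn_ge0 ?w_ge0 ?addr_ge0 ?mulr_ge0//.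
      by rewrite exprn_ile1 ?w_ge0 ?w_le1.
    rewrite le_eqVlt; apply/orP; left; apply/eqP; ring.
  by rewrite mul1r.
- by move=> x; apply: mulr_ge0; [rewrite mulr_ge0 ?invr_ge0// ltW | apply: mulr_ge0; rewrite ?addr_ge0 ?sqr_ge0].
- by move=> x; apply: mulr_ge0; [rewrite mulr_ge0 ?invr_ge0// ltW | apply: mulr_ge0; rewrite ?addr_ge0 ?sqr_ge0].
- exact: itgZl.
- exact: itgZl.
- move=> x y; apply: (le_trans (bnd x y)).
  set S := (X in _ * X <= _).
  have S0 : 0 <= S by rewrite !addr_ge0.
  apply: (@le_trans _ _ (K * (w (x - y) * (D * (P x * Q y))) * S)).
    rewrite ler_wpM2r// ler_wpM2l// expr2 ler_wpM2l ?w_ge0//.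
  have PQ0 : 0 <= P x * Q y by rewrite mulr_ge0.
  have e1 (u v : R) : P x * Q y * `|u * v| = `|(P x * u) * (Q y * v)|.
    by rewrite -[P x * Q y]ger0_norm// -normrM; congr (`| _ |); ring.
  have h1 := amgm (P x * A x) (Q y * A' y); have h2 := amgm (P x * B x) (Q y * B' y).
  have h3 := amgm (P x * A x) (Q y * B' y); have h4 := amgm (P x * B x) (Q y * A' y).
  rewrite -!e1 !exprMn in h1 h2 h3 h4.
  have -> : K * (w (x - y) * (D * (P x * Q y))) * S =
    (K * D * w (x - y)) * (P x * Q y * S) by ring.
  have -> : w (x - y) * (K * D * eta * (P x ^+ 2 * (A x ^+ 2 + B x ^+ 2)) +
      K * D * eta^-1 * (Q y ^+ 2 * (A' y ^+ 2 + B' y ^+ 2))) =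
    (K * D * w (x - y)) * (eta * (P x ^+ 2 * (A x ^+ 2 + B x ^+ 2)) +
     eta^-1 * (Q y ^+ 2 * (A' y ^+ 2 + B' y ^+ 2))) by ring.
  rewrite ler_wpM2l ?mulr_ge0 ?w_ge0// /S !(mulrDr (P x * Q y)).
  rewrite !(mulrDr (P x ^+ 2)) !(mulrDr (Q y ^+ 2)) (mulrDr eta) (mulrDr eta^-1).
  lra.
Qed.
End Pair.
End Bilinear.

(** * Gaps of the dispersion relation *)

Section Dispersion.

(** If $x<y$ then $y^{2j+1}-x^{2j+1}\ge(y-x)\,y^{2j}\ge y^{2j}$. This settles the larger of the two
    numbers, hence also the smaller. *)
Lemma nat_pow_gap (j a b : nat) : (1 <= j)%N -> a <> b ->
  (b%:Z ^+ (2 * j) <= `|a%:Z ^+ (2 * j).+1 - b%:Z ^+ (2 * j).+1|)%R.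
Proof.
move=> j1 ab.
have hP (x y : nat) : (x < y)%N ->
    (y%:Z ^+ (2 * j) <= y%:Z ^+ (2 * j).+1 - x%:Z ^+ (2 * j).+1)%R.
  move=> xy; rewrite !exprS.
  have h1 : (x%:Z ^+ (2 * j) <= y%:Z ^+ (2 * j))%R by rewrite lerXn2r// lez_nat ltnW.
  have h2 : (0 <= x%:Z ^+ (2 * j))%R by rewrite exprn_ge0.
  have h3 : (x%:Z + 1 <= y%:Z)%R by lia.
  nia.
have [xy|yx|//] := ltngtP a b.
  by rewrite distrC (le_trans (hP _ _ xy))// ler_norm.
apply: le_trans (ler_norm _); apply: le_trans (hP _ _ yx).
by rewrite lerXn2r// lez_nat ltnW.
Qed.

(** Equal signs reduce to natural numbers. For opposite signs the odd powers add up in absolute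
    value, and $b^{2j+1}\ge b^{2j}$ for an integer $b\ge1$. *)
Lemma int_pow_gap (j : nat) (k m : int) : (1 <= j)%N -> k != m ->
  (m ^+ (2 * j) <= `|k ^+ (2 * j).+1 - m ^+ (2 * j).+1|)%R.
Proof.
move=> j1 km.
have oN (x : int) : ((- x) ^+ (2 * j).+1 = - x ^+ (2 * j).+1)%R.
  by rewrite exprNn -signr_odd /= mul2n odd_double expr1 mulN1r.
have eN (x : int) : ((- x) ^+ (2 * j) = x ^+ (2 * j))%R.
  by rewrite exprNn -signr_odd mul2n odd_double expr0 mul1r.
have opp (a b : nat) : (b%:Z ^+ (2 * j) <= a%:Z ^+ (2 * j).+1 + b%:Z ^+ (2 * j).+1)%R.
  have h : (0 <= a%:Z ^+ (2 * j).+1)%R by rewrite exprn_ge0.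
  case: b => [|b]; first by rewrite expr0n muln_eq0 (gtn_eqF j1) addr_ge0// exprn_ge0.
  apply: (@le_trans _ _ (b.+1%:Z ^+ (2 * j).+1)%R); last by rewrite lerDr.
  by rewrite exprS ler_peMl ?exprn_ge0.
case: (intP k) km => [|a|a]; case: (intP m) => [|b|b] km.
- by rewrite eqxx in km.
- by apply: (@nat_pow_gap j 0 b.+1).
- by rewrite oN eN opprK (le_trans (opp 0%N _))// ler_norm.
- by apply: (@nat_pow_gap j a.+1 0).
- by apply: nat_pow_gap => // ab; rewrite ab eqxx in km.
- by rewrite !oN eN opprK (le_trans (opp a.+1 _))// ler_norm.
- by rewrite distrC oN opprK addrC (le_trans (opp a.+1 _))// ler_norm.
- by rewrite oN -opprD normrN (le_trans (opp a.+1 _))// ler_norm.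
- rewrite !oN eN opprK addrC distrC; apply: nat_pow_gap => // ab.
  by rewrite ab eqxx in km.
Qed.

End Dispersion.

(** * Comparison of the weights of two modes *)

Section Weights.
Context {R : realType}.
Local Notation mu := (@lebesgue_measure R).
Local Notation pi := (@pi R).

Lemma bracket_sqr (x : R) : bracket x ^+ 2 = 1 + x ^+ 2.
Proof. by rewrite /bracket sqr_sqrtr// addr_ge0// sqr_ge0. Qed.

Lemma bracket_ge1 (x : R) : 1 <= bracket x.
Proof. by rewrite /bracket -[leLHS]sqrtr1 ler_sqrt ?lerDl ?sqr_ge0// addr_ge0// sqr_ge0. Qed.

Lemma bracket_gt0 (x : R) : 0 < bracket x.
Proof. exact: lt_le_trans (bracket_ge1 x). Qed.

Lemma bracketN (x : R) : bracket (- x) = bracket x.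
Proof. by rewrite /bracket sqrrN. Qed.

Lemma bracketD (x y : R) : bracket (x + y) <= 2 * (bracket x * bracket y).
Proof.
have h z := ltW (bracket_gt0 z).
rewrite -(@ler_pXn2r _ 2%N)// ?nnegrE ?mulr_ge0// !exprMn !bracket_sqr.
have h1 := sqr_ge0 (x - y); have h2 := sqr_ge0 (x * y).
have e : (x * y) ^+ 2 = x ^+ 2 * y ^+ 2 by rewrite exprMn.
nra.
Qed.

Local Notation kap j k := ((k%:~R : R) ^+ (2 * j).+1).

(** The first bound is integrality: by [int_pow_gap] in both directions the gap vanishes only if
    $k^{2j}$ and $m^{2j}$ both do, that is if $k=m=0$. *)
Lemma dispersion_gap (j : nat) (k m : int) : (1 <= j)%N -> k != m ->
  1 <= `|kap j k - kap j m| /\ (m%:~R : R) ^+ (2 * j) <= `|kap j k - kap j m|.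
Proof.
move=> j1 km.
have E (x y : int) : `|kap j x - kap j y| = (`|x ^+ (2 * j).+1 - y ^+ (2 * j).+1|%R)%:~R.
  by rewrite intr_norm rmorphB /= !rmorphXn.
have h := int_pow_gap j1 km.
split; last by rewrite E -rmorphXn ler_int.
rewrite E -[leLHS]/(1%:~R) ler_int -gtz0_ge1 normr_gt0 subr_eq0.
apply/eqP => e.
have h2 : m ^+ (2 * j) = 0.
  apply/eqP; rewrite eq_le exprM exprn_ge0 ?sqr_ge0// andbT -exprM.
  by have := h; rewrite e subrr normr0.
have h' : k ^+ (2 * j) <= 0.
  have mk : m != k by rewrite eq_sym.
  by have := int_pow_gap j1 mk; rewrite -e subrr normr0.
have nz (x : int) : x ^+ (2 * j) <= 0 -> x = 0.
  move=> hx; have : x ^+ (2 * j) = 0.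
    by apply/eqP; rewrite eq_le hx exprM exprn_ge0// sqr_ge0.
  by move/eqP; rewrite expf_eq0 => /andP[_ /eqP].
by move: km; rewrite (nz k h') (nz m _) ?h2 ?eqxx.
Qed.

(** Let $d$ be the gap, $N=\langle m\rangle$, $X=\langle x-y\rangle$, and $p$, $S$ the brackets of
    $x-k^{2j+1}$, $y-m^{2j+1}$. Then $S\le8pXd$ and $N^{2j}\le2^jd$. Raising the first to the power
    $b$ and the second to $1-b$ produces $d^b\,d^{1-b}=d$, a single power of the gap; this is what
    fixes the exponent $-2j+2jb$. *)
Lemma weight_pair (j : nat) (b : R) (k m : int) (x y : R) : (1 <= j)%N -> k != m ->
  0 <= b -> b <= 1 ->
  (1 + (x - y) ^+ 2)^-1 <= (8 * 2 ^+ j * `|kap j k - kap j m|) *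
    (bracket (x - kap j k) `^ b *
     (bracket m%:~R `^ (- 2 * j%:R + 2 * j%:R * b) * bracket (y - kap j m) `^ (- b))).
Proof.
move=> j1 km b0 b1; have [d1 d2] := dispersion_gap j1 km.
set d := `|_| in d1 d2 *.
set S := bracket (y - kap j m); set N := bracket m%:~R; set p := bracket (x - kap j k).
set X := bracket (x - y).
have dp : 0 < d by exact: lt_le_trans d1.
have hd : bracket (kap j k - kap j m) <= 2 * d.
  rewrite -(@ler_pXn2r _ 2%N)// ?nnegrE ?(ltW (bracket_gt0 _)) ?mulr_ge0 ?(ltW dp)//.
  rewrite bracket_sqr exprMn -normrX ger0_norm ?sqr_ge0//.
  have : 1 <= d ^+ 2 by rewrite exprn_ege1.
  rewrite /d -normrX ger0_norm ?sqr_ge0//; lra.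
have S0 : 0 < S by exact: bracket_gt0.
have N0 : 0 < N by exact: bracket_gt0.
have p0 : 0 < p by exact: bracket_gt0.
have X0 : 0 < X by exact: bracket_gt0.
have X1 : 1 <= X by exact: bracket_ge1.
(* Two uses of [bracketD] and the bound of the bracket of the gap by [2 * d] contribute a factor 2
   each. *)
have hS : S <= 8 * (p * X * d).
  have -> : S = bracket ((x - kap j k) + (- (x - y) + (kap j k - kap j m))).
    by rewrite /S; congr bracket; ring.
  apply: (le_trans (bracketD _ _)).
  have -> : 8 * (p * X * d) = 2 * (p * (2 * (X * (2 * d)))) by ring.
  rewrite ler_wpM2l// ler_wpM2l ?(ltW p0)//.
  apply: (le_trans (bracketD _ _)); rewrite bracketN ler_wpM2l// ler_wpM2l ?(ltW X0)//.
(* If $m^2\ge1$ then $1+m^2\le2m^2$ and the gap dominates $m^{2j}$; otherwise $1+m^2\le2$ and the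
   gap is at least 1. *)
have hN : N ^+ (2 * j) <= 2 ^+ j * d.
  rewrite exprM bracket_sqr.
  have := d2; rewrite exprM; have := sqr_ge0 (m%:~R : R).
  move: (m%:~R ^+ 2) => z z0 zd.
  have [m1|m1] := leP 1 z.
    apply: (@le_trans _ _ ((2 * z) ^+ j)).
      by apply: lerXn2r; rewrite ?nnegrE ?addr_ge0 ?mulr_ge0//; lra.
    by rewrite exprMn ler_wpM2l// exprn_ge0.
  apply: (@le_trans _ _ (2 ^+ j * 1)); last by rewrite ler_wpM2l// exprn_ge0.
  by rewrite mulr1; apply: lerXn2r; rewrite ?nnegrE ?addr_ge0//; lra.
have hSb : S `^ b <= 8 * (p `^ b * X * d `^ b).
  apply: (@le_trans _ _ ((8 * (p * X * d)) `^ b)).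
    have B0 : 0 <= 8 * (p * X * d) by exact: le_trans (ltW S0) hS.
    by apply: ge0_ler_powR => //; rewrite ?nnegrE ?ltW.
  rewrite powRM ?mulr_ge0 ?(ltW p0) ?(ltW X0) ?(ltW dp)//.
  rewrite powRM ?mulr_ge0 ?(ltW p0) ?(ltW X0) ?(ltW dp)//.
  rewrite powRM ?(ltW p0) ?(ltW X0)//.
  apply: ler_pM; rewrite ?mulr_ge0 ?powR_ge0//.
    by rewrite -[leRHS]powRr1// ler_powR//; lra.
  rewrite ler_wpM2r ?powR_ge0// ler_wpM2l ?powR_ge0//.
  by rewrite -[leRHS]powRr1 ?(ltW X0)// ler_powR.
have hNb : N `^ (2 * j%:R - 2 * j%:R * b) <= 2 ^+ j * d `^ (1 - b).
  have -> : 2 * j%:R - 2 * j%:R * b = (2 * j)%:R * (1 - b) by rewrite natrM; ring.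
  rewrite powRrM powR_mulrn ?(ltW N0)//.
  apply: (@le_trans _ _ ((2 ^+ j * d) `^ (1 - b))).
    apply: ge0_ler_powR; rewrite ?nnegrE ?exprn_ge0 ?mulr_ge0 ?(ltW N0) ?(ltW dp) ?exprn_ge0//.
    lra.
  rewrite powRM ?exprn_ge0 ?(ltW dp)// ler_wpM2r ?powR_ge0//.
  rewrite -[leRHS]powRr1 ?exprn_ge0// ler_powR//; last by lra.
  by rewrite exprn_ege1//; lra.
have hprod : N `^ (2 * j%:R - 2 * j%:R * b) * S `^ b <= 8 * 2 ^+ j * d * (p `^ b * X).
  have -> : 8 * 2 ^+ j * d * (p `^ b * X) =
     (2 ^+ j * d `^ (1 - b)) * (8 * (p `^ b * X * d `^ b)).
    have E : d `^ (1 - b) * d `^ b = d.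
      rewrite -powRD ?subrK ?powRr1 ?(ltW dp)//.
      by apply/implyP => _; rewrite gt_eqF.
    by rewrite -[X in 8 * 2 ^+ j * X]E; ring.
  by apply: ler_pM; rewrite ?powR_ge0.
have -> : (1 + (x - y) ^+ 2)^-1 = (X ^+ 2)^-1 by rewrite bracket_sqr.
have -> : N `^ (- 2 * j%:R + 2 * j%:R * b) * S `^ (- b) =
   (N `^ (2 * j%:R - 2 * j%:R * b) * S `^ b)^-1.
  by rewrite invfM -!powRN; congr (_ `^ _ * _); ring.
have Z0 : 0 < N `^ (2 * j%:R - 2 * j%:R * b) * S `^ b by rewrite mulr_gt0// powR_gt0.
rewrite mulrA ler_pdivlMr// mulrC ler_pdivrMr ?exprn_gt0//.
apply: (le_trans hprod); rewrite -!mulrA !ler_wpM2l ?exprn_ge0 ?(ltW dp) ?powR_ge0//.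
by rewrite expr2 ler_peMl// ltW.
Qed.

Lemma powR_sqr (a u : R) : a `^ (2 * u) = (a `^ u) ^+ 2.
Proof. by rewrite -powR_mulrn ?powR_ge0// -powRrM mulrC. Qed.

Lemma weight0E (j : nat) (b : R) (k : int) (x : R) :
  weight j 0 b k x = (bracket (x - kap j k) `^ b) ^+ 2.
Proof.
by rewrite /weight mulr0 powRr0 mul1r powR_sqr.
Qed.

Lemma weight_sqr (j : nat) (s b : R) (k : int) (x : R) :
  weight j s b k x = (bracket k%:~R `^ s * bracket (x - kap j k) `^ b) ^+ 2.
Proof. by rewrite exprMn /weight !powR_sqr. Qed.

Lemma weight_gt0 (j : nat) (s b : R) (k : int) (x : R) : 0 < weight j s b k x.
Proof. by rewrite mulr_gt0// powR_gt0// bracket_gt0. Qed.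

(** As $b\ge-1$, the inverse weight is at most a constant times $\langle\tau-k^{2j+1}\rangle^2$, and
    removing the shift costs a constant depending on [k]. *)
Lemma weight_lower (j : nat) (s b : R) (k : int) : - 1 <= b -> exists C, 0 <= C /\
  forall x, (weight j s b k x)^-1 <= C * (1 + x ^+ 2).
Proof.
move=> b1.
exists (bracket k%:~R `^ (- (2 * s)) * (4 * bracket (kap j k) ^+ 2)); split.
  by rewrite mulr_ge0 ?powR_ge0// mulr_ge0// sqr_ge0.
move=> x; rewrite /weight invfM -!powRN -!mulrA ler_wpM2l ?powR_ge0//.
apply: (@le_trans _ _ (bracket (x - kap j k) ^+ 2)).
  rewrite -powR_mulrn ?(ltW (bracket_gt0 _))// ler_powR ?bracket_ge1//; lra.
rewrite -bracket_sqr.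
apply: (@le_trans _ _ ((2 * (bracket x * bracket (kap j k))) ^+ 2)).
  apply: lerXn2r; rewrite ?nnegrE ?mulr_ge0 ?(ltW (bracket_gt0 _))//.
  by rewrite -[bracket (kap j k)]bracketN bracketD.
by rewrite le_eqVlt; apply/orP; left; apply/eqP; ring.
Qed.

End Weights.

(** * Sums over finite families of frequencies *)

Section SeqSums.
Context {R : realType}.

Lemma cvg_sum_seq (I : Type) (s : seq I) (F : I -> nat -> R) (l : I -> R) :
  (forall i, F i n @[n --> \oo] --> l i) ->
  (\sum_(i <- s) F i n) @[n --> \oo] --> \sum_(i <- s) l i.
Proof.
move=> h; elim: s => [|i s IH].
  by rewrite big_nil; under eq_fun do rewrite big_nil; exact: cvg_cst.
by rewrite big_cons; under eq_fun do rewrite big_cons; apply: cvgD.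
Qed.

Lemma count_near (s : seq int) (k : int) (L : nat) : uniq s ->
  \sum_(m <- s | (`|k - m| <= L%:Z)%R) (1 : R) <= (2 * L).+1%:R.
Proof.
move=> us; rewrite -big_filter big_const_seq count_predT iter_addr_0 ler_nat.
set t := [seq k - L%:Z + i%:Z | i <- iota 0 (2 * L).+1].
have -> : (2 * L).+1 = size t by rewrite size_map size_iota.
apply: uniq_leq_size; first exact: filter_uniq.
move=> m; rewrite mem_filter => /andP[kmL _].
apply/mapP; exists (absz (m - k + L%:Z)%R); last by lia.
by rewrite mem_iota; lia.
Qed.

(** Each frequency has at most $2L+1$ neighbours within distance [L], so a banded double sum costs
    only this factor, whatever the number of modes. *)
Lemma double_sum_near (ks : seq int) (L : nat) (F G : int -> R) : uniq ks ->
  (forall k, 0 <= F k) -> (forall k, 0 <= G k) ->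
  \sum_(k <- ks) \sum_(m <- ks | (`|k - m| <= L%:Z)%R) (F k + G m) <=
  (2 * L).+1%:R * (\sum_(k <- ks) F k + \sum_(k <- ks) G k).
Proof.
move=> us F0 G0; rewrite mulrDr.
rewrite (eq_bigr (fun k => \sum_(m <- ks | (`|k - m| <= L%:Z)%R) F k +
  \sum_(m <- ks | (`|k - m| <= L%:Z)%R) G m)) => [|k _]; last by rewrite big_split.
have H (A : int -> R) : (forall k, 0 <= A k) ->
    \sum_(k <- ks) \sum_(m <- ks | (`|k - m| <= L%:Z)%R) A k <= (2 * L).+1%:R * \sum_(k <- ks) A k.
  move=> A0; rewrite mulr_sumr; apply: ler_sum => k _.
  rewrite (eq_bigr (fun _ => A k * 1)) => [|m _]; last by rewrite mulr1.
  by rewrite -mulr_sumr mulrC ler_wpM2r// count_near.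
rewrite big_split /=; apply: lerD; first exact: H.
rewrite (exchange_big_dep xpredT)//=; apply: le_trans (H G G0).
by apply: ler_sum => k _; rewrite le_eqVlt; apply/orP; left; apply/eqP; apply: eq_bigl => m; rewrite distrC.
Qed.

Lemma sum_le_esum (a : int -> \bar R) (f : int -> R) (s : seq int) : uniq s ->
  (forall k, (f k)%:E = a k) -> (forall k, 0 <= a k)%E ->
  ((\sum_(k <- s) f k)%:E <= \esum_(k in [set: int]) a k)%E.
Proof.
move=> us fa a0; rewrite -sumEFin (eq_bigr a) => [|k _]; last exact: fa.
apply: esum_ge; exists [set` s]; first by split => //; exact: finite_seq.
by rewrite (fsbig_seq _ _ us).
Qed.

End SeqSums.

(** * Pairings of mollified modes *)

Section Modes.
Context {R : realType}.
Local Notation mu := (@lebesgue_measure R).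
Local Notation pi := (@pi R).
Local Notation kap j k := ((k%:~R : R) ^+ (2 * j).+1).
Variables (rho : R -> R) (d : R).
Hypotheses (d0 : 0 < d) (srho : smooth1 rho) (rhoeven : forall x, rho (- x) = rho x)
  (rhos : forall x, rho x != 0 -> - d <= x <= d) (rhoM : exists M, forall x, `|rho x| <= M)
  (rho0 : forall x, 0 <= rho x) (rho1 : \int[mu]_(s in `[- d, d]) rho s <= 1).
Let hat := cosT rho d.
Let chat : continuous hat. Proof. exact: continuous_cosT. Qed.

(** A nonnegative [rho] of mass at most 1 has a transform bounded by 1. Hence mollification never
    increases the weighted energies, and the bounds on pairings are independent of [rho]. *)
Lemma hat_le1 tau : `|hat tau| <= 1.
Proof.
apply: le_trans rho1; have crho := smooth1_continuous srho.
apply: Rint_bound => //; last 2 first.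
- exact: itg_cont.
- by move=> s _; rewrite normrM (ger0_norm (rho0 s)) ler_piMr// cos_max.
apply: measurable_cont => // s; apply: cvgM; first exact: crho.
exact: continuous_cosl.
Qed.

Definition hRe g k tau := hat tau * complex.Re (fourier g tau k).
Definition hIm g k tau := hat tau * complex.Im (fourier g tau k).

Lemma itg_hRe g k : schwartzC g -> itg setT (hRe g k).
Proof.
move=> sg; have [M hM] := fourier_bound sg k.
apply: (itg_hatM d0 srho rhos (M := M)); first exact: continuous_Re_fourier.
by move=> x; have [] := hM x.
Qed.

Lemma itg_hIm g k : schwartzC g -> itg setT (hIm g k).
Proof.
move=> sg; have [M hM] := fourier_bound sg k.
apply: (itg_hatM d0 srho rhos (M := M)); first exact: continuous_Im_fourier.
by move=> x; have [] := hM x.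
Qed.

Lemma moR_osc g k t : schwartzC g ->
  moR (distr_of g) (fun s => rho (t - s)) k = osc (hRe g k) (hIm g k) t.
Proof.
move=> sg; rewrite (moR_rep sg t k d0 srho rhoeven rhos rhoM).
by apply: eq_Rintegral => tau _; rewrite /oscR /hRe /hIm -/hat; ring.
Qed.

Lemma moI_osc g k t : schwartzC g ->
  moI (distr_of g) (fun s => rho (t - s)) k = osc (hIm g k) (fun tau => - hRe g k tau) t.
Proof.
move=> sg; rewrite (moI_rep sg t k d0 srho rhoeven rhos rhoM).
by apply: eq_Rintegral => tau _; rewrite /oscR /hRe /hIm -/hat; ring.
Qed.

Definition fX (j : nat) (s b : R) (g : R -> R -> R[i]) (k : int) : R :=
  \int[mu]_tau (weight j s b k tau * en g tau k).

Lemma itg_wen (j : nat) (s b : R) g k : schwartzC g -> (Xterm j s b g k < +oo)%E ->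
  itg setT (fun tau => weight j s b k tau * en g tau k).
Proof.
move=> sg h; apply/integrableP; split.
  by apply: measurable_EFin_comp; exact: measurable_wen.
rewrite (_ : integral _ _ _ = Xterm j s b g k)//; apply: eq_integral => x _.
by rewrite /= ger0_norm// mulr_ge0 ?weight_ge0 ?en_ge0.
Qed.

Lemma fXE (j : nat) (s b : R) g k : schwartzC g -> (Xterm j s b g k < +oo)%E ->
  (fX j s b g k)%:E = Xterm j s b g k.
Proof. by move=> sg h; rewrite /fX Rint_EFin//; exact: itg_wen. Qed.

Lemma hat_en g k tau : hRe g k tau ^+ 2 + hIm g k tau ^+ 2 = hat tau ^+ 2 * en g tau k.
Proof. by rewrite /hRe /hIm /en !exprMn mulrDr. Qed.

Lemma hat_sqr_le1 tau : hat tau ^+ 2 <= 1.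
Proof.
by rewrite -[hat tau ^+ 2]ger0_norm ?sqr_ge0// normrX exprn_ile1// hat_le1.
Qed.

Lemma measurable_weightV (j : nat) (s b : R) k :
  measurable_fun setT (fun tau : R => (weight j s b k tau)^-1).
Proof.
have -> : (fun tau : R => (weight j s b k tau)^-1) = weight j (- s) (- b) k.
  by apply/funext => tau; rewrite /weight invfM -!powRN !mulrN.
exact: measurable_weight.
Qed.

Lemma amgm_weight (h r i v : R) : 0 < v ->
  `|h * r| + `|h * i| <= h ^+ 2 * v^-1 + v * (r ^+ 2 + i ^+ 2).
Proof.
move=> v0; have A (x : R) : 2 * `|h * x| <= h ^+ 2 * v^-1 + v * x ^+ 2.
  have B (y : R) : 0 <= h ^+ 2 * v^-1 + v * y ^+ 2 - 2 * (h * y).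
    have -> : h ^+ 2 * v^-1 + v * y ^+ 2 - 2 * (h * y) =
       v * (y - v^-1 * h) ^+ 2 by field; rewrite gt_eqF.
    by rewrite mulr_ge0 ?sqr_ge0// ltW.
  have h1 := B x; have h2 := B (- x); rewrite sqrrN mulrN in h2.
  by case: (ger0P (h * x)) => _; lra.
have h1 := A r; have h2 := A i; rewrite mulrDr.
have h3 : 0 <= v * r ^+ 2 by rewrite mulr_ge0 ?sqr_ge0// ltW.
have h4 : 0 <= v * i ^+ 2 by rewrite mulr_ge0 ?sqr_ge0// ltW.
lra.
Qed.

(* Cauchy-Schwarz against the weight, which grows at most quadratically. *)
Lemma mode_bound (j : nat) (s b M : R) k : - 1 <= b ->
  exists C, forall g t, schwartzC g -> (Xsq j s b g <= M%:E)%E ->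
    `|moR (distr_of g) (fun s => rho (t - s)) k| <= C /\
    `|moI (distr_of g) (fun s => rho (t - s)) k| <= C.
Proof.
move=> b1; have [C0 [C00 hC0]] := weight_lower j s k b1.
have [K hK] := cosT_decay d0 srho rhos.
(* [hat] decays like $(1+\tau^2)^{-1}$, so its square absorbs the growth of the inverse weight and
   leaves an integrable function. The resulting constant depends on [rho], which is harmless: it
   serves only for domination. *)
pose W tau := hat tau ^+ 2 * (weight j s b k tau)^-1.
have W0 tau : 0 <= W tau by rewrite mulr_ge0 ?sqr_ge0// invr_ge0 weight_ge0.
have iW : itg setT W.
  apply: (@itg_le _ _ (fun tau => (K ^+ 2 * C0) * (1 + tau ^+ 2)^-1)) => //.
  - apply: measurable_funM; last exact: measurable_weightV.
    apply: continuous_measurable_fun => x; rewrite /continuous_at expr2.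
    by under eq_fun do rewrite expr2; apply: cvgM; exact: chat.
  - move=> tau _; rewrite ger0_norm//.
    have o0 := oneDsqr_gt0 tau.
    rewrite ler_pdivlMr//.
    apply: (@le_trans _ _ ((`|hat tau| * (1 + tau ^+ 2)) ^+ 2 * C0)); last first.
      rewrite ler_wpM2r//; apply: lerXn2r; rewrite ?nnegrE ?hK ?mulr_ge0 ?(ltW o0)//.
      by apply: le_trans (hK tau); rewrite mulr_ge0// ltW.
    rewrite exprMn -normrX (ger0_norm (sqr_ge0 _)) /W.
    have -> : hat tau ^+ 2 * (1 + tau ^+ 2) ^+ 2 * C0 =
      hat tau ^+ 2 * (C0 * (1 + tau ^+ 2)) * (1 + tau ^+ 2) by ring.
    by rewrite ler_wpM2r ?(ltW o0)// ler_wpM2l ?sqr_ge0.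
  - by apply: itgZl => //; exact: itg_oneDsqrV.
exists (\int[mu]_tau W tau + M) => g t sg XM.
have XtM : (Xterm j s b g k <= M%:E)%E.
  apply: le_trans XM; apply: esum_ge; exists [set k]; first by split.
  by rewrite fsbig_set1.
have Xf : (Xterm j s b g k < +oo)%E by rewrite (le_lt_trans XtM)// ltry.
have iwe := itg_wen sg Xf.
have fM : fX j s b g k <= M by rewrite -lee_fin fXE.
have iR := itg_hRe k sg; have iI := itg_hIm k sg.
have bnd tau : `|hRe g k tau| + `|hIm g k tau| <= W tau + weight j s b k tau * en g tau k.
  exact: (amgm_weight (hat tau) (complex.Re (fourier g tau k))
    (complex.Im (fourier g tau k)) (weight_gt0 j s b k tau)).
have key A B : itg setT A -> itg setT B ->
    (forall tau, `|A tau| + `|B tau| <= W tau + weight j s b k tau * en g tau k) ->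
    `|osc A B t| <= \int[mu]_tau W tau + M.
  move=> iA iB hAB; apply: (@le_trans _ _ (\int[mu]_tau (W tau + weight j s b k tau * en g tau k))).
    apply: Rint_bound => //; [|exact: itgD|].
      by apply: itg_measurable; exact: itg_oscR.
    by move=> tau _; rewrite (le_trans (oscR_le _ _ _ _)).
  by rewrite RintegralD// lerD2l.
rewrite moR_osc// moI_osc//; split; apply: key => //; first exact: itgN.
by move=> tau; rewrite normrN addrC.
Qed.

Lemma weighted_mode (j : nat) (s b : R) g k (V : R -> R) : schwartzC g ->
  (Xterm j s b g k < +oo)%E -> (forall x, V x = weight j s b k x) ->
  itg setT (fun x => V x * (hRe g k x ^+ 2 + hIm g k x ^+ 2)) /\
  \int[mu]_x (V x * (hRe g k x ^+ 2 + hIm g k x ^+ 2)) <= fX j s b g k.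
Proof.
move=> sg Xg VE; have -> : V = weight j s b k by apply/funext.
have ig := itg_wen sg Xg.
have le x : weight j s b k x * (hRe g k x ^+ 2 + hIm g k x ^+ 2) <= weight j s b k x * en g x k.
  by rewrite ler_wpM2l ?weight_ge0// hat_en ler_piMl ?en_ge0// hat_sqr_le1.
have i1 : itg setT (fun x => weight j s b k x * (hRe g k x ^+ 2 + hIm g k x ^+ 2)).
  apply: (itg_le _ _ _ ig) => //; last first.
    by move=> x _; rewrite ger0_norm// mulr_ge0 ?weight_ge0// addr_ge0// sqr_ge0.
  apply: measurable_funM; first exact: measurable_weight.
  by apply: measurable_funD; apply: measurable_funX; apply: itg_measurable; [exact: itg_hRe|exact: itg_hIm].
by split => //; apply: le_Rintegral.
Qed.

Section PairBound.
Variables (j : nat) (b a c K : R) (psi : R -> R).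
Hypotheses (j1 : (1 <= j)%N) (b0 : 0 <= b) (b1 : b <= 1) (cpsi : continuous psi)
  (hK : forall x p, `|\int[mu]_(t in `[a, c]) (psi t * cos (x * t + p))| * (1 + x ^+ 2) ^+ 2 <= K).
Let s : R := - 2 * j%:R + 2 * j%:R * b.

(* With [Z = moR + i moI]: the integral of [psi Re (Z1 conj Z2)], or of
   [psi Im (Z1 conj Z2)] when [rot] is set. *)
Definition pairing (rot : bool) (d1 d2 : @distr R) (k m : int) : R :=
  \int[mu]_(t in `[a, c]) (psi t *
    (if rot then moI d1 (fun s => rho (t - s)) k * moR d2 (fun s => rho (t - s)) m -
                 moR d1 (fun s => rho (t - s)) k * moI d2 (fun s => rho (t - s)) m
     else moR d1 (fun s => rho (t - s)) k * moR d2 (fun s => rho (t - s)) m +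
          moI d1 (fun s => rho (t - s)) k * moI d2 (fun s => rho (t - s)) m)).

(* One factor is measured in [X^{0,b}], the other in [X^{s,-b}] with [s = -2j + 2jb]. *)
Lemma pairing_schwartz rot g h (k m : int) (eta : R) : schwartzC g -> schwartzC h ->
  k != m -> 0 < eta -> (Xterm j 0 b g k < +oo)%E -> (Xterm j s (- b) h m < +oo)%E ->
  `|pairing rot (distr_of g) (distr_of h) k m| <=
  `|kap j k - kap j m| * ((K * (8 * 2 ^+ j) * pi) *
     (eta * fX j 0 b g k + eta^-1 * fX j s (- b) h m)).
Proof.
move=> sg sh km eta0 Xg Xh.
pose P x := bracket (x - kap j k) `^ b.
pose Q x := bracket m%:~R `^ s * bracket (x - kap j m) `^ (- b).
have PE x : P x ^+ 2 = weight j 0 b k x by rewrite weight0E.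
have QE x : Q x ^+ 2 = weight j s (- b) m x by rewrite weight_sqr.
have [i1 l1] := weighted_mode sg Xg PE.
have [i2 l2] := weighted_mode sh Xh QE.
have K0 : 0 <= K.
  by apply: le_trans (hK 0 0); rewrite mulr_ge0// exprn_ge0// ltW// oneDsqr_gt0.
have p0 := pi_gt0 R.
have D0 : 0 <= 8 * 2 ^+ j * `|kap j k - kap j m| by rewrite !mulr_ge0 ?exprn_ge0.
have P0 x : 0 <= P x by exact: powR_ge0.
have Q0 x : 0 <= Q x by rewrite mulr_ge0 ?powR_ge0.
have B : `|pairing rot (distr_of g) (distr_of h) k m| <=
    K * (8 * 2 ^+ j * `|kap j k - kap j m|) * pi *
    (eta * \int[mu]_x (P x ^+ 2 * (hRe g k x ^+ 2 + hIm g k x ^+ 2)) +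
     eta^-1 * \int[mu]_x (Q x ^+ 2 * (hRe h m x ^+ 2 + hIm h m x ^+ 2))).
  have E (p x1 x2 x3 x4 y1 y2 y3 y4 : R) : x1 = y1 -> x2 = y2 -> x3 = y3 -> x4 = y4 ->
    p * (x1 * x2 + x3 * x4) = p * (y1 * y2 + y3 * y4) by move=> -> -> -> ->.
  have E' (p x1 x2 x3 x4 y1 y2 y3 y4 : R) : x1 = y1 -> x2 = y2 -> x3 = - y3 -> x4 = y4 ->
    p * (x1 * x2 - x3 * x4) = p * (y1 * y2 + y3 * y4) by move=> -> -> -> ->; rewrite mulNr opprK.
  (* Since $\mathrm{Im}(Z_1\overline{Z_2})=\mathrm{Re}(-iZ_1\overline{Z_2})$, the rotated case is
     the same bound with [hIm] and [- hRe] in place of [hRe] and [hIm]. *)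
  case: rot.
    have iN := itgN measurableT (itg_hRe k sg).
    have sw x : P x ^+ 2 * (hIm g k x ^+ 2 + (- hRe g k x) ^+ 2) =
        P x ^+ 2 * (hRe g k x ^+ 2 + hIm g k x ^+ 2) by rewrite sqrrN addrC.
    have i1' : itg setT (fun x => P x ^+ 2 * (hIm g k x ^+ 2 + (- hRe g k x) ^+ 2)).
      by apply: eq_integrable i1 => // x _; rewrite /= sw.
    have I1 : \int[mu]_x (P x ^+ 2 * (hIm g k x ^+ 2 + (- hRe g k x) ^+ 2)) =
        \int[mu]_x (P x ^+ 2 * (hRe g k x ^+ 2 + hIm g k x ^+ 2)).
      by apply: eq_Rintegral => x _; rewrite sw.
    have cong (y z : R) (F : R -> R) : y = z -> F y <= F z by move=> ->.
    have B := @bilinear_bound R a c K psi cpsi hK (hIm g k) (fun x => - hRe g k x) (hRe h m) (hIm h m) P Q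
      (8 * 2 ^+ j * `|kap j k - kap j m|) eta (itg_hIm k sg) iN (itg_hRe m sh) (itg_hIm m sh)
      P0 Q0 eta0 D0 (fun x y => weight_pair x y j1 km b0 b1) i1' i2.
    refine (le_trans _ (le_trans B _)); last first.
      exact: (cong _ _ (fun I => K * (8 * 2 ^+ j * `|kap j k - kap j m|) * pi * (eta * I + _)) I1).
    rewrite le_eqVlt; apply/orP; left; apply/eqP.
    congr (`| _ |); apply: eq_Rintegral => t _.
    have oN : moR (distr_of g) (fun s => rho (t - s)) k =
        - osc (fun x => - hRe g k x) (fun x => - hIm g k x) t.
      by rewrite moR_osc// -RintN; apply: eq_Rintegral => x _; rewrite /oscR; ring.
    exact: (E' _ _ _ _ _ _ _ _ _ (moI_osc k t sg) (moR_osc m t sh) oN (moI_osc m t sh)).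
  have B := @bilinear_bound R a c K psi cpsi hK (hRe g k) (hIm g k) (hRe h m) (hIm h m) P Q
    (8 * 2 ^+ j * `|kap j k - kap j m|) eta (itg_hRe k sg) (itg_hIm k sg) (itg_hRe m sh) (itg_hIm m sh)
    P0 Q0 eta0 D0 (fun x y => weight_pair x y j1 km b0 b1) i1 i2.
  refine (le_trans _ B); rewrite le_eqVlt; apply/orP; left; apply/eqP.
  congr (`| _ |); apply: eq_Rintegral => t _.
  exact: (E _ _ _ _ _ _ _ _ _ (moR_osc k t sg) (moR_osc m t sh) (moI_osc k t sg) (moI_osc m t sh)).
have E (A C D p e1 e2 I1 I2 F1 F2 : R) : 0 <= A -> 0 <= C -> 0 <= D -> 0 <= p -> 0 <= e1 ->
    0 <= e2 -> I1 <= F1 -> I2 <= F2 ->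
    A * (C * D) * p * (e1 * I1 + e2 * I2) <= D * ((A * C * p) * (e1 * F1 + e2 * F2)).
  move=> A0 C0 D1 p1 f1 f2 IF1 IF2.
  have -> : D * ((A * C * p) * (e1 * F1 + e2 * F2)) = A * (C * D) * p * (e1 * F1 + e2 * F2) by ring.
  by rewrite ler_wpM2l ?mulr_ge0// lerD// ler_wpM2l.
have C0 : 0 <= 8 * 2 ^+ j :> R by rewrite mulr_ge0 ?exprn_ge0.
have ei0 : 0 <= eta^-1 by rewrite invr_ge0 ltW.
exact: le_trans B (E _ _ _ _ _ _ _ _ _ _ K0 C0 (normr_ge0 _) (ltW p0) (ltW eta0) ei0 l1 l2).
Qed.

Section Limit.
Variables (d1 d2 : @distr R) (g h : nat -> R -> R -> R[i]) (M1 M2 : R).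
Hypotheses (sg : forall n, schwartzC (g n)) (sh : forall n, schwartzC (h n))
  (Xg : forall n, (Xsq j 0 b (g n) <= M1%:E)%E)
  (Xh : forall n, (Xsq j s (- b) (h n) <= M2%:E)%E)
  (wg : forall t k, a <= t <= c ->
    moR (distr_of (g n)) (fun s => rho (t - s)) k @[n --> \oo] --> moR d1 (fun s => rho (t - s)) k /\
    moI (distr_of (g n)) (fun s => rho (t - s)) k @[n --> \oo] --> moI d1 (fun s => rho (t - s)) k)
  (wh : forall t k, a <= t <= c ->
    moR (distr_of (h n)) (fun s => rho (t - s)) k @[n --> \oo] --> moR d2 (fun s => rho (t - s)) k /\
    moI (distr_of (h n)) (fun s => rho (t - s)) k @[n --> \oo] --> moI d2 (fun s => rho (t - s)) k).

(** Weak convergence controls the mollified modes only pointwise in [t]; [mode_bound] provides the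
    domination, uniform in [t] and [n]. *)
Lemma pairing_cvg rot k m :
  pairing rot (distr_of (g n)) (distr_of (h n)) k m @[n --> \oo] --> pairing rot d1 d2 k m.
Proof.
have nb1 : - 1 <= b by have := b0; lra.
have nb2 : - 1 <= - b by have := b1; lra.
have [C1 hC1] := mode_bound j 0 M1 k nb1.
have [C2 hC2] := mode_bound j s M2 m nb2.
have cmo (u : R -> R -> R[i]) n : schwartzC u ->
    continuous (fun t => moR (distr_of u) (fun s => rho (t - s)) n) /\
    continuous (fun t => moI (distr_of u) (fun s => rho (t - s)) n).
  move=> su.
  split.
    have -> : (fun t => moR (distr_of u) (fun s => rho (t - s)) n) = osc (hRe u n) (hIm u n).
      by apply/funext => t; exact: moR_osc.
    exact: continuous_osc (itg_hRe n su) (itg_hIm n su).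
  have -> : (fun t => moI (distr_of u) (fun s => rho (t - s)) n) =
      osc (hIm u n) (fun tau => - hRe u n tau).
    by apply/funext => t; exact: moI_osc.
  exact: continuous_osc (itg_hIm n su) (itgN measurableT (itg_hRe n su)).
pose G n t := psi t *
    (if rot then moI (distr_of (g n)) (fun s => rho (t - s)) k * moR (distr_of (h n)) (fun s => rho (t - s)) m -
       moR (distr_of (g n)) (fun s => rho (t - s)) k * moI (distr_of (h n)) (fun s => rho (t - s)) m
     else moR (distr_of (g n)) (fun s => rho (t - s)) k * moR (distr_of (h n)) (fun s => rho (t - s)) m +
     moI (distr_of (g n)) (fun s => rho (t - s)) k * moI (distr_of (h n)) (fun s => rho (t - s)) m).
pose G0 t := psi t *
    (if rot then moI d1 (fun s => rho (t - s)) k * moR d2 (fun s => rho (t - s)) m -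
       moR d1 (fun s => rho (t - s)) k * moI d2 (fun s => rho (t - s)) m
     else moR d1 (fun s => rho (t - s)) k * moR d2 (fun s => rho (t - s)) m +
     moI d1 (fun s => rho (t - s)) k * moI d2 (fun s => rho (t - s)) m).
have mG n : measurable_fun `[a, c] (G n).
  apply: measurable_cont => // t.
  have [c1 c2] := cmo (g n) k (sg n); have [c3 c4] := cmo (h n) m (sh n).
  apply: cvgM; first exact: cpsi.
  case: (rot).
    by apply: cvgB; apply: cvgM; [exact: c2|exact: c3|exact: c1|exact: c4].
  by apply: cvgD; apply: cvgM; [exact: c1|exact: c3|exact: c2|exact: c4].
have GG0 t : `[a, c]%classic t -> G n t @[n --> \oo] --> G0 t.
  rewrite /= in_itv /= => act; have [w1 w2] := wg k act; have [w3 w4] := wh m act.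
  apply: cvg_scale; case: (rot); first by apply: cvgB; apply: cvgM.
  by apply: cvgD; apply: cvgM.
apply: (@Rdominated R `[a, c] G G0 (fun t => `|psi t| * (C1 * C2 + C1 * C2))) => //.
- exact: measurable_fun_cvg mG GG0.
- by apply: itgZr => //; apply: itg_norm => //; exact: itg_cont.
- move=> n t _; rewrite /G normrM ler_wpM2l//.
  have [h1 h2] := hC1 (g n) t (sg n) (Xg n); have [h3 h4] := hC2 (h n) t (sh n) (Xh n).
  case: (rot); rewrite ?(le_trans (ler_normB _ _))// ?(le_trans (ler_normD _ _))// !normrM;
    by apply: lerD; apply: ler_pM.
Qed.

(** Proved for the approximations, whose energies over any finite set of frequencies are at most
    [M1] and [M2], then passed to the limit. The coefficients [beta] carry the division by the gap,
    which cancels the gap in [pairing_schwartz]; the constant depends on the bandwidth [L] but not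
    on [ks]. *)
Lemma pairing_sum_bound rot (ks : seq int) (L : nat) (eta : R) (beta : int -> int -> R) :
  uniq ks -> 0 < eta ->
  (forall k m, beta k m != 0 -> k != m /\ (`|k - m| <= L%:Z)%R) ->
  (forall k m, `|beta k m| * `|kap j k - kap j m| <= 1) ->
  `|\sum_(k <- ks) \sum_(m <- ks) (beta k m * pairing rot d1 d2 k m)| <=
  (K * (8 * 2 ^+ j) * pi) * (2 * L).+1%:R * (eta * M1 + eta^-1 * M2).
Proof.
move=> uks eta0 bz bD; set Kc := K * (8 * 2 ^+ j) * pi.
have K0 : 0 <= K.
  by apply: le_trans (hK 0 0); rewrite mulr_ge0// exprn_ge0// ltW// oneDsqr_gt0.
have Kc0 : 0 <= Kc by rewrite !mulr_ge0 ?exprn_ge0 ?pi_ge0.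
have Xfin (j' : nat) (s' b' M : R) u n : (Xsq j' s' b' u <= M%:E)%E -> (Xterm j' s' b' u n < +oo)%E.
  move=> XM; apply: (@le_lt_trans _ _ M%:E); last by rewrite ltry.
  apply: le_trans XM; apply: esum_ge; exists [set n]; first by split.
  by rewrite fsbig_set1.
have fsum (s' b' M : R) u : schwartzC u -> (Xsq j s' b' u <= M%:E)%E ->
    \sum_(k <- ks) fX j s' b' u k <= M.
  move=> su XM; rewrite -lee_fin; apply: le_trans (XM).
  apply: sum_le_esum => // k; last exact: Xterm_ge0.
  by apply: fXE => //; exact: Xfin XM.
have f0 (s' b' : R) u k : 0 <= fX j s' b' u k.
  by apply: Rintegral_ge0 => x _; rewrite mulr_ge0 ?weight_ge0 ?en_ge0.
have fsum' (F : int -> R) (M e : R) : (forall k, 0 <= F k) -> 0 <= e -> \sum_(k <- ks) F k <= M ->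
    \sum_(k <- ks) (e * F k) <= e * M.
  by move=> F0 e0 FM; rewrite -mulr_sumr ler_wpM2l.
have e0 := ltW eta0; have ei0 : 0 <= eta^-1 by rewrite invr_ge0.
have fin n : `|\sum_(k <- ks) \sum_(m <- ks) (beta k m * pairing rot (distr_of (g n)) (distr_of (h n)) k m)|
    <= Kc * (2 * L).+1%:R * (eta * M1 + eta^-1 * M2).
  apply: (@le_trans _ _ (\sum_(k <- ks) \sum_(m <- ks | (`|k - m| <= L%:Z)%R)
      Kc * (eta * fX j 0 b (g n) k + eta^-1 * fX j s (- b) (h n) m))).
    apply: (le_trans (ler_norm_sum _ _ _)); apply: ler_sum => k _.
    apply: (le_trans (ler_norm_sum _ _ _)); rewrite [leRHS]big_mkcond; apply: ler_sum => m _.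
    have [->|bnz] := eqVneq (beta k m) 0.
      rewrite mul0r normr0; case: ifP => // _.
      by rewrite mulr_ge0// addr_ge0// mulr_ge0.
    have [km kmL] := bz k m bnz; rewrite kmL normrM.
    have P := pairing_schwartz rot (sg n) (sh n) km eta0 (Xfin _ _ _ _ _ k (Xg n)) (Xfin _ _ _ _ _ m (Xh n)).
    rewrite -/Kc in P; apply: (le_trans (ler_wpM2l (normr_ge0 (beta k m)) P)).
    rewrite mulrA ler_piMl//.
    by rewrite mulr_ge0// addr_ge0// mulr_ge0.
  have -> : \sum_(k <- ks) \sum_(m <- ks | (`|k - m| <= L%:Z)%R)
      Kc * (eta * fX j 0 b (g n) k + eta^-1 * fX j s (- b) (h n) m) =
     Kc * \sum_(k <- ks) \sum_(m <- ks | (`|k - m| <= L%:Z)%R)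
       (eta * fX j 0 b (g n) k + eta^-1 * fX j s (- b) (h n) m).
    by rewrite mulr_sumr; apply: eq_bigr => k _; rewrite mulr_sumr.
  rewrite -mulrA ler_wpM2l//.
  apply: le_trans (double_sum_near L uks _ _) _; try by move=> k; rewrite mulr_ge0.
  refine (ler_wpM2l (ler0n _ _) _).
  exact: lerD (fsum' _ _ _ (fun k => f0 0 b (g n) k) e0 (fsum _ _ _ _ (sg n) (Xg n)))
    (fsum' _ _ _ (fun k => f0 s (- b) (h n) k) ei0 (fsum _ _ _ _ (sh n) (Xh n))).
have cv : `|\sum_(k <- ks) \sum_(m <- ks) (beta k m * pairing rot (distr_of (g n)) (distr_of (h n)) k m)|
   @[n --> \oo] --> `|\sum_(k <- ks) \sum_(m <- ks) (beta k m * pairing rot d1 d2 k m)|.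
  apply: cvg_norm; apply: cvg_sum_seq => k; apply: cvg_sum_seq => m.
  by apply: cvg_scale; exact: pairing_cvg.
rewrite -(cvg_lim _ cv)//; apply: limr_le; last exact: nearW.
by apply/cvg_ex; eexists; exact: cv.
Qed.

End Limit.
End PairBound.
End Modes.

(** * The equation satisfied by the modes *)

Section Equation.
Context {R : realType}.
Local Notation mu := (@lebesgue_measure R).
Local Notation pi := (@pi R).
Local Notation kap j k := ((k%:~R : R) ^+ (2 * j).+1).

Lemma Rint_sum4 (a c x : R) (h1 h2 h3 h4 : R -> R) : continuous h1 -> continuous h2 ->
  continuous h3 -> continuous h4 ->
  \int[mu]_(t in `[a, c]) (x * h1 t + h2 t + h3 t + h4 t) =
  x * \int[mu]_(t in `[a, c]) h1 t + \int[mu]_(t in `[a, c]) h2 t +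
  \int[mu]_(t in `[a, c]) h3 t + \int[mu]_(t in `[a, c]) h4 t.
Proof.
move=> c1 c2 c3 c4.
have i1 : itg `[a, c] (fun t => x * h1 t) by apply: itgZl => //; exact: itg_cont.
have i12 := itgD (measurable_itv _) i1 (itg_cont a c c2).
have i123 := itgD (measurable_itv _) i12 (itg_cont a c c3).
rewrite RintegralD//; last exact: itg_cont.
rewrite RintegralD//; last exact: itg_cont.
rewrite RintegralD//; last exact: itg_cont.
by rewrite RintegralZl//; exact: itg_cont.
Qed.

Lemma continuous_mulf (f g : R -> R) : continuous f -> continuous g ->
  continuous (fun t => f t * g t).
Proof. by move=> cf cg t; apply: cvgM; [exact: cf|exact: cg]. Qed.

Lemma continuous_addf (f g : R -> R) : continuous f -> continuous g ->
  continuous (fun t => f t + g t).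
Proof. by move=> cf cg t; apply: cvgD; [exact: cf|exact: cg]. Qed.

Lemma continuous_subf (f g : R -> R) : continuous f -> continuous g ->
  continuous (fun t => f t - g t).
Proof. by move=> cf cg t; apply: cvgB; [exact: cf|exact: cg]. Qed.

Lemma continuous_scalef (x : R) (f : R -> R) : continuous f ->
  continuous (fun t => x * f t).
Proof. by move=> cf t; apply: cvgM; [exact: cvg_cst|exact: cf]. Qed.

Lemma is_derive_subf (f g : R -> R) (x df dg : R) :
  is_derive x (1 : R) f df -> is_derive x (1 : R) g dg ->
  is_derive x (1 : R) (fun y => f y - g y) (df - dg).
Proof. by move=> hf hg; exact: is_deriveB. Qed.

Ltac cont := lazymatch goal with
  | |- continuous (fun t => (_ - _)%R) => apply: continuous_subf; cont
  | |- continuous (fun t => (_ + _)%R) => apply: continuous_addf; cont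
  | |- continuous (fun t => (_ * _)%R) => first [apply: continuous_scalef | apply: continuous_mulf]; cont
  | |- _ => assumption
  end.

Section Pure.
Variables (a c k m : R) (psi dpsi X1 Y1 X2 Y2 dX1 dY1 dX2 dY2 : R -> R).
Hypotheses (ac : a <= c)
  (hpsi : forall t : R, is_derive t (1 : R) psi (dpsi t)) (cdpsi : continuous dpsi)
  (psia : psi a = 0) (psic : psi c = 0)
  (hX1 : forall t : R, is_derive t (1 : R) X1 (dX1 t)) (cX1 : continuous dX1)
  (hY1 : forall t : R, is_derive t (1 : R) Y1 (dY1 t)) (cY1 : continuous dY1)
  (hX2 : forall t : R, is_derive t (1 : R) X2 (dX2 t)) (cX2 : continuous dX2)
  (hY2 : forall t : R, is_derive t (1 : R) Y2 (dY2 t)) (cY2 : continuous dY2).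

Let cp := is_derive_cont hpsi.
Let c1 := is_derive_cont hX1.
Let c2 := is_derive_cont hY1.
Let c3 := is_derive_cont hX2.
Let c4 := is_derive_cont hY2.

(** With $Z=X+iY$, the function $\psi\,\mathrm{Im}(Z_1\overline{Z_2})$ vanishes at both ends, so its
    derivative integrates to 0. The combinations $dX+kY$ and $dY-kX$ are the components of the
    forcing $Z'-ikZ$. *)
Lemma ode_cos : (k - m) * \int[mu]_(t in `[a, c]) (psi t * (X1 t * X2 t + Y1 t * Y2 t)) =
  - (\int[mu]_(t in `[a, c]) (dpsi t * (Y1 t * X2 t - X1 t * Y2 t)) +
     \int[mu]_(t in `[a, c]) (psi t * ((dY1 t - k * X1 t) * X2 t - (dX1 t + k * Y1 t) * Y2 t)) +
     \int[mu]_(t in `[a, c]) (psi t * (Y1 t * (dX2 t + m * Y2 t) - X1 t * (dY2 t - m * X2 t)))).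
Proof.
pose F t := psi t * (Y1 t * X2 t - X1 t * Y2 t).
have dF (t : R) : is_derive t (1 : R) F (dpsi t * (Y1 t * X2 t - X1 t * Y2 t) +
    psi t * ((dY1 t * X2 t + Y1 t * dX2 t) - (dX1 t * Y2 t + X1 t * dY2 t))).
  exact: (is_derive_mulf (hpsi t) (is_derive_subf (is_derive_mulf (hY1 t) (hX2 t)) (is_derive_mulf (hX1 t) (hY2 t)))).
have cF : continuous (fun t : R => dpsi t * (Y1 t * X2 t - X1 t * Y2 t) +
    psi t * ((dY1 t * X2 t + Y1 t * dX2 t) - (dX1 t * Y2 t + X1 t * dY2 t))).
  by cont.
have := FTC2 ac dF cF; rewrite /F psia psic !mul0r subrr.
have -> : \int[mu]_(t in `[a, c]) (dpsi t * (Y1 t * X2 t - X1 t * Y2 t) +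
    psi t * ((dY1 t * X2 t + Y1 t * dX2 t) - (dX1 t * Y2 t + X1 t * dY2 t))) =
  \int[mu]_(t in `[a, c]) ((k - m) * (psi t * (X1 t * X2 t + Y1 t * Y2 t)) +
     dpsi t * (Y1 t * X2 t - X1 t * Y2 t) +
     psi t * ((dY1 t - k * X1 t) * X2 t - (dX1 t + k * Y1 t) * Y2 t) +
     psi t * (Y1 t * (dX2 t + m * Y2 t) - X1 t * (dY2 t - m * X2 t))).
  by apply: eq_Rintegral => t _; ring.
rewrite Rint_sum4; try by cont.
by move=> h; lra.
Qed.

(** The same computation with $\psi\,\mathrm{Re}(Z_1\overline{Z_2})$. *)
Lemma ode_sin : (k - m) * \int[mu]_(t in `[a, c]) (psi t * (Y1 t * X2 t - X1 t * Y2 t)) =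
   \int[mu]_(t in `[a, c]) (dpsi t * (X1 t * X2 t + Y1 t * Y2 t)) +
   \int[mu]_(t in `[a, c]) (psi t * ((dX1 t + k * Y1 t) * X2 t + (dY1 t - k * X1 t) * Y2 t)) +
   \int[mu]_(t in `[a, c]) (psi t * (X1 t * (dX2 t + m * Y2 t) + Y1 t * (dY2 t - m * X2 t))).
Proof.
pose F t := psi t * (X1 t * X2 t + Y1 t * Y2 t).
have dF (t : R) : is_derive t (1 : R) F (dpsi t * (X1 t * X2 t + Y1 t * Y2 t) +
    psi t * ((dX1 t * X2 t + X1 t * dX2 t) + (dY1 t * Y2 t + Y1 t * dY2 t))).
  exact: (is_derive_mulf (hpsi t) (is_derive_addf (is_derive_mulf (hX1 t) (hX2 t)) (is_derive_mulf (hY1 t) (hY2 t)))).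
have cF : continuous (fun t : R => dpsi t * (X1 t * X2 t + Y1 t * Y2 t) +
    psi t * ((dX1 t * X2 t + X1 t * dX2 t) + (dY1 t * Y2 t + Y1 t * dY2 t))).
  by cont.
have := FTC2 ac dF cF; rewrite /F psia psic !mul0r subrr.
have -> : \int[mu]_(t in `[a, c]) (dpsi t * (X1 t * X2 t + Y1 t * Y2 t) +
    psi t * ((dX1 t * X2 t + X1 t * dX2 t) + (dY1 t * Y2 t + Y1 t * dY2 t))) =
  \int[mu]_(t in `[a, c]) (- (k - m) * (psi t * (Y1 t * X2 t - X1 t * Y2 t)) +
     dpsi t * (X1 t * X2 t + Y1 t * Y2 t) +
     psi t * ((dX1 t + k * Y1 t) * X2 t + (dY1 t - k * X1 t) * Y2 t) +
     psi t * (X1 t * (dX2 t + m * Y2 t) + Y1 t * (dY2 t - m * X2 t))).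
  by apply: eq_Rintegral => t _; ring.
rewrite Rint_sum4; try by cont.
by move=> h; lra.
Qed.

End Pure.

Lemma bounded_support (f : R -> R) (d : R) : 0 < d -> continuous f ->
  (forall x, f x != 0 -> - d <= x <= d) -> exists M, forall x, `|f x| <= M.
Proof.
move=> d0 cf fs.
have cnf : {within `[- d, d], continuous (fun x => `|f x|)}.
  by apply: continuous_subspaceT => x; apply: cvg_norm; exact: cf.
have dd : - d <= d by lra.
have [z _ hz] := EVT_max dd cnf.
exists `|f z| => x; have [->|fx] := eqVneq (f x) 0; first by rewrite normr0.
by apply: hz; rewrite in_itv /=; exact: fs.
Qed.

Section Modes.
Variables (T : R) (w : R -> R -> R).
Hypotheses (w1 : measurable_fun setT (fun p : R * R => w p.1 p.2))
  (w3 : forall t, itg `[0, 2 * pi] (fun x => w t x ^+ 2))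
  (w4 : itg `]0, T[ (fun t => \int[mu]_(x in `[0, 2 * pi]) w t x ^+ 2)).

Let P2 : 0 < 2 * pi. Proof. by rewrite mulr_gt0// pi_gt0. Qed.

Let mw t (D : set R) : measurable D -> measurable_fun D (w t).
Proof.
move=> mD; apply: (measurable_funS measurableT) => //.
by apply: (measurableT_comp (g := fun y => (t, y)) w1); exact: pair1_measurable.
Qed.

Lemma itg_wx t : itg `[0, 2 * pi] (w t).
Proof. by apply: itg_L2_L1 => //; [exact: mu_itv_lty|exact: mw]. Qed.

Section Chi.
Variables (chi : R -> R).
Hypotheses (cchi : continuous chi) (chi1 : forall x, `|chi x| <= 1).

Lemma itg_chiw t : itg `[0, 2 * pi] (fun y => chi y * w t y).
Proof.
apply: (itgM_bdd (M := 1)) => //; last exact: itg_wx.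
exact: measurable_cont.
Qed.

Lemma measurable_xintw : measurable_fun `]0, T[ (xint chi w).
Proof.
apply: (measurable_funS measurableT) => //.
apply: (@measurable_section R _ (fun t y => chi y * w t y)) => //.
by apply: measurable_funM => //; apply: measurable_pr2; exact: continuous_measurable_fun.
Qed.

(** Cauchy-Schwarz, obtained from [jensen_sq] with the constant density $(2\pi)^{-1}$. *)
Lemma xintw_sq t : xint chi w t ^+ 2 <= 2 * pi * \int[mu]_(x in `[0, 2 * pi]) w t x ^+ 2.
Proof.
have iq : itg `[0, 2 * pi] (fun y => (chi y * w t y) ^+ 2).
  apply: (itg_le _ _ _ (w3 t)) => //.
    by apply: measurable_funX; apply: itg_measurable; exact: itg_chiw.
  move=> y _; rewrite ger0_norm ?sqr_ge0// exprMn ler_piMl ?sqr_ge0//.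
  by rewrite -[_ ^+ 2]ger0_norm ?sqr_ge0// normrX exprn_ile1.
have := @jensen_sq R 0 (2 * pi) (fun _ => (2 * pi)^-1) (fun y => chi y * w t y).
have p0 : 0 <= (2 * pi)^-1 by rewrite invr_ge0 ltW.
move=> /(_ (fun x => cvg_cst _) (fun _ => p0)); rewrite Rint_cst_itv; last exact: ltW.
rewrite subr0 mulVf ?gt_eqF//.
move=> /(_ erefl (itg_measurable (itg_chiw t)) iq).
rewrite RintegralZl//; last exact: itg_chiw.
rewrite RintegralZl// exprMn -/(xint chi w t) => h.
have h2 : \int[mu]_(y in `[0, 2 * pi]) (chi y * w t y) ^+ 2 <= \int[mu]_(x in `[0, 2 * pi]) w t x ^+ 2.
  apply: le_Rintegral => // y _; rewrite exprMn ler_piMl ?sqr_ge0//.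
  by rewrite -[_ ^+ 2]ger0_norm ?sqr_ge0// normrX exprn_ile1.
have : (2 * pi) ^+ 2 * ((2 * pi)^-1 ^+ 2 * xint chi w t ^+ 2) <=
    (2 * pi) ^+ 2 * ((2 * pi)^-1 * \int[mu]_(y in `[0, 2 * pi]) (chi y * w t y) ^+ 2).
  by rewrite ler_wpM2l// sqr_ge0.
have p2 : 2 * pi != 0 by rewrite gt_eqF.
rewrite mulrA -exprMn mulfV// expr1n mul1r mulrA expr2 mulfK// => h3.
by rewrite (le_trans h3)// ler_wpM2l// ltW.
Qed.

Lemma itg_xintw_sq : itg `]0, T[ (fun t => xint chi w t ^+ 2).
Proof.
apply: (@itg_le _ _ (fun t => 2 * pi * \int[mu]_(x in `[0, 2 * pi]) w t x ^+ 2)) => //.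
- by apply: measurable_funX; exact: measurable_xintw.
- by move=> t _; rewrite ger0_norm ?sqr_ge0// xintw_sq.
- exact: itgZl.
Qed.

Lemma itg_xintw : itg `]0, T[ (xint chi w).
Proof.
apply: itg_L2_L1 => //; [exact: mu_itv_lty|exact: measurable_xintw|exact: itg_xintw_sq].
Qed.

Lemma stint_tensw theta : stint `]0, T[ (fun t x => w t x * tens theta chi t x) =
  \int[mu]_(t in `]0, T[) (theta t * xint chi w t).
Proof.
apply: eq_Rintegral => t _; rewrite /xint -RintegralZl//; last exact: itg_chiw.
by apply: eq_Rintegral => y _; rewrite /tens; ring.
Qed.

Definition mol (rho : R -> R) (t : R) : R :=
  \int[mu]_(s in `]0, T[) (rho (t - s) * xint chi w s).

Section Smooth.
Variables (rho : R -> R) (d : R).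
Hypotheses (d0 : 0 < d) (srho : smooth1 rho)
  (rhos : forall x, rho x != 0 -> - d <= x <= d).

Let crho : continuous rho. Proof. exact: smooth1_continuous. Qed.

Let itg_mol (r : R -> R) (M t : R) : continuous r -> (forall x, `|r x| <= M) ->
  itg `]0, T[ (fun s => r (t - s) * xint chi w s).
Proof.
move=> cr rM; apply: (itgM_bdd (M := M)) => //; last exact: itg_xintw.
apply: measurable_cont => // s.
apply: (@continuous_comp _ _ _ (fun s : R => t - s) r); last exact: cr.
by apply: cvgB; [exact: cvg_cst|exact: cvg_id].
Qed.

Let shift_cont (r : R -> R) s : continuous r -> continuous (fun t => r (t - s)).
Proof.
move=> cr t; apply: (@continuous_comp _ _ _ (fun t : R => t - s) r); last exact: cr.
by apply: cvgB; [exact: cvg_id|exact: cvg_cst].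
Qed.

Lemma continuous_mol : continuous (mol rho).
Proof.
have [M hM] := bounded_support d0 crho rhos.
apply: (@continuous_param _ _ _ (fun s => M * `|xint chi w s|)) => //.
- by move=> t; apply: itg_measurable; exact: itg_mol hM.
- by move=> s; apply: continuous_mulf; [exact: shift_cont|move=> ?; exact: cvg_cst].
- by apply: itgZl => //; apply: itg_norm => //; exact: itg_xintw.
- by move=> t s _; rewrite normrM ler_wpM2r.
Qed.

Lemma is_derive_mol (t : R) : is_derive t (1 : R) (mol rho) (mol (derive1 rho) t).
Proof.
have s1 := smooth1_derive1 srho; have c1 := smooth1_continuous s1.
have [M hM] := bounded_support d0 crho rhos.
have [M' hM'] := bounded_support d0 c1 (derive_support (smooth1_is_derive srho) rhos c1).
apply: (@is_derive_param _ `]0, T[ (fun t s => rho (t - s) * xint chi w s)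
   (fun t s => derive1 rho (t - s) * xint chi w s) (fun s => M' * `|xint chi w s|)) => //.
- by move=> x; exact: itg_mol hM.
- move=> x s.
  have h : is_derive x (1 : R) (fun x => rho (1 * x + (- s))) (1 * derive1 rho (1 * x + (- s))).
    exact: (is_derive_comp_affine 1 (- s) x (smooth1_is_derive srho)).
  rewrite !mul1r in h.
  have e : (fun x => rho (1 * x + - s)) = (fun x => rho (x - s)) by apply/funext => y; rewrite mul1r.
  rewrite e in h.
  have := is_derive_mulf h (is_derive_cst (xint chi w s) x (1 : R)).
  by rewrite mulr0 addr0.
- by apply: itgZl => //; apply: itg_norm => //; exact: itg_xintw.
- by move=> x s _; rewrite normrM ler_wpM2r.
Qed.
End Smooth.
End Chi.
Section Identity.
Variables (j : nat) (F : @distr R) (rho : R -> R) (d a c : R).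
Hypotheses (d0 : 0 < d) (srho : smooth1 rho)
  (rhos : forall x, rho x != 0 -> - d <= x <= d) (ad : 0 < a - d) (cd : c + d < T)
  (ac : a <= c).
(** [U] stays abstract: the norms and the equation are given for the distribution of the original
    solution, while modes are computed from the representative [w]; the two agree on the tensor
    products that serve as tests. *)
Variable U : @distr R.
Hypothesis hU : forall theta k ph, continuous theta ->
  U (tens theta (wave k ph)) = distr_of_real T w (tens theta (wave k ph)).
Hypothesis heqF : forall phi, test_function T phi ->
  distr_dt U phi + (-1) ^+ j.+1 * iter (2 * j).+1 distr_dx U phi = F phi.

Let wv k ph : continuous (@wave R k ph). Proof. exact: wave_cont. Qed.
Let wv1 k ph x : `|@wave R k ph x| <= 1. Proof. exact: wave_le1. Qed.

Lemma smooth1_reflect t : smooth1 (fun s => rho (t - s)).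
Proof.
have -> : (fun s => rho (t - s)) = (fun s => rho ((-1) * s + t)).
  by apply/funext => s; rewrite mulN1r addrC.
exact: smooth1_affine.
Qed.

Lemma reflect_test t k ph : a <= t <= c ->
  test_function T (tens (fun s => rho (t - s)) (wave k ph)).
Proof.
move=> /andP[at_ tc]; apply: (@test_function_tens _ T (a - d) (c + d)) => //.
  exact: smooth1_reflect.
by move=> s /rhos /andP[h1 h2]; apply/andP; split; lra.
Qed.

Lemma realtype_tens theta k ph : continuous theta -> U (tens theta (wave k ph)) =
  (\int[mu]_(t in `]0, T[) (theta t * xint (wave k ph) w t))%:C.
Proof. by move=> ct; rewrite hU// /distr_of_real stint_tensw. Qed.

Let creflect t : continuous (fun s => rho (t - s)).
Proof. exact: smooth1_continuous (smooth1_reflect t). Qed.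

Lemma moR_real t k : moR U (fun s => rho (t - s)) k = mol (wave k 0) rho t.
Proof. by rewrite /moR !(realtype_tens _ _ (@creflect t)) /= addr0. Qed.

Lemma moI_real t k : moI U (fun s => rho (t - s)) k = (-1) * mol (wave k (- (pi / 2))) rho t.
Proof. by rewrite /moI !(realtype_tens _ _ (@creflect t)) /= sub0r mulN1r. Qed.

Lemma iter_distr_dx n (V : @distr R) phi :
  iter n distr_dx V phi = (-1) ^+ n * V (iter n partial_x phi).
Proof.
elim: n phi => [|n IH] phi; first by rewrite mul1r.
by rewrite iterS {1}/distr_dx IH -iterSr exprS mulN1r mulNr.
Qed.

Lemma cosDnpi (x : R) n : cos (x + n%:R * pi) = (-1) ^+ n * cos x.
Proof.
elim: n => [|n IH]; first by rewrite mul0r addr0 mul1r.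
rewrite -natr1 mulrDl mul1r addrA cosDpi IH exprS; ring.
Qed.

Let itg_molw (r : R -> R) (t M : R) k ph : continuous r -> (forall x, `|r x| <= M) ->
  itg `]0, T[ (fun s => r (t - s) * xint (wave k ph) w s).
Proof.
move=> cr rM; apply: (itgM_bdd (M := M)) => //; last exact: itg_xintw.
apply: measurable_cont => // s.
apply: (@continuous_comp _ _ _ (fun s : R => t - s) r); last exact: cr.
by apply: cvgB; [exact: cvg_cst|exact: cvg_id].
Qed.

(** The derivative of [rho (t - s)] in [s] brings a sign that cancels the one in [distr_dt]. In
    space, $2j+1$ derivatives of the wave give $k^{2j+1}$ and a phase shift $\pi/2+j\pi$; the sign
    $(-1)^j$ of the latter, the $(-1)^{2j+1}$ of the distributional derivatives and the $(-1)^{j+1}$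
    of the equation multiply to 1. *)
Lemma forcing_tens t k ph : a <= t <= c ->
  F (tens (fun s => rho (t - s)) (wave k ph)) =
  (mol (wave k ph) (derive1 rho) t + kap j k * mol (wave k (ph + pi / 2)) rho t)%:C.
Proof.
move=> act; rewrite -heqF; last exact: reflect_test.
have c0 := smooth1_continuous srho.
have s1 := smooth1_derive1 srho; have c1 := smooth1_continuous s1.
have [M hM] := bounded_support d0 c0 rhos.
have [M' hM'] := bounded_support d0 c1 (derive_support (smooth1_is_derive srho) rhos c1).
have e1 : distr_dt U (tens (fun s => rho (t - s)) (wave k ph)) =
    (mol (wave k ph) (derive1 rho) t)%:C.
  rewrite /distr_dt partial_t_tens; last exact: smooth1_reflect.
  have -> : derive1 (fun s => rho (t - s)) = (fun s => (-1) * derive1 rho (t - s)).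
    apply: derive1_is_derive => s.
    have h := is_derive_comp_affine (-1) t s (smooth1_is_derive srho).
    have e y : (-1) * y + t = t - y by rewrite mulN1r addrC.
    have e' : (fun y => rho ((-1) * y + t)) = (fun y => rho (t - y)).
      by apply/funext => y; rewrite e.
    by rewrite e e' in h.
  have c2 : continuous (fun s => (-1) * derive1 rho (t - s)).
    apply: continuous_scalef => s; apply: (@continuous_comp _ _ _ (fun s : R => t - s) (derive1 rho)).
      by apply: cvgB; [exact: cvg_cst|exact: cvg_id].
    exact: c1.
  rewrite (realtype_tens _ _ c2) -rmorphN /=; congr (_%:C).
  have -> : \int[mu]_(s in `]0, T[) (-1 * derive1 rho (t - s) * xint (wave k ph) w s) =
      -1 * mol (wave k ph) (derive1 rho) t.
    rewrite /mol -RintegralZl//; last exact: itg_molw hM'.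
    by apply: eq_Rintegral => s _; rewrite mulrA.
  by rewrite mulN1r opprK.
have e2 : U (iter (2 * j).+1 partial_x (tens (fun s => rho (t - s)) (wave k ph))) =
    ((-1) ^+ j * (kap j k * mol (wave k (ph + pi / 2)) rho t))%:C.
  rewrite iter_partial_x_tens; last exact: smooth1_wave.
  rewrite iter_derive1_wave.
  have -> : tens (fun s => rho (t - s)) (fun x => kap j k * wave k (ph + (2 * j).+1%:R * (pi / 2)) x) =
     tens (fun s => ((-1) ^+ j * kap j k) * rho (t - s)) (wave k (ph + pi / 2)).
    apply/funext => s; apply/funext => x; rewrite /tens /wave.
    have -> : k%:~R * x + (ph + (2 * j).+1%:R * (pi / 2)) = (k%:~R * x + (ph + pi / 2)) + j%:R * pi.
      by rewrite -natr1 natrM; field.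
    by rewrite cosDnpi; ring.
  rewrite (realtype_tens _ _ (continuous_scalef (x := (-1) ^+ j * kap j k) (@creflect t))); congr (_%:C); rewrite mulrA /mol -RintegralZl//; last exact: itg_molw hM.
  by apply: eq_Rintegral => s _; ring.
rewrite iter_distr_dx e1 e2.
have -> : (-1) ^+ (2 * j).+1 = -1 :> R[i] by rewrite exprS exprM sqrrN expr1n expr1n mulr1.
rewrite -signr_odd -[in (-1) ^+ j * _]signr_odd /=.
case: (odd j) => /=; rewrite ?expr1 ?expr0 ?mul1r ?mulN1r ?opprK rmorphD /=.
  by congr (_ + _); apply/eqP; rewrite eq_complex /= opprK oppr0 !eqxx.
by [].
Qed.

(** Real part of $F_k=Z_k'-i\kappa_kZ_k$ for the mollified mode $Z_k=X_k+iY_k$; the factor $-1$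
    inside $Y_k$ comes from $e^{-ikx}$. *)
Lemma moR_forcing t k : a <= t <= c -> moR F (fun s => rho (t - s)) k =
  mol (wave k 0) (derive1 rho) t + kap j k * ((-1) * mol (wave k (- (pi / 2))) rho t).
Proof.
move=> act; rewrite /moR !forcing_tens//= addr0 add0r; congr (_ + _ * _).
rewrite /mol -RintegralZl//; last first.
  have [M hM] := bounded_support d0 (smooth1_continuous srho) rhos.
  exact: itg_molw (smooth1_continuous srho) hM.
apply: eq_Rintegral => s _; rewrite mulrCA; congr (_ * _).
rewrite /xint -RintegralZl//; last exact: itg_chiw.
apply: eq_Rintegral => y _; rewrite mulrA; congr (_ * _).
by rewrite waveS mulN1r /wave cosDpihalf.
Qed.

Lemma moI_forcing t k : a <= t <= c -> moI F (fun s => rho (t - s)) k =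
  (-1) * mol (wave k (- (pi / 2))) (derive1 rho) t - kap j k * mol (wave k 0) rho t.
Proof.
move=> act; rewrite /moI !forcing_tens//= sub0r opprD mulN1r.
have -> : - (pi / 2) + pi / 2 = 0 :> R by rewrite addrC subrr.
by rewrite addrC.
Qed.

Section Psi.
Variables (psi dpsi : R -> R).
Hypotheses (hpsi : forall t : R, is_derive t (1 : R) psi (dpsi t)) (cdpsi : continuous dpsi)
  (psia : psi a = 0) (psic : psi c = 0).

(** Integration by parts turns real parts into imaginary ones and conversely, hence [~~ rot] on the
    right. The three terms come from the derivative of [psi] and from the equation for either
    factor. *)
Lemma dispersion_identity rot k m :
  (kap j k - kap j m) * pairing rho a c psi rot U U k m =
  (if rot then 1 else -1) * (pairing rho a c dpsi (~~ rot) U U k m +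
    pairing rho a c psi (~~ rot) F U k m + pairing rho a c psi (~~ rot) U F k m).
Proof.
have s1 := smooth1_derive1 srho; have c1 := smooth1_continuous s1.
have supp1 := derive_support (smooth1_is_derive srho) rhos c1.
pose X n := mol (wave n 0) rho; pose dX n := mol (wave n 0) (derive1 rho).
pose Y n (t : R) : R := (-1) * mol (wave n (- (pi / 2))) rho t.
pose dY n (t : R) : R := (-1) * mol (wave n (- (pi / 2))) (derive1 rho) t.
have hX n (t : R) : is_derive t (1 : R) (X n) (dX n t) by exact: (is_derive_mol (@wv n 0) (@wv1 n 0) d0 srho rhos t).
have hY n (t : R) : is_derive t (1 : R) (Y n) (dY n t).
  exact (is_derive_scalef (-1) (@is_derive_mol (wave n (- (pi / 2))) (@wv n (- (pi / 2)))
    (@wv1 n (- (pi / 2))) rho d d0 srho rhos t)).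
have cX n : continuous (dX n) by exact (@continuous_mol (wave n 0) (@wv n 0) (@wv1 n 0) (derive1 rho) d d0 s1 supp1).
have cY n : continuous (dY n).
  exact (@continuous_scalef (-1) _ (@continuous_mol (wave n (- (pi / 2))) (@wv n (- (pi / 2)))
    (@wv1 n (- (pi / 2))) (derive1 rho) d d0 s1 supp1)).
have inI t : t \in `[a, c]%classic -> a <= t <= c by rewrite inE /= in_itv.
have E n t : [/\ moR U (fun s => rho (t - s)) n = X n t, moI U (fun s => rho (t - s)) n = Y n t &
   a <= t <= c -> moR F (fun s => rho (t - s)) n = dX n t + kap j n * Y n t /\
    moI F (fun s => rho (t - s)) n = dY n t - kap j n * X n t].
  split; [exact: moR_real|exact: moI_real|move=> act; split; [exact: moR_forcing|exact: moI_forcing]].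
have E2 (p x1 x2 x3 x4 y1 y2 y3 y4 : R) : x1 = y1 -> x2 = y2 -> x3 = y3 -> x4 = y4 ->
  p * (x1 * x2 + x3 * x4) = p * (y1 * y2 + y3 * y4) by move=> -> -> -> ->.
have E3 (p x1 x2 x3 x4 y1 y2 y3 y4 : R) : x1 = y1 -> x2 = y2 -> x3 = y3 -> x4 = y4 ->
  p * (x1 * x2 - x3 * x4) = p * (y1 * y2 - y3 * y4) by move=> -> -> -> ->.
have UUf q : pairing rho a c q false U U k m =
    \int[mu]_(t in `[a, c]) (q t * (X k t * X m t + Y k t * Y m t)).
  apply: eq_Rintegral => t _; have [x1 y1 _] := E k t; have [x2 y2 _] := E m t.
  exact: (E2 _ _ _ _ _ _ _ _ _ x1 x2 y1 y2).
have UUt q : pairing rho a c q true U U k m =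
    \int[mu]_(t in `[a, c]) (q t * (Y k t * X m t - X k t * Y m t)).
  apply: eq_Rintegral => t _; have [x1 y1 _] := E k t; have [x2 y2 _] := E m t.
  exact: (E3 _ _ _ _ _ _ _ _ _ y1 x2 x1 y2).
have FUf q : pairing rho a c q false F U k m =
    \int[mu]_(t in `[a, c]) (q t * ((dX k t + kap j k * Y k t) * X m t + (dY k t - kap j k * X k t) * Y m t)).
  apply: eq_Rintegral => t /inI act; have [_ _ /(_ act)[x1 y1]] := E k t; have [x2 y2 _] := E m t.
  exact: (E2 _ _ _ _ _ _ _ _ _ x1 x2 y1 y2).
have FUt q : pairing rho a c q true F U k m =
    \int[mu]_(t in `[a, c]) (q t * ((dY k t - kap j k * X k t) * X m t - (dX k t + kap j k * Y k t) * Y m t)).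
  apply: eq_Rintegral => t /inI act; have [_ _ /(_ act)[x1 y1]] := E k t; have [x2 y2 _] := E m t.
  exact: (E3 _ _ _ _ _ _ _ _ _ y1 x2 x1 y2).
have UFf q : pairing rho a c q false U F k m =
    \int[mu]_(t in `[a, c]) (q t * (X k t * (dX m t + kap j m * Y m t) + Y k t * (dY m t - kap j m * X m t))).
  apply: eq_Rintegral => t /inI act; have [x1 y1 _] := E k t; have [_ _ /(_ act)[x2 y2]] := E m t.
  exact: (E2 _ _ _ _ _ _ _ _ _ x1 x2 y1 y2).
have UFt q : pairing rho a c q true U F k m =
    \int[mu]_(t in `[a, c]) (q t * (Y k t * (dX m t + kap j m * Y m t) - X k t * (dY m t - kap j m * X m t))).
  apply: eq_Rintegral => t /inI act; have [x1 y1 _] := E k t; have [_ _ /(_ act)[x2 y2]] := E m t.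
  exact: (E3 _ _ _ _ _ _ _ _ _ y1 x2 x1 y2).
case: rot => /=.
  rewrite mul1r UUt UUf FUf UFf.
  exact: (ode_sin (kap j k) (kap j m) ac hpsi cdpsi psia psic (hX k) (cX k) (hY k) (cY k) (hX m) (cX m) (hY m) (cY m)).
rewrite mulN1r UUt UUf FUt UFt.
exact: (ode_cos (kap j k) (kap j m) ac hpsi cdpsi psia psic (hX k) (cX k) (hY k) (cY k) (hX m) (cX m) (hY m) (cY m)).
Qed.
End Psi.
End Identity.
End Modes.
End Equation.

(** * Sums of pairings of the solution with itself *)

Section SumBound.
Context {R : realType}.
Local Notation mu := (@lebesgue_measure R).
Local Notation pi := (@pi R).
Local Notation kap j k := ((k%:~R : R) ^+ (2 * j).+1).
Variables (T : R) (w : R -> R -> R).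
Hypotheses (w1 : measurable_fun setT (fun p : R * R => w p.1 p.2))
  (w3 : forall t, itg `[0, 2 * pi] (fun x => w t x ^+ 2))
  (w4 : itg `]0, T[ (fun t => \int[mu]_(x in `[0, 2 * pi]) w t x ^+ 2)).
Variables (j : nat) (b : R) (F : @distr R) (rho : R -> R) (d a c : R).
Hypotheses (j1 : (1 <= j)%N) (b0 : 0 <= b) (b1 : b <= 1)
  (d0 : 0 < d) (srho : smooth1 rho) (rhoeven : forall x, rho (- x) = rho x)
  (rhos : forall x, rho x != 0 -> - d <= x <= d) (rhoM : exists M, forall x, `|rho x| <= M)
  (rho0 : forall x, 0 <= rho x) (rho1 : \int[mu]_(s in `[- d, d]) rho s <= 1)
  (ad : 0 < a - d) (cd : c + d < T) (ac : a <= c).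
Let s : R := - 2 * j%:R + 2 * j%:R * b.
Variable U : @distr R.
Hypothesis hU : forall theta k ph, continuous theta ->
  U (tens theta (wave k ph)) = distr_of_real T w (tens theta (wave k ph)).
Hypothesis heqF : forall phi, test_function T phi ->
  distr_dt U phi + (-1) ^+ j.+1 * iter (2 * j).+1 distr_dx U phi = F phi.

(** For [t] in [[a, c]] the translate of [rho] has its support inside $(0,T)$, where the convergence
    of the approximations to [V] is known. *)
Lemma approx_modes (V : @distr R) (g : nat -> R -> R -> R[i]) :
  (forall phi, test_function T phi -> schwartz phi ->
    complex.Re (distr_of (g n) phi) @[n --> \oo] --> complex.Re (V phi) /\
    complex.Im (distr_of (g n) phi) @[n --> \oo] --> complex.Im (V phi)) ->
  forall t k, a <= t <= c ->
    moR (distr_of (g n)) (fun s => rho (t - s)) k @[n --> \oo] --> moR V (fun s => rho (t - s)) k /\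
    moI (distr_of (g n)) (fun s => rho (t - s)) k @[n --> \oo] --> moI V (fun s => rho (t - s)) k.
Proof.
move=> gV t k act.
have sch ph : schwartz (tens (fun s => rho (t - s)) (wave k ph)).
  apply: (@schwartz_tens _ T); first exact: smooth1_reflect.
  move=> x /rhos /andP[h1 h2]; move: act => /andP[h3 h4].
  by have := ad; have := cd; have := d0 => *; apply/andP; split; lra.
have tst ph := reflect_test srho rhos ad cd k ph act.
have [h1 h2] := gV _ (tst 0) (sch 0).
have [h3 h4] := gV _ (tst (- (pi / 2))) (sch (- (pi / 2))).
by split; rewrite /moR /moI; [apply: cvgD|apply: cvgB].
Qed.

(** Complex conjugation: the real part is symmetric, the imaginary part antisymmetric. This moves
    the forcing into the second slot, the one measured in $X^{-2j+2jb,-b}$. *)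
Lemma pairing_swap psi rot (V W : @distr R) k m : pairing rho a c psi rot V W k m =
  (if rot then -1 else 1) * pairing rho a c psi rot W V m k.
Proof.
rewrite /pairing; case: rot; last by rewrite mul1r; apply: eq_Rintegral => t _; congr (_ * _); ring.
rewrite mulN1r -RintN; apply: eq_Rintegral => t _.
have E (p x1 x2 x3 x4 : R) : p * (x1 * x2 - x3 * x4) = - (p * (x4 * x3 - x2 * x1)) by ring.
exact: E.
Qed.

Section Bound.
Variables (psi dpsi : R -> R) (K M e : R).
Hypotheses (hpsi : forall t : R, is_derive t (1 : R) psi (dpsi t)) (cdpsi : continuous dpsi)
  (psia : psi a = 0) (psic : psi c = 0)
  (hK : forall x p, `|\int[mu]_(t in `[a, c]) (psi t * cos (x * t + p))| * (1 + x ^+ 2) ^+ 2 <= K)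
  (hK' : forall x p, `|\int[mu]_(t in `[a, c]) (dpsi t * cos (x * t + p))| * (1 + x ^+ 2) ^+ 2 <= K)
  (M0 : 0 < M) (e0 : 0 < e)
  (UM : (XTnorm j 0 b T U < M%:E)%E) (Ue : (XTnorm j s (- b) T U < e%:E)%E)
  (Fe : (XTnorm j s (- b) T F < e%:E)%E).

(** Dividing [dispersion_identity] by the gap leaves three sums, each pairing the bounded solution
    in the first slot with the small solution or the small forcing in the second; hence the factor
    3. [U] is approximated by [g] in $X^{0,b}$ and by [h] in $X^{-2j+2jb,-b}$, according to its
    slot. *)
Lemma mode_sum_bound rot (ks : seq int) (L : nat) (eta : R) (gam : int -> int -> R) :
  uniq ks -> 0 < eta ->
  (forall k m, gam k m != 0 -> k != m /\ (`|k - m| <= L%:Z)%R) ->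
  (forall k m, `|gam k m| <= 1) ->
  `|\sum_(k <- ks) \sum_(m <- ks) (gam k m * pairing rho a c psi rot U U k m)| <=
  3 * ((K * (8 * 2 ^+ j) * pi) * (2 * L).+1%:R *
    (eta * (2 * pi * M ^+ 2) + eta^-1 * (2 * pi * e ^+ 2))).
Proof.
move=> uks eta0 gz g1.
have [g [sg Xg wg]] := XT_approx M0 UM.
have [h [sh Xh wh]] := XT_approx e0 Ue.
have [f [sf Xf wf]] := XT_approx e0 Fe.
have wg' := approx_modes wg; have wh' := approx_modes wh; have wf' := approx_modes wf.
have cp := is_derive_cont hpsi.
pose bet k m := gam k m / (kap j k - kap j m).
set B := (X in 3 * X).
have bz k m : bet k m != 0 -> k != m /\ (`|k - m| <= L%:Z)%R.
  move=> h0; apply: gz; apply: contraNN h0 => /eqP h0.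
  by rewrite /bet h0 mul0r.
have D0 k m : k != m -> kap j k - kap j m != 0.
  by move=> km; have [h0 _] := dispersion_gap (R := R) j1 km; rewrite -normr_gt0 (lt_le_trans _ h0).
have bD k m : `|bet k m| * `|kap j k - kap j m| <= 1.
  rewrite -normrM /bet; have [->|km] := eqVneq (kap j k - kap j m) 0.
    by rewrite mulr0 normr0.
  by rewrite mulfVK.
have bz' sgn k m : sgn * bet m k != 0 -> k != m /\ (`|k - m| <= L%:Z)%R.
  rewrite mulf_eq0 negb_or => /andP[_ /bz[h1 h2]]; split; first by rewrite eq_sym.
  by rewrite distrC.
have bD' (r : bool) k m : `|(if r then -1 else 1) * bet m k| * `|kap j k - kap j m| <= 1.
  have -> : `|(if r then -1 else 1) * bet m k| = `|bet m k|.
    by case: r; rewrite ?mulN1r ?normrN ?mul1r.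
  by rewrite [X in _ * X]distrC.
have H1 := pairing_sum_bound d0 srho rhoeven rhos rhoM rho0 rho1 j1 b0 b1 cdpsi hK'
   sg sh Xg Xh wg' wh' (~~ rot) uks eta0 bz bD.
have H2 := pairing_sum_bound d0 srho rhoeven rhos rhoM rho0 rho1 j1 b0 b1 cp hK
   sg sf Xg Xf wg' wf' (~~ rot) uks eta0 (bz' _) (bD' (~~ rot)).
have H3 := pairing_sum_bound d0 srho rhoeven rhos rhoM rho0 rho1 j1 b0 b1 cp hK
   sg sf Xg Xf wg' wf' (~~ rot) uks eta0 bz bD.
have id k m := dispersion_identity w1 w3 w4 d0 srho rhos ad cd ac hU heqF hpsi cdpsi psia psic rot k m.
have -> : \sum_(k <- ks) \sum_(m <- ks) (gam k m * pairing rho a c psi rot U U k m) =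
  (if rot then 1 else -1) *
  (\sum_(k <- ks) \sum_(m <- ks) (bet k m * pairing rho a c dpsi (~~ rot) U U k m) +
   \sum_(k <- ks) \sum_(m <- ks) ((if ~~ rot then -1 else 1) * bet m k * pairing rho a c psi (~~ rot) U F k m) +
   \sum_(k <- ks) \sum_(m <- ks) (bet k m * pairing rho a c psi (~~ rot) U F k m)).
  rewrite [X in _ + X + _]exchange_big /= -!big_split /= mulr_sumr; apply: eq_bigr => k _.
  rewrite -!big_split /= mulr_sumr; apply: eq_bigr => m _.
  (* Where [gam] vanishes both sides are 0; elsewhere [k != m], and the division by the gap is
     legitimate. *)
  have [g00|gn0] := eqVneq (gam k m) 0; first by rewrite /bet g00 !mul0r !(mulr0, mul0r, addr0).
  have [km _] := gz k m gn0.
  have E (D x y : R) : D != 0 -> D * x = y -> x = y / D.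
    by move=> Dn <-; field.
  have E4 (g0 Di x1 x2 P1 P2 P3 : R) : g0 * ((x1 * (P1 + x2 * P2 + P3)) * Di) =
      x1 * (g0 * Di * P1 + x2 * (g0 * Di) * P2 + g0 * Di * P3) by ring.
  rewrite (E _ _ _ (D0 k m km) (id k m)) /bet (pairing_swap _ _ F).
  exact: E4.
have E5 (r : bool) (x y z : R) : `|x| <= B -> `|y| <= B -> `|z| <= B ->
    `|(if r then 1 else -1) * (x + y + z)| <= 3 * B.
  move=> hx hy hz; have -> : `|(if r then 1 else -1) * (x + y + z)| = `|x + y + z|.
    by case: r; rewrite ?mulN1r ?normrN ?mul1r.
  have h1 := ler_normD (x + y) z; have h2 := ler_normD x y; lra.
exact: E5 H1 H2 H3.
Qed.
End Bound.
End SumBound.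

(** * Removal of the mollifier *)

Section ModesBound.
Context {R : realType}.
Local Notation mu := (@lebesgue_measure R).
Local Notation pi := (@pi R).
Variables (T : R) (w : R -> R -> R).
Hypotheses (w1 : measurable_fun setT (fun p : R * R => w p.1 p.2))
  (w3 : forall t, itg `[0, 2 * pi] (fun x => w t x ^+ 2))
  (w4 : itg `]0, T[ (fun t => \int[mu]_(x in `[0, 2 * pi]) w t x ^+ 2)).

Lemma Rint_oo_cc (a c : R) (f : R -> R) : a < c -> itg `[a, c] f ->
  \int[mu]_(t in `[a, c]) f t = \int[mu]_(t in `]a, c[) f t.
Proof.
move=> ac itf.
rewrite -Rintegral_itv_obnd_cbnd; last first.
  by apply: (integrableS _ _ _ itf) => //; apply: subset_itvr; rewrite bnd_simp.
rewrite -Rintegral_itv_bndo_bndc//.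
by apply: (integrableS _ _ _ itf) => //; exact: subset_itv_oo_cc.
Qed.

Section Moll.
Variables (a c delta : R) (rho : nat -> R -> R).
Hypotheses (ac : a < c) (d0 : 0 < delta) (ad : 0 < a - delta) (cd : c + delta < T)
  (srho : forall n, smooth1 (rho n)) (rho0 : forall n x, 0 <= rho n x)
  (rhos : forall n x, rho n x != 0 -> - delta <= x <= delta)
  (rhoI : forall n a b t, a + delta <= t -> t <= b - delta ->
        \int[mu]_(s in `[a, b]) rho n (t - s) = 1)
  (rhoJ : forall n a b s, a <= b -> \int[mu]_(t in `[a, b]) rho n (t - s) <= 1)
  (rhoB : forall n, exists B, forall x, rho n x <= B)
  (rhoC : forall eta, 0 < eta -> exists N, forall n, (N <= n)%N ->
       forall x, eta <= `|x| -> rho n x = 0).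

Section Chi.
Variable (chi : R -> R).
Hypotheses (cchi : continuous chi) (chi1 : forall x, `|chi x| <= 1).

Let v := (xint chi w) \_ `]0, T[.

Let mv : measurable_fun setT v.
Proof. by apply/(measurable_restrictT _ _).1 => //; exact: measurable_xintw. Qed.

Let iv : itg setT (fun t => v t ^+ 2).
Proof.
have h := itg_xintw_sq w1 w3 w4 cchi chi1.
have -> : (EFin \o (fun t => v t ^+ 2)) = ((EFin \o (fun t => xint chi w t ^+ 2)) \_ `]0, T[).
  apply/funext => t; rewrite /= /v !patchE; case: ifPn => // _.
  by rewrite expr0n.
exact: (integrable_mkcond _ _).1.
Qed.

(** Mollifying the zero extension [v] is a kernel operator on [[0, T]] evaluated on []a, c[]; this
    interval keeps a distance greater than [delta] from both ends, so the kernel has full mass there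
    and [approx_id_L2] applies. *)
Lemma mol_cvg_L2 :
  [/\ forall n, measurable_fun `]a, c[ (mol T w chi (rho n)),
    measurable_fun `]a, c[ (xint chi w),
    forall n, itg `]a, c[ (fun t => mol T w chi (rho n) t ^+ 2),
    itg `]a, c[ (fun t => xint chi w t ^+ 2) &
    \int[mu]_(t in `]a, c[) (mol T w chi (rho n) t - xint chi w t) ^+ 2 @[n --> \oo] --> (0 : R)].
Proof.
have sub : `]a, c[ `<=` (`]0, T[ : set R).
  move=> t /=; rewrite !in_itv /= => /andP[h1 h2].
  by have := ad; have := cd; have := d0 => *; apply/andP; split; lra.
have cmol n : continuous (mol T w chi (rho n)).
  exact (@continuous_mol R T w w1 w3 w4 chi cchi chi1 (rho n) delta d0 (srho n) (@rhos n)).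
have mI D : measurable D -> measurable_fun D v.
  by move=> mD; apply: (measurable_funS measurableT).
have molE n t : mol T w chi (rho n) t = kconv 0 T (fun n x y => rho n (x - y)) n v t.
  rewrite /mol /kconv Rintegral_mkcond [RHS]Rintegral_mkcond; apply: eq_Rintegral => s _.
  rewrite /v !patchE; case: ifPn => sT; case: ifPn => sT' //; rewrite ?mulr0//.
  by exfalso; move: sT sT'; rewrite !notin_setE !inE /= !in_itv /= => /andP[/ltW-> /ltW->].
have vE t : t \in `]a, c[%classic -> v t = xint chi w t.
  by rewrite inE => /sub tT; rewrite /v patchE mem_set.
split.
- by move=> n; apply: measurable_cont => //; exact: cmol.
- by apply: (measurable_funS _ sub) => //; exact: measurable_xintw.
- move=> n; apply: (@integrableS _ _ _ mu `[a, c]) => //; first exact: subset_itv_oo_cc.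
  apply: itg_cont => t; rewrite /continuous_at expr2; under eq_fun do rewrite expr2.
  by apply: cvgM; exact: cmol.
- by apply: (@integrableS _ _ _ mu `]0, T[) => //; exact: itg_xintw_sq.
have k0 : 0 <= a by have := ad; have := d0 => *; lra.
have kT : c <= T by have := cd; have := d0 => *; lra.
pose B n := sval (cid (rhoB n)).
have H : \int[mu]_(x in `]a, c[) (kconv 0 T (fun n x y => rho n (x - y)) n v x - v x) ^+ 2
    @[n --> \oo] --> (0 : R).
  apply: (@approx_id_L2 R 0 T a c (fun n x y => rho n (x - y)) B k0 kT).
  - move=> n x y; apply: (@continuous_comp _ _ _ (fun y : R => x - y) (rho n)).
      by apply: cvgB; [exact: cvg_cst|exact: cvg_id].
    exact: smooth1_continuous.
  - move=> n; apply: measurable_prB; apply: continuous_measurable_fun.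
    exact: smooth1_continuous.
  - by move=> n x y; exact: rho0.
  - by move=> n x y; rewrite /B; case: (cid (rhoB n)) => /= B' hB'; exact: hB'.
  - move=> n x /andP[h1 h2]; have := ad; have := cd => *; apply: rhoI; lra.
  - move=> n y _; have ic : itg `[a, c] (fun x => rho n (x - y)).
      apply: itg_cont => x; apply: (@continuous_comp _ _ _ (fun x : R => x - y) (rho n)).
        by apply: cvgB; [exact: cvg_id|exact: cvg_cst].
      exact: smooth1_continuous.
    by rewrite -Rint_oo_cc//; apply: rhoJ; exact: ltW.
  - move=> x _ eta e eta0 e0; have [N hN] := rhoC eta0; exists N => n Nn y _ xy.
    by rewrite (hN n Nn); [exact: ltW|rewrite distrC].
  - exact: mI.
  - by apply: (integrableS measurableT).
apply: cvg_trans H; apply: near_eq_cvg; apply: nearW => n.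
by apply: eq_Rintegral => t tac; rewrite -molE vE.
Qed.
End Chi.

Variable U : @distr R.
Hypothesis hU : forall theta k ph, continuous theta ->
  U (tens theta (wave k ph)) = distr_of_real T w (tens theta (wave k ph)).
Local Notation A k := (xint (wave k 0) w).
Local Notation B k := (xint (wave k (- (pi / 2))) w).

(** The sign in the second limit comes from $Z_k=A_k-iB_k$: the imaginary part of a mode is minus
    its sine coefficient. *)
Lemma pairing_moll_cvg (psi : R -> R) k m : continuous psi ->
  pairing (rho n) a c psi false U U k m @[n --> \oo] -->
    \int[mu]_(t in `]a, c[) (psi t * (A k t * A m t + B k t * B m t)) /\
  pairing (rho n) a c psi true U U k m @[n --> \oo] -->
    - \int[mu]_(t in `]a, c[) (psi t * (B k t * A m t - A k t * B m t)).
Proof.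
move=> cpsi.
have wc l ph : continuous (@wave R l ph) by exact: wave_cont.
have wl l ph x : `|@wave R l ph x| <= 1 by exact: wave_le1.
have L l ph := mol_cvg_L2 (@wc l ph) (@wl l ph).
have [Mp _ hMp] := itv_bounded (ltW ac) cpsi.
have mp : measurable_fun `]a, c[ psi by exact: measurable_cont.
have P l ph l' ph' :
    \int[mu]_(t in `]a, c[) (psi t * (mol T w (wave l ph) (rho n) t * mol T w (wave l' ph') (rho n) t))
    @[n --> \oo] --> \int[mu]_(t in `]a, c[) (psi t * (xint (wave l ph) w t * xint (wave l' ph') w t)).
  have [m1 m2 i1 i2 cv] := L l ph; have [m1' m2' i1' i2' cv'] := L l' ph'.
  by apply: (cvg_prod_L2 _ mp hMp m1 m2 m1' m2' i1 i2 i1' i2' cv cv').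
have Pi l ph l' ph' : itg `]a, c[ (fun t => psi t * (xint (wave l ph) w t * xint (wave l' ph') w t)).
  have [m1 m2 i1 i2 cv] := L l ph; have [m1' m2' i1' i2' cv'] := L l' ph'.
  by apply: (itgM_bdd (M := Mp)) => //; exact: itg_mulL2.
have cm n l ph : continuous (mol T w (wave l ph) (rho n)).
  exact (@continuous_mol R T w w1 w3 w4 (wave l ph) (@wc l ph) (@wl l ph) (rho n) delta d0 (srho n) (@rhos n)).
have ci n l ph l' ph' : continuous (fun t => psi t * (mol T w (wave l ph) (rho n) t * mol T w (wave l' ph') (rho n) t)).
  exact (continuous_mulf cpsi (continuous_mulf (cm n l ph) (cm n l' ph'))).
have Mi n l ph l' ph' : itg `]a, c[ (fun t => psi t * (mol T w (wave l ph) (rho n) t * mol T w (wave l' ph') (rho n) t)).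
  apply: (@integrableS _ _ _ mu `[a, c]) => //; first exact: subset_itv_oo_cc.
  exact: itg_cont (ci n l ph l' ph').
have rl n t l : moR U (fun s => rho n (t - s)) l = mol T w (wave l 0) (rho n) t.
  by apply: moR_real.
have il n t l : moI U (fun s => rho n (t - s)) l = (-1) * mol T w (wave l (- (pi / 2))) (rho n) t.
  by apply: moI_real.
split.
- have -> : \int[mu]_(t in `]a, c[) (psi t * (A k t * A m t + B k t * B m t)) =
    \int[mu]_(t in `]a, c[) (psi t * (A k t * A m t)) + \int[mu]_(t in `]a, c[) (psi t * (B k t * B m t)).
    rewrite -RintegralD//; [|exact: Pi..].
    by apply: eq_Rintegral => t _; rewrite mulrDr.
  apply: cvg_trans (cvgD (P k 0 m 0) (P k (- (pi / 2)) m (- (pi / 2)))).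
  apply: near_eq_cvg; apply: nearW => n; rewrite /pairing.
  transitivity (\int[mu]_(t in `[a, c]) (psi t * (mol T w (wave k 0) (rho n) t * mol T w (wave m 0) (rho n) t) +
     psi t * (mol T w (wave k (- (pi / 2))) (rho n) t * mol T w (wave m (- (pi / 2))) (rho n) t))).
    rewrite Rint_oo_cc//; last by exact: itg_cont (continuous_addf (ci n k 0 m 0) (ci n k (- (pi / 2)) m (- (pi / 2)))).
    by rewrite RintegralD//; exact: Mi.
  have E1 (p x x' y y' r r' i i' : R) : r = x -> r' = x' -> i = -1 * y -> i' = -1 * y' ->
    p * (r * r' + i * i') = p * (x * x') + p * (y * y') by move=> -> -> -> ->; ring.
  by apply: eq_Rintegral => t _ /=; exact: (esym (E1 _ _ _ _ _ _ _ _ _ (rl n t k) (rl n t m) (il n t k) (il n t m))).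
- have -> : (- \int[mu]_(t in `]a, c[) (psi t * (B k t * A m t - A k t * B m t)))%R =
    \int[mu]_(t in `]a, c[) (psi t * (A k t * B m t)) - \int[mu]_(t in `]a, c[) (psi t * (B k t * A m t)).
    rewrite -RintegralB//; [|exact: Pi..]; rewrite -RintN.
    by apply: eq_Rintegral => t _; rewrite mulrBr opprB.
  apply: cvg_trans (cvgB (P k 0 m (- (pi / 2))) (P k (- (pi / 2)) m 0)).
  apply: near_eq_cvg; apply: nearW => n; rewrite /pairing.
  transitivity (\int[mu]_(t in `[a, c]) (psi t * (mol T w (wave k 0) (rho n) t * mol T w (wave m (- (pi / 2))) (rho n) t) -
     psi t * (mol T w (wave k (- (pi / 2))) (rho n) t * mol T w (wave m 0) (rho n) t))).
    rewrite Rint_oo_cc//; last by exact: itg_cont (continuous_subf (ci n k 0 m (- (pi / 2))) (ci n k (- (pi / 2)) m 0)).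
    by rewrite RintegralB//; exact: Mi.
  have E1 (p x x' y y' r r' i i' : R) : r = x -> r' = x' -> i = -1 * y -> i' = -1 * y' ->
    p * (i * r' - r * i') = p * (x * y') - p * (y * x') by move=> -> -> -> ->; ring.
  by apply: eq_Rintegral => t _ /=; exact: (esym (E1 _ _ _ _ _ _ _ _ _ (rl n t k) (rl n t m) (il n t k) (il n t m))).
Qed.
End Moll.

Local Notation A k := (xint (wave k 0) w).
Local Notation B k := (xint (wave k (- (pi / 2))) w).

Section Final.
Variables (j : nat) (b : R) (F : @distr R) (a c : R) (psi dpsi : R -> R) (K M e : R).
Hypotheses (j1 : (1 <= j)%N) (b0 : 0 <= b) (b1 : b <= 1) (a0 : 0 < a) (ac : a < c) (cT : c < T).
Let s : R := - 2 * j%:R + 2 * j%:R * b.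
Variable U : @distr R.
Hypothesis hU : forall theta k ph, continuous theta ->
  U (tens theta (wave k ph)) = distr_of_real T w (tens theta (wave k ph)).
Hypothesis heqF : forall phi, test_function T phi ->
  distr_dt U phi + (-1) ^+ j.+1 * iter (2 * j).+1 distr_dx U phi = F phi.
Hypotheses (hpsi : forall t : R, is_derive t (1 : R) psi (dpsi t)) (cdpsi : continuous dpsi)
  (psia : psi a = 0) (psic : psi c = 0)
  (hK : forall x p, `|\int[mu]_(t in `[a, c]) (psi t * cos (x * t + p))| * (1 + x ^+ 2) ^+ 2 <= K)
  (hK' : forall x p, `|\int[mu]_(t in `[a, c]) (dpsi t * cos (x * t + p))| * (1 + x ^+ 2) ^+ 2 <= K)
  (M0 : 0 < M) (e0 : 0 < e)
  (UM : (XTnorm j 0 b T U < M%:E)%E) (Ue : (XTnorm j s (- b) T U < e%:E)%E)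
  (Fe : (XTnorm j s (- b) T F < e%:E)%E).

(** The bound of [mode_sum_bound] does not involve the mollifier, so it survives the limit in which
    the mollifier concentrates. *)
Lemma modes_bound (ks : seq int) (L : nat) (eta : R) (gam : int -> int -> R) :
  uniq ks -> 0 < eta ->
  (forall k m, gam k m != 0 -> k != m /\ (`|k - m| <= L%:Z)%R) ->
  (forall k m, `|gam k m| <= 1) ->
  let Bnd := 3 * ((K * (8 * 2 ^+ j) * pi) * (2 * L).+1%:R *
    (eta * (2 * pi * M ^+ 2) + eta^-1 * (2 * pi * e ^+ 2))) in
  `|\sum_(k <- ks) \sum_(m <- ks) (gam k m *
     \int[mu]_(t in `]a, c[) (psi t * (A k t * A m t + B k t * B m t)))| <= Bnd /\
  `|\sum_(k <- ks) \sum_(m <- ks) (gam k m *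
     \int[mu]_(t in `]a, c[) (psi t * (B k t * A m t - A k t * B m t)))| <= Bnd.
Proof.
move=> uks eta0 gz g1 Bnd.
(* Half the distance from [[a, c]] to the ends of $(0,T)$, so that the translated mollifiers stay
   supported inside. *)
pose delta := Num.min a (T - c) / 2.
have m0 : 0 < Num.min a (T - c) by rewrite lt_min a0 subr_gt0.
have d0 : 0 < delta by rewrite divr_gt0.
have m1 : Num.min a (T - c) <= a by rewrite ge_min lexx.
have m2 : Num.min a (T - c) <= T - c by rewrite ge_min lexx orbT.
have ad : 0 < a - delta by rewrite /delta; move: m0 m1; set z := Num.min _ _ => *; lra.
have cd : c + delta < T by rewrite /delta; move: m0 m2; set z := Num.min _ _ => *; lra.
have [rho [srho rho0 rhoeven rhos [rhoI rhoJ rhoB rhoC]]] := mollifier_exists d0.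
have cp := is_derive_cont hpsi.
have cv k m := pairing_moll_cvg ac d0 ad cd srho rho0 rhos rhoI rhoJ rhoB rhoC hU k m cp.
have rhoM n : exists M', forall x, `|rho n x| <= M'.
  by have [B' hB'] := rhoB n; exists B' => x; rewrite ger0_norm.
have rho1 n : \int[mu]_(s in `[- delta, delta]) rho n s <= 1.
  have dd : - delta <= delta by move: d0 => *; lra.
  by have := rhoJ n (- delta) delta 0 dd; under eq_Rintegral do rewrite subr0.
have bnd n rot := mode_sum_bound w1 w3 w4 j1 b0 b1 d0 (srho n) (rhoeven n) (@rhos n) (rhoM n)
  (rho0 n) (rho1 n) ad cd (ltW ac) hU heqF hpsi cdpsi psia psic hK hK' M0 e0 UM Ue Fe rot uks eta0 gz g1.
have lim rot (l : int -> int -> R) : (forall k m, pairing (rho n) a c psi rot U U k m @[n --> \oo] --> l k m) ->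
    `|\sum_(k <- ks) \sum_(m <- ks) (gam k m * l k m)| <= Bnd.
  move=> hl.
  have h : `|\sum_(k <- ks) \sum_(m <- ks) (gam k m * pairing (rho n) a c psi rot U U k m)|
     @[n --> \oo] --> `|\sum_(k <- ks) \sum_(m <- ks) (gam k m * l k m)|.
    apply: cvg_norm; apply: cvg_sum_seq => k; apply: cvg_sum_seq => m.
    exact: cvg_scale.
  rewrite -(cvg_lim _ h)//; apply: limr_le; first by apply/cvg_ex; eexists; exact: h.
  by apply: nearW => n; exact: bnd.
split; first by apply: (lim false) => k m; have [] := cv k m.
have := lim true (fun k m => - \int[mu]_(t in `]a, c[) (psi t * (B k t * A m t - A k t * B m t)))
  (fun k m => (cv k m).2).
have -> : \sum_(k <- ks) \sum_(m <- ks) (gam k m *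
     - \int[mu]_(t in `]a, c[) (psi t * (B k t * A m t - A k t * B m t))) =
  - \sum_(k <- ks) \sum_(m <- ks) (gam k m *
     \int[mu]_(t in `]a, c[) (psi t * (B k t * A m t - A k t * B m t))).
  rewrite -sumrN; apply: eq_bigr => k _; rewrite -sumrN; apply: eq_bigr => m _.
  by rewrite mulrN.
by rewrite normrN.
Qed.
End Final.
End ModesBound.

(** * Fejer means and windows *)

Section Fiber.
Context {R : realType}.
Local Notation mu := (@lebesgue_measure R).
Local Notation pi := (@pi R).

Definition freqs (N : nat) : seq int := [seq i%:Z - N%:Z | i <- iota 0 (2 * N).+1].

Lemma freqs_uniq N : uniq (freqs N).
Proof. by rewrite map_inj_uniq ?iota_uniq// => i i' /(addIr _) []. Qed.

Lemma big_freqs N (h : int -> R) :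
  \sum_(k <- freqs N) h k = \sum_(i < (2 * N).+1) h (i%:Z - N%:Z).
Proof. by rewrite big_map -(big_mkord xpredT (fun i => h (i%:Z - N%:Z))) /index_iota subn0. Qed.

Lemma big_freqs_odd N (h : int -> R) : (forall k, h (- k) = - h k) ->
  \sum_(k <- freqs N) h k = 0.
Proof.
move=> hodd; have E : \sum_(k <- freqs N) h k = - \sum_(k <- freqs N) h k.
  rewrite {1}big_freqs (reindex_inj rev_ord_inj) /= big_freqs -sumrN.
  apply: eq_bigr => i _; rewrite -hodd; congr (h _).
  by have := ltn_ord i; lia.
by lra.
Qed.

(* [a k + i p k] are the terms of a complex sum whose value is real. *)
Lemma double_sum_sqr (I : Type) (s : seq I) (a p : I -> R) : \sum_(k <- s) p k = 0 ->
  (\sum_(k <- s) a k) ^+ 2 = \sum_(k <- s) \sum_(m <- s) (a k * a m + p k * p m).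
Proof.
move=> p0; transitivity ((\sum_(k <- s) a k) ^+ 2 + (\sum_(k <- s) p k) ^+ 2).
  by rewrite p0 expr0n addr0.
rewrite !expr2 !mulr_suml -big_split /=; apply: eq_bigr => k _.
by rewrite !mulr_sumr -big_split.
Qed.

Lemma int_pi2_norm (f : R -> R) : measurable_fun `[0, 2 * pi] f -> (forall x, `|f x| <= 1) ->
  `|\int[mu]_(x in `[0, 2 * pi]) f x| <= 2 * pi.
Proof.
move=> mf f1; have p0 : 0 <= 2 * pi by rewrite mulr_ge0// pi_ge0.
apply: (@le_trans _ _ (\int[mu]_(x in `[0, 2 * pi]) 1)).
  by apply: Rint_bound => //; apply: (@itg_bdd _ _ _ 1) => //; [exact: mu_itv_lty|move=> *; rewrite normr1].
by rewrite Rint_cst_itv// subr0 mul1r.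
Qed.

Section Window.
Variables (L : nat) (x0 : R).

Definition qc (l : int) : R := \int[mu]_(x in `[0, 2 * pi]) (cospow L (x - x0) * cos (l%:~R * x)).
Definition qs (l : int) : R := \int[mu]_(x in `[0, 2 * pi]) (cospow L (x - x0) * sin (l%:~R * x)).

Let cqc l : continuous (fun x : R => cospow L (x - x0) * cos (l%:~R * x)).
Proof. by apply: continuous_mulf; [exact: continuous_cospowB|exact: continuous_cosl]. Qed.
Let cqs l : continuous (fun x : R => cospow L (x - x0) * sin (l%:~R * x)).
Proof. by apply: continuous_mulf; [exact: continuous_cospowB|exact: continuous_sinl]. Qed.

Lemma qc_far l : (L < `|l|)%N -> qc l = 0.
Proof.
move=> Ll; rewrite -[RHS](@int_cospow_cos0 R L l x0 0 Ll).
by apply: eq_Rintegral => x _; rewrite addr0.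
Qed.

Lemma qs_far l : (L < `|l|)%N -> qs l = 0. Proof. exact: int_cospow_sin0. Qed.

Lemma qc_0 : qc 0 = cpmass L.
Proof.
rewrite -(cpmass_shift2 L x0); apply: eq_Rintegral => x _.
by rewrite mul0r cos0 mulr1.
Qed.

Lemma qs_0 : qs 0 = 0.
Proof.
rewrite /qs (_ : \int[mu]_(x in _) _ = \int[mu]_(x in `[0, 2 * pi]) (0 : R)).
  by rewrite Rint_cst_itv ?mul0r// mulr_ge0// pi_ge0.
by apply: eq_Rintegral => x _; rewrite mul0r sin0 mulr0.
Qed.

Let cp1 z : `|@cospow R L z| <= 1. Proof. by rewrite ger0_norm ?cospow_ge0// cospow_le1. Qed.

Lemma qc_le l : `|qc l| <= 2 * pi.
Proof.
apply: int_pi2_norm; first by apply: measurable_cont => //; exact: cqc.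
by move=> x; rewrite normrM mulr_ile1// cos_max.
Qed.

Lemma qs_le l : `|qs l| <= 2 * pi.
Proof.
apply: int_pi2_norm; first by apply: measurable_cont => //; exact: cqs.
by move=> x; rewrite normrM mulr_ile1// sin_max.
Qed.
End Window.

(** Factor by which the truncation kernel multiplies frequency [k]. It includes the $(2\pi)^{-1}$ of
    the Fourier series, as the coefficients [mC] and [mS] are not normalised. *)
Definition fg (N : nat) (k : int) : R := cpcoef N k / cpmass N.

Lemma fg_le N k : `|fg N k| <= (2 * pi)^-1.
Proof.
rewrite /fg normrM normfV (ger0_norm (ltW (cpmass_gt0 N))) ler_pdivrMr ?cpmass_gt0//.
exact: cpcoef_bound.
Qed.

Lemma fgN N k : fg N (- k) = fg N k.
Proof. by rewrite /fg cpcoefN. Qed.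

Lemma cpmass_0 : cpmass 0 = 2 * pi :> R.
Proof.
rewrite /cpmass (_ : \int[mu]_(x in _) _ = \int[mu]_(x in `[0, 2 * pi]) (1 : R)).
  by rewrite Rint_cst_itv ?mulr_ge0 ?pi_ge0// subr0 mul1r.
by apply: eq_Rintegral => x _; rewrite /cospow expr0.
Qed.

(** The diagonal is removed because it reproduces the mean of the window times the energy. What
    remains is at most $(2\pi)^{-2}\cdot2\pi\le1$ and lives in the band of width [L], the degree of
    the window. *)
Definition gamC N L x0 (k m : int) : R :=
  if k == m then 0 else fg N k * fg N m * qc L x0 (k - m).
Definition gamS N L x0 (k m : int) : R :=
  if k == m then 0 else fg N k * fg N m * qs L x0 (k - m).

Let gam_le N k m (q : R) : `|q| <= 2 * pi -> `|fg N k * fg N m * q| <= 1.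
Proof.
move=> hq; have p2 : 2 <= 2 * pi :> R by have := pi_ge2 R; lra.
have p1 : 0 <= (2 * pi)^-1 :> R by rewrite invr_ge0; lra.
rewrite (normrM _ q) (normrM (fg N k)).
apply: (@le_trans _ _ ((2 * pi)^-1 * (2 * pi)^-1 * (2 * pi))).
  have h : `|fg N k| * `|fg N m| <= (2 * pi)^-1 * (2 * pi)^-1 by apply: ler_pM => //; exact: fg_le.
  by apply: ler_pM.
rewrite -mulrA mulVf ?gt_eqF ?mulr1 ?invf_le1//; lra.
Qed.

Lemma gamC_spec N L x0 k m : `|gamC N L x0 k m| <= 1 /\
  (gamC N L x0 k m != 0 -> k != m /\ (`|k - m| <= L%:Z)%R).
Proof.
rewrite /gamC; case: eqVneq => [_|km]; first by rewrite normr0 eqxx.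
split; first by apply: gam_le; exact: qc_le.
move=> h; split=> //; rewrite leNgt; apply/negP => h'; move/eqP: h; apply.
by rewrite qc_far ?mulr0//; lia.
Qed.

Lemma gamS_spec N L x0 k m : `|gamS N L x0 k m| <= 1 /\
  (gamS N L x0 k m != 0 -> k != m /\ (`|k - m| <= L%:Z)%R).
Proof.
rewrite /gamS; case: eqVneq => [_|km]; first by rewrite normr0 eqxx.
split; first by apply: gam_le; exact: qs_le.
move=> h; split=> //; rewrite leNgt; apply/negP => h'; move/eqP: h; apply.
by rewrite qs_far ?mulr0//; lia.
Qed.

Section Fun.
Variable (v : R -> R).
Hypotheses (mv : measurable_fun setT v) (iv : itg `[0, 2 * pi] (fun x => v x ^+ 2)).
Let P0 : 0 < 2 * pi. Proof. by rewrite mulr_gt0// pi_gt0. Qed.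

Let mI D : measurable D -> measurable_fun D v.
Proof. by move=> mD; apply: (measurable_funS measurableT). Qed.

Let iv1 : itg `[0, 2 * pi] v.
Proof. by apply: itg_L2_L1 => //; [exact: mu_itv_lty|exact: mI]. Qed.

Definition mC k := \int[mu]_(y in `[0, 2 * pi]) (wave k 0 y * v y).
Definition mS k := \int[mu]_(y in `[0, 2 * pi]) (wave k (- (pi / 2)) y * v y).

Let iwv k ph : itg `[0, 2 * pi] (fun y => wave k ph y * v y).
Proof.
apply: (itgM_bdd (M := 1)) => //; last by move=> x _; exact: wave_le1.
by apply: measurable_cont => //; exact: wave_cont.
Qed.

Lemma mCN k : mC (- k) = mC k.
Proof. by apply: eq_Rintegral => y _; rewrite !waveC mulrNz mulNr cosN. Qed.

Lemma mSN k : mS (- k) = - mS k.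
Proof.
rewrite /mS -RintN; apply: eq_Rintegral => y _.
by rewrite !waveS mulrNz mulNr sinN mulNr.
Qed.

(** The kernel is the normalised power of the raised cosine, that is de la Vallee-Poussin's kernel.
    Like Fejer's it is nonnegative, of mass 1, concentrated at the origin and a trigonometric
    polynomial of degree [N]. *)
Definition fejer (N : nat) (x : R) : R :=
  kconv 0 (2 * pi) (fun n x y => (cpmass n)^-1 * cospow n (x - y)) N v x.

Lemma fejerE N x : fejer N x = \sum_(k <- freqs N)
  (fg N k * (cos (k%:~R * x) * mC k + sin (k%:~R * x) * mS k)).
Proof.
rewrite /fejer /kconv.
transitivity (\int[mu]_(y in `[0, 2 * pi]) \sum_(k <- freqs N)
   (fg N k * cos (k%:~R * x) * (wave k 0 y * v y) + fg N k * sin (k%:~R * x) * (wave k (- (pi / 2)) y * v y))).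
  apply: eq_Rintegral => y _.
  rewrite (cospow_expand (x - y) (leqnn N)) -(big_freqs N (fun k => cpcoef N k * cos (k%:~R * (x - y)))).
  rewrite mulr_sumr mulr_suml; apply: eq_bigr => k _.
  by rewrite waveC waveS mulrBr cosB /fg; ring.
rewrite Rint_sum//; last first.
  by move=> k; apply: itgD => //; apply: itgZl => //; exact: iwv.
apply: eq_bigr => k _; rewrite Rint_lin//; try exact: iwv.
by rewrite -/(mC k) -/(mS k); ring.
Qed.

(** [fejer] is a sum of complex terms whose real parts are those of [fejerE] and whose imaginary
    parts are odd in [k], hence of sum 0. Taking the squared modulus of the complex sum leaves only
    the differences [k - m] as frequencies. *)
Lemma fejer_sqr N x : fejer N x ^+ 2 = \sum_(k <- freqs N) \sum_(m <- freqs N)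
  ((fg N k * fg N m) * (cos ((k - m)%:~R * x) * (mC k * mC m + mS k * mS m) +
     sin ((k - m)%:~R * x) * (mS k * mC m - mC k * mS m))).
Proof.
rewrite fejerE (@double_sum_sqr _ (freqs N)
  (fun k => fg N k * (cos (k%:~R * x) * mC k + sin (k%:~R * x) * mS k))
  (fun k => fg N k * (sin (k%:~R * x) * mC k - cos (k%:~R * x) * mS k))); last first.
  apply: big_freqs_odd => k; rewrite fgN mCN mSN mulrNz mulNr sinN cosN; ring.
apply: eq_bigr => k _; apply: eq_bigr => m _.
have E (g g' C C' S S' c c' s s' : R) : g * (c * C + s * S) * (g' * (c' * C' + s' * S')) +
    g * (s * C - c * S) * (g' * (s' * C' - c' * S')) =
  (g * g') * ((c * c' + s * s') * (C * C' + S * S') + (s * c' - c * s') * (S * C' - C * S')) by ring.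
by rewrite intrB mulrBl cosB sinB; exact: E.
Qed.

Lemma continuous_fejer N : continuous (fejer N).
Proof.
apply: (@continuous_param R `[0, 2 * pi] (fun x y => (cpmass N)^-1 * cospow N (x - y) * v y)
  (fun y => (cpmass N)^-1 * `|v y|)) => //.
- move=> x; apply: measurable_funM; last exact: mI.
  apply: measurable_cont => //; apply: continuous_scalef => y.
  apply: (@continuous_comp _ _ _ (fun y : R => x - y) (cospow N)).
    by apply: cvgB; [exact: cvg_cst|exact: cvg_id].
  exact: continuous_cospow.
- move=> y; apply: continuous_mulf; last by move=> ?; exact: cvg_cst.
  by apply: continuous_scalef; exact: continuous_cospowB.
- by apply: itgZl => //; exact: itg_norm.
- move=> x y _; have m0 : 0 <= (cpmass N)^-1 :> R by rewrite invr_ge0 ltW// cpmass_gt0.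
  rewrite normrM ler_wpM2r// normrM (ger0_norm m0) ler_piMr//.
  by rewrite ger0_norm ?cospow_ge0// cospow_le1.
Qed.

Lemma fejer_window N L x0 :
  \int[mu]_(x in `[0, 2 * pi]) (cospow L (x - x0) * fejer N x ^+ 2) =
  \sum_(k <- freqs N) \sum_(m <- freqs N)
    ((fg N k * fg N m) * (qc L x0 (k - m) * (mC k * mC m + mS k * mS m) +
       qs L x0 (k - m) * (mS k * mC m - mC k * mS m))).
Proof.
have cc l : continuous (fun x : R => cospow L (x - x0) * cos (l%:~R * x)).
  by apply: continuous_mulf; [exact: continuous_cospowB|exact: continuous_cosl].
have cs l : continuous (fun x : R => cospow L (x - x0) * sin (l%:~R * x)).
  by apply: continuous_mulf; [exact: continuous_cospowB|exact: continuous_sinl].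
pose C k m := fg N k * fg N m * (mC k * mC m + mS k * mS m).
pose S k m := fg N k * fg N m * (mS k * mC m - mC k * mS m).
have E (q c s g x y : R) : q * (g * (c * x + s * y)) = g * x * (q * c) + g * y * (q * s) by ring.
transitivity (\int[mu]_(x in `[0, 2 * pi]) \sum_(k <- freqs N) \sum_(m <- freqs N)
   (C k m * (cospow L (x - x0) * cos ((k - m)%:~R * x)) +
    S k m * (cospow L (x - x0) * sin ((k - m)%:~R * x)))).
  apply: eq_Rintegral => x _; rewrite fejer_sqr mulr_sumr; apply: eq_bigr => k _.
  by rewrite mulr_sumr; apply: eq_bigr => m _; exact: E.
have ii k m : itg `[0, 2 * pi] (fun x => C k m * (cospow L (x - x0) * cos ((k - m)%:~R * x)) +
    S k m * (cospow L (x - x0) * sin ((k - m)%:~R * x))).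
  by apply: itgD => //; apply: itgZl => //; apply: itg_cont; [exact: cc|exact: cs].
rewrite Rint_sum//; last by move=> k; apply: itg_sum.
apply: eq_bigr => k _; rewrite Rint_sum//; apply: eq_bigr => m _.
rewrite Rint_lin//; [|apply: itg_cont; exact: cc|apply: itg_cont; exact: cs].
have E2 (g x y c s : R) : g * x * c + g * y * s = g * (c * x + s * y) by ring.
exact: E2.
Qed.

Definition window (L : nat) (x0 : R) (f : R -> R) : R :=
  \int[mu]_(x in `]0, 2 * pi[) (cospow L (x - x0) * f x ^+ 2).

(** [window 0] is the full energy, as [cospow 0] is 1, and its double sum is diagonal. Multiplied by
    the mean [cpmass L / (2 * pi)] of the window it cancels the diagonal of [window L]. *)
Lemma window_diff N L x0 :
  window L x0 (fejer N) - cpmass L / (2 * pi) * window 0 x0 (fejer N) =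
  \sum_(k <- freqs N) \sum_(m <- freqs N)
    (gamC N L x0 k m * (mC k * mC m + mS k * mS m) +
     gamS N L x0 k m * (mS k * mC m - mC k * mS m)).
Proof.
have W M : window M x0 (fejer N) = \int[mu]_(x in `[0, 2 * pi]) (cospow M (x - x0) * fejer N x ^+ 2).
  rewrite /window Rint_oo_cc//; apply: itg_cont; apply: continuous_mulf; first exact: continuous_cospowB.
  by move=> x; rewrite /continuous_at expr2; under eq_fun do rewrite expr2; apply: cvgM; exact: continuous_fejer.
rewrite !W !fejer_window mulr_sumr -sumrB; apply: eq_bigr => k _.
rewrite mulr_sumr -sumrB; apply: eq_bigr => m _.
have p2 : 2 * pi != 0 :> R by rewrite gt_eqF.
rewrite /gamC /gamS; case: eqVneq => [->|km].
  rewrite subrr !qc_0 !qs_0 cpmass_0.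
  have E (g c C p S : R) : p != 0 -> g * (c * C + 0 * S) - c / p * (g * (p * C + 0 * S)) = 0 * C + 0 * S.
    by move=> p0; field.
  exact: E.
have l0 : (0 < `|k - m|)%N by rewrite absz_gt0 subr_eq0.
rewrite (qc_far x0 l0) (qs_far x0 l0).
have E (g c C s S p : R) : g * (c * C + s * S) - p * (g * (0 * C + 0 * S)) = g * c * C + g * s * S by ring.
exact: E.
Qed.

Let kf n (x y : R) : R := (cpmass n)^-1 * cospow n (x - y).

Let m0 n : 0 <= (cpmass n)^-1 :> R. Proof. by rewrite invr_ge0 ltW// cpmass_gt0. Qed.

Let kf_cont2 n x : continuous (kf n x).
Proof.
apply: continuous_scalef => y; apply: (@continuous_comp _ _ _ (fun y : R => x - y) (cospow n)).
  by apply: cvgB; [exact: cvg_cst|exact: cvg_id].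
exact: continuous_cospow.
Qed.

Let kf_meas n : measurable_fun setT (fun p : R * R => kf n p.1 p.2).
Proof.
apply: measurable_funM => //; apply: measurable_prB.
by apply: continuous_measurable_fun; exact: continuous_cospow.
Qed.

Let kf0 n x y : 0 <= kf n x y. Proof. by rewrite mulr_ge0// cospow_ge0. Qed.

Let kfB n x y : kf n x y <= (cpmass n)^-1.
Proof. by rewrite ler_piMr// cospow_le1. Qed.

Let kf1 n x : 0 < x < 2 * pi -> \int[mu]_(y in `[0, 2 * pi]) kf n x y = 1.
Proof.
move=> _; rewrite RintegralZl//; last first.
  apply: itg_cont => y; apply: (@continuous_comp _ _ _ (fun y : R => x - y) (cospow n)).
    by apply: cvgB; [exact: cvg_cst|exact: cvg_id].
  exact: continuous_cospow.
by rewrite cpmass_shift mulVf// gt_eqF// cpmass_gt0.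
Qed.

Let kf2 n y : 0 <= y <= 2 * pi -> \int[mu]_(x in `]0, 2 * pi[) kf n x y <= 1.
Proof.
move=> _; rewrite -Rint_oo_cc//; last first.
  by apply: itg_cont; apply: continuous_scalef; exact: continuous_cospowB.
rewrite RintegralZl//; last by apply: itg_cont; exact: continuous_cospowB.
by rewrite cpmass_shift2 mulVf// gt_eqF// cpmass_gt0.
Qed.

Let kfc (x : R) : 0 < x < 2 * pi -> forall eta e : R, 0 < eta -> 0 < e ->
  exists N, forall n, (N <= n)%N -> forall y, 0 <= y <= 2 * pi -> eta <= `|y - x| -> kf n x y <= e.
Proof.
move=> x02 eta e eta0 e0; have [N hN] := cospow_concentration x02 eta0 e0.
exists N => n Nn y y02 xy; rewrite /kf mulrC ler_pdivrMr ?cpmass_gt0//.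
by rewrite -cospow_even opprB; exact: hN.
Qed.

Lemma fejer_facts N : [/\ itg `]0, 2 * pi[ (fejer N), itg `]0, 2 * pi[ (fun x => fejer N x ^+ 2) &
  \int[mu]_(x in `]0, 2 * pi[) fejer N x ^+ 2 <= \int[mu]_(x in `[0, 2 * pi]) v x ^+ 2].
Proof.
have mvI : measurable_fun `[0, 2 * pi] v by exact: mI.
have [h1 h2] := @kconv_sq_le R 0 (2 * pi) 0 (2 * pi) kf (fun n => (cpmass n)^-1)
  kf_cont2 kf_meas kf0 kfB kf1 kf2 N v mvI iv.
split => //.
exact: (@itg_kconv R 0 (2 * pi) 0 (2 * pi) kf (fun n => (cpmass n)^-1) kf_meas kf0 kfB N v iv1).
Qed.

Lemma fejer_cvg : \int[mu]_(x in `]0, 2 * pi[) (fejer n x - v x) ^+ 2 @[n --> \oo] --> (0 : R).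
Proof.
have mvI : measurable_fun `[0, 2 * pi] v by exact: mI.
exact: (@approx_id_L2 R 0 (2 * pi) 0 (2 * pi) kf (fun n => (cpmass n)^-1) (lexx 0) (lexx _)
  kf_cont2 kf_meas kf0 kfB kf1 kf2 kfc v mvI iv).
Qed.

Lemma window_cvg L x0 : window L x0 (fejer n) @[n --> \oo] --> window L x0 v.
Proof.
apply: (@cvg_sq_L2 R `]0, 2 * pi[ (fun x => cospow L (x - x0)) 1 fejer v) => //.
- by apply: measurable_cont => //; exact: continuous_cospowB.
- by move=> x _; rewrite ger0_norm ?cospow_ge0// cospow_le1.
- by move=> n; apply: measurable_cont => //; exact: continuous_fejer.
- exact: mI.
- by move=> n; have [] := fejer_facts n.
- by apply: (@integrableS _ _ _ mu `[0, 2 * pi]) => //; exact: subset_itv_oo_cc.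
- exact: fejer_cvg.
Qed.

Lemma window_fejer_le N L x0 : `|window L x0 (fejer N)| <= \int[mu]_(x in `[0, 2 * pi]) v x ^+ 2.
Proof.
have [_ i2 le] := fejer_facts N; apply: le_trans le.
apply: Rint_bound => //.
  apply: measurable_cont => //; apply: continuous_mulf; first exact: continuous_cospowB.
  by move=> x; rewrite /continuous_at expr2; under eq_fun do rewrite expr2; apply: cvgM; exact: continuous_fejer.
move=> x _; rewrite normrM (ger0_norm (sqr_ge0 _)) ler_piMl ?sqr_ge0//.
by rewrite ger0_norm ?cospow_ge0// cospow_le1.
Qed.
End Fun.
End Fiber.

(** * The localised energy inequality *)

Section Key.
Context {R : realType}.

Lemma absorb (x y z r : R) : x <= y - z -> - r <= x -> z <= y + r.
Proof. by move=> *; lra. Qed.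

Local Notation mu := (@lebesgue_measure R).
Local Notation pi := (@pi R).
Variables (T : R) (w : R -> R -> R).
Hypotheses (w1 : measurable_fun setT (fun p : R * R => w p.1 p.2))
  (w3 : forall t, itg `[0, 2 * pi] (fun x => w t x ^+ 2))
  (w4 : itg `]0, T[ (fun t => \int[mu]_(x in `[0, 2 * pi]) w t x ^+ 2)).
Variables (j : nat) (b : R) (F : @distr R) (a c : R) (psi dpsi : R -> R) (K M e : R).
Hypotheses (j1 : (1 <= j)%N) (b0 : 0 <= b) (b1 : b <= 1) (a0 : 0 < a) (ac : a < c) (cT : c < T).
Let s : R := - 2 * j%:R + 2 * j%:R * b.
Variable U : @distr R.
Hypothesis hU : forall theta k ph, continuous theta ->
  U (tens theta (wave k ph)) = distr_of_real T w (tens theta (wave k ph)).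
Hypothesis heqF : forall phi, test_function T phi ->
  distr_dt U phi + (-1) ^+ j.+1 * iter (2 * j).+1 distr_dx U phi = F phi.
Hypotheses (hpsi : forall t : R, is_derive t (1 : R) psi (dpsi t)) (cdpsi : continuous dpsi)
  (psia : psi a = 0) (psic : psi c = 0)
  (hK : forall x p, `|\int[mu]_(t in `[a, c]) (psi t * cos (x * t + p))| * (1 + x ^+ 2) ^+ 2 <= K)
  (hK' : forall x p, `|\int[mu]_(t in `[a, c]) (dpsi t * cos (x * t + p))| * (1 + x ^+ 2) ^+ 2 <= K)
  (M0 : 0 < M) (e0 : 0 < e)
  (UM : (XTnorm j 0 b T U < M%:E)%E) (Ue : (XTnorm j s (- b) T U < e%:E)%E)
  (Fe : (XTnorm j s (- b) T F < e%:E)%E).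

Local Notation A k := (xint (wave k 0) w).
Local Notation B k := (xint (wave k (- (pi / 2))) w).
Local Notation E t := (\int[mu]_(x in `[0, 2 * pi]) w t x ^+ 2).
Let P0 : 0 < 2 * pi. Proof. by rewrite mulr_gt0// pi_gt0. Qed.
Let cpsi : continuous psi. Proof. exact: is_derive_cont hpsi. Qed.

Let sub : `]a, c[ `<=` (`]0, T[ : set R).
Proof.
move=> t /=; rewrite !in_itv /= => /andP[h1 h2].
by rewrite (lt_trans a0 h1) (lt_trans h2 cT).
Qed.

Let wt_meas t : measurable_fun setT (w t).
Proof. by apply: (measurableT_comp (g := fun y => (t, y)) w1); exact: pair1_measurable. Qed.

Lemma itg_psiM (f : R -> R) : itg `]a, c[ f -> itg `]a, c[ (fun t => psi t * f t).
Proof.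
move=> itf; have [Mp _ hMp] := itv_bounded (ltW ac) cpsi.
by apply: (itgM_bdd (M := Mp)) => //; exact: measurable_cont.
Qed.

Lemma itg_E : itg `]a, c[ (fun t => E t).
Proof. by apply: (@integrableS _ _ _ mu `]0, T[). Qed.

Lemma itg_mode_prod l ph l' ph' :
  itg `]a, c[ (fun t => xint (@wave R l ph) w t * xint (wave l' ph') w t).
Proof.
have m k p : measurable_fun `]a, c[ (xint (@wave R k p) w).
  by apply: (measurable_funS _ sub) => //; apply: measurable_xintw => //; exact: wave_cont.
have i k p : itg `]a, c[ (fun t => xint (@wave R k p) w t ^+ 2).
  by apply: (@integrableS _ _ _ mu `]0, T[) => //; apply: itg_xintw_sq => //; [exact: wave_cont|exact: wave_le1].
exact: itg_mulL2.
Qed.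

Let CC k m t := A k t * A m t + B k t * B m t.
Let SS k m t := B k t * A m t - A k t * B m t.

Let iCC k m : itg `]a, c[ (fun t => psi t * CC k m t).
Proof. by apply: itg_psiM; apply: itgD => //; exact: itg_mode_prod. Qed.

Let iSS k m : itg `]a, c[ (fun t => psi t * SS k m t).
Proof. by apply: itg_psiM; apply: itgB => //; exact: itg_mode_prod. Qed.

Definition excess L x0 (f : R -> R) : R :=
  window L x0 f - cpmass L / (2 * pi) * window 0 x0 f.

Definition err_bound (L : nat) (eta : R) : R := 3 * ((K * (8 * 2 ^+ j) * pi) * (2 * L).+1%:R *
    (eta * (2 * pi * M ^+ 2) + eta^-1 * (2 * pi * e ^+ 2))).

(** For fixed [N] only finitely many modes occur, so [modes_bound] applies, once with the cosine and
    once with the sine coefficients of the window: hence the factor 2. Measurability is recorded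
    because it passes to the limit in [N]. *)
Lemma excess_fejer_bound N L x0 eta : 0 < eta ->
  measurable_fun `]a, c[ (fun t => psi t * excess L x0 (fejer (w t) N)) /\
  `|\int[mu]_(t in `]a, c[) (psi t * excess L x0 (fejer (w t) N))| <= 2 * err_bound L eta.
Proof.
move=> eta0.
pose gC := gamC N L x0; pose gS := gamS N L x0.
have fE t : psi t * excess L x0 (fejer (w t) N) = \sum_(k <- freqs N) \sum_(m <- freqs N)
    (gC k m * (psi t * CC k m t) + gS k m * (psi t * SS k m t)).
  rewrite /excess (window_diff (wt_meas t) (w3 t)) mulr_sumr; apply: eq_bigr => k _.
  rewrite mulr_sumr; apply: eq_bigr => m _.
  have Eq (p g g' x y : R) : p * (g * x + g' * y) = g * (p * x) + g' * (p * y) by ring.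
  exact: Eq.
have ii k m : itg `]a, c[ (fun t => gC k m * (psi t * CC k m t) + gS k m * (psi t * SS k m t)).
  by apply: itgD => //; apply: itgZl.
split.
  rewrite (_ : (fun t => _) = (fun t => \sum_(k <- freqs N) \sum_(m <- freqs N)
    (gC k m * (psi t * CC k m t) + gS k m * (psi t * SS k m t)))); last by apply/funext.
  by apply: itg_measurable; apply: itg_sum => // k; apply: itg_sum.
under eq_Rintegral do rewrite fE.
rewrite Rint_sum//; last by move=> k; apply: itg_sum.
have [h1 h2] := modes_bound w1 w3 w4 j1 b0 b1 a0 ac cT hU heqF hpsi cdpsi psia psic hK hK' M0 e0
  UM Ue Fe (freqs_uniq N) eta0 (fun k m => (gamC_spec N L x0 k m).2) (fun k m => (gamC_spec N L x0 k m).1).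
have [h3 h4] := modes_bound w1 w3 w4 j1 b0 b1 a0 ac cT hU heqF hpsi cdpsi psia psic hK hK' M0 e0
  UM Ue Fe (freqs_uniq N) eta0 (fun k m => (gamS_spec N L x0 k m).2) (fun k m => (gamS_spec N L x0 k m).1).
have -> : \sum_(k <- freqs N) \int[mu]_(t in `]a, c[) \sum_(m <- freqs N)
    (gC k m * (psi t * CC k m t) + gS k m * (psi t * SS k m t)) =
  \sum_(k <- freqs N) \sum_(m <- freqs N) (gC k m * \int[mu]_(t in `]a, c[) (psi t * CC k m t)) +
  \sum_(k <- freqs N) \sum_(m <- freqs N) (gS k m * \int[mu]_(t in `]a, c[) (psi t * SS k m t)).
  rewrite -big_split /=; apply: eq_bigr => k _; rewrite Rint_sum// -big_split /=.
  by apply: eq_bigr => m _; rewrite Rint_lin.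
have tri (x y z : R) : `|x| <= z -> `|y| <= z -> `|x + y| <= 2 * z.
  by move=> hx hy; have := ler_normD x y; lra.
exact: tri h1 h4.
Qed.

Let excess_tri (x y z p : R) : 0 <= p -> `|x| <= z -> `|y| <= z -> `|x - p * y| <= (1 + p) * z.
Proof.
move=> p0 xz yz; rewrite (le_trans (ler_normB _ _))// normrM (ger0_norm p0) mulrDl mul1r.
by rewrite lerD// ler_wpM2l.
Qed.

Let window_le L x0 t : `|window L x0 (w t)| <= E t.
Proof.
rewrite Rint_oo_cc//; apply: Rint_bound => //.
- apply: measurable_funM; first by apply: measurable_cont => //; exact: continuous_cospowB.
  by apply: measurable_funX; apply: (measurable_funS measurableT).
- by apply: (@integrableS _ _ _ mu `[0, 2 * pi]) => //; exact: subset_itv_oo_cc.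
- move=> x _; rewrite normrM (ger0_norm (sqr_ge0 _)) ler_piMl ?sqr_ge0//.
  by rewrite ger0_norm ?cospow_ge0// cospow_le1.
Qed.

Lemma excess_cvg L x0 t :
  (psi t * excess L x0 (fejer (w t) N)) @[N --> \oo] --> psi t * excess L x0 (w t).
Proof.
apply: cvg_scale; apply: cvgB; first exact: (window_cvg (wt_meas t) (w3 t)).
by apply: cvg_scale; exact: (window_cvg (wt_meas t) (w3 t)).
Qed.

(** Measurability in [t] is inherited from the truncations as [N] grows; the size is controlled by
    the energy of the slice. *)
Lemma itg_excess L x0 : itg `]a, c[ (fun t => psi t * excess L x0 (w t)).
Proof.
have m0 : 0 <= cpmass L / (2 * pi) by rewrite divr_ge0// ltW// cpmass_gt0.
apply: (@itg_le _ _ (fun t => (1 + cpmass L / (2 * pi)) * `|psi t * E t|)) => //.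
- apply: measurable_fun_cvg (fun N => (excess_fejer_bound N L x0 ltr01).1) _ => t _.
  exact: excess_cvg.
- move=> t _; rewrite normrM [X in _ <= _ * X]normrM mulrCA ler_wpM2l//.
  rewrite (ger0_norm (le_trans (normr_ge0 _) (window_le L x0 t))).
  exact: excess_tri.
- by apply: itgZl => //; apply: itg_norm => //; apply: itg_psiM; exact: itg_E.
Qed.

(** The bound for the truncations is independent of [N], and they are dominated by a multiple of
    $|\psi E|$. *)
Lemma key_bound L x0 eta : 0 < eta ->
  `|\int[mu]_(t in `]a, c[) (psi t * excess L x0 (w t))| <= 2 * err_bound L eta.
Proof.
move=> eta0; have H N := excess_fejer_bound N L x0 eta0.
have m0 : 0 <= cpmass L / (2 * pi) by rewrite divr_ge0// ltW// cpmass_gt0.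
have h : `|\int[mu]_(t in `]a, c[) (psi t * excess L x0 (fejer (w t) N))| @[N --> \oo] -->
   `|\int[mu]_(t in `]a, c[) (psi t * excess L x0 (w t))|.
  apply: cvg_norm.
  apply: (@Rdominated R `]a, c[ (fun N t => psi t * excess L x0 (fejer (w t) N))
    (fun t => psi t * excess L x0 (w t)) (fun t => (1 + cpmass L / (2 * pi)) * `|psi t * E t|)) => //.
  - by move=> N; exact: (H N).1.
  - by apply: itg_measurable; exact: itg_excess.
  - by apply: itgZl => //; apply: itg_norm => //; apply: itg_psiM; exact: itg_E.
  - by move=> t _; exact: excess_cvg.
  - move=> N t _; rewrite normrM [X in _ <= _ * X]normrM mulrCA ler_wpM2l//.
    have h1 := window_fejer_le (wt_meas t) (w3 t) N L x0.
    have h2 := window_fejer_le (wt_meas t) (w3 t) N 0 x0.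
    have Ege := le_trans (normr_ge0 _) h1.
    rewrite (ger0_norm Ege); exact: excess_tri.
rewrite -(cvg_lim _ h)//; apply: limr_le; first by apply/cvg_ex; eexists; exact: h.
by apply: nearW => N; exact: (H N).2.
Qed.

(* Where the window is small it is absorbed by half of the average; what is left
   is supported in [omega]. *)
Lemma observability (omega : set R) L x0 eta : 0 < eta ->
  measurable omega -> (forall t, 0 <= psi t) ->
  (forall x, 0 <= x <= 2 * pi -> ~ omega x -> cospow L (x - x0) <= (4 * pi)^-1 * cpmass L) ->
  itg `]a, c[ (fun t => \int[mu]_(x in omega `&` `[0, 2 * pi]) w t x ^+ 2) ->
  cpmass L / (4 * pi) * \int[mu]_(t in `]a, c[) (psi t * E t) <=
  \int[mu]_(t in `]a, c[) (psi t * \int[mu]_(x in omega `&` `[0, 2 * pi]) w t x ^+ 2)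
  + 2 * err_bound L eta.
Proof.
move=> eta0 mo psi0 far iO.
have mL := cpmass_gt0 (R := R) L.
pose O t := \int[mu]_(x in omega `&` `[0, 2 * pi]) w t x ^+ 2.
have mI : measurable (omega `&` `[0, 2 * pi]) by apply: measurableI.
have win t : - excess L x0 (w t) >= cpmass L / (4 * pi) * E t - O t.
  have w0E : window 0 x0 (w t) = E t.
    rewrite Rint_oo_cc//; apply: eq_Rintegral => x _.
    by rewrite /cospow expr0 mul1r.
  have wL : window L x0 (w t) <= O t + (4 * pi)^-1 * cpmass L * E t.
    have icw : itg `[0, 2 * pi] (fun x => cospow L (x - x0) * w t x ^+ 2).
      apply: (itgM_bdd (M := 1)) => //; first by apply: measurable_cont => //; exact: continuous_cospowB.
      by move=> x _; rewrite ger0_norm ?cospow_ge0// cospow_le1.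
    rewrite /window -Rint_oo_cc//.
    have OE : O t = \int[mu]_(x in `[0, 2 * pi]) ((fun x => w t x ^+ 2) \_ omega) x.
      by rewrite /O Rintegral_mkcondl.
    have ip : itg `[0, 2 * pi] ((fun x => w t x ^+ 2) \_ omega).
      apply: (itg_le _ _ _ (w3 t)) => //.
        apply: (measurable_funS measurableT) => //.
        apply/(measurable_restrictT _ _).1 => //.
        by apply: measurable_funX; apply: (measurable_funS measurableT).
      move=> x _; rewrite patchE; case: ifP => _; first by rewrite ger0_norm// sqr_ge0.
      by rewrite normr0 sqr_ge0.
    rewrite OE -RintegralZl// -RintegralD//; last exact: itgZl.
    apply: le_Rintegral => //; first by apply: itgD => //; exact: itgZl.
    move=> x; rewrite /= in_itv /= => x02; rewrite patchE; case: ifPn => ox.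
      apply: (@le_trans _ _ (w t x ^+ 2)); first by rewrite ler_piMl ?sqr_ge0// cospow_le1.
      by rewrite lerDl mulr_ge0 ?sqr_ge0// mulr_ge0 ?(ltW mL)// invr_ge0 mulr_ge0// pi_ge0.
    rewrite add0r ler_wpM2r ?sqr_ge0//; apply: far => //.
    by move: ox; rewrite notin_setE.
  rewrite /excess w0E.
  have -> : cpmass L / (2 * pi) = 2 * ((4 * pi)^-1 * cpmass L).
    have Ef (m p : R) : p != 0 -> m / (2 * p) = 2 * ((4 * p)^-1 * m) by move=> pn; field.
    by apply: Ef; rewrite gt_eqF// pi_gt0.
  rewrite mulrC; lra.
have iEx : itg `]a, c[ (fun t => psi t * E t) by apply: itg_psiM; exact: itg_E.
have iO' : itg `]a, c[ (fun t => psi t * O t) by exact: itg_psiM.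
have le : \int[mu]_(t in `]a, c[) (psi t * excess L x0 (w t)) <=
    \int[mu]_(t in `]a, c[) (psi t * O t) -
    cpmass L / (4 * pi) * \int[mu]_(t in `]a, c[) (psi t * E t).
  rewrite -RintegralZl// -RintegralB//; last exact: itgZl.
  apply: le_Rintegral => //; [exact: itg_excess|by apply: itgB => //; exact: itgZl|].
  move=> t _; have := ler_wpM2l (psi0 t) (win t); rewrite mulrN mulrBr.
  by rewrite [X in X - _]mulrCA; lra.
have := key_bound L x0 eta0; rewrite ler_norml => /andP[h _].
exact: absorb le h.
Qed.
End Key.

(** * The local estimate *)

Section Representative.
Context {R : realType}.
Local Notation mu := (@lebesgue_measure R).
Local Notation pi := (@pi R).

(* Replacing [u] by zero on the null set of times where [u t] is not square
   integrable makes every time slice square integrable. *)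
Lemma L2_representative (T : R) (u : R -> R -> R) : L2fun T u ->
  exists w : R -> R -> R, [/\ measurable_fun setT (fun p : R * R => w p.1 p.2),
    forall t, itg `[0, 2 * pi] (fun x => w t x ^+ 2),
    itg `]0, T[ (fun t => \int[mu]_(x in `[0, 2 * pi]) w t x ^+ 2),
    forall theta k ph, continuous theta ->
      distr_of_real T u (tens theta (wave k ph)) = distr_of_real T w (tens theta (wave k ph)) &
    forall I A, measurable I -> measurable A -> I `<=` `]0, T[ ->
      L2sqnorm I A u = (\int[mu]_(t in I) (\int[mu]_(x in A `&` `[0%R, (2 * pi)%R]) w t x ^+ 2)%:E)%E].
Proof.
move=> [_ mu0 L2]; pose D : set R := `]0, T[%classic.
have mD : measurable D by exact: measurable_itv.
pose ut t x := ((fun p : R * R => u p.1 p.2) \_ (D `*` setT)) (t, x).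
have mDT : measurable (D `*` (setT : set R)) by exact: measurableX.
have mut : measurable_fun setT (fun p : R * R => ut p.1 p.2).
  have := (measurable_restrictT (fun p : R * R => u p.1 p.2) mDT).1 mu0.
  by congr (measurable_fun _ _); apply/funext => -[t x].
have utE t x : D t -> ut t x = u t x.
  by move=> Dt; rewrite /ut patchE mem_set.
pose E0 t := (\int[mu]_(x in `[0%R, (2 * pi)%R]) (ut t x ^+ 2)%:E)%E.
have msq : measurable_fun setT (fun p : R * R => ut p.1 p.2 ^+ 2) by exact: measurable_funX.
have mE0 : measurable_fun setT E0.
  by apply: (@measurable_section_ge0 R _ (fun t x => ut t x ^+ 2)) => // t x; exact: sqr_ge0.
pose N := E0 @^-1` [set +oo%E].
have mN : measurable N by rewrite -[N]setTI; exact: mE0 (emeasurable_set1 _).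
pose w t x := (1 - \1_N t) * ut t x.
have wN t x : N t -> w t x = 0.
  by move=> Nt; rewrite /w indicE mem_set// subrr mul0r.
have wE t x : ~ N t -> w t x = ut t x.
  by move=> Nt; rewrite /w indicE memNset// subr0 mul1r.
have mw : measurable_fun setT (fun p : R * R => w p.1 p.2).
  apply: measurable_funM => //; apply: measurable_funB => //.
  by apply: measurable_pr1; exact: measurable_indic.
have ms t (B : set R) (v : R -> R -> R) : measurable_fun setT (fun p : R * R => v p.1 p.2) ->
    measurable B -> measurable_fun B (v t).
  move=> mv mB; apply: (measurable_funS measurableT) => //.
  by apply: (measurableT_comp (g := fun y => (t, y)) mv); exact: pair1_measurable.
have w3 t : itg `[0, 2 * pi] (fun x => w t x ^+ 2).
  have [Nt|Nt] := pselect (N t).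
    have -> : (fun x => w t x ^+ 2) = (fun=> 0) by apply/funext => x; rewrite wN// expr0n.
    exact: integrable0.
  have -> : (fun x => w t x ^+ 2) = (fun x => ut t x ^+ 2) by apply/funext => x; rewrite wE.
  apply/integrableP; split.
    by apply: measurable_EFin_comp; apply: measurable_funX; exact: ms.
  rewrite (_ : integral _ _ _ = E0 t); last first.
    by apply: eq_integral => x _; rewrite /= ger0_norm// sqr_ge0.
  by rewrite ltey; apply/eqP.
have E00 t : (0 <= E0 t)%E by apply: integral_ge0 => x _; rewrite lee_fin sqr_ge0.
have iE0 : mu.-integrable D E0.
  apply/integrableP; split; first exact: (measurable_funS measurableT).
  rewrite (_ : integral _ _ _ = (\int[mu]_(t in D) E0 t)%E); last by apply: eq_integral => t _; rewrite gee0_abs.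
  apply: le_lt_trans L2; rewrite /L2sqnorm le_eqVlt; apply/orP; left; apply/eqP.
  apply: eq_integral => t; rewrite inE => Dt; rewrite setTI.
  by apply: eq_integral => x _; rewrite utE.
have ae_w : {ae mu, forall t, D t -> forall x, u t x = w t x}.
  have := @integrable_ae _ _ R mu D mD E0 iE0; apply: filterS => t h Dt x.
  by rewrite wE ?utE// => Nt; have := h Dt; rewrite Nt.
exists w; split => //.
- apply: (@itg_le _ _ (fun t => fine (E0 t))) => //.
  + apply: (measurable_funS measurableT) => //.
    by apply: (@measurable_section R _ (fun t x => w t x ^+ 2)) => //; exact: measurable_funX.
  + move=> t Dt; rewrite ger0_norm; last by apply: Rintegral_ge0 => x _; exact: sqr_ge0.
    have [Nt|Nt] := pselect (N t).
      rewrite (_ : (fun x => w t x ^+ 2) = (fun=> 0)); last by apply/funext => x; rewrite wN// expr0n.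
      by rewrite [leLHS]/Rintegral integral0_eq// fine_ge0.
    by under eq_Rintegral do rewrite wE//.
  + apply: (@le_integrable _ _ R mu D mD _ E0) => //.
      apply: measurable_EFin_comp; apply: (measurable_funS measurableT) => //.
      exact: measurableT_comp.
    by move=> t _ /=; case: (E0 t) => [r| |] //=; rewrite ?normr0// leey.
- move=> theta k ph cth; rewrite /distr_of_real; congr (_%:C).
  have H (v : R -> R -> R) : measurable_fun setT (fun p : R * R => v p.1 p.2) ->
      measurable_fun D (fun t => (\int[mu]_(x in `[0, 2 * pi]) (v t x * tens theta (wave k ph) t x))%:E).
    move=> mv; apply: measurable_EFin_comp; apply: (measurable_funS measurableT) => //.
    apply: (@measurable_section R _ (fun t x => v t x * tens theta (wave k ph) t x)) => //.
    apply: measurable_funM => //; apply: measurable_funM.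
      by apply: measurable_pr1; exact: continuous_measurable_fun.
    by apply: measurable_pr2; apply: continuous_measurable_fun; exact: wave_cont.
  transitivity (\int[mu]_(t in D) \int[mu]_(x in `[0, 2 * pi]) (ut t x * tens theta (wave k ph) t x)).
    apply: eq_Rintegral => t; rewrite inE => Dt; apply: eq_Rintegral => x _.
    by rewrite utE.
  rewrite /stint /Rintegral; congr fine; apply: ae_eq_integral => //; [exact: H|exact: H|].
  case: ae_w => Z [mZ Z0 ZS]; exists Z; split => // t nh; apply: ZS => h; apply: nh => Dt.
  congr (_%:E); apply: eq_Rintegral => x _.
  by rewrite utE// (h Dt).
- move=> I A mI mA ID.
  have mA' : measurable (A `&` `[0%R, (2 * pi)%R]) by exact: measurableI.
  have iA t : itg (A `&` `[0, 2 * pi]) (fun x => w t x ^+ 2).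
    by apply: (@integrableS _ _ _ mu `[0, 2 * pi]).
  have H (v : R -> R -> R) : measurable_fun setT (fun p : R * R => v p.1 p.2) ->
      measurable_fun I (fun t => \int[mu]_(x in A `&` `[0%R, (2 * pi)%R]) (v t x ^+ 2)%:E)%E.
    move=> mv; apply: (measurable_funS measurableT) => //.
    apply: (@measurable_section_ge0 R _ (fun t x => v t x ^+ 2)) => //; first exact: measurable_funX.
    by move=> t x; exact: sqr_ge0.
  transitivity (\int[mu]_(t in I) \int[mu]_(x in A `&` `[0%R, (2 * pi)%R]) (ut t x ^+ 2)%:E)%E.
    apply: eq_integral => t; rewrite inE => It; apply: eq_integral => x _.
    by rewrite utE//; exact: ID.
  transitivity (\int[mu]_(t in I) \int[mu]_(x in A `&` `[0%R, (2 * pi)%R]) (w t x ^+ 2)%:E)%E.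
    apply: ge0_ae_eq_integral => //; [exact: H|exact: H|..].
    + by move=> t _; apply: integral_ge0 => x _; rewrite lee_fin sqr_ge0.
    + by move=> t _; apply: integral_ge0 => x _; rewrite lee_fin sqr_ge0.
    case: ae_w => Z [mZ Z0 ZS]; exists Z; split => // t nh; apply: ZS => h; apply: nh => It.
    apply: eq_integral => x _.
    by rewrite utE; [rewrite (h (ID _ It))|exact: ID].
  by apply: eq_integral => t _; rewrite Rint_EFin.
Qed.

End Representative.

(** * Cutoff in time and the uniform local estimate *)

Section Local.
Context {R : realType}.
Local Notation mu := (@lebesgue_measure R).
Local Notation pi := (@pi R).

Lemma is_derive_poly (p : {poly R}) (x : R) :
  is_derive x (1 : R) (fun t => p.[t]) (p^`()).[x].
Proof.
elim/poly_ind: p => [|p c IH].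
  rewrite deriv0 horner0; under eq_fun do rewrite horner0.
  exact: is_derive_cst.
under eq_fun do rewrite hornerMXaddC.
have -> : ((p * 'X + c%:P)^`()).[x] = (p^`()).[x] * x + p.[x] * 1 + 0.
  by rewrite derivD derivM derivX derivC !hornerE.
exact: (is_derive_addf (is_derive_mulf IH (is_derive_id x (1 : R))) (is_derive_cst c x (1 : R))).
Qed.

(** A zero of order $i+n$ loses at most one order per derivative. *)
Lemma poly_zero_derivn (d p q : {poly R}) (n i : nat) : p = d ^+ (i + n) * q ->
  exists q', p^`(i) = d ^+ n * q'.
Proof.
elim: i n p q => [|i IH] n p q e; first by exists q; rewrite derivn0 e.
have [q' e'] : exists q', p^`() = d ^+ (i + n) * q'.
  exists (d^`() * q *+ (i + n).+1 + d * q^`()).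
  rewrite e addSn derivM deriv_exp /= mulrDr mulrnAl mulrnAr exprS.
  by congr (_ *+ _ + _); ring.
by rewrite derivSn; exact: IH e'.
Qed.

Section Cutoff.
Variables (a c : R).
Hypothesis (ac : a < c).

(** A polynomial suffices, since only its values on [[a, c]] matter. Fourth-order decay for it and
    for its derivative requires the derivatives of order 0 to 4 to vanish at both ends, so the zeros
    must have order at least 5; the even exponent 6 also gives nonnegativity. *)
Definition cutoff_poly : {poly R} := (('X - a%:P) * (c%:P - 'X)) ^+ 6.
Definition cutoff (t : R) : R := cutoff_poly.[t].

Lemma cutoffE t : cutoff t = ((t - a) * (c - t)) ^+ 6.
Proof. by rewrite /cutoff /cutoff_poly horner_exp hornerM !hornerE. Qed.

Lemma cutoff_ge0 t : 0 <= cutoff t.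
Proof. by rewrite cutoffE (exprM _ 2 3) exprn_ge0// sqr_ge0. Qed.

Lemma cutoff_derivn i : (i <= 5)%N ->
  (cutoff_poly^`(i)).[a] = 0 /\ (cutoff_poly^`(i)).[c] = 0.
Proof.
move=> i5; have H : cutoff_poly = (('X - a%:P) * (c%:P - 'X)) ^+ (i + (5 - i).+1) * 1.
  by rewrite mulr1 addnS subnKC.
have [q ->] := poly_zero_derivn H.
by rewrite !hornerM !exprS !hornerM !hornerE !subrr !(mul0r, mulr0).
Qed.

Lemma cutoff_decay : exists K : R,
  (forall x p, `|\int[mu]_(t in `[a, c]) (cutoff t * cos (x * t + p))| * (1 + x ^+ 2) ^+ 2 <= K) /\
  (forall x p, `|\int[mu]_(t in `[a, c]) ((cutoff_poly^`()).[t] * cos (x * t + p))| * (1 + x ^+ 2) ^+ 2 <= K).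
Proof.
pose P i t : R := (cutoff_poly^`(i)).[t].
have dP i (t : R) : is_derive t (1 : R) (P i) (P i.+1 t).
  by rewrite /P derivnS; exact: is_derive_poly.
have cP i : continuous (P i) by exact: is_derive_cont (dP i).
have z i : (i <= 5)%N -> P i a = 0 /\ P i c = 0 by exact: cutoff_derivn.
have [K1 h1] := decay4 (ltW ac) (dP 0%N) (dP 1%N) (dP 2%N) (dP 3%N) (@cP 4%N)
  (z 0%N isT).1 (z 0%N isT).2 (z 1%N isT).1 (z 1%N isT).2 (z 2%N isT).1 (z 2%N isT).2 (z 3%N isT).1 (z 3%N isT).2.
have [K2 h2] := decay4 (ltW ac) (dP 1%N) (dP 2%N) (dP 3%N) (dP 4%N) (@cP 5%N)
  (z 1%N isT).1 (z 1%N isT).2 (z 2%N isT).1 (z 2%N isT).2 (z 3%N isT).1 (z 3%N isT).2 (z 4%N isT).1 (z 4%N isT).2.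
exists (Num.max K1 K2); split => x p; rewrite le_max.
  by rewrite h1.
by rewrite h2 orbT.
Qed.
End Cutoff.

(** [Q] and [S] collect the factors of [err_bound] once [eta] is [e]: the error becomes
    [Q * (e * S)], and everything is linear in [e1 + e]. *)
Lemma final_estimate (m0 kap Mp Q S e e1 X I1 err : R) : 0 < m0 -> 0 < kap -> 0 <= Mp ->
  0 <= Q -> 0 <= S -> 0 <= e -> 0 <= e1 -> m0 * X <= I1 ->
  kap * I1 <= Mp * e1 + 2 * err -> err = Q * (e * S) ->
  X <= ((m0 * kap)^-1 * (Mp + 2 * Q * S) + 1) * (e1 + e).
Proof.
move=> m00 k0 Mp0 Q0 S0 e0 e10 h1 h2 errE; rewrite errE in h2; have mk : 0 < m0 * kap by rewrite mulr_gt0.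
have h3 : m0 * kap * X <= Mp * e1 + 2 * (Q * (e * S)).
  by apply: le_trans h2; rewrite mulrAC mulrC ler_wpM2l// ltW.
have QS0 : 0 <= Q * S by rewrite mulr_ge0.
have h4 : Mp * e1 + 2 * (Q * (e * S)) <= (Mp + 2 * Q * S) * (e1 + e).
  have -> : (Mp + 2 * Q * S) * (e1 + e) =
    Mp * e1 + 2 * (Q * (e * S)) + (Mp * e + 2 * ((Q * S) * e1)) by ring.
  by rewrite lerDl addr_ge0// mulr_ge0// mulr_ge0.
have h5 : X <= (m0 * kap)^-1 * (Mp + 2 * Q * S) * (e1 + e).
  by rewrite -mulrA ler_pdivlMl//; exact: le_trans h3 h4.
by rewrite mulrDl mul1r; have := addr_ge0 e10 e0; lra.
Qed.

(** Compactness in the form of near coverings: each point of [K] has a neighbourhood with margin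
    $1/(n+1)$ for large [n], so one [n] serves all of [K]. The bound by [T / 2] is imposed
    separately, as [K] may be empty. *)
Lemma compact_inside (T : R) (K : set R) : 0 < T -> compact K -> K `<=` `]0, T[ ->
  exists2 r : R, 0 < r < T / 2 & forall t, K t -> r < t /\ t < T - r.
Proof.
move=> T0 /compact_near_coveringP cK KT.
have H : forall t, K t -> \forall t' \near t & n \near \oo,
    (n.+1%:R^-1 < t') /\ (t' < T - n.+1%:R^-1).
  move=> t /KT; rewrite /= in_itv /= => /andP[t0 tT].
  have m0 : 0 < Num.min t (T - t) / 2 by rewrite divr_gt0// lt_min t0 subr_gt0.
  have m1 : Num.min t (T - t) <= t by rewrite ge_min lexx.
  have m2 : Num.min t (T - t) <= T - t by rewrite ge_min lexx orbT.
  move: m0 m1 m2; set m := Num.min _ _ => m0 m1 m2.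
  exists (ball t (m / 2), [set n | n.+1%:R^-1 < m / 2]); first split => /=.
  - exact: nbhsx_ballx.
  - exists (Num.truncn (m / 2)^-1) => // n /= hn.
    rewrite invf_plt ?posrE//; apply: (lt_le_trans (truncnS_gt _)).
    by rewrite ler_nat.
  - move=> [t' n] /= []; rewrite /ball /= ltr_norml => /andP[h1 h2].
    by move: (n.+1%:R^-1) => v h3; split; lra.
have [N _ hN] := cK _ \oo _ _ H.
have [N' hN'] : exists N' : nat, N'.+1%:R^-1 < T / 2.
  exists (Num.truncn (T / 2)^-1); rewrite invf_plt ?posrE ?divr_gt0//.
  exact: truncnS_gt.
pose n := maxn N N'.
have h := hN n (leq_maxl _ _).
exists (n.+1%:R^-1).
  rewrite invr_gt0 ltr0n /=; apply: le_lt_trans hN'.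
  by rewrite lef_pV2 ?posrE ?ltr0n// ler_nat ltnS leq_maxr.
by move=> t /h.
Qed.

(** A point of [omega] is brought into $[0,2\pi)$ by periodicity and then moved slightly to the
    right, since the concentration of the window is stated for centres in the open interval. *)
Lemma torus_window (omega : set R) : torus_open omega -> omega !=set0 ->
  exists x0 r : R, [/\ 0 < x0 < 2 * pi, 0 < r & forall x, `|x - x0| < r -> omega x].
Proof.
move=> [oo po] [x1 ox1].
have P0 : 0 < 2 * pi by rewrite mulr_gt0// pi_gt0.
have shn (n : nat) x : omega (x + n%:R * (2 * pi)) <-> omega x.
  elim: n => [|n IH]; first by rewrite mul0r addr0.
  by rewrite -natr1 mulrDl mul1r addrA po.
have shz (z : int) x : omega (x - z%:~R * (2 * pi)) <-> omega x.
  case: z => n; last first.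
    rewrite NegzE mulrNz mulNr opprK; exact: shn.
  by rewrite -[X in _ <-> omega X](subrK (n%:R * (2 * pi)) x) shn.
pose y := x1 - (Num.floor (x1 / (2 * pi)))%:~R * (2 * pi).
have oy : omega y by apply/shz.
have y0 : 0 <= y < 2 * pi.
  have /andP[h1 h2] := floor_itv (x1 / (2 * pi)).
  rewrite /y subr_ge0 -ler_pdivlMr// h1 /= ltrBlDr.
  by rewrite -[X in _ < X + _]mul1r -mulrDl -ltr_pdivrMr// addrC -intrD1.
have /nbhs_ballP[r0 /= r00 br] := open_nbhs_nbhs (conj oo oy).
have m1 : Num.min r0 (2 * pi - y) <= r0 by rewrite ge_min lexx.
have m2 : Num.min r0 (2 * pi - y) <= 2 * pi - y by rewrite ge_min lexx orbT.
have m0 : 0 < Num.min r0 (2 * pi - y) by rewrite lt_min r00 subr_gt0; case/andP: y0.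
move: m0 m1 m2; set m := Num.min _ _ => m0 m1 m2.
exists (y + m / 2), (r0 / 2); split.
- case/andP: y0 => h1 h2; apply/andP; split; lra.
- by rewrite divr_gt0.
- move=> x; rewrite ltr_norml => /andP[h1 h2]; apply: br; rewrite /ball /= ltr_norml.
  by apply/andP; split; lra.
Qed.

(** The constant is chosen before [u], [F], [e] and [e1]: it depends only on the data fixed
    beforehand, so it serves a whole sequence of solutions. *)
Lemma local_estimate (j : nat) (T b M : R) (K omega : set R) :
  (1 <= j)%N -> 0 < T -> 0 <= b -> b <= 1 -> 0 < M ->
  compact K -> K `<=` `]0, T[ -> torus_open omega -> omega !=set0 ->
  exists2 C : R, 0 < C & forall (u : R -> R -> R) (F : @distr R) (e e1 : R),
    0 < e -> L2fun T u ->
    (forall phi, test_function T phi ->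
      distr_dt (distr_of_real T u) phi
      + (-1) ^+ j.+1 * iter (2 * j).+1 distr_dx (distr_of_real T u) phi = F phi) ->
    (XTnorm j 0 b T (distr_of_real T u) < M%:E)%E ->
    (XTnorm j (- 2 * j%:R + 2 * j%:R * b) (- b) T (distr_of_real T u) < e%:E)%E ->
    (XTnorm j (- 2 * j%:R + 2 * j%:R * b) (- b) T F < e%:E)%E ->
    (L2sqnorm `]0%R, T[ omega u <= e1%:E)%E ->
    (L2sqnorm K setT u <= (C * (e1 + e))%:E)%E.
Proof.
move=> j1 T0 b0 b1 M0 cK KT to on0.
have [r /andP[r0 rT] hr] := compact_inside T0 cK KT.
have [x0 [r1 [x02 r10 hom]]] := torus_window to on0.
have p0 := pi_gt0 R.
have e40 : 0 < (4 * pi)^-1 :> R by rewrite invr_gt0 mulr_gt0.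
have [L hL] := cospow_concentration x02 r10 e40.
have far x : 0 <= x <= 2 * pi -> ~ omega x -> cospow L (x - x0) <= (4 * pi)^-1 * cpmass L.
  by move=> x2 nox; apply: hL => //; rewrite leNgt; apply/negP => /hom.
(* Half of the margin [r]: on [K] both [t - a] and [c - t] exceed [r / 2], which gives the lower
   bound [m0] of the cutoff there. *)
pose a := r / 2; pose c := T - r / 2.
have ac : a < c by rewrite /a /c; lra.
have a0 : 0 < a by rewrite /a; lra.
have cT : c < T by rewrite /c; lra.
have [K' [hK hK']] := cutoff_decay ac.
have K'0 : 0 <= K'.
  by apply: le_trans (hK 0 0); rewrite mulr_ge0// exprn_ge0// ltW// oneDsqr_gt0.
have hpsi (t : R) : is_derive t (1 : R) (cutoff a c) ((cutoff_poly a c)^`()).[t] by exact: is_derive_poly.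
have cpsi : continuous (cutoff a c) by exact: is_derive_cont hpsi.
have cdpsi : continuous (fun t => ((cutoff_poly a c)^`()).[t]).
  exact: is_derive_cont (fun t => is_derive_poly ((cutoff_poly a c)^`()) t).
have [Mp Mp0 hMp] := itv_bounded (ltW ac) cpsi.
have [psia psic] : cutoff a c a = 0 /\ cutoff a c c = 0.
  by have := @cutoff_derivn a c 0 isT; rewrite derivn0.
pose m0 : R := ((r / 2) * (r / 2)) ^+ 6.
have m00 : 0 < m0 by rewrite exprn_gt0// mulr_gt0// divr_gt0.
have mK t : K t -> m0 <= cutoff a c t.
  move=> /hr[h1 h2]; rewrite cutoffE /m0; apply: lerXn2r.
  - by rewrite nnegrE ltW// mulr_gt0// divr_gt0.
  - by rewrite nnegrE mulr_ge0//; rewrite /a /c; lra.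
  - by apply: ler_pM; rewrite /a /c; lra.
have KI : K `<=` `]a, c[.
  by move=> t /hr[h1 h2]; rewrite /= in_itv /=; apply/andP; split; rewrite /a /c; lra.
pose kap := cpmass L / (4 * pi) : R.
have kap0 : 0 < kap by rewrite divr_gt0 ?cpmass_gt0// mulr_gt0.
pose Q := 3 * ((K' * (8 * 2 ^+ j) * pi) * (2 * L).+1%:R) : R.
have Q0 : 0 <= Q by rewrite !mulr_ge0 ?exprn_ge0 ?(ltW p0).
pose S := 2 * pi * M ^+ 2 + 2 * pi : R.
have pp : 0 <= 2 * pi :> R by rewrite mulr_ge0// ltW.
have S0 : 0 <= S by rewrite addr_ge0// mulr_ge0// sqr_ge0.
exists ((m0 * kap)^-1 * (Mp + 2 * Q * S) + 1).
  have B1 : 0 <= (m0 * kap)^-1 by rewrite invr_ge0 ltW// mulr_gt0.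
  have B2 : 0 <= Mp + 2 * Q * S by rewrite addr_ge0// mulr_ge0// mulr_ge0.
  by rewrite ltr_wpDl// mulr_ge0.
move=> u F e e1 e0 L2u heqF UM Ue Fe Oe.
have [w [w1 w3 w4 hU hN]] := L2_representative L2u.
have mo : measurable omega by case: to => oo _; exact: open_measurable.
have mK' : measurable K by exact: compact_measurable.
pose E t := \int[mu]_(x in `[0, 2 * pi]) w t x ^+ 2.
pose O t := \int[mu]_(x in omega `&` `[0, 2 * pi]) w t x ^+ 2.
have mI : measurable (omega `&` `[0, 2 * pi]) by exact: measurableI.
have msq : measurable_fun setT (fun p : R * R => w p.1 p.2 ^+ 2) by exact: measurable_funX.
have mO : measurable_fun setT O by exact: (@measurable_section R _ (fun t x => w t x ^+ 2)).
have O0 t : 0 <= O t by apply: Rintegral_ge0 => x _; exact: sqr_ge0.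
have E0 t : 0 <= E t by apply: Rintegral_ge0 => x _; exact: sqr_ge0.
have OE t : O t <= E t.
  rewrite -lee_fin Rint_EFin//; last by apply: (@integrableS _ _ _ mu `[0, 2 * pi]).
  rewrite Rint_EFin//; apply: ge0_subset_integral => //.
    by apply: measurable_EFin_comp; apply: itg_measurable.
  by move=> x _; rewrite lee_fin sqr_ge0.
have sub : `]a, c[ `<=` (`]0, T[ : set R).
  by move=> t /=; rewrite !in_itv /= => /andP[h1 h2]; rewrite (lt_trans a0 h1) (lt_trans h2 cT).
have iOT : itg `]0, T[ O.
  apply: (@itg_le _ _ E) => //; first exact: (measurable_funS measurableT).
  by move=> t _; rewrite ger0_norm.
have iO : itg `]a, c[ O by apply: (@integrableS _ _ _ mu `]0, T[).
have iE : itg `]a, c[ E by apply: (@integrableS _ _ _ mu `]0, T[).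
have iEK : itg K E by apply: (@integrableS _ _ _ mu `]a, c[).
have ipsi (f : R -> R) : itg `]a, c[ f -> itg `]a, c[ (fun t => cutoff a c t * f t).
  by move=> itf; apply: (itgM_bdd (M := Mp)) => //; exact: measurable_cont.
(* The free parameter [eta] is set to [e]: then $\eta\,2\pi M^2+\eta^{-1}2\pi e^2=e\,(2\pi
   M^2+2\pi)$. *)
have obs := @observability R T w w1 w3 w4 j b F a c (cutoff a c) _ K' M e j1 b0 b1 a0 ac cT
  (distr_of_real T u) hU heqF hpsi cdpsi psia psic hK hK' M0 e0 UM Ue Fe omega L x0 e e0 mo
  (cutoff_ge0 a c) far iO.
have I2 : \int[mu]_(t in `]a, c[) (cutoff a c t * O t) <= Mp * e1.
  apply: (@le_trans _ _ (Mp * \int[mu]_(t in `]a, c[) O t)).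
    rewrite -RintegralZl//; apply: le_Rintegral => //; [exact: ipsi|exact: itgZl|].
    by move=> t /hMp; rewrite ger0_norm ?cutoff_ge0// => h; rewrite ler_wpM2r.
  rewrite ler_wpM2l// -lee_fin Rint_EFin//; apply: le_trans Oe.
  rewrite hN//; apply: ge0_subset_integral => //.
    by apply: measurable_EFin_comp; apply: (measurable_funS measurableT).
  by move=> t _; rewrite lee_fin.
have I1 : m0 * \int[mu]_(t in K) E t <= \int[mu]_(t in `]a, c[) (cutoff a c t * E t).
  rewrite -RintegralZl// -lee_fin Rint_EFin//; last exact: itgZl.
  rewrite Rint_EFin//; last exact: ipsi.
  apply: (@le_trans _ _ (\int[mu]_(t in K) (cutoff a c t * E t)%:E)%E).
    apply: ge0_le_integral => //.
    - by move=> t _; rewrite lee_fin mulr_ge0// ltW.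
    - by apply: measurable_EFin_comp; apply: itg_measurable; exact: itgZl.
    - by apply: measurable_EFin_comp; apply: itg_measurable; apply: (@integrableS _ _ _ mu `]a, c[) => //; exact: ipsi.
    - by move=> t Kt; rewrite lee_fin ler_wpM2r// mK.
  apply: ge0_subset_integral => //.
    by apply: measurable_EFin_comp; apply: itg_measurable; exact: ipsi.
  by move=> t _; rewrite lee_fin mulr_ge0// cutoff_ge0.
have errE : err_bound j K' M e L e = Q * (e * S).
  rewrite /err_bound /Q /S.
  have Ef (q p m z : R) : z != 0 -> 3 * (q * (z * (2 * p * m) + z^-1 * (2 * p * z ^+ 2))) = 3 * q * (z * (2 * p * m + 2 * p)).
    by move=> z0; field.
  by apply: Ef; rewrite gt_eqF.
have LK : L2sqnorm K setT u = (\int[mu]_(t in K) E t)%:E.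
  by rewrite hN// Rint_EFin//; apply: eq_integral => t _; rewrite setTI.
rewrite LK lee_fin.
have X0 : 0 <= \int[mu]_(t in K) E t by apply: Rintegral_ge0.
have e10 : 0 <= e1.
  rewrite -lee_fin; apply: le_trans Oe; apply: integral_ge0 => t _.
  by apply: integral_ge0 => x _; rewrite lee_fin sqr_ge0.
exact: (final_estimate m00 kap0 Mp0 Q0 S0 (ltW e0) e10 I1 (le_trans obs (lerD I2 (lexx _))) errE).
Qed.

Lemma cvg0_lt (f : nat -> \bar R) (e : R) : f @ \oo --> 0%E -> 0 < e ->
  exists N : nat, forall n, (N <= n)%N -> (f n < e%:E)%E.
Proof.
move=> /fine_cvgP[[N1 _ h1] h2] e0.
have /cvgrPdist_lt/(_ e e0)[N2 _ h3] := h2.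
exists (maxn N1 N2) => n; rewrite geq_max => /andP[n1 n2].
have := h3 n n2; rewrite /= sub0r normrN ltr_norml => /andP[_ h4].
by rewrite -(fineK (h1 n n1)) lte_fin.
Qed.

Lemma cvg0_le (f : nat -> \bar R) : (forall n, 0 <= f n)%E ->
  (forall e : R, 0 < e -> exists N : nat, forall n, (N <= n)%N -> (f n <= e%:E)%E) ->
  f @ \oo --> 0%E.
Proof.
move=> f0 H; have fn n (e : R) : (f n <= e%:E)%E -> f n \is a fin_num.
  by move=> h; rewrite ge0_fin_numE// (le_lt_trans h)// ltry.
apply/fine_cvgP; split.
  by have [N hN] := H 1 ltr01; exists N => // n /= Nn; exact: fn (hN n Nn).
apply/cvgrPdist_le => e e0; have [N hN] := H e e0; exists N => // n /= Nn.
rewrite sub0r normrN ger0_norm ?fine_ge0//.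
by rewrite -lee_fin fineK; [exact: hN|exact: fn (hN n Nn)].
Qed.

Lemma sum3_lt (x y z e : \bar R) : (0 <= x)%E -> (0 <= y)%E -> (0 <= z)%E ->
  (x + y + z < e)%E -> (x < e)%E /\ (y < e)%E.
Proof.
move=> x0 y0 z0 h; split; apply: le_lt_trans h.
  by rewrite -addeA leeDl// adde_ge0.
by rewrite -addeA addeCA leeDl// adde_ge0.
Qed.
End Local.
Theorem proposition4p5 (R : realType) (j : nat) (hj : (1 <= j)%N)
  (T b b' : R) (hT : 0 < T) (hb'0 : 0 <= b') (hb'b : b' <= b) (hb1 : b <= 1)
  (hb0 : 0 < b)
  (u : nat -> R -> R -> R) (f : nat -> @distr R)
  (huL2 : forall n, L2fun T (u n))
  (hu : forall n, XTspace j 0 b T (distr_of_real T (u n)))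
  (hf : forall n, XTspace j (- 2 * j%:R + 2 * j%:R * b) (- b) T (f n))
  (heq : forall n phi, test_function T phi ->
     distr_dt (distr_of_real T (u n)) phi
     + (-1) ^+ j.+1
       * iter (2 * j).+1 distr_dx (distr_of_real T (u n)) phi
     = f n phi)
  (hC : exists2 C : R, 0 < C &
     forall n, (XTnorm j 0 b T (distr_of_real T (u n)) <= C%:E)%E)
  (hlim :
     (fun n => XTnorm j (- 2 * j%:R + 2 * j%:R * b) (- b) T
                 (distr_of_real T (u n))
             + XTnorm j (- 2 * j%:R + 2 * j%:R * b) (- b) T (f n)
             + XTnorm j (- 1 + 2 * j%:R * b') (- b') T
                 (distr_of_real T (u n)))%E @ \oo --> 0%E)
  (omega : set R) (homega : torus_open omega) (homega0 : omega !=set0)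
  (hloc : (fun n => L2sqnorm `]0, T[ omega (u n)) @ \oo --> 0%E) :
  forall K : set R, compact K -> K `<=` `]0, T[ ->
    (fun n => L2sqnorm K setT (u n)) @ \oo --> 0%E.
Proof.
move=> K cK KT; case: hC => C C0 UC.
have b0 : 0 <= b by exact: ltW.
(* The bound by [C] is not strict while [local_estimate] takes a strict one, hence [C + 1]. *)
have [A A0 hA] := local_estimate hj hT b0 hb1 (addr_gt0 C0 ltr01) cK KT homega homega0.
apply: cvg0_le => [n|eps eps0].
  by apply: integral_ge0 => t _; apply: integral_ge0 => x _; rewrite lee_fin sqr_ge0.
(* The same threshold is used for the small norms and for the norm on [omega]; their sum times [A]
   is [eps]. *)
have e0 : 0 < eps / (2 * A) by rewrite divr_gt0// mulr_gt0.
have [N1 h1] := cvg0_lt hlim e0; have [N2 h2] := cvg0_lt hloc e0.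
exists (maxn N1 N2) => n; rewrite geq_max => /andP[n1 n2].
have -> : eps = A * (eps / (2 * A) + eps / (2 * A)) by field; rewrite gt_eqF.
have p1 := XTnorm_ge0 j (- 2 * j%:R + 2 * j%:R * b) (- b) T (distr_of_real T (u n)).
have p2 := XTnorm_ge0 j (- 2 * j%:R + 2 * j%:R * b) (- b) T (f n).
have p3 := XTnorm_ge0 j (- 1 + 2 * j%:R * b') (- b') T (distr_of_real T (u n)).
have q1 : (XTnorm j 0 b T (distr_of_real T (u n)) < (C + 1)%:E)%E.
  by apply: le_lt_trans (UC n) _; rewrite lte_fin ltrDl.
have [q2 q3] := sum3_lt p1 p2 p3 (h1 n n1).
exact: (hA (u n) (f n) _ _ e0 (huL2 n) (heq n) q1 q2 q3 (ltW (h2 n n2))).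
Qed.
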